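(* Let $A$ be a tractable commutative DG ring and let $\bar{A} := \mathrm{H}^0(A)$. Then the operation $R \mapsto \operatorname{RHom}_A(\bar{A}, R)$ induces a bijection from the set of isomorphism classes (in $\mathsf{D}(A)$) of dualizing DG $A$-modules to the set of isomorphism classes (in $\mathsf{D}(\bar{A})$) of dualizing DG $\bar{A}$-modules.
   Context: A commutative DG ring is a graded associative unital ring $A=\bigoplus_{i\le 0}A^i$ with a differential $\mathrm{d}$ of degree $1$ satisfying the graded Leibniz rule, such that $b\cdot a=(-1)^{ij}a\cdot b$ for $a\in A^i$, $b\in A^j$, and $a\cdot a=0$ for $a\in A^i$ with $i$ odd. Commutative rings are DG rings concentrated in degree $0$. There is a canonical DG ring homomorphism $A\to\bar A=\mathrm{H}^0(A)$, through which $\operatorname{RHom}_A(\bar A,R)$ is an object of $\mathsf{D}(\bar A)$. $\mathsf{D}(A)$ is the derived category of DG $A$-modules (quasi-isomorphisms inverted). $A$ is cohomologically pseudo-noetherian if $\bar A$ is noetherian and every $\mathrm{H}^i(A)$ is a finitely generated $\bar A$-module. $A$ is tractable if it is cohomologically pseudo-noetherian and there exists a DG ring homomorphism $\mathbb{K}\to A$ from some finite dimensional regular noetherian commutative ring $\mathbb{K}$ such that the induced ring homomorphism $\mathbb{K}\to\bar A$ is essentially of finite type (a localization of a finitely generated $\mathbb{K}$-ring). For $A$ cohomologically pseudo-noetherian, a DG $A$-module $R$ is dualizing if: (i) each $\mathrm{H}^i(R)$ is a finitely generated $\bar A$-module; (ii) $R$ has finite injective dimension relative to $\mathsf{D}(A)$,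 i.e. there are integers $d_0\le d_1$ with $\operatorname{con}(\mathrm{H}(\operatorname{RHom}_A(M,R)))\subseteq-\operatorname{con}(\mathrm{H}(M))+[d_0,d_1]$ for all $M\in\mathsf{D}(A)$; (iii) the adjunction morphism $A\to\operatorname{RHom}_A(R,R)$ (given by multiplication) is an isomorphism in $\mathsf{D}(A)$. Here, for a graded module $H$, $\operatorname{con}(H)$ is the smallest integer interval (endpoints possibly $\pm\infty$; empty if $H=0$) containing all degrees $i$ with $H^i\ne0$; intervals are added endpoint-wise, $-[i_0,i_1]=[-i_1,-i_0]$, and $\varnothing+[d_0,d_1]=\varnothing$. The same definition applies to the ring $\bar A$, viewed as a DG ring. *)

(* Defs.v *)
From HB Require Import structures.
From mathcomp Require Import all_boot all_order all_algebra.
From mathcomp Require Import zify.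
From mathcomp Require Import boolp classical_sets functions.

Set Implicit Arguments.
Unset Strict Implicit.
Unset Printing Implicit Defensive.

Import Order.TTheory GRing.Theory Num.Theory.

Local Open Scope ring_scope.
Local Open Scope quotient_scope.
Local Open Scope classical_set_scope.

(* Every operation that changes the degree takes the target degree together
   with an equation as arguments, e.g. [df : i + 1 = j -> M i -> M j].  The
   type [int] has unique identity proofs, so this adds no data; it replaces
   transports along equations such as [(i + j) + k = i + (j + k)]. *)

Definition oddz (n : int) : bool := odd `|n|%N.

(* [ksgn n x] is (-1)^n x. *)
Definition ksgn (V : zmodType) (n : int) (x : V) : V :=
  if oddz n then - x else x.

Lemma oddzD m n : oddz (m + n) = oddz m (+) oddz n.
Proof. rewrite /oddz; lia. Qed.

Lemma oddzM m n : oddz (m * n) = oddz m && oddz n.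
Proof. by rewrite /oddz abszM oddM. Qed.

Lemma oddz1 : oddz 1 = true. Proof. by []. Qed.

Lemma ksgnD (V : zmodType) n (x y : V) : ksgn n (x + y) = ksgn n x + ksgn n y.
Proof. by rewrite /ksgn; case: ifP => // _; rewrite opprD. Qed.

Record complex := Complex {
  cpx :> int -> zmodType;
  df : forall i j, i + 1 = j -> {additive cpx i -> cpx j};
  dfK : forall i j k (h : i + 1 = j) (h' : j + 1 = k) x, df h' (df h x) = 0
}.

Section Cohomology.
Variables (M : complex) (i : int).

Definition is_cocycle : {pred M i} :=
  fun z => `[< forall j (h : i + 1 = j), df M h z = 0 >].

Lemma is_cocycle_zmod : zmod_closed is_cocycle.
Proof.
split; first by apply/asboolP => j h; rewrite raddf0.
move=> x y /asboolP hx /asboolP hy; apply/asboolP => j h.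
by rewrite raddfB /= hx hy subr0.
Qed.

HB.instance Definition _ := GRing.isZmodClosed.Build (M i) is_cocycle
  is_cocycle_zmod.

Record cocycle := Cocycle { cval :> M i; cvalP : cval \in is_cocycle }.

HB.instance Definition _ := [isSub for cval].
HB.instance Definition _ := [Choice of cocycle by <:].
HB.instance Definition _ := [SubChoice_isSubZmodule of cocycle by <:].

Definition is_coboundary : {pred cocycle} :=
  fun z => `[< exists j (h : j + 1 = i) y, df M h y = cval z >].

Lemma is_coboundary_zmod : zmod_closed is_coboundary.
Proof.
split.
  have h : (i - 1) + 1 = i by rewrite subrK.
  by apply/asboolP; exists (i - 1), h, 0; rewrite raddf0.
move=> x y /asboolP[j [h [u hu]]] /asboolP[k [h' [v hv]]]; apply/asboolP.
have e : k = j by apply: (addIr 1); rewrite h h'.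
subst k; exists j, h, (u - v); rewrite raddfB /= hu.
by rewrite (eq_irrelevance h h') hv.
Qed.

HB.instance Definition _ := GRing.isZmodClosed.Build cocycle is_coboundary
  is_coboundary_zmod.

Definition cohomology : zmodType :=
  Quotient.quot (is_coboundary : zmodClosed cocycle).

Definition cls (z : cocycle) : cohomology := \pi z.
Definition rep (c : cohomology) : cocycle := repr c.

End Cohomology.

Lemma repK (M : complex) i (c : cohomology M i) : cls (rep c) = c.
Proof. exact: reprK. Qed.

Lemma cls_eq (M : complex) i (x y : cocycle M i) :
  cls x = cls y <-> exists j (h : j + 1 = i) u, df M h u = cval x - cval y.
Proof.
split.
  by move/eqP; rewrite -Quotient.idealrBE => /asboolP[j [h [u e]]]; exists j, h, u.
by move=> e; apply/eqP; rewrite -Quotient.idealrBE; apply/asboolP.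
Qed.

Lemma clsB (M : complex) i (x y : cocycle M i) : cls (x - y) = cls x - cls y.
Proof. exact: raddfB. Qed.

Lemma clsD (M : complex) i (x y : cocycle M i) : cls (x + y) = cls x + cls y.
Proof. exact: raddfD. Qed.

Lemma cocycleE (M : complex) i (z : cocycle M i) j (h : i + 1 = j) :
  df M h (cval z) = 0.
Proof. by have /asboolP := cvalP z; apply. Qed.

Record cplxmor (M N : complex) := CplxMor {
  cmor :> forall i, {additive M i -> N i};
  cmor_d : forall i j (h : i + 1 = j) x, df N h (cmor i x) = cmor j (df M h x)
}.

Section CohomologyMap.
Variables (M N : complex) (f : cplxmor M N) (i : int).

Lemma cocycle_map_subproof (z : cocycle M i) : f i (cval z) \in is_cocycle (M := N) (i := i).
Proof. by apply/asboolP => j h; rewrite cmor_d cocycleE raddf0. Qed.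

Definition cocycle_map (z : cocycle M i) : cocycle N i :=
  Cocycle (cocycle_map_subproof z).

Definition cohomology_map (c : cohomology M i) : cohomology N i :=
  cls (cocycle_map (rep c)).

Lemma cohomology_mapE z : cohomology_map (cls z) = cls (cocycle_map z).
Proof.
apply/cls_eq; have /cls_eq[j [h [u e]]] := repK (cls z).
by exists j, h, (f j u); rewrite cmor_d e raddfB.
Qed.

End CohomologyMap.

Definition quasi_iso (M N : complex) (f : cplxmor M N) : Prop :=
  forall i, bijective (@cohomology_map M N f i).

Definition acyclic (M : complex) : Prop :=
  forall i (c : cohomology M i), c = 0.

Record cdgring := CDGRing {
  dgr :> complex;
  dgmul : forall i j k, i + j = k -> dgr i -> dgr j -> dgr k;
  dgone : dgr 0;
  dgmulDl : forall i j k (h : i + j = k) a a' b,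
    dgmul h (a + a') b = dgmul h a b + dgmul h a' b;
  dgmulDr : forall i j k (h : i + j = k) a b b',
    dgmul h a (b + b') = dgmul h a b + dgmul h a b';
  dgmulA : forall i j k ij jk ijk (h1 : i + j = ij) (h2 : ij + k = ijk)
      (h3 : j + k = jk) (h4 : i + jk = ijk) a b c,
    dgmul h2 (dgmul h1 a b) c = dgmul h4 a (dgmul h3 b c);
  dgmul1l : forall i (h : 0 + i = i) a, dgmul h dgone a = a;
  dgmul1r : forall i (h : i + 0 = i) a, dgmul h a dgone = a;
  dgmul_d : forall i j k i' j' k' (h : i + j = k) (hi : i + 1 = i')
      (hj : j + 1 = j') (hk : k + 1 = k') (h1 : i' + j = k') (h2 : i + j' = k')
      a b,
    df dgr hk (dgmul h a b) =
    dgmul h1 (df dgr hi a) b + ksgn i (dgmul h2 a (df dgr hj b));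
  dgmulC : forall i j k (h : i + j = k) (h' : j + i = k) a b,
    dgmul h' b a = ksgn (i * j) (dgmul h a b);
  dgmul_odd : forall i k (h : i + i = k) a, oddz i -> dgmul h a a = 0;
  dg_nonpos : forall i, 0 < i -> forall a : dgr i, a = 0
}.

Record dgrmor (A B : cdgring) := DGRMor {
  rmor :> cplxmor A B;
  rmor_mul : forall i j k (h : i + j = k) a b,
    rmor k (dgmul h a b) = dgmul h (rmor i a) (rmor j b);
  rmor_one : rmor 0 (dgone A) = dgone B
}.

Section Identity.
Variable A : cdgring.

Definition cplx_id (M : complex) : cplxmor M M :=
  @CplxMor M M (fun i => idfun) (fun i j h x => erefl).

Definition dgr_id : dgrmor A A :=
  @DGRMor A A (cplx_id A) (fun i j k h a b => erefl) erefl.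

End Identity.

Record dgmod (A : cdgring) := DGMod {
  dgm :> complex;
  act : forall i j k, i + j = k -> A i -> dgm j -> dgm k;
  actDl : forall i j k (h : i + j = k) a a' x,
    act h (a + a') x = act h a x + act h a' x;
  actDr : forall i j k (h : i + j = k) a x x',
    act h a (x + x') = act h a x + act h a x';
  actA : forall i j k ij jk ijk (h1 : i + j = ij) (h2 : ij + k = ijk)
      (h3 : j + k = jk) (h4 : i + jk = ijk) a b x,
    act h2 (dgmul h1 a b) x = act h4 a (act h3 b x);
  act1 : forall i (h : 0 + i = i) x, act h (dgone A) x = x;
  act_d : forall i j k i' j' k' (h : i + j = k) (hi : i + 1 = i')
      (hj : j + 1 = j') (hk : k + 1 = k') (h1 : i' + j = k') (h2 : i + j' = k')
      a x,
    df dgm hk (act h a x) =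
    act h1 (df A hi a) x + ksgn i (act h2 a (df dgm hj x))
}.

Record dgmor (A : cdgring) (M N : dgmod A) := DGMor {
  mmor :> cplxmor M N;
  mmor_act : forall i j k (h : i + j = k) a x,
    mmor k (act h a x) = act h a (mmor j x)
}.

Section DGModules.
Variable A : cdgring.

Definition dgmor_id (M : dgmod A) : dgmor M M :=
  @DGMor A M M (cplx_id M) (fun i j k h a x => erefl).

Definition cplx_comp (M N P : complex) (g : cplxmor N P) (f : cplxmor M N) :
  cplxmor M P.
Proof.
exists (fun i => g i \o f i) => i j h x /=; by rewrite !cmor_d.
Defined.

Definition dgmor_comp (M N P : dgmod A) (g : dgmor N P) (f : dgmor M N) :
  dgmor M P.
Proof.
exists (cplx_comp g f) => i j k h a x /=; by rewrite !mmor_act.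
Defined.

Definition selfmod : dgmod A :=
  @DGMod A A (@dgmul A) (@dgmulDl A) (@dgmulDr A) (@dgmulA A) (@dgmul1l A)
    (@dgmul_d A).

End DGModules.

Definition restrict_dg (A B : cdgring) (phi : dgrmor A B) (N : dgmod B) : dgmod A.
Proof.
exists N (fun i j k h a x => act h (phi i a) x).
- by move=> i j k h a a' x; rewrite raddfD actDl.
- by move=> i j k h a x x'; rewrite actDr.
- by move=> i j k ij jk ijk h1 h2 h3 h4 a b x; rewrite rmor_mul; apply: actA.
- by move=> i h x; rewrite rmor_one act1.
- move=> i j k i' j' k' h hi hj hk h1 h2 a x.
  by rewrite (act_d h hi hj hk h1 h2) cmor_d.
Defined.

Definition H0 (A : cdgring) : Type := cohomology A 0.

HB.instance Definition _ A := GRing.Zmodule.on (H0 A).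

Definition Hmod (A : cdgring) (M : dgmod A) (i : int) : Type := cohomology M i.

HB.instance Definition _ A M i := GRing.Zmodule.on (@Hmod A M i).

Section CohomologyAction.
Variable A : cdgring.

Lemma cocycle0_subproof (a : A 0) : a \in is_cocycle (M := A) (i := 0).
Proof. by apply/asboolP => j h; apply: dg_nonpos; lia. Qed.

Definition cocycle0 (a : A 0) : cocycle A 0 := Cocycle (cocycle0_subproof a).

Lemma cocycle0K (z : cocycle A 0) : cocycle0 (cval z) = z.
Proof. exact: val_inj. Qed.

Lemma cocycle_act_subproof (M : dgmod A) i (a : cocycle A 0) (z : cocycle M i) :
  act (add0r i) (cval a) (cval z) \in is_cocycle (M := M) (i := i).
Proof.
apply/asboolP => j h.
have h1 : 1 + i = j by lia.
rewrite (act_d (add0r i) (add0r 1) h h h1 (add0r j)) !cocycleE.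
have -> : act h1 (0 : A 1) (cval z) = 0.
  by apply: (addrI (act h1 (0 : A 1) (cval z))); rewrite -actDl !addr0.
have -> : act (add0r j) (cval a) (0 : M j) = 0.
  by apply: (addrI (act (add0r j) (cval a) (0 : M j))); rewrite -actDr !addr0.
by rewrite addr0.
Qed.

Definition cocycle_act (M : dgmod A) i (a : cocycle A 0) (z : cocycle M i) :
  cocycle M i := Cocycle (cocycle_act_subproof a z).

Definition cohomology_act (M : dgmod A) i (a : H0 A) (c : Hmod M i) :
  Hmod M i := cls (cocycle_act (rep a) (rep c)).

Lemma act0l (M : dgmod A) i j k (h : i + j = k) (x : M j) :
  act h (0 : A i) x = 0.
Proof. by apply: (addrI (act h 0 x)); rewrite -actDl !addr0. Qed.

Lemma act0r (M : dgmod A) i j k (h : i + j = k) (a : A i) :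
  act h a (0 : M j) = 0.
Proof. by apply: (addrI (act h a 0)); rewrite -actDr !addr0. Qed.

Lemma dgmul0l i j k (h : i + j = k) (b : A j) : dgmul h (0 : A i) b = 0.
Proof. exact: (@act0l (selfmod A)). Qed.

Lemma dgmul0r i j k (h : i + j = k) (a : A i) : dgmul h a (0 : A j) = 0.
Proof. exact: (@act0r (selfmod A)). Qed.

Lemma actNl (M : dgmod A) i j k (h : i + j = k) (a : A i) (x : M j) :
  act h (- a) x = - act h a x.
Proof. by apply: (addrI (act h a x)); rewrite -actDl !subrr act0l. Qed.

Lemma actNr (M : dgmod A) i j k (h : i + j = k) (a : A i) (x : M j) :
  act h a (- x) = - act h a x.
Proof. by apply: (addrI (act h a x)); rewrite -actDr !subrr act0r. Qed.

Lemma cohomology_actE (M : dgmod A) i (a : cocycle A 0) (z : cocycle M i) :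
  cohomology_act (cls a : H0 A) (cls z : Hmod M i) = cls (cocycle_act a z).
Proof.
have /cls_eq[j [hj [u eu]]] := repK (cls a).
have /cls_eq[k [hk [v ev]]] := repK (cls z).
apply/cls_eq => /=.
set a' := rep _ in eu *; set z' := rep _ in ev *.
have hki : j + i = k by lia.
exists k, hk, (act hki u (cval z') + act (add0r k) (cval a) v).
rewrite raddfD /=.
have h2 : j + (i + 1) = i by lia.
have h3 : 1 + k = i by lia.
rewrite (act_d hki hj (erefl (i + 1)) hk (add0r i) h2) cocycleE act0r eu.
rewrite (act_d (add0r k) (add0r 1) hk hk h3 (add0r i)) cocycleE act0l ev add0r.
rewrite /ksgn oppr0 if_same addr0 /= actDl actNl actDr actNr.
by rewrite addrA subrK.
Qed.

Lemma HactA (M : dgmod A) i (a b : H0 A) (c : Hmod M i) :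
  cohomology_act (M := M) a (cohomology_act b c) =
  cohomology_act (cohomology_act (M := selfmod A) a (b : Hmod (selfmod A) 0)) c.
Proof.
rewrite -[a]repK -[b]repK -[c]repK; set x := rep a; set y := rep b; set z := rep c.
rewrite (@cohomology_actE (selfmod A)) !cohomology_actE; congr cls.
apply: val_inj => /=; apply/esym; exact: actA.
Qed.

Lemma Hact1 (M : dgmod A) i (c : Hmod M i) :
  cohomology_act (cls (cocycle0 (dgone A)) : H0 A) c = c.
Proof.
rewrite -[c]repK cohomology_actE; congr cls; apply: val_inj; exact: act1.
Qed.

Lemma HactDr (M : dgmod A) i (a : H0 A) (c c' : Hmod M i) :
  cohomology_act a (c + c') = cohomology_act a c + cohomology_act a c'.
Proof.
rewrite -[a]repK -[c]repK -[c']repK -[in LHS]clsD !cohomology_actE -clsD.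
congr cls; apply: val_inj; exact: actDr.
Qed.

Lemma HactDl (M : dgmod A) i (a a' : H0 A) (c : Hmod M i) :
  cohomology_act (a + a') c = cohomology_act a c + cohomology_act a' c.
Proof.
rewrite -[a]repK -[c]repK -[a']repK -[in LHS]clsD !cohomology_actE -clsD.
congr cls; apply: val_inj; exact: actDl.
Qed.

Definition H0_one : H0 A := cls (cocycle0 (dgone A)).

Definition H0_mul : H0 A -> H0 A -> H0 A :=
  @cohomology_act (selfmod A) 0.

Lemma H0_mulC : commutative H0_mul.
Proof.
move=> a b; rewrite /H0_mul -[a]repK -[b]repK.
rewrite (@cohomology_actE (selfmod A)) (@cohomology_actE (selfmod A)).
by congr cls; apply: val_inj; apply: dgmulC.
Qed.

Lemma H0_mulA : associative H0_mul.
Proof. by move=> a b c; apply: (@HactA (selfmod A)). Qed.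

Lemma H0_mul1l : left_id H0_one H0_mul.
Proof. by move=> a; apply: (@Hact1 (selfmod A)). Qed.

Lemma H0_mulDl : left_distributive H0_mul +%R.
Proof. by move=> a b c; apply: (@HactDl (selfmod A)). Qed.

HB.instance Definition _ := GRing.Zmodule_isComPzRing.Build (H0 A)
  H0_mulA H0_mulC H0_mul1l H0_mulDl.

Section Module.
Variables (M : dgmod A) (i : int).

Lemma Hmod_scaleA (a b : H0 A) (c : Hmod M i) :
  cohomology_act a (cohomology_act b c) = cohomology_act (a * b) c.
Proof. exact: HactA. Qed.

Lemma Hmod_scale1 : left_id (1 : H0 A) (@cohomology_act M i).
Proof. exact: Hact1. Qed.

Lemma Hmod_scaleDr : right_distributive (@cohomology_act M i) +%R.
Proof. exact: HactDr. Qed.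

Lemma Hmod_scaleDl (c : Hmod M i) :
  {morph (@cohomology_act M i)^~ c : a b / a + b}.
Proof. by move=> a b; apply: HactDl. Qed.

HB.instance Definition _ := GRing.Zmodule_isLmodule.Build (H0 A) (Hmod M i)
  Hmod_scaleA Hmod_scale1 Hmod_scaleDr Hmod_scaleDl.

End Module.
End CohomologyAction.

Section UnitZmodule.
Let uadd (_ _ : unit) : unit := tt.
Let uopp (_ : unit) : unit := tt.
Let uaddA : associative uadd. Proof. by []. Qed.
Let uaddC : commutative uadd. Proof. by []. Qed.
Let uadd0 : left_id tt uadd. Proof. by case. Qed.
Let uaddN : left_inverse tt uopp uadd. Proof. by []. Qed.
HB.instance Definition _ := GRing.isZmodule.Build unit uaddA uaddC uadd0 uaddN.
End UnitZmodule.

Section RingDG.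
Variable B : comPzRingType.

Definition conc (i : int) : zmodType := if i is Posz 0 then B else unit.

Lemma conc_triv i (x : conc i) : i <> 0 -> x = 0.
Proof. by case: i x => [[|n]|n] // []. Qed.

Definition conc_cplx : complex :=
  @Complex conc (fun i j _ => \0) (fun i j k h h' x => erefl).

Definition conc_mul (i j k : int) (_ : i + j = k) :
    conc i -> conc j -> conc k :=
  match i, j, k return conc i -> conc j -> conc k with
  | Posz 0, Posz 0, Posz 0 => fun a b => a * b
  | _, _, _ => fun _ _ => 0
  end.

Lemma conc_mul0l i j k (h : i + j = k) b : conc_mul h 0 b = 0.
Proof. by case: i j k h b => [[|i]|i] [[|j]|j] [[|k]|k] h b //=; rewrite mul0r. Qed.

Lemma conc_mul0r i j k (h : i + j = k) a : conc_mul h a 0 = 0.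
Proof. by case: i j k h a => [[|i]|i] [[|j]|j] [[|k]|k] h a //=; rewrite mulr0. Qed.

Lemma conc_mulA i j k ij jk ijk (h1 : i + j = ij) (h2 : ij + k = ijk)
    (h3 : j + k = jk) (h4 : i + jk = ijk) a b c :
  conc_mul h2 (conc_mul h1 a b) c = conc_mul h4 a (conc_mul h3 b c).
Proof.
have [ei|ei] := EM (i = 0); last first.
  by rewrite [a]conc_triv // !conc_mul0l.
have [ej|ej] := EM (j = 0); last first.
  by rewrite [b]conc_triv // conc_mul0l !conc_mul0r conc_mul0l.
have [ek|ek] := EM (k = 0); last first.
  by rewrite [c]conc_triv // !conc_mul0r.
have eij : ij = 0 by lia.
have ejk : jk = 0 by lia.
have eijk : ijk = 0 by lia.
by subst i j k ij jk ijk; rewrite /= mulrA.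
Qed.

Definition ring_dg : cdgring.
Proof.
exists conc_cplx conc_mul (1 : B).
- by move=> [[|i]|i] [[|j]|j] [[|k]|k] h a a' b //=; rewrite ?addr0 // mulrDl.
- by move=> [[|i]|i] [[|j]|j] [[|k]|k] h a b b' //=; rewrite ?addr0 // mulrDr.
- exact: conc_mulA.
- by case=> [[|n]|n] h //= a; [apply: mul1r|case: a|case: a].
- by case=> [[|n]|n] h //= a; [apply: mulr1|case: a|case: a].
- move=> i j k i' j' k' h hi hj hk h1 h2 a b /=.
  by rewrite conc_mul0l conc_mul0r /ksgn oppr0 if_same addr0.
- move=> [[|i]|i] [[|j]|j] [[|k]|k] h h' a b //=; rewrite /ksgn ?oppr0 ?if_same //.
  by rewrite mulrC.
- by case=> [[|n]|n] [[|k]|k].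
- by case=> [[|n]|n] // _ [].
Defined.

End RingDG.

Definition Abar (A : cdgring) : comPzRingType := H0 A.

Section Canonical.
Variable A : cdgring.

Definition canon_fun (i : int) : A i -> conc (Abar A) i :=
  match i return A i -> conc (Abar A) i with
  | Posz 0 => fun a => cls (cocycle0 a)
  | _ => fun _ => 0
  end.

Lemma canon_zmod i : zmod_morphism (@canon_fun i).
Proof.
case: i => [[|n]|n] a b //=; rewrite -clsB; congr cls; exact: val_inj.
Qed.

HB.instance Definition _ i := GRing.isZmodMorphism.Build (A i) (conc (Abar A) i)
  (@canon_fun i) (@canon_zmod i).

Definition canon_cplx : cplxmor A (ring_dg (Abar A)).
Proof.
exists (fun i => @canon_fun i : {additive A i -> conc (Abar A) i}) => i j h x /=.
have [e|?] := EM (j = 0); last by rewrite [RHS]conc_triv.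
move: h; move/esym: e => e; case: j / e => h /=; apply/esym.
have cls0 : cls (0 : cocycle A 0) = 0 by apply: raddf0.
apply: (@etrans _ _ (cls (0 : cocycle A 0))); last exact: cls0.
by apply/cls_eq; exists i, h, x; rewrite /= subr0.
Defined.

Definition canon : dgrmor A (ring_dg (Abar A)).
Proof.
exists canon_cplx => //= i j k h a b.
have [ek|?] := EM (k = 0); last by rewrite [LHS]conc_triv // [RHS]conc_triv.
have [ei|ei] := EM (i = 0).
  have ej : j = 0 by lia.
  subst i j k => /=; apply: esym.
  apply: etrans (@cohomology_actE A (selfmod A) 0 (cocycle0 a) (cocycle0 b)) _.
  congr cls; apply: val_inj => /=.
  by congr (dgmul _ _ _); exact: eq_irrelevance.
have [lt|lt] := EM (0 < i).
  by rewrite (dg_nonpos lt a) dgmul0l !raddf0 conc_mul0l.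
have lj : 0 < j by lia.
by rewrite (dg_nonpos lj b) dgmul0r !raddf0 conc_mul0r.
Defined.

End Canonical.

Lemma act_ksgn (A : cdgring) (M : dgmod A) i j k (h : i + j = k) s a x :
  act (d := M) h a (ksgn s x) = ksgn s (act h a x).
Proof. by rewrite /ksgn; case: ifP => // _; rewrite actNr. Qed.

Lemma act_ksgnl (A : cdgring) (M : dgmod A) i j k (h : i + j = k) s a x :
  act (d := M) h (ksgn s a) x = ksgn s (act h a x).
Proof. by rewrite /ksgn; case: ifP => // _; rewrite actNl. Qed.

Lemma df_ksgn (M : complex) i j (h : i + 1 = j) s x :
  df M h (ksgn s x) = ksgn s (df M h x).
Proof. by rewrite /ksgn; case: ifP => // _; rewrite raddfN. Qed.

Section Hom.
Variables (A : cdgring) (M N : dgmod A).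

Record hom (n : int) := Hom {
  hf : forall i j, i + n = j -> M i -> N j;
  hfD : forall i j (h : i + n = j) x y, hf h (x + y) = hf h x + hf h y;
  hf_act : forall p i j k l (hp : p + i = k) (hk : k + n = l) (hn : i + n = j)
      (hl : p + j = l) (a : A p) x,
    hf hk (act hp a x) = ksgn (p * n) (act hl a (hf hn x))
}.

Lemma hom_ext n (f g : hom n) :
  (forall i j (h : i + n = j) x, hf f h x = hf g h x) -> f = g.
Proof.
case: f g => [f fD fa] [g gD ga] /= e.
have {}e : f = g.
  do 3 (apply: functional_extensionality_dep => ?).
  by apply: functional_extensionality_dep => ?; apply: e.
by subst g; congr Hom; apply: Prop_irrelevance.
Qed.

HB.instance Definition _ n := gen_eqMixin (hom n).
HB.instance Definition _ n := gen_choiceMixin (hom n).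

Section HomZmod.
Variable n : int.

Definition hom_zero : hom n.
Proof.
exists (fun i j h x => 0) => [i j h x y|p i j k l hp hk hn hl a x].
  by rewrite addr0.
by rewrite act0r /ksgn oppr0 if_same.
Defined.

Definition hom_opp (f : hom n) : hom n.
Proof.
exists (fun i j h x => - hf f h x) => [i j h x y|p i j k l hp hk hn hl a x].
  by rewrite hfD opprD.
by rewrite (hf_act f hp hk hn hl) actNr /ksgn; case: ifP.
Defined.

Definition hom_add (f g : hom n) : hom n.
Proof.
exists (fun i j h x => hf f h x + hf g h x)
    => [i j h x y|p i j k l hp hk hn hl a x].
  by rewrite !hfD addrACA.
by rewrite (hf_act f hp hk hn hl) (hf_act g hp hk hn hl) actDr ksgnD.
Defined.

Lemma hom_addA : associative hom_add.
Proof. by move=> f g k; apply: hom_ext => i j h x /=; rewrite addrA. Qed.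
Lemma hom_addC : commutative hom_add.
Proof. by move=> f g; apply: hom_ext => i j h x /=; rewrite addrC. Qed.
Lemma hom_add0 : left_id hom_zero hom_add.
Proof. by move=> f; apply: hom_ext => i j h x /=; rewrite add0r. Qed.
Lemma hom_addN : left_inverse hom_zero hom_opp hom_add.
Proof. by move=> f; apply: hom_ext => i j h x /=; rewrite addNr. Qed.

HB.instance Definition _ :=
  GRing.isZmodule.Build (hom n) hom_addA hom_addC hom_add0 hom_addN.

End HomZmod.

Lemma hf0 n (f : hom n) i j (h : i + n = j) : hf f h 0 = 0.
Proof. by apply: (addrI (hf f h 0)); rewrite -hfD !addr0. Qed.

Lemma hfN n (f : hom n) i j (h : i + n = j) x : hf f h (- x) = - hf f h x.
Proof. by apply: (addrI (hf f h x)); rewrite -hfD !subrr hf0. Qed.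

Lemma hf_ksgn n (f : hom n) i j (h : i + n = j) s x :
  hf f h (ksgn s x) = ksgn s (hf f h x).
Proof. by rewrite /ksgn; case: ifP => // _; rewrite hfN. Qed.

Section Differential.
Variables (n n' : int) (hn : n + 1 = n').

Lemma hom_d_eq1 i j : i + n' = j -> (i + n) + 1 = j.
Proof. move: hn; lia. Qed.

Lemma hom_d_eq2 i j : i + n' = j -> (i + 1) + n = j.
Proof. move: hn; lia. Qed.

(* d(f) = d o f - (-1)^n f o d *)
Definition hom_d_fun (f : hom n) i j (h : i + n' = j) (x : M i) : N j :=
  df N (hom_d_eq1 h) (hf f erefl x)
  - ksgn n (hf f (hom_d_eq2 h) (df M erefl x)).

Lemma hom_d_funE (f : hom n) i j (h : i + n' = j) i1 j1 (h1 : i + n = j1)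
    (h2 : j1 + 1 = j) (h3 : i + 1 = i1) (h4 : i1 + n = j) x :
  hom_d_fun f h x = df N h2 (hf f h1 x) - ksgn n (hf f h4 (df M h3 x)).
Proof.
subst j1 i1; rewrite /hom_d_fun (eq_irrelevance (hom_d_eq1 h) h2).
by rewrite (eq_irrelevance (hom_d_eq2 h) h4).
Qed.

Definition hom_d (f : hom n) : hom n'.
Proof.
exists (@hom_d_fun f) => [i j h x y|p i j k l hp hk hn' hl a x].
  by rewrite /hom_d_fun hfD !raddfD /= hfD ksgnD opprD addrACA.
have e1 : k + n + 1 = l by lia.
have e2 : k + 1 + n = l by lia.
have e3 : i + n + 1 = j by lia.
have e4 : i + 1 + n = j by lia.
have e5 : p + 1 + i = k + 1 by lia.
have e6 : p + (i + 1) = k + 1 by lia.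
have e7 : p + (i + n) = k + n by lia.
have e8 : p + 1 + (i + n) = l by lia.
rewrite (hom_d_funE f hk (erefl _) e1 (erefl _) e2).
rewrite (hom_d_funE f hn' (erefl _) e3 (erefl _) e4).
rewrite (act_d hp (erefl _) (erefl _) (erefl _) e5 e6) hfD.
rewrite (hf_act f hp (erefl _) (erefl _) e7).
rewrite (hf_act f e5 e2 (erefl _) e8).
have -> : hf f e2 (ksgn p (act e6 a (df M erefl x)))
        = ksgn p (ksgn (p * n) (act hl a (hf f e4 (df M erefl x)))).
  by rewrite -(hf_act f e6 e2 e4 hl) /ksgn; case: ifP => // _; rewrite hfN.
have -> : df N e1 (ksgn (p * n) (act e7 a (hf f erefl x)))
        = ksgn (p * n) (act e8 (df A erefl a) (hf f erefl x)
           + ksgn p (act hl a (df N e3 (hf f erefl x)))).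
  rewrite -(act_d e7 (erefl _) e3 e1 e8 hl) /ksgn; case: ifP => // _.
  by rewrite raddfN.
rewrite actDr actNr.
rewrite /ksgn -hn !(oddzM, oddzD) oddz1.
case: (oddz p); case: (oddz n) => /=;
  rewrite ?actNr ?opprD ?opprK ?addrA;
  set u := act e8 _ _; set v := act hl _ _; set w := act hl _ _;
  rewrite ?(addrC (- u)) ?(addrC u);
  rewrite ?addrK ?subrK //.
Defined.

Lemma hom_dE (f : hom n) i j (h : i + n' = j) i1 j1 (h1 : i + n = j1)
    (h2 : j1 + 1 = j) (h3 : i + 1 = i1) (h4 : i1 + n = j) x :
  hf (hom_d f) h x = df N h2 (hf f h1 x) - ksgn n (hf f h4 (df M h3 x)).
Proof. exact: hom_d_funE. Qed.

Lemma hom_d_zmod : zmod_morphism hom_d.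
Proof.
move=> f g; apply: hom_ext => i j h x.
rewrite -[RHS]/(hf (hom_d f) h x - hf (hom_d g) h x).
have e1 : i + n + 1 = j by move: hn; lia.
have e2 : i + 1 + n = j by move: hn; lia.
rewrite !(hom_dE _ h (erefl _) e1 (erefl _) e2) -[hf (f - g) _ _]/(hf f _ _ - hf g _ _).
rewrite -[hf (f - g) e2 _]/(hf f _ _ - hf g _ _) raddfB ksgnD /=.
have -> y : ksgn n (- y) = - ksgn n y :> N j by rewrite /ksgn; case: ifP.
by rewrite !opprD !opprK addrACA.
Qed.

HB.instance Definition _ := GRing.isZmodMorphism.Build (hom n) (hom n') hom_d
  hom_d_zmod.

End Differential.

Lemma hom_dK n n' n'' (h : n + 1 = n') (h' : n' + 1 = n'') (f : hom n) :
  hom_d h' (hom_d h f) = 0.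
Proof.
apply: hom_ext => i j e x; rewrite [RHS]/(0 : N j).
have e1 : i + n' + 1 = j by lia.
have e2 : i + 1 + n' = j by lia.
have e3 : i + n + 1 = i + n' by lia.
have e4 : i + 1 + n = i + n' by lia.
have e5 : i + 1 + 1 + n = j by lia.
rewrite (hom_dE h' _ e (erefl _) e1 (erefl _) e2).
rewrite (hom_dE h f (erefl (i + n')) (erefl _) e3 (erefl _) e4).
rewrite (hom_dE h f e2 e4 e1 (erefl _) e5) dfK hf0.
have sn : oddz n' = ~~ oddz n by rewrite -h oddzD oddz1 addbT.
rewrite raddfB /= dfK sub0r /ksgn sn.
case: (oddz n) => /=; rewrite ?raddfN /= ?oppr0 ?subr0 ?opprK ?subrr ?addNr.
all: rewrite ?addr0; first [exact: subrr | exact: addNr].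
Qed.

Definition hom_cplx : complex :=
  @Complex (fun n => hom n)
    (fun n n' h => hom_d h : {additive hom n -> hom n'}) hom_dK.

End Hom.

Section Coinduction.
Variables (A B : cdgring) (phi : dgrmor A B) (N : dgmod B) (J : dgmod A).

Local Notation M := (restrict_dg phi N).

Section Action.
Variables (p n q : int) (hq : p + n = q).

Lemma coind_eq i j : i + q = j -> (p + i) + n = j.
Proof. move: hq; lia. Qed.

(* (b f)(x) = (-1)^(|b| |f|) f(b x) *)
Definition coind_fun (b : B p) (f : hom M J n) i j (h : i + q = j) (x : N i) :
    J j :=
  ksgn (p * n) (hf f (coind_eq h) (@act B N _ _ _ erefl b x)).

Lemma coind_funE (b : B p) (f : hom M J n) i j (h : i + q = j) k
    (h1 : p + i = k) (h2 : k + n = j) x :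
  coind_fun b f h x = ksgn (p * n) (hf f h2 (@act B N _ _ _ h1 b x)).
Proof. by subst k; rewrite /coind_fun (eq_irrelevance (coind_eq h) h2). Qed.

Definition coind_act (b : B p) (f : hom M J n) : hom M J q.
Proof.
exists (@coind_fun b f) => [i j h x y|r i j k l hr hk hn hl a x].
  by rewrite /coind_fun actDr hfD ksgnD.
have e1 : p + r = r + p by lia.
have e2 : r + p + i = r + (p + i) by lia.
have e3 : p + k = r + (p + i) by lia.
have e4 : r + (p + i) + n = l by lia.
have e5 : p + i + n = j by lia.
rewrite (coind_funE b f hk e3 e4) (coind_funE b f hn (erefl _) e5).
rewrite -(actA (d := N) e1 e2 hr e3).
rewrite (dgmulC (erefl _)) act_ksgnl hf_ksgn.
have -> : @act B N _ _ _ e2 (dgmul erefl (phi r a) b) x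
        = @act A M _ _ _ erefl a (@act B N _ _ _ erefl b x).
  exact: actA.
rewrite (hf_act f erefl e4 e5 hl) act_ksgn /ksgn -hq !(oddzM, oddzD).
by case: (oddz p); case: (oddz r); case: (oddz n) => /=; rewrite ?opprK.
Defined.

Lemma coind_actE (b : B p) (f : hom M J n) i j (h : i + q = j) k
    (h1 : p + i = k) (h2 : k + n = j) x :
  hf (coind_act b f) h x = ksgn (p * n) (hf f h2 (@act B N _ _ _ h1 b x)).
Proof. exact: coind_funE. Qed.

End Action.

Definition coind : dgmod B.
Proof.
exists (hom_cplx M J) (fun p n q hq b f => coind_act hq b f).
- move=> p n q hq b b' f; apply: hom_ext => i j h x /=.
  rewrite -[RHS]/(coind_fun hq b f h x + coind_fun hq b' f h x).
  by rewrite /coind_fun actDl hfD ksgnD.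
- move=> p n q hq b f f'; apply: hom_ext => i j h x /=.
  rewrite -[RHS]/(coind_fun hq b f h x + coind_fun hq b f' h x).
  by rewrite /coind_fun -ksgnD.
- move=> p q n pq qn pqn h1 h2 h3 h4 b c f; apply: hom_ext => i j h x /=.
  have e1 : pq + i + n = j by lia.
  have e2 : p + i + qn = j by lia.
  have e3 : q + (p + i) = pq + i by lia.
  have e4 : q + p = pq by lia.
  rewrite (coind_funE h2 _ f h (erefl _) e1) (coind_funE h4 b _ h (erefl _) e2) /=.
  rewrite (coind_funE h3 c f e2 e3 e1) (dgmulC e4) act_ksgnl hf_ksgn.
  rewrite (actA e4 (erefl _) (erefl _) e3); set u := hf f e1 _.
  rewrite /ksgn -h1 -h3 !(oddzM, oddzD).
  by case: (oddz p); case: (oddz q); case: (oddz n) => /=; rewrite ?opprK.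
- move=> n h0 f; apply: hom_ext => i j h x /=.
  by rewrite (coind_funE h0 _ f h (add0r i) h) act1 mul0r.
- move=> p n q p' n' q' h hp hn hq h1 h2 b f; apply: hom_ext => i j e x.
  rewrite -[LHS]/(hf (hom_d hq (coind_act h b f)) e x).
  rewrite -[RHS]/(coind_fun h1 (df B hp b) f e x
    + hf (ksgn p (coind_act h2 b (hom_d hn f))) e x).
  have -> : hf (ksgn p (coind_act h2 b (hom_d hn f))) e x
          = ksgn p (coind_fun h2 b (hom_d hn f) e x).
    by rewrite /ksgn; case: ifP.
  have e1 : i + q + 1 = j by lia.
  have e2 : i + 1 + q = j by lia.
  have e3 : p + i + n = i + q by lia.
  have e4 : p + (i + 1) = p + i + 1 by lia.
  have e5 : p + i + 1 + n = j by lia.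
  have e6 : p' + i = p + i + 1 by lia.
  have e7 : p + i + n' = j by lia.
  have e8 : p + i + n + 1 = j by lia.
  rewrite (@hom_dE A M J q q' hq (coind_act h b f) i j e _ _ (erefl _) e1 (erefl _) e2).
  rewrite (coind_actE h b f (erefl _) (erefl _) e3).
  rewrite (coind_actE h b f e2 e4 e5).
  rewrite (coind_funE h1 _ f e e6 e5).
  rewrite (coind_funE h2 _ _ e (erefl _) e7).
  rewrite (@hom_dE A M J n n' hn f (p + i) j e7 _ _ e3 e1 (erefl _) e5).
  have -> : df M (erefl (p + i + 1)) (@act B N _ _ _ erefl b x)
          = @act B N _ _ _ e6 (df B hp b) x
            + ksgn p (@act B N _ _ _ e4 b (df M erefl x)) :> M (p + i + 1).
    exact: (@act_d B N p i (p + i) p' (i + 1)).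
  rewrite hfD hf_ksgn df_ksgn.
  set u := df J e1 _; set v := hf f e5 _; set w := hf f e5 _.
  have sq : oddz q = oddz p (+) oddz n by rewrite -h oddzD.
  have sp : oddz p' = ~~ oddz p by rewrite -hp oddzD oddz1 addbT.
  have sn : oddz n' = ~~ oddz n by rewrite -hn oddzD oddz1 addbT.
  clearbody u v w; rewrite /ksgn !(oddzM, sq, sp, sn).
  case: (oddz p); case: (oddz n) => /=;
    by rewrite ?opprD ?opprK [RHS]addrCA ?addKr ?addNKr.
Defined.

End Coinduction.

(* For phi the identity, [coind] is Hom_A(M, J) with its usual action: by
   linearity, (-1)^(|a| |f|) f(a x) = a f(x). *)
Definition hom_dg (A : cdgring) (M J : dgmod A) : dgmod A :=
  coind (dgr_id A) M J.

(* The map A -> Hom_A(M, J) sending a to x |-> a eta(x), for eta : M -> J. *)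
Section Multiplication.
Variables (A : cdgring) (M J : dgmod A) (eta : dgmor M J).

Definition mul_fun (n : int) (a : A n) : hom (restrict_dg (dgr_id A) M) J n.
Proof.
apply: (@Hom A (restrict_dg (dgr_id A) M) J n
    (fun i j h x => act (etrans (addrC n i) h) a (eta i x)))
    => [i j h x y|p i j k l hp hk hn hl b x].
  by rewrite raddfD actDr.
have e1 : p + n = n + p by lia.
have e2 : n + p + i = l by lia.
have e3 : n + i = j by lia.
have e4 : n + k = l by lia.
rewrite (eq_irrelevance (etrans _ hk) e4) (eq_irrelevance (etrans _ hn) e3).
have -> : eta k (@act A (restrict_dg (dgr_id A) M) _ _ _ hp b x)
        = act hp b (eta i x) by exact: mmor_act.
by rewrite -(actA (erefl _) e2) (dgmulC e1) act_ksgnl (actA e1 e2 e3 hl).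
Defined.

Lemma mul_funE n (a : A n) i j (h : i + n = j) (h' : n + i = j) x :
  hf (mul_fun a) h x = act h' a (eta i x).
Proof. by rewrite /= (eq_irrelevance (etrans _ h) h'). Qed.

Lemma mul_fun_zmod n : zmod_morphism (@mul_fun n).
Proof.
move=> a b; apply: hom_ext => i j h x.
rewrite -[RHS]/(hf (mul_fun a) h x - hf (mul_fun b) h x) /=.
by rewrite actDl actNl.
Qed.

HB.instance Definition _ n := GRing.isZmodMorphism.Build (A n)
  (hom (restrict_dg (dgr_id A) M) J n) (@mul_fun n) (@mul_fun_zmod n).

Definition mul_cplx : cplxmor (selfmod A) (hom_dg M J).
Proof.
exists (fun n => @mul_fun n :
  {additive A n -> hom (restrict_dg (dgr_id A) M) J n}).
move=> n n' hn a; apply: hom_ext => i j h x.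
have e1 : i + n + 1 = j by lia.
have e2 : i + 1 + n = j by lia.
have e3 : n + i = i + n by lia.
have e4 : n + (i + 1) = j by lia.
have e5 : n' + i = j by lia.
rewrite -[LHS]/(hf (hom_d hn (mul_fun a)) h x).
rewrite (hom_dE hn _ h (erefl _) e1 (erefl _) e2).
rewrite (mul_funE a _ e3) (mul_funE a _ e4) (mul_funE _ h e5).
rewrite (act_d e3 hn (erefl _) e1 e5 e4) -cmor_d.
by rewrite addrK.
Defined.

Definition mul_mor : dgmor (selfmod A) (hom_dg M J).
Proof.
exists mul_cplx => p n q h b a; apply: hom_ext => i j e x.
have e1 : p + i + n = j by lia.
have e2 : q + i = j by lia.
have e3 : n + (p + i) = j by lia.
have e4 : n + p = q by lia.
rewrite -[LHS]/(hf (mul_fun (dgmul h b a)) e x).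
rewrite -[RHS]/(hf (@coind_act A A (dgr_id A) M J p n q h b (mul_fun a)) e x).
rewrite (mul_funE _ _ e2) (coind_actE h b _ e (erefl _) e1) (mul_funE _ _ e3).
have -> : eta (p + i) (act erefl b x) = act erefl b (eta i x)
  by exact: mmor_act.
by rewrite -(actA e4 e2) (dgmulC h e4) act_ksgnl /ksgn; case: (oddz _); rewrite ?opprK.
Defined.

End Multiplication.

Definition Kinjective (A : cdgring) (J : dgmod A) : Prop :=
  forall N : dgmod A, acyclic N -> acyclic (hom_cplx N J).

Record target (A : cdgring) (R : dgmod A) := Target {
  tgt :> dgmod A;
  tgt_map : dgmor R tgt
}.

Definition is_Kinj_resolution (A : cdgring) (R : dgmod A) (J : target R) :=
  Kinjective J /\ quasi_iso (tgt_map J).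

(* Every DG module has a K-injective resolution, so the default value is never
   taken; any two are homotopy equivalent, so [RHom_along] does not depend on
   the choice up to isomorphism in the derived category. *)
Definition Kinj_resolution (A : cdgring) (R : dgmod A) : target R :=
  match pselect (exists J : target R, is_Kinj_resolution J) with
  | left h => sval (cid h)
  | right _ => Target (dgmor_id R)
  end.

(* RHom_A(N, R) as a DG B-module: B acts through N. *)
Definition RHom_along (A B : cdgring) (phi : dgrmor A B) (N : dgmod B)
    (R : dgmod A) : dgmod B :=
  coind phi N (Kinj_resolution R).

Definition RHom (A : cdgring) (M R : dgmod A) : dgmod A :=
  RHom_along (dgr_id A) M R.

Definition adjunction (A : cdgring) (R : dgmod A) :
    dgmor (selfmod A) (RHom R R) :=
  mul_mor (tgt_map (Kinj_resolution R)).

(* D(A) is the localization of the category of DG modules at the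
   quasi-isomorphisms: its morphisms are the classes, for [zeq], of formal
   composites of morphisms and of inverses of quasi-isomorphisms. *)

Section DerivedCategory.
Variable A : cdgring.

Inductive zigzag : dgmod A -> dgmod A -> Type :=
| zmor M N of dgmor M N : zigzag M N
| zinv M N (s : dgmor N M) of quasi_iso s : zigzag M N
| zcomp M N P of zigzag N P & zigzag M N : zigzag M P.

Inductive zeq : forall M N, zigzag M N -> zigzag M N -> Prop :=
| zeq_refl M N (f : zigzag M N) : zeq f f
| zeq_sym M N (f g : zigzag M N) : zeq f g -> zeq g f
| zeq_trans M N (f g h : zigzag M N) : zeq f g -> zeq g h -> zeq f h
| zeq_comp M N P (g g' : zigzag N P) (f f' : zigzag M N) :
    zeq g g' -> zeq f f' -> zeq (zcomp g f) (zcomp g' f')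
| zeq_assoc M N P Q (h : zigzag P Q) (g : zigzag N P) (f : zigzag M N) :
    zeq (zcomp h (zcomp g f)) (zcomp (zcomp h g) f)
| zeq_idl M N (f : zigzag M N) : zeq (zcomp (zmor (dgmor_id N)) f) f
| zeq_idr M N (f : zigzag M N) : zeq (zcomp f (zmor (dgmor_id M))) f
| zeq_mor M N P (g : dgmor N P) (f : dgmor M N) :
    zeq (zcomp (zmor g) (zmor f)) (zmor (dgmor_comp g f))
| zeq_invl M N (s : dgmor N M) (hs : quasi_iso s) :
    zeq (zcomp (zinv hs) (zmor s)) (zmor (dgmor_id N))
| zeq_invr M N (s : dgmor N M) (hs : quasi_iso s) :
    zeq (zcomp (zmor s) (zinv hs)) (zmor (dgmor_id M)).

Definition is_iso (M N : dgmod A) (f : zigzag M N) : Prop :=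
  exists g : zigzag N M,
    zeq (zcomp g f) (zmor (dgmor_id M)) /\ zeq (zcomp f g) (zmor (dgmor_id N)).

Definition isomorphic (M N : dgmod A) : Prop :=
  exists f : zigzag M N, is_iso f.

Definition iso_class (M : dgmod A) : dgmod A -> Prop := isomorphic M.

End DerivedCategory.

Definition int_interval (I : set int) : Prop :=
  forall x y, I x -> I y -> forall z, x <= z <= y -> I z.

Definition con (M : complex) : set int :=
  smallest int_interval [set i | exists c : cohomology M i, c <> 0].

(* The interval - I + [d0, d1]; for intervals of integers, the elementwise sum
   agrees with adding the (possibly infinite) endpoints. *)
Definition opp_shift (I : set int) (d0 d1 : int) : set int :=
  [set n | exists2 i, I i & - i + d0 <= n <= - i + d1].

Definition fin_gen (B : comPzRingType) (V : lmodType B) : Prop :=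
  exists (n : nat) (v : 'I_n -> V), forall x, exists b : 'I_n -> B,
    x = \sum_(i < n) b i *: v i.

Definition finite_injdim (A : cdgring) (R : dgmod A) : Prop :=
  exists d0 d1 : int, d0 <= d1 /\
    forall M : dgmod A, con (RHom M R) `<=` opp_shift (con M) d0 d1.

Definition dualizing (A : cdgring) (R : dgmod A) : Prop :=
  [/\ forall i, fin_gen (Hmod R i : lmodType (Abar A)),
      finite_injdim R &
      is_iso (zmor (adjunction R))].

(* Predicates rather than [set]s: the universe of [classical_sets.set] is too
   small for [dgmod A]. *)
Definition dualizing_class (A : cdgring) : Type :=
  {C : dgmod A -> Prop | exists R, dualizing R /\ C = iso_class R}.

Definition dclass (A : cdgring) (R : dgmod A) (hR : dualizing R) :
    dualizing_class A :=
  exist _ (iso_class R) (ex_intro _ R (conj hR erefl)).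

Section Ideals.
Variable B : comPzRingType.

Definition is_ideal (I : set B) : Prop :=
  [/\ I 0, forall x y, I x -> I y -> I (x + y) & forall a x, I x -> I (a * x)].

Definition generates (n : nat) (e : 'I_n -> B) (I : set B) : Prop :=
  I = [set x | exists b : 'I_n -> B, x = \sum_(i < n) b i * e i].

Definition noetherian : Prop :=
  forall I, is_ideal I -> exists (n : nat) (e : 'I_n -> B), generates e I.

Definition prime_ideal (P : set B) : Prop :=
  [/\ is_ideal P, ~ P 1 & forall x y, P (x * y) -> P x \/ P y].

Definition maximal_ideal (P : set B) : Prop :=
  [/\ is_ideal P, ~ P 1 &
      forall I, is_ideal I -> ~ I 1 -> P `<=` I -> I = P].

Definition prime_chain (n : nat) : Prop :=
  exists P : nat -> set B, (forall i, (i <= n)%N -> prime_ideal (P i)) /\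
    (forall i, (i < n)%N -> P i `<` P i.+1).

Definition finite_dimensional : Prop :=
  exists d : nat, forall n, prime_chain n -> (n <= d)%N.

Definition krull_dim (d : nat) : Prop :=
  prime_chain d /\ forall n, prime_chain n -> (n <= d)%N.

Definition regular_local : Prop :=
  noetherian /\ exists P : set B,
    (forall Q, maximal_ideal Q <-> Q = P) /\
    exists2 d, krull_dim d & exists e : 'I_d -> B, generates e P.

Definition multiplicative (S : set B) : Prop :=
  S 1 /\ forall x y, S x -> S y -> S (x * y).

End Ideals.

Section Localization.
Variables (B C : comPzRingType).

(* f exhibits C as the ring of fractions of B with denominators in S. *)
Definition is_localization (S : set B) (f : {rmorphism B -> C}) : Prop :=
  [/\ forall s, S s -> exists t, f s * t = 1,
      forall c, exists b s, S s /\ c * f s = f b &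
      forall b, f b = 0 -> exists2 s, S s & s * b = 0].

Definition finite_type (f : {rmorphism B -> C}) : Prop :=
  exists (n : nat) (c : 'I_n -> C), forall T : set C,
    (forall b, T (f b)) -> (forall i, T (c i)) ->
    (forall x y, T x -> T y -> T (x - y)) ->
    (forall x y, T x -> T y -> T (x * y)) ->
    T = setT.

End Localization.

Definition ess_finite_type (B C : comPzRingType) (f : B -> C) : Prop :=
  exists (D : comPzRingType) (g : {rmorphism B -> D}) (S : set D)
      (l : {rmorphism D -> C}),
    [/\ finite_type g, multiplicative S, is_localization S l &
        forall b, f b = l (g b)].

Definition regular (B : comPzRingType) : Prop :=
  noetherian B /\ forall P : set B, prime_ideal P ->
    exists (L : comPzRingType) (f : {rmorphism B -> L}),
      is_localization (~` P) f /\ regular_local L.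

Definition pseudo_noetherian (A : cdgring) : Prop :=
  noetherian (Abar A) /\
  forall i, fin_gen (Hmod (selfmod A) i : lmodType (Abar A)).

(* The homomorphism K -> H^0(A) induced by a DG ring homomorphism K -> A. *)
Definition induced (K : comPzRingType) (A : cdgring)
    (f : dgrmor (ring_dg K) A) (x : K) : Abar A :=
  canon A 0 (f 0 x).

Definition tractable (A : cdgring) : Prop :=
  pseudo_noetherian A /\
  exists (K : comPzRingType) (f : dgrmor (ring_dg K) A),
    [/\ regular K, finite_dimensional K & ess_finite_type (induced f)].

(* The operation R |-> RHom_A(H^0(A), R), with values in D(H^0(A)). *)
Definition RHom_bar (A : cdgring) (R : dgmod A) : dgmod (ring_dg (Abar A)) :=
  RHom_along (canon A) (selfmod (ring_dg (Abar A))) R.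

(* Main.v *)
(* Write B for H^0(A), N for the kernel of A -> B (living in negative degrees), and
   compute RHom by semi-injective modules J. A way-out argument by attaching cells
   shows that a dualizing J induces a dualizing Hom_A(B, J).

   Injectivity: let J, J' be dualizing with Hom_A(B, J) and Hom_A(B, J') isomorphic,
   and F(M) = Hom(Hom(M, J), J'). Then F(B) has no cohomology in positive degrees,
   and descending induction along N -> A -> B gives the same for F(A); so the
   isomorphism, a class in H^0 F(B), lifts to H^0 F(A), that is, to a map J -> J'.
   It is a quasi-isomorphism because Hom_A(B, -) detects the lowest cohomology.

   Surjectivity: start from S dualizing over B and a resolution I of S over A. The
   cokernel C of S -> Hom_A(B, I) is measured by the top degree of Hom_B(C, S);
   replacing I by the cone of a suitable map into it lowers this degree by one, while
   I changes only in higher and higher degrees. The colimit J has Hom_A(B, J)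
   isomorphic to S, and its bounds and biduality are inherited from S because a module
   with cohomology in a single degree comes from B. *)

From HB Require Import structures.
From mathcomp Require Import all_boot all_order all_algebra.
From mathcomp Require Import zify.
From mathcomp Require Import boolp classical_sets functions.
Require Import Defs.

Set Implicit Arguments.
Unset Strict Implicit.
Unset Printing Implicit Defensive.

Import Order.TTheory GRing.Theory Num.Theory.

Local Open Scope ring_scope.

(** * Complexes and long exact sequences *)

(** A semi-injective module is both K-injective and injective as a graded module, so Hom into it is
    exact on the nose. Every derived statement is therefore phrased as vanishing of cohomology in a
    range of degrees and propagated through honest long exact sequences. A map is made injective by
    adding a contractible summand to its target, after which its cone is a cokernel.

    The obstacle to surjectivity is that Hom_A(B, I) is larger than S. The quotient has the
    cohomology of Hom(N, I) shifted by one, and N lives in degrees at most -1; so it starts two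
    degrees above S, and its dual into S ends two degrees below Hom(S, S). As Hom(S, S) is B, with
    top degree 0, the construction starts from the bound -2. The correction at top degree p is
    coinduced from a resolution over A; its own error is two degrees lower, of which forming the
    cone gives one back. Hence the net gain of one degree per step, and hence the bounds carried
    along everywhere.

    Dévissage runs over predicates [h M i] rather than functors, since only vanishing or finite
    generation is ever transported. *)

Definition mkadd (U V : zmodType) (f : U -> V) (h : zmod_morphism f) :
  {additive U -> V} := HB.pack f (GRing.isZmodMorphism.Build U V f h).

Definition cyc (C : complex) i (z : C i) := forall j (h : i + 1 = j), df C h z = 0.
Definition bnd (C : complex) i (z : C i) := exists j (h : j + 1 = i) u, df C h u = z.
Definition exact (C : complex) i := forall z : C i, cyc z -> bnd z.

Lemma cyc_at (C : complex) i j (h : i + 1 = j) (z : C i) : df C h z = 0 -> cyc z.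
Proof.
move=> e k h'; have ek : k = j by lia.
by move: h'; rewrite ek => h'; rewrite (eq_irrelevance h' h).
Qed.

Lemma bnd_at (C : complex) i j (h : j + 1 = i) (z : C i) :
  bnd z -> exists u, df C h u = z.
Proof.
move=> [k [h' [u e]]]; have ek : k = j by lia.
by move: h' u e; rewrite ek => h' u e; exists u; rewrite (eq_irrelevance h h').
Qed.

Lemma bnd_d (C : complex) i j (h : j + 1 = i) u : bnd (df C h u).
Proof. by exists j, h, u. Qed.

Lemma bnd_cyc (C : complex) i (z : C i) : bnd z -> cyc z.
Proof. by move=> [j [h [u <-]]] k h'; rewrite dfK. Qed.

Lemma cyc_d (C : complex) i j (h : j + 1 = i) u : cyc (df C h u).
Proof. exact/bnd_cyc/bnd_d. Qed.

Lemma cyc0 (C : complex) i : cyc (0 : C i).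
Proof. by move=> j h; rewrite raddf0. Qed.
Lemma cycD (C : complex) i (x y : C i) : cyc x -> cyc y -> cyc (x + y).
Proof. by move=> hx hy j h; rewrite raddfD /= hx hy addr0. Qed.
Lemma cycN (C : complex) i (x : C i) : cyc x -> cyc (- x).
Proof. by move=> hx j h; rewrite raddfN /= hx oppr0. Qed.
Lemma cycB (C : complex) i (x y : C i) : cyc x -> cyc y -> cyc (x - y).
Proof. by move=> hx hy; apply: cycD => //; apply: cycN. Qed.
Lemma bnd0 (C : complex) i : bnd (0 : C i).
Proof. by exists (i - 1), (subrK 1 i), 0; rewrite raddf0. Qed.
Lemma bndD (C : complex) i (x y : C i) : bnd x -> bnd y -> bnd (x + y).
Proof.
move=> [j [h [u <-]]] /(bnd_at h)[v <-]; rewrite -raddfD; exact: bnd_d.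
Qed.
Lemma bndN (C : complex) i (x : C i) : bnd x -> bnd (- x).
Proof. move=> [j [h [u <-]]]; rewrite -raddfN; exact: bnd_d. Qed.
Lemma bndB (C : complex) i (x y : C i) : bnd x -> bnd y -> bnd (x - y).
Proof. by move=> hx hy; apply: bndD => //; apply: bndN. Qed.
Lemma ksgn_cyc (C : complex) i s (x : C i) : cyc x -> cyc (ksgn s x).
Proof. by rewrite /ksgn; case: ifP => // _; apply: cycN. Qed.
Lemma ksgn_bnd (C : complex) i s (x : C i) : bnd x -> bnd (ksgn s x).
Proof. by rewrite /ksgn; case: ifP => // _; apply: bndN. Qed.
Lemma ksgnK (V : zmodType) s (x : V) : ksgn s (ksgn s x) = x.
Proof. by rewrite /ksgn; case: (oddz s) => //; rewrite opprK. Qed.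

Lemma cyc_mor (M N : complex) (f : cplxmor M N) i (z : M i) : cyc z -> cyc (f i z).
Proof. by move=> hz j h; rewrite cmor_d hz raddf0. Qed.
Lemma bnd_mor (M N : complex) (f : cplxmor M N) i (z : M i) : bnd z -> bnd (f i z).
Proof. by move=> [j [h [u <-]]]; rewrite -cmor_d; apply: bnd_d. Qed.

Lemma cyc_is (C : complex) i (z : C i) : cyc z <-> z \in is_cocycle (M := C) (i := i).
Proof. by split=> [h|/asboolP//]; apply/asboolP. Qed.

Lemma cls0 (C : complex) i (z : cocycle C i) : cls z = 0 <-> bnd (cval z).
Proof.
have e0 : cls (0 : cocycle C i) = 0 by apply: raddf0.
by rewrite -e0; split => [/cls_eq|h]; [|apply/cls_eq]; rewrite subr0.
Qed.

Lemma clsS (C : complex) i (c : cohomology C i) :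
  exists2 z : cocycle C i, c = cls z & cyc (cval z).
Proof. by exists (rep c); rewrite ?repK //; apply/cyc_is; apply: cvalP. Qed.

Lemma exactP (C : complex) i : exact C i <-> (forall c : cohomology C i, c = 0).
Proof.
split=> h.
  by move=> c; have [z -> hz] := clsS c; apply/cls0/h.
by move=> z /cyc_is hz; apply/(cls0 (Cocycle hz))/h.
Qed.

Lemma acyclicP (C : complex) : acyclic C <-> forall i, exact C i.
Proof. by split=> h i; apply/exactP/h. Qed.

(* [Hinj f i] and [Hsurj f i]: f is injective, respectively surjective, on H^i. *)
Definition Hinj (M N : complex) (f : cplxmor M N) i :=
  forall z : M i, cyc z -> bnd (f i z) -> bnd z.
Definition Hsurj (M N : complex) (f : cplxmor M N) i :=
  forall w : N i, cyc w -> exists z : M i, cyc z /\ bnd (w - f i z).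

Lemma quasi_isoP (M N : complex) (f : cplxmor M N) :
  quasi_iso f <-> forall i, Hinj f i /\ Hsurj f i.
Proof.
split=> [h i|h i].
  have [g gK fK] := h i; split.
    move=> z /cyc_is hz hb; apply/(cls0 (Cocycle hz)).
    have e0 : cohomology_map f (0 : cohomology M i) = 0.
      have -> : 0 = cls (0 : cocycle M i) by rewrite [RHS]raddf0.
      by rewrite cohomology_mapE; apply/cls0; rewrite /= raddf0; apply: bnd0.
    apply: (can_inj gK); rewrite e0 cohomology_mapE; exact/cls0.
  move=> w /cyc_is hw; set c := g (cls (Cocycle hw)).
  exists (cval (rep c)); split; first by apply/cyc_is; apply: cvalP.
  have := fK (cls (Cocycle hw)); rewrite -/c -[c in LHS]repK cohomology_mapE.
  move/esym/cls_eq => [j [hj [u e]]]; exists j, hj, u; exact: e.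
have [hi hs] := h i.
have inj : injective (@cohomology_map M N f i).
  move=> a b; rewrite -[a]repK -[b]repK !cohomology_mapE => /cls_eq/= hb.
  apply/cls_eq; apply: hi.
    by apply: cycB; apply/cyc_is; apply: cvalP.
  by rewrite raddfB.
have surj : forall c, exists b, @cohomology_map M N f i b = c.
  move=> c; have [w -> hw] := clsS c; have [z [/cyc_is hz hb]] := hs _ hw.
  exists (cls (Cocycle hz)); rewrite cohomology_mapE; apply/esym/cls_eq; exact: hb.
exists (fun c => sval (cid (surj c))) => x.
  by apply: inj; case: cid.
by case: cid.
Qed.

Lemma exact_Hinj (M N : complex) (f : cplxmor M N) i : exact M i -> Hinj f i.
Proof. by move=> h z hz _; apply: h. Qed.
Lemma exact_Hsurj (M N : complex) (f : cplxmor M N) i : exact N i -> Hsurj f i.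
Proof.
by move=> h w hw; exists 0; split; [apply: cyc0|rewrite raddf0 subr0; apply: h].
Qed.
Lemma Hinj_exact (M N : complex) (f : cplxmor M N) i :
  Hinj f i -> exact N i -> exact M i.
Proof. by move=> h e z hz; apply: h => //; apply: e; apply: cyc_mor. Qed.
Lemma Hsurj_exact (M N : complex) (f : cplxmor M N) i :
  Hsurj f i -> exact M i -> exact N i.
Proof.
move=> h e w hw; have [z [hz hb]] := h w hw.
by rewrite -[w](subrK (f i z)); apply: bndD => //; apply: bnd_mor; apply: e.
Qed.

Section Compose.
Variables (M N P : complex) (f : cplxmor M N) (g : cplxmor N P) (k : cplxmor M P).
Variable i : int.
Hypothesis E : forall x, k i x = g i (f i x).

Lemma Hinj_comp : Hinj f i -> Hinj g i -> Hinj k i.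
Proof. by move=> hf hg z hz; rewrite E => hb; apply: hf => //; apply: hg => //; apply: cyc_mor. Qed.
Lemma Hsurj_comp : Hsurj f i -> Hsurj g i -> Hsurj k i.
Proof.
move=> hf hg w hw; have [y [hy by_]] := hg w hw; have [x [hx bx]] := hf y hy.
exists x; split=> //; rewrite E -[w](subrK (g i y)) -addrA -raddfB.
by apply: bndD => //; apply: bnd_mor.
Qed.
Lemma Hinj_compl : Hinj k i -> Hinj f i.
Proof. by move=> hk z hz hb; apply: hk => //; rewrite E; apply: bnd_mor. Qed.
Lemma Hsurj_compr : Hsurj k i -> Hsurj g i.
Proof.
move=> hk w hw; have [x [hx bx]] := hk w hw.
by exists (f i x); rewrite -E; split=> //; apply: cyc_mor.
Qed.
Lemma Hinj_compr : Hinj k i -> Hsurj f i -> Hinj g i.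
Proof.
move=> hk hf y hy hb; have [x [hx bx]] := hf y hy.
rewrite -[y](subrK (f i x)); apply: bndD => //; apply: bnd_mor.
apply: hk => //; rewrite E; rewrite -[f i x](subKr y) raddfB.
by apply: bndB => //; apply: bnd_mor.
Qed.
Lemma Hsurj_compl : Hsurj k i -> Hinj g i -> Hsurj f i.
Proof.
move=> hk hg y hy; have [x [hx bx]] := hk (g i y) (cyc_mor g hy).
exists x; split=> //; apply: hg; first by apply: cycB => //; apply: cyc_mor.
by rewrite raddfB -E.
Qed.
End Compose.

Section Homotopic.
Variables (M N : complex) (f g : cplxmor M N) (i : int).
Hypothesis E : forall x, cyc x -> bnd (f i x - g i x).
Lemma Hinj_homotopic : Hinj f i -> Hinj g i.
Proof.
move=> h z hz hb; apply: h => //.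
by rewrite -[f i z](subrK (g i z)); apply: bndD => //; apply: E.
Qed.
Lemma Hsurj_homotopic : Hsurj f i -> Hsurj g i.
Proof.
move=> h w hw; have [z [hz hb]] := h w hw; exists z; split=> //.
by rewrite -[w](subrK (f i z)) -addrA; apply: bndD => //; apply: E.
Qed.
End Homotopic.

Section BijHiso.
Variables (M N : complex) (f : cplxmor M N).
Hypothesis finj : forall i x, f i x = 0 -> x = 0.
Hypothesis fsurj : forall i y, exists x, f i x = y.
Lemma bij_Hinj i : Hinj f i.
Proof.
move=> z hz [j [h [u e]]]; have [v ev] := fsurj u; exists j, h, v.
by apply/eqP; rewrite -subr_eq0; apply/eqP/finj; rewrite raddfB /= -cmor_d ev e subrr.
Qed.
Lemma bij_Hsurj i : Hsurj f i.
Proof.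
move=> w hw; have [v ev] := fsurj w; exists v; rewrite ev subrr; split; last exact: bnd0.
by move=> j h; apply: finj; rewrite -cmor_d ev hw.
Qed.
Lemma bij_quasi_iso : quasi_iso f.
Proof. by apply/quasi_isoP => i; split; [apply: bij_Hinj|apply: bij_Hsurj]. Qed.
Lemma bij_exact i : exact M i <-> exact N i.
Proof.
by split=> e; [apply: Hsurj_exact (@bij_Hsurj i) e|apply: Hinj_exact (@bij_Hinj i) e].
Qed.
End BijHiso.

Record ses (X Y Z : complex) (f : cplxmor X Y) (g : cplxmor Y Z) : Prop := Ses {
  ses_inj : forall i x, f i x = 0 -> x = 0;
  ses_surj : forall i z, exists y, g i y = z;
  ses_ex : forall i y, g i y = 0 -> exists x, f i x = y;
  ses_0 : forall i x, g i (f i x) = 0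
}.

Section LES.
Variables (X Y Z : complex) (f : cplxmor X Y) (g : cplxmor Y Z).
Hypothesis S : ses f g.

Lemma ses_inj' i x y : f i x = f i y -> x = y.
Proof.
by move=> e; apply/eqP; rewrite -subr_eq0; apply/eqP/(ses_inj S); rewrite raddfB /= e subrr.
Qed.

Lemma ses_cyc i x : cyc (f i x) -> cyc x.
Proof. by move=> h j hj; apply: (ses_inj S); rewrite -cmor_d h. Qed.

Lemma les_mid i (y : Y i) : cyc y -> bnd (g i y) ->
  exists x : X i, cyc x /\ bnd (y - f i x).
Proof.
move=> hy [j [h [u e]]]; have [v ev] := ses_surj S u.
have [|x ex] := ses_ex S (y := y - df Y h v).
  by rewrite raddfB /= -cmor_d ev e subrr.
exists x; rewrite ex; split; last by rewrite subKr; apply: bnd_d.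
by apply: ses_cyc; rewrite ex; apply: cycB => //; apply: cyc_d.
Qed.

Lemma les_lift i j (h : i + 1 = j) (z : Z i) : exact X j -> cyc z ->
  exists2 y : Y i, cyc y & g i y = z.
Proof.
move=> eX hz; have [y ey] := ses_surj S z.
have [|x ex] := ses_ex S (y := df Y h y); first by rewrite -cmor_d ey hz.
have /eX/(bnd_at h)[u eu] : cyc x by apply: ses_cyc; rewrite ex; apply: cyc_d.
exists (y - f i u); last by rewrite raddfB ey /= (ses_0 S) subr0.
by apply: (cyc_at (h := h)); rewrite raddfB /= cmor_d eu ex subrr.
Qed.

Lemma les_rel i j (h : j + 1 = i) (y : Y i) (z : Z j) : exact X i -> cyc y ->
  df Z h z = g i y -> exists2 y' : Y j, g j y' = z & df Y h y' = y.
Proof.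
move=> eX hy e; have [y0 ey0] := ses_surj S z.
have [|x ex] := ses_ex S (y := y - df Y h y0).
  by rewrite raddfB /= -cmor_d ey0 e subrr.
have /eX/(bnd_at h)[u eu] : cyc x.
  by apply: ses_cyc; rewrite ex; apply: cycB => //; apply: cyc_d.
exists (y0 + f j u); first by rewrite raddfD /= ey0 (ses_0 S) addr0.
by rewrite raddfD /= cmor_d eu ex addrC subrK.
Qed.

Lemma ses_exactY i : exact X i -> exact Z i -> exact Y i.
Proof.
move=> eX eZ y hy; have [|x [hx hb]] := les_mid hy; first by apply: eZ; apply: cyc_mor.
by rewrite -[y](subrK (f i x)); apply: bndD => //; apply: bnd_mor; apply: eX.
Qed.

Lemma ses_exactZ i j (h : i + 1 = j) : exact Y i -> exact X j -> exact Z i.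
Proof.
move=> eY eX z hz; have [y hy <-] := les_lift h eX hz.
by apply: bnd_mor; apply: eY.
Qed.

Lemma ses_Hinj i j (h : j + 1 = i) : exact Z j -> Hinj f i.
Proof.
move=> eZ x hx /(bnd_at h)[y ey].
have /eZ/(bnd_at (subrK 1 j))[z ez] : cyc (g j y).
  by apply: (cyc_at (h := h)); rewrite cmor_d ey (ses_0 S).
have [v ev] := ses_surj S z.
have [|u eu] := ses_ex S (y := y - df Y (subrK 1 j) v).
  by rewrite raddfB /= -cmor_d ev ez subrr.
exists j, h, u; apply: ses_inj'.
by rewrite -cmor_d eu raddfB /= ey dfK subr0.
Qed.

Lemma ses_Hsurj i : exact Z i -> Hsurj f i.
Proof. by move=> eZ y hy; apply: les_mid => //; apply: eZ; apply: cyc_mor. Qed.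

Lemma ses_exactX i j (h : j + 1 = i) : exact Y i -> exact Z j -> exact X i.
Proof. by move=> eY eZ; apply: Hinj_exact eY; apply: ses_Hinj eZ. Qed.

Lemma ses_gHinj i : exact X i -> Hinj g i.
Proof.
move=> eX y hy hb; have [x [hx bx]] := les_mid hy hb.
by rewrite -[y](subrK (f i x)); apply: bndD => //; apply: bnd_mor; apply: eX.
Qed.

Lemma ses_gHsurj i j (h : i + 1 = j) : exact X j -> Hsurj g i.
Proof.
move=> eX z hz; have [y hy ey] := les_lift h eX hz.
by exists y; rewrite ey subrr; split=> //; apply: bnd0.
Qed.

Lemma ses_exactX' i j (h : j + 1 = i) : Hinj g i -> Hsurj g j -> exact X i.
Proof.
move=> hi hs x hx; have /(bnd_at h)[y ey] : bnd (f i x).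
  by apply: hi; rewrite ?(ses_0 S); [apply: cyc_mor|apply: bnd0].
have [|w [hw /(bnd_at (subrK 1 j))[z ez]]] := hs (g j y).
  by apply: (cyc_at (h := h)); rewrite cmor_d ey (ses_0 S).
have [v ev] := ses_surj S z.
have [|u eu] := ses_ex S (y := y - w - df Y (subrK 1 j) v).
  by rewrite !raddfB /= -cmor_d ev ez subrr.
exists j, h, u; apply: ses_inj'.
by rewrite -cmor_d eu !raddfB /= ey dfK (hw _ h) !subr0.
Qed.

End LES.

Section Transport.
Variable C : complex.
(** Shifts produce degrees such as i + n + m and i + (m + n), and elements themselves must be moved
    between them; equations passed as arguments no longer suffice. *)
Definition tr i j (e : i = j) (x : C i) : C j := eq_rect i (fun k => C k) x j e.
Lemma tr_id i (e : i = i) x : tr e x = x.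
Proof. by rewrite (eq_irrelevance e erefl). Qed.
Lemma tr_zmod i j (e : i = j) : zmod_morphism (tr e).
Proof. by move=> x y; case: j / e. Qed.
HB.instance Definition _ i j (e : i = j) :=
  GRing.isZmodMorphism.Build (C i) (C j) (tr e) (tr_zmod e).
Lemma trK i j (e : i = j) (e' : j = i) x : tr e' (tr e x) = x.
Proof. by subst j; rewrite !tr_id. Qed.
Lemma df_tr i j i' j' (e : i = i') (e' : j = j') (h : i + 1 = j) (h' : i' + 1 = j') x :
  df C h' (tr e x) = tr e' (df C h x).
Proof. by move: h h'; case: i' / e; case: j' / e' => h h'; rewrite (eq_irrelevance h h'). Qed.
Lemma tr_irr i j (e e' : i = j) x : tr e x = tr e' x.
Proof. by rewrite (eq_irrelevance e e'). Qed.
Lemma tr_cyc i j (e : i = j) x : cyc x -> cyc (tr e x).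
Proof. by case: j / e. Qed.
Lemma tr_bnd i j (e : i = j) x : bnd (tr e x) <-> bnd x.
Proof. by case: j / e. Qed.
End Transport.

Lemma mor_tr (M N : complex) (f : cplxmor M N) i j (e : i = j) x :
  f j (tr e x) = tr e (f i x).
Proof. by case: j / e. Qed.

Lemma act_tr A (M : dgmod A) i j j' k k' (e : j = j') (e' : k = k')
   (h : i + j = k) (h' : i + j' = k') a (x : M j) :
  act h' a (tr e x) = tr e' (act h a x).
Proof. by move: h h'; case: j' / e; case: k' / e' => h h'; rewrite (eq_irrelevance h h'). Qed.

Lemma hf_tr A (M N : dgmod A) n (f : hom M N n) i i' j j' (e : i = i') (e' : j = j')
   (h : i + n = j) (h' : i' + n = j') (x : M i) :
  hf f h' (tr e x) = tr e' (hf f h x).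
Proof. by move: h h'; case: i' / e; case: j' / e' => h h'; rewrite (eq_irrelevance h h'). Qed.

Lemma ksgn_tr (C : complex) i j (e : i = j) s (x : C i) : tr e (ksgn s x) = ksgn s (tr e x).
Proof. by case: j / e. Qed.

Lemma ksgn0 (V : zmodType) s : ksgn s (0 : V) = 0.
Proof. by rewrite /ksgn oppr0 if_same. Qed.
Lemma ksgnN (V : zmodType) s (x : V) : ksgn s (- x) = - ksgn s x.
Proof. by rewrite /ksgn; case: (oddz s). Qed.
Lemma ksgnB (V : zmodType) s (x y : V) : ksgn s (x - y) = ksgn s x - ksgn s y.
Proof. by rewrite ksgnD ksgnN. Qed.
Lemma ksgnM (V : zmodType) s t (x : V) : ksgn s (ksgn t x) = ksgn (s + t) x.
Proof. by rewrite /ksgn oddzD; case: (oddz s); case: (oddz t) => //=; rewrite opprK. Qed.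
Lemma ksgn_mor (V W : zmodType) (f : {additive V -> W}) s x : f (ksgn s x) = ksgn s (f x).
Proof. by rewrite /ksgn; case: (oddz s); rewrite ?raddfN. Qed.
Lemma ksgn_odd (V : zmodType) s t (x : V) : oddz s = oddz t -> ksgn s x = ksgn t x.
Proof. by rewrite /ksgn => ->. Qed.
Lemma ksgn_inj (V : zmodType) s (x y : V) : ksgn s x = ksgn s y -> x = y.
Proof. by move=> e; rewrite -[x](ksgnK s) e ksgnK. Qed.
Lemma oddzN s : oddz (- s) = oddz s.
Proof. by rewrite /oddz abszN. Qed.
Lemma oddzS i j : i + 1 = j -> oddz j = ~~ oddz i.
Proof. by move=> <-; rewrite oddzD oddz1 addbT. Qed.
Lemma oddzB s t : oddz (s - t) = oddz s (+) oddz t.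
Proof. by rewrite oddzD oddzN. Qed.

Lemma actBr A (M : dgmod A) i j k (h : i + j = k) a (x y : M j) :
  act h a (x - y) = act h a x - act h a y.
Proof. by rewrite actDr actNr. Qed.
Lemma actBl A (M : dgmod A) i j k (h : i + j = k) a b (x : M j) :
  act h (a - b) x = act h a x - act h b x.
Proof. by rewrite actDl actNl. Qed.
Lemma hfB A (M N : dgmod A) n (f : hom M N n) i j (h : i + n = j) x y :
  hf f h (x - y) = hf f h x - hf f h y.
Proof. by rewrite hfD hfN. Qed.
Lemma act_irr A (M : dgmod A) i j k (h h' : i + j = k) a (x : M j) :
  act h a x = act h' a x.
Proof. by rewrite (eq_irrelevance h h'). Qed.
Lemma hf_irr A (M N : dgmod A) n (f : hom M N n) i j (h h' : i + n = j) x :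
  hf f h x = hf f h' x.
Proof. by rewrite (eq_irrelevance h h'). Qed.
Lemma df_irr (C : complex) i j (h h' : i + 1 = j) (x : C i) : df C h x = df C h' x.
Proof. by rewrite (eq_irrelevance h h'). Qed.

Lemma additiveB (U V : zmodType) (f : {additive U -> V}) : zmod_morphism f.
Proof. exact: raddfB. Qed.

Section MkMor.
Variables (A : cdgring) (M N : dgmod A) (f : forall i, M i -> N i).
Hypothesis fB : forall i, zmod_morphism (f (i := i)).
Hypothesis fd : forall i j (h : i + 1 = j) x, df N h (f x) = f (df M h x).
Hypothesis fa : forall i j k (h : i + j = k) a x, f (act h a x) = act h a (f x).
Definition mkmor : dgmor M N :=
  @DGMor A M N (@CplxMor M N (fun i => mkadd (@fB i)) fd) fa.
End MkMor.

(** * Shifts, twisted extensions and fibres *)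

Section Shift.
Variables (A : cdgring) (m : int) (M : dgmod A).
Lemma sh_eq1 (i j : int) : i + 1 = j -> (i + m) + 1 = j + m. Proof. lia. Qed.
Lemma sh_eq2 (i j k : int) : i + j = k -> i + (j + m) = k + m. Proof. lia. Qed.

(** Neither the differential nor the action carries a sign; multiplication by (-1)^(m i) in degree i
    identifies this with the usual shift. The signs reappear in maps into or out of shifts:
    [fib_th], [att_th], [hom_unshift]. *)
Definition sh : dgmod A.
Proof.
exists (@Complex (fun i => M (i + m)) (fun i j h => df M (sh_eq1 h))
   (fun i j k h h' x => dfK (sh_eq1 h) (sh_eq1 h') x))
  (fun i j k h a x => act (sh_eq2 h) a x).
- by move=> *; apply: actDl.
- by move=> *; apply: actDr.
- by move=> *; apply: actA.
- by move=> *; apply: act1.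
- by move=> i j k i' j' k' h hi hj hk h1 h2 a x; apply: act_d.
Defined.

Lemma sh_exact i j (e : i + m = j) : exact sh i <-> exact M j.
Proof.
case: j / e; split=> h z hz.
  have e : (i - 1) + 1 = i by lia.
  have /h/(bnd_at e)[u eu] : cyc (z : sh i).
    by apply: (cyc_at (h := erefl)); apply: (hz _ (sh_eq1 erefl)).
  exact: (ex_intro _ _ (ex_intro _ (sh_eq1 e) (ex_intro _ u eu))).
have /h[j [e [u eu]]] : @cyc M (i + m) z.
  exact: (cyc_at (h := sh_eq1 erefl) (hz _ erefl)).
have ej : (j - m) + m = j by lia.
have e2 : (j - m) + 1 = i by lia.
exists (j - m), e2, (tr (esym ej) u).
have E := df_tr (esym ej) (erefl (i + m)) e (sh_eq1 e2) u.
by apply: etrans E _; rewrite tr_id.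
Qed.
End Shift.

Lemma sh_add_eq (m n l : int) : m + n = l -> forall i, i + n + m = i + l.
Proof. lia. Qed.

Definition sh_add A m n l (e : m + n = l) (M : dgmod A) : dgmor (sh n (sh m M)) (sh l M).
Proof.
apply: (@mkmor A (sh n (sh m M)) (sh l M) (fun i x => @tr M (i + n + m) (i + l) (sh_add_eq e i) x)) => [i|i j h x|i j k h a x].
- exact: (@tr_zmod M _ _ (sh_add_eq e i)).
- exact: (df_tr (sh_add_eq e i) (sh_add_eq e j) (sh_eq1 m (sh_eq1 n h)) (sh_eq1 l h)).
- exact: esym (act_tr (sh_add_eq e j) (sh_add_eq e k) (sh_eq2 m (sh_eq2 n h)) (sh_eq2 l h) a x).
Defined.

Lemma sh_add_inj A m n l (e : m + n = l) (M : dgmod A) i (x : sh n (sh m M) i) :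
  sh_add e M i x = 0 -> x = 0.
Proof.
move=> h; have h' : @tr M _ _ (sh_add_eq e i) x = 0 := h.
apply: etrans (esym (@trK M _ _ (sh_add_eq e i) (esym (sh_add_eq e i)) x)) _.
by rewrite h' raddf0.
Qed.

Lemma sh_add_surj A m n l (e : m + n = l) (M : dgmod A) i (y : sh l M i) :
  exists x, sh_add e M i x = y.
Proof.
exists (@tr M _ _ (esym (sh_add_eq e i)) y); exact: (@trK M).
Qed.

Definition sh0 A (M : dgmod A) : dgmor (sh 0 M) M.
Proof.
apply: (@mkmor A (sh 0 M) M (fun i x => @tr M (i + 0) i (addr0 i) x)) => [i|i j h x|i j k h a x].
- exact: (@tr_zmod M _ _ (addr0 i)).
- exact: (df_tr (addr0 i) (addr0 j) (sh_eq1 0 h) h).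
- exact: esym (act_tr (addr0 j) (addr0 k) (sh_eq2 0 h) h a x).
Defined.

Section Twist.
Variables (A : cdgring) (P Q : dgmod A) (th : hom P Q 1).
Hypothesis thd : forall n (h : 1 + 1 = n), hom_d h th = 0.

Definition tw_d i j (h : i + 1 = j) (x : P i * Q i) : P j * Q j :=
  (df P h x.1, df Q h x.2 + hf th h x.1).
Lemma tw_dB i j (h : i + 1 = j) : zmod_morphism (tw_d h).
Proof.
move=> [p q] [p' q']; rewrite /tw_d /= !raddfB hfB /=; congr pair.
by rewrite addrACA -opprD.
Qed.
Lemma th_d i j k (h : i + 1 = j) (h' : j + 1 = k) x :
  df Q h' (hf th h x) + hf th h' (df P h x) = 0.
Proof.
have e : i + 2 = k by lia.
have := congr1 (fun g : hom P Q 2 => hf g e x) (thd erefl).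
by rewrite (hom_dE erefl th e h h' h h') /= opprK.
Qed.
Lemma tw_dK i j k (h : i + 1 = j) (h' : j + 1 = k) x :
  mkadd (tw_dB h') (mkadd (tw_dB h) x) = 0.
Proof.
rewrite /= /tw_d /= dfK raddfD /= dfK add0r.
by rewrite th_d.
Qed.

(** The extension of P by Q classified by the degree one cocycle th, split as a graded module.
    Direct sums (th = 0), fibres and attached cells are all instances, so one short exact sequence
    [tw_ses] serves them all. *)
Definition tw : dgmod A.
Proof.
exists (@Complex (fun i => (P i * Q i)%type : zmodType)
   (fun i j h => mkadd (tw_dB h)) tw_dK)
  (fun i j k h a x => (act h a x.1, act h a x.2)).
- by move=> *; rewrite !actDl.
- by move=> *; rewrite !actDr.
- by move=> i j k ij jk ijk h1 h2 h3 h4 a b x; rewrite !(actA h1 h2 h3 h4).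
- by move=> i h [p q]; rewrite !act1.
- move=> i j k i' j' k' h hi hj hk h1 h2 a [p q].
  rewrite /= /tw_d /= !(act_d h hi hj hk h1 h2) actDr.
  rewrite (hf_act th h hk hj h2) mulr1 -addrA -ksgnD.
  by rewrite /ksgn; case: (oddz i).
Defined.

Definition tw_in : dgmor Q tw.
Proof.
apply: (@mkmor A Q tw (fun i q => (0, q))) => [i|i j h x|i j k h a x].
- by move=> x y; rewrite -[LHS]/(0, x - y); congr pair; rewrite subr0.
- by rewrite /= /tw_d /= raddf0 hf0 addr0.
- by rewrite /= act0r.
Defined.

Definition tw_pr : dgmor tw P.
Proof. by apply: (@mkmor A tw P (fun i x => x.1)). Defined.

Lemma tw_ses : ses tw_in tw_pr.
Proof.
split=> //.
- by move=> i x /(congr1 snd).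
- by move=> i z; exists (z, 0).
- by move=> i [p q] /= ->; exists q.
Qed.
End Twist.

Section Sum.
Variables (A : cdgring) (P Q : dgmod A).
Lemma sum_th n (h : 1 + 1 = n) : hom_d h (0 : hom P Q 1) = 0.
Proof. exact: raddf0. Qed.
Definition sum := tw sum_th.
Definition sum_mor (M : dgmod A) (u : dgmor M P) (v : dgmor M Q) : dgmor M sum.
Proof.
apply: (@mkmor A M sum (fun i x => (u i x, v i x))) => [i|i j h x|i j k h a x].
- by move=> x y; rewrite !raddfB.
- by rewrite /= /tw_d /= !cmor_d addr0.
- by rewrite /= !mmor_act.
Defined.
End Sum.

Section Fib.
Variables (A : cdgring) (X Y : dgmod A) (f : dgmor X Y).

Lemma fib_eq (i j : int) : i + 1 = j -> i = j + -1. Proof. lia. Qed.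

Definition fib_th : hom X (sh (-1) Y) 1.
Proof.
exists (fun i j h x => ksgn i (@tr Y i (j + -1) (fib_eq h) (f i x)) : sh (-1) Y j).
  by move=> i j h x y; rewrite !raddfD /= ksgnD.
move=> p i j k l hp hk hn hl a x; rewrite /= mmor_act.
rewrite -(act_tr (fib_eq hn) (fib_eq hk) hp (sh_eq2 (-1) hl)).
rewrite act_ksgn ksgnM; apply: ksgn_odd; rewrite -hp mulr1 //.
Defined.

Lemma fib_thd n (h : 1 + 1 = n) : hom_d h fib_th = 0.
Proof.
apply: hom_ext => i j e x.
have e1 : i + 1 + 1 = j by lia.
rewrite (hom_dE h fib_th e erefl e1 erefl e1) /=.
rewrite -cmor_d df_ksgn.
have -> : df Y (sh_eq1 (-1) e1) (tr (fib_eq erefl) (f i x))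
   = tr (fib_eq e1) (df Y erefl (f i x)) by apply: df_tr.
rewrite /ksgn (oddzS (erefl (i + 1))); case: (oddz i); rewrite /= ?opprK ?addNr ?subrr //.
Qed.

(** The homotopy fibre, that is, the mapping cone shifted by -1. By [fib_quasi_iso] its exactness
    expresses that u is a quasi-isomorphism, degree by degree. *)
Definition fib := tw fib_thd.

Lemma fib_bnd_iff i (z : X i) (w : sh (-1) Y i) j (h : i + 1 = j) :
  df fib h (z, w) = 0 -> bnd (f i z).
Proof.
case=> _ e; exists (i + -1), (subrK 1 i), (- ksgn i w).
rewrite raddfN /= df_ksgn.
have E : tr (fib_eq h) (df Y (subrK 1 i) w) = - ksgn i (tr (fib_eq h) (f i z)).
  move/eqP: e; rewrite addr_eq0 => /eqP <-.
  by rewrite -(df_tr (erefl (i + -1)) (fib_eq h) (subrK 1 i) (sh_eq1 (-1) h)).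
have {E} E : df Y (subrK 1 i) w = - ksgn i (f i z).
  rewrite -ksgn_tr -raddfN /= in E.
  by move: E; case: _ / (fib_eq h) => /=.
by rewrite E ksgnN ksgnK opprK.
Qed.

Lemma fib_cyc i (z : X i) (w : Y (i + -1)) :
  cyc z -> df Y (subrK 1 i) w = - ksgn i (f i z) -> @cyc fib i (z, w).
Proof.
move=> hz e; apply: (cyc_at (h := erefl)); rewrite /= /tw_d /= hz.
congr pair; have E : df Y (sh_eq1 (-1) erefl) w = tr (fib_eq erefl) (df Y (subrK 1 i) w).
  exact: (df_tr (erefl (i + -1))).
by apply: etrans (congr1 (fun x => x + _) E) _; rewrite e raddfN /= ksgn_tr addNr.
Qed.
End Fib.

(** * Submodules, quotients and Hom modules *)

Record subgroup (V : zmodType) := Subgroup {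
  sgp :> V -> Prop;
  sgp0 : sgp 0;
  sgpB : forall x y, sgp x -> sgp y -> sgp (x - y)
}.

Section Subgroup.
Variables (V : zmodType) (P : subgroup V).
Lemma sgpN x : P x -> P (- x).
Proof. by move=> h; rewrite -sub0r; apply: sgpB => //; apply: sgp0. Qed.
Lemma sgpD x y : P x -> P y -> P (x + y).
Proof. by move=> hx hy; rewrite -[y]opprK; apply: sgpB => //; apply: sgpN. Qed.

Definition sg_pred : {pred V} := fun x => `[< P x >].
Lemma sg_zmod : zmod_closed sg_pred.
Proof.
split; first by apply/asboolP/sgp0.
by move=> x y /asboolP hx /asboolP hy; apply/asboolP/sgpB.
Qed.
HB.instance Definition _ := GRing.isZmodClosed.Build V sg_pred sg_zmod.

Record sgT := SgT { sgval : V; sgvalP : sgval \in sg_pred }.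
HB.instance Definition _ := [isSub for sgval].
HB.instance Definition _ := [Choice of sgT by <:].
HB.instance Definition _ := [SubChoice_isSubZmodule of sgT by <:].
Definition mksg x (h : P x) : sgT := SgT (introT (asboolP _) h : x \in sg_pred).
Lemma sg_prop (x : sgT) : P (sgval x).
Proof. exact/asboolP/(sgvalP x). Qed.
Lemma sgvalB : zmod_morphism sgval.
Proof. exact: (raddfB (val : sgT -> V)). Qed.

Definition qzT : zmodType := Quotient.quot (sg_pred : zmodClosed V).
Definition qpi (x : V) : qzT := (\pi x)%qT.
Lemma qpiB : zmod_morphism qpi.
Proof. exact: raddfB. Qed.
HB.instance Definition _ := GRing.isZmodMorphism.Build V qzT qpi qpiB.
Lemma qpi_surj (c : qzT) : exists x, qpi x = c.
Proof. by exists (repr c); apply: reprK. Qed.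
Lemma qpi_eq x y : qpi x = qpi y <-> P (x - y).
Proof.
split; first by move/eqP; rewrite -Quotient.idealrBE => /asboolP.
by move=> h; apply/eqP; rewrite -Quotient.idealrBE; apply/asboolP.
Qed.
Lemma qpi0 x : qpi x = 0 <-> P x.
Proof. by rewrite -(raddf0 qpi) qpi_eq subr0. Qed.
Definition qrep (c : qzT) : V := repr c.
Lemma qrepK c : qpi (qrep c) = c.
Proof. exact: reprK. Qed.
Definition qlift (W : zmodType) (f : V -> W) (c : qzT) : W := f (qrep c).
Lemma qliftE (W : zmodType) (f : V -> W) (fB : zmod_morphism f)
  (h : forall x, P x -> f x = 0) x : qlift f (qpi x) = f x.
Proof.
apply/eqP; rewrite -subr_eq0 -fB; apply/eqP/h; apply/qpi_eq; exact: qrepK.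
Qed.
Lemma qlift_morph (W : zmodType) (f : V -> W) (fB : zmod_morphism f)
  (h : forall x, P x -> f x = 0) : zmod_morphism (qlift f).
Proof.
move=> c c'; have [x <-] := qpi_surj c; have [y <-] := qpi_surj c'.
by rewrite -raddfB !qliftE.
Qed.
End Subgroup.

Record submod (A : cdgring) (M : dgmod A) := Submod {
  smP :> forall i, subgroup (M i);
  sm_d : forall i j (h : i + 1 = j) x, smP i x -> smP j (df M h x);
  sm_a : forall i j k (h : i + j = k) (a : A i) x, smP j x -> smP k (act h a x)
}.

Section SubQuo.
Variables (A : cdgring) (M : dgmod A) (P : submod M).

Definition sub_d i j (h : i + 1 = j) (x : sgT (P i)) : sgT (P j) :=
  mksg (sm_d h (sg_prop x)).
Lemma sub_dB i j (h : i + 1 = j) : zmod_morphism (sub_d h).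
Proof. by move=> x y; apply: val_inj; rewrite /= raddfB. Qed.
Lemma sub_dK i j k (h : i + 1 = j) (h' : j + 1 = k) x :
  mkadd (sub_dB h') (mkadd (sub_dB h) x) = 0.
Proof. by apply: val_inj; rewrite /= dfK. Qed.

Definition sub : dgmod A.
Proof.
exists (@Complex (fun i => sgT (P i) : zmodType)
   (fun i j h => mkadd (sub_dB h)) sub_dK)
  (fun i j k h a x => mksg (sm_a h a (sg_prop x))).
- by move=> i j k h a a' x; apply: val_inj; rewrite /= actDl.
- by move=> i j k h a x x'; apply: val_inj; rewrite /= actDr.
- by move=> i j k ij jk ijk h1 h2 h3 h4 a b x; apply: val_inj; apply: actA.
- by move=> i h x; apply: val_inj; apply: act1.
- move=> i j k i' j' k' h hi hj hk h1 h2 a x; apply: val_inj.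
  rewrite /= (act_d h hi hj hk h1 h2) /=; congr (_ + _).
  by rewrite /ksgn; case: (oddz i).
Defined.

Definition sub_in : dgmor sub M.
Proof. by apply: (@mkmor A sub M (fun i x => sgval x)) => // i; apply: sgvalB. Defined.

Lemma sub_in_inj i x : sub_in i x = 0 -> x = 0.
Proof. by move=> h; apply: val_inj. Qed.

Definition sub_lift (N : dgmod A) (u : dgmor N M) (h : forall i x, P i (u i x)) :
  dgmor N sub.
Proof.
apply: (@mkmor A N sub (fun i x => mksg (h i x))).
- by move=> i x y; apply: val_inj; rewrite /= raddfB.
- by move=> i j e x; apply: val_inj; rewrite /= cmor_d.
- by move=> i j k e a x; apply: val_inj; rewrite /= mmor_act.
Defined.

Definition quo_d i j (h : i + 1 = j) : qzT (P i) -> qzT (P j) :=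
  qlift (fun x => qpi (P j) (df M h x)).
Lemma quo_d1 i j (h : i + 1 = j) : zmod_morphism (fun x => qpi (P j) (df M h x)).
Proof. by move=> x y; rewrite !raddfB. Qed.
Lemma quo_d2 i j (h : i + 1 = j) x : P i x -> qpi (P j) (df M h x) = 0.
Proof. by move=> hx; apply/qpi0/sm_d. Qed.
Lemma quo_dE i j (h : i + 1 = j) x : quo_d h (qpi (P i) x) = qpi (P j) (df M h x).
Proof. by rewrite /quo_d qliftE //; [apply: quo_d1|apply: quo_d2]. Qed.
Lemma quo_dB i j (h : i + 1 = j) : zmod_morphism (quo_d h).
Proof. by apply: qlift_morph; [apply: quo_d1|apply: quo_d2]. Qed.
Lemma quo_dK i j k (h : i + 1 = j) (h' : j + 1 = k) x :
  mkadd (quo_dB h') (mkadd (quo_dB h) x) = 0.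
Proof. by have [y <-] := qpi_surj x; rewrite /= !quo_dE dfK raddf0. Qed.

Definition quo_a i j k (h : i + j = k) (a : A i) : qzT (P j) -> qzT (P k) :=
  qlift (fun x => qpi (P k) (act h a x)).
Lemma quo_aE i j k (h : i + j = k) (a : A i) x :
  quo_a h a (qpi (P j) x) = qpi (P k) (act h a x).
Proof.
rewrite /quo_a qliftE // => [y z|y hy]; first by rewrite -raddfB actBr.
by apply/qpi0/sm_a.
Qed.

Definition quo : dgmod A.
Proof.
exists (@Complex (fun i => qzT (P i)) (fun i j h => mkadd (quo_dB h)) quo_dK)
  (fun i j k h a x => quo_a h a x).
- by move=> i j k h a a' x; have [y <-] := @qpi_surj _ (P j) x; rewrite /= !quo_aE actDl raddfD.
- move=> i j k h a x x'; have [y <-] := @qpi_surj _ (P j) x; have [z <-] := @qpi_surj _ (P j) x'.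
  rewrite /= -raddfD !quo_aE actDr raddfD; exact: erefl.
- move=> i j k ij jk ijk h1 h2 h3 h4 a b x; have [y <-] := @qpi_surj _ (P k) x.
  by rewrite /= !quo_aE; congr (qpi _ _); apply: actA.
- by move=> i h x; have [y <-] := @qpi_surj _ (P i) x; rewrite /= quo_aE act1.
- move=> i j k i' j' k' h hi hj hk h1 h2 a x; have [y <-] := @qpi_surj _ (P j) x.
  rewrite /= !(quo_aE, quo_dE) (act_d h hi hj hk h1 h2) raddfD; congr (_ + _).
  exact: (ksgn_mor (qpi (P k'))).
Defined.

Definition quo_pi : dgmor M quo.
Proof.
apply: (@mkmor A M quo (fun i x => qpi (P i) x)).
- by move=> i x y; rewrite raddfB.
- by move=> i j h x; rewrite /= quo_dE.
- by move=> i j k h a x; rewrite /= quo_aE.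
Defined.

Lemma quo_pi_surj i (y : quo i) : exists x, quo_pi i x = y.
Proof. exact: qpi_surj. Qed.

Lemma quo_pi0 i x : quo_pi i x = 0 <-> P i x.
Proof. exact: qpi0. Qed.

Lemma sub_quo_ses : ses sub_in quo_pi.
Proof.
split.
- exact: sub_in_inj.
- exact: quo_pi_surj.
- by move=> i y /quo_pi0 h; exists (mksg h).
- by move=> i x; apply/quo_pi0/sg_prop.
Qed.

End SubQuo.

Section ImKer.
Variables (A : cdgring) (X Y : dgmod A) (u : dgmor X Y).
Definition im_sg i : subgroup (Y i).
Proof.
exists (fun y => exists x, u i x = y); first by exists 0; rewrite raddf0.
by move=> _ _ [x <-] [y <-]; exists (x - y); rewrite raddfB.
Defined.
Definition im_sub : submod Y.
Proof.
exists im_sg.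
- by move=> i j h _ [x <-]; exists (df X h x); rewrite cmor_d.
- by move=> i j k h a _ [x <-]; exists (act h a x); rewrite mmor_act.
Defined.
Definition ker_sg i : subgroup (X i).
Proof.
exists (fun x => u i x = 0); first by rewrite raddf0.
by move=> x y ex ey; rewrite raddfB /= ex ey subr0.
Defined.
Definition ker_sub : submod X.
Proof.
exists ker_sg.
- by move=> i j h x /= e; rewrite -cmor_d e raddf0.
- by move=> i j k h a x /= e; rewrite mmor_act e act0r.
Defined.
Definition coker := quo im_sub.
Definition ker := sub ker_sub.
Lemma coker_ses : (forall i x, u i x = 0 -> x = 0) -> ses u (quo_pi im_sub).
Proof.
split=> //.
- exact: quo_pi_surj.
- by move=> i y /quo_pi0.
- by move=> i x; apply/quo_pi0; exists x.
Qed.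
Lemma ker_ses : (forall i y, exists x, u i x = y) -> ses (sub_in ker_sub) u.
Proof.
split=> //.
- exact: sub_in_inj.
- by move=> i y e; exists (mksg (P := ker_sg i) e).
- by move=> i x; apply: (sg_prop x).
Qed.
End ImKer.

Section HomDG.
Variables (A : cdgring) (M J : dgmod A).

(* The action (a f)(x) = a f(x); it agrees with the one on [coind] for the
   identity, and the underlying complex is literally that of [hom_cplx]. *)
Definition hact p n q (hq : p + n = q) (a : A p) (f : hom M J n) : hom M J q.
Proof.
exists (fun i j (h : i + q = j) x =>
   act (etrans (etrans (addrCA _ _ _) (congr1 (fun t => i + t) hq)) h) a (hf f (erefl (i + n)) x)).
  by move=> i j h x y; rewrite hfD actDr.
move=> r i j k l hr hk hn hl b x.
have e1 : r + (i + n) = k + n by lia.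
rewrite (hf_act f hr erefl erefl e1) act_ksgn.
have e2 : p + (r + (i + n)) = l by lia.
have e3 : p + r + (i + n) = l by lia.
have e4 : p + (k + n) = l by lia.
rewrite (act_irr _ e4) -(actA (erefl (p + r)) e3).
have e5 : r + p = p + r by lia.
have e6 : p + (i + n) = j by lia.
rewrite (dgmulC e5) act_ksgnl ksgnM (actA e5 e3 e6 hl) (act_irr _ e6).
by apply: ksgn_odd; rewrite -hq !(oddzD, oddzM); case: (oddz r); case: (oddz p); case: (oddz n).
Defined.

Lemma hactE p n q (hq : p + n = q) (a : A p) (f : hom M J n) i j k (h : i + q = j)
  (h1 : i + n = k) (h2 : p + k = j) x : hf (hact hq a f) h x = act h2 a (hf f h1 x).
Proof. by subst k; rewrite /=; apply: act_irr. Qed.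

Definition hdg : dgmod A.
Proof.
exists (hom_cplx M J) (fun p n q hq a f => hact hq a f).
- by move=> p n q hq b b' f; apply: hom_ext => i j h x /=; apply: actDl.
- by move=> p n q hq b f f'; apply: hom_ext => i j h x /=; apply: actDr.
- move=> p q n pq qn pqn h1 h2 h3 h4 b c f; apply: hom_ext => i j h x.
  have e1 : pq + (i + n) = j by lia.
  have e2 : p + (i + qn) = j by lia.
  have e3 : q + (i + n) = i + qn by lia.
  rewrite (hactE h2 _ _ h erefl e1) (hactE h4 _ _ h erefl e2) (hactE h3 _ _ erefl erefl e3).
  exact: actA.
- by move=> n h0 f; apply: hom_ext => i j h x; rewrite (hactE h0 _ _ h h (add0r j)) act1.
- move=> p n q p' n' q' h hp hn hq h1 h2 b f; apply: hom_ext => i j e x.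
  rewrite -[LHS]/(hf (hom_d hq (hact h b f)) e x).
  have e1 : i + q + 1 = j by lia.
  have e2 : i + 1 + q = j by lia.
  rewrite (hom_dE hq _ e erefl e1 erefl e2).
  have e3 : p + (i + n) = i + q by lia.
  have e4 : p + (i + 1 + n) = j by lia.
  rewrite (hactE h _ _ erefl erefl e3) (hactE h _ _ e2 erefl e4).
  have e5 : p' + (i + n) = j by lia.
  have e6 : i + n + 1 = i + n' by lia.
  have e7 : p + (i + n') = j by lia.
  rewrite (act_d e3 hp e6 e1 e5 e7).
  rewrite -[RHS]/(hf (hact h1 (df A hp b) f) e x + hf (ksgn p (hact h2 b (hom_d hn f))) e x).
  have -> : hf (ksgn p (hact h2 b (hom_d hn f))) e x = ksgn p (hf (hact h2 b (hom_d hn f)) e x).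
    by rewrite /ksgn; case: ifP.
  have e8 : i + 1 + n = i + n' by lia.
  rewrite (hactE h1 _ _ e erefl e5) (hactE h2 _ _ e erefl e7).
  rewrite (hom_dE hn f erefl erefl e6 erefl e8) actBr ksgnB addrA; congr (_ - _).
  rewrite (hf_tr f erefl e8 erefl e8) /= act_ksgn ksgnM -h.
  have -> : act e7 b (tr e8 (hf f erefl (df M erefl x))) = act e4 b (hf f erefl (df M erefl x)).
    exact: (act_tr e8 erefl).
  by apply: ksgn_odd; rewrite addrC.
Defined.
End HomDG.

Section Comp.
Variables (A : cdgring) (M N P : dgmod A).
Definition comp m n k (e : n + m = k) (g : hom N P m) (f : hom M N n) : hom M P k.
Proof.
exists (fun i j (h : i + k = j) x => hf g (etrans (etrans (esym (addrA _ _ _)) (congr1 (fun t => i + t) e)) h) (hf f (erefl (i + n)) x)).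
  by move=> i j h x y; rewrite !hfD.
move=> p i j l o hp hk hn hl a x.
have e1 : p + (i + n) = l + n by lia.
have e2 : l + n + m = o by lia.
have e3 : i + n + m = j by lia.
rewrite (hf_act f hp erefl erefl e1) hf_ksgn (hf_irr _ _ e2) (hf_irr _ (etrans _ hn) e3).
rewrite (hf_act g e1 e2 e3 hl) ksgnM; apply: ksgn_odd.
by rewrite -e !(oddzD, oddzM); case: (oddz p); case: (oddz n); case: (oddz m).
Defined.
Lemma compE m n k (e : n + m = k) (g : hom N P m) (f : hom M N n) i j l
  (h : i + k = j) (h1 : i + n = l) (h2 : l + m = j) x :
  hf (comp e g f) h x = hf g h2 (hf f h1 x).
Proof. by subst l; rewrite /=; apply: hf_irr. Qed.

Lemma ksgn_hf (X Y : dgmod A) n s (f : hom X Y n) i j (h : i + n = j) x :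
  hf (ksgn s f) h x = ksgn s (hf f h x).
Proof. by rewrite /ksgn; case: ifP. Qed.

Lemma comp_d m n k m' n' k' (e : n + m = k) (hm : m + 1 = m') (hn : n + 1 = n')
  (hk : k + 1 = k') (e1 : n + m' = k') (e2 : n' + m = k') (g : hom N P m) (f : hom M N n) :
  hom_d hk (comp e g f) = comp e1 (hom_d hm g) f + ksgn m (comp e2 g (hom_d hn f)).
Proof.
apply: hom_ext => i j h x.
rewrite -[RHS]/(hf (comp e1 (hom_d hm g) f) h x + hf (ksgn m (comp e2 g (hom_d hn f))) h x).
rewrite ksgn_hf.
have h1 : i + k + 1 = j by lia.
have h2 : i + 1 + k = j by lia.
rewrite (hom_dE hk _ h erefl h1 erefl h2).
have h3 : i + n + m = i + k by lia.
have h4 : i + 1 + n + m = j by lia.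
rewrite (compE e _ _ erefl erefl h3) (compE e _ _ h2 erefl h4).
have h5 : i + n + m' = j by lia.
have h6 : i + n' + m = j by lia.
rewrite (compE e1 _ _ h erefl h5) (compE e2 _ _ h erefl h6).
have h7 : i + n + 1 + m = j by lia.
rewrite (hom_dE hm g h5 h3 h1 erefl h7).
have h8 : i + n + 1 = i + n' by lia.
have h9 : i + 1 + n = i + n' by lia.
rewrite (hom_dE hn f erefl erefl h8 erefl h9) hfB ksgnB.
have -> : hf g h6 (df N h8 (hf f erefl x)) = hf g h7 (df N erefl (hf f erefl x)).
  have -> : df N h8 (hf f erefl x) = tr h8 (df N erefl (hf f erefl x)).
    exact: (df_tr erefl h8 erefl h8).
  exact: (hf_tr g h8 erefl h7 h6).
have -> : hf f h9 (df M erefl x) = tr h9 (hf f erefl (df M erefl x)).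
  exact: (hf_tr f erefl h9 erefl h9).
rewrite hf_ksgn (hf_tr g h9 erefl h4 h6) ksgnM addrA subrK; congr (_ - _).
by apply: ksgn_odd; rewrite -e addrC.
Qed.
End Comp.

Section HomMor.
Variables (A : cdgring) (M N : dgmod A).
Definition hom_of (u : dgmor M N) : hom M N 0.
Proof.
exists (fun i j h x => tr (etrans (esym (addr0 i)) h) (u i x)).
  by move=> i j h x y; rewrite !raddfD.
move=> p i j k l hp hk hn hl a x.
by rewrite mmor_act mulr0; apply/esym; apply: act_tr.
Defined.
Lemma hom_ofE (u : dgmor M N) i (h : i + 0 = i) x : hf (hom_of u) h x = u i x.
Proof. exact: tr_id. Qed.
Lemma hom_ofE' (u : dgmor M N) i j (h : i + 0 = j) (e : i = j) x : hf (hom_of u) h x = tr e (u i x).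
Proof. exact: tr_irr. Qed.
Lemma hom_of_cyc (u : dgmor M N) : @cyc (hom_cplx M N) 0 (hom_of u).
Proof.
apply: (@cyc_at (hom_cplx M N) 0 1 (add0r 1)); apply: hom_ext => i j h x.
rewrite -[LHS]/(hf (hom_d (add0r 1) (hom_of u)) h x).
rewrite (hom_dE _ _ h (addr0 i) h h (addr0 j)) !hom_ofE cmor_d; exact: subrr.
Qed.

Variables (f : hom M N 0) (fc : @cyc (hom_cplx M N) 0 f).
Definition mor_of : dgmor M N.
Proof.
apply: (@mkmor A M N (fun i x => hf f (addr0 i) x)).
- by move=> i x y; apply: hfB.
- move=> i j h x; have := congr1 (fun g : hom M N 1 => hf g h x) (fc (add0r 1)).
  rewrite [LHS](hom_dE _ _ h (addr0 i) h h (addr0 j)) => /eqP.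
  by rewrite subr_eq0 => /eqP.
- by move=> i j k h a x; rewrite (hf_act f h (addr0 k) (addr0 j) h) mulr0.
Defined.
End HomMor.

Section PrePost.
Variables (A : cdgring).
Definition pre_hom (M M' J : dgmod A) (u : dgmor M' M) n (f : hom M J n) : hom M' J n.
Proof.
exists (fun i j h x => hf f h (u i x)).
  by move=> i j h x y; rewrite raddfD hfD.
by move=> p i j k l hp hk hn hl a x; rewrite mmor_act (hf_act f hp hk hn hl).
Defined.
Definition pre (M M' J : dgmod A) (u : dgmor M' M) : dgmor (hdg M J) (hdg M' J).
Proof.
apply: (@mkmor A (hdg M J) (hdg M' J) (fun n f => pre_hom u f)).
- by move=> n f g; apply: hom_ext => i j h x.
- move=> n n' hn f; apply: hom_ext => i j h x.
  have e1 : i + n + 1 = j by lia.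
  have e2 : i + 1 + n = j by lia.
  rewrite [LHS](hom_dE hn _ h erefl e1 erefl e2) [RHS](hom_dE hn _ h erefl e1 erefl e2).
  by rewrite /= cmor_d.
- by move=> p n q hq a f; apply: hom_ext => i j h x.
Defined.
Definition post_hom (M J J' : dgmod A) (v : dgmor J J') n (f : hom M J n) : hom M J' n.
Proof.
exists (fun i j h x => v j (hf f h x)).
  by move=> i j h x y; rewrite hfD raddfD.
move=> p i j k l hp hk hn hl a x.
by rewrite (hf_act f hp hk hn hl) (ksgn_mor (v l)) mmor_act.
Defined.
Definition post (M J J' : dgmod A) (v : dgmor J J') : dgmor (hdg M J) (hdg M J').
Proof.
apply: (@mkmor A (hdg M J) (hdg M J') (fun n f => post_hom v f)).
- by move=> n f g; apply: hom_ext => i j h x /=; apply: raddfB.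
- move=> n n' hn f; apply: hom_ext => i j h x.
  have e1 : i + n + 1 = j by lia.
  have e2 : i + 1 + n = j by lia.
  rewrite [LHS](hom_dE hn _ h erefl e1 erefl e2) [RHS](congr1 (v j) (hom_dE hn f h erefl e1 erefl e2 x)).
  by rewrite /= cmor_d raddfB /= (ksgn_mor (v j)).
- move=> p n q hq a f; apply: hom_ext => i j h x /=.
  exact: mmor_act.
Defined.
End PrePost.

Lemma ses_exactZ' (X Y Z : complex) (f : cplxmor X Y) (g : cplxmor Y Z) (S : ses f g)
  i j (h : i + 1 = j) : Hsurj f i -> Hinj f j -> exact Z i.
Proof.
move=> hs hi z hz; have [y ey] := ses_surj S z.
have [|x ex] := ses_ex S (y := df Y h y); first by rewrite -cmor_d ey hz.
have /(bnd_at h)[u eu] : bnd x.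
  by apply: hi; [apply: (ses_cyc S); rewrite ex; apply: cyc_d|rewrite ex; apply: bnd_d].
have [|w [hw bw]] := hs (y - f i u).
  by apply: (cyc_at (h := h)); rewrite raddfB /= cmor_d eu ex subrr.
have := bnd_mor g bw; rewrite !raddfB /= !(ses_0 S) !subr0 ey; exact.
Qed.

(* Injectivity of the underlying graded module makes Hom(-, J) carry short
   exact sequences to short exact sequences, so that long exact sequences
   replace all triangulated arguments. *)
Definition graded_inj (A : cdgring) (J : dgmod A) := forall X Y (u : dgmor X Y),
  (forall i x, u i x = 0 -> x = 0) -> forall n (f : hom X J n),
  exists g : hom Y J n, pre_hom u g = f.
Definition semiinj (A : cdgring) (J : dgmod A) := Kinjective J /\ graded_inj J.

Lemma hf_eq A (M N : dgmod A) n (f g : hom M N n) i j (h : i + n = j) x :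
  f = g -> hf f h x = hf g h x.
Proof. by move=> ->. Qed.

Section HomSes.
Variables (A : cdgring) (X Y Z : dgmod A) (u : dgmor X Y) (v : dgmor Y Z).
Hypothesis S : ses u v.

Lemma hom_factor (J : dgmod A) n (g : hom Y J n) : pre_hom u g = 0 ->
  exists f : hom Z J n, pre_hom v f = g.
Proof.
move=> e; have e0 i j (h : i + n = j) y : v i y = 0 -> hf g h y = 0.
  move=> /(ses_ex S)[x <-]; exact: (hf_eq h x e).
pose s i (z : Z i) := sval (cid (ses_surj S z)).
have sK i z : v i (s i z) = z by rewrite /s; case: cid.
have E i j (h : i + n = j) y y' : v i y = v i y' -> hf g h y = hf g h y'.
  move=> h'; apply/eqP; rewrite -subr_eq0 -hfB; apply/eqP/e0.
  by rewrite raddfB /= h' subrr.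
unshelve eexists.
  exists (fun i j h z => hf g h (s i z)) => [i j h z z'|p i j k l hp hk hn hl a z].
    by rewrite -hfD; apply: E; rewrite raddfD /= !sK.
  by rewrite -(hf_act g hp hk hn hl); apply: E; rewrite mmor_act !sK.
by apply: hom_ext => i j h y /=; apply: E; rewrite sK.
Qed.

Lemma pre_ses J : graded_inj J -> ses (pre J v) (pre J u).
Proof.
move=> gJ; split.
- move=> n f e; apply: hom_ext => i j h z; have [y <-] := ses_surj S z.
  exact: (hf_eq h y e).
- by move=> n f; apply: gJ; apply: ses_inj S.
- by move=> n g; apply: hom_factor.
- by move=> n f; apply: hom_ext => i j h x /=; rewrite (ses_0 S) hf0.
Qed.

Lemma post_lift V n (f : hom V Y n) : post_hom v f = 0 -> exists g : hom V X n, post_hom u g = f.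
Proof.
move=> e; have E i j (h : i + n = j) x : exists y, u j y = hf f h x.
  exact: (ses_ex S (hf_eq h x e)).
pose s i j h x := sval (cid (@E i j h x)).
have sK i j h x : u j (s i j h x) = hf f h x by rewrite /s; case: cid.
have inj := ses_inj' S.
unshelve eexists.
  exists (fun i j h x => s i j h x) => [i j h x y|p i j k l hp hk hn hl a x].
    by apply: inj; rewrite raddfD /= !sK hfD.
  by apply: inj; rewrite (ksgn_mor (u l)) mmor_act !sK (hf_act f hp hk hn hl).
by apply: hom_ext => i j h x /=; rewrite sK.
Qed.

(** Injectivity of X splits the sequence as graded modules: the identity of X extends to a linear
    retraction r of u, which need not commute with the differentials, and 1 - u r vanishes on X, so
    it induces a linear section of v. *)
Lemma post_surj V n (f : hom V Z n) : graded_inj X -> exists g : hom V Y n, post_hom v g = f.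
Proof.
move=> gX; have [r er] := gX _ _ u (ses_inj S) 0 (hom_of (dgmor_id X)).
have ru i x : hf r (addr0 i) (u i x) = x.
  by have := hf_eq (addr0 i) x er; rewrite hom_ofE.
pose q i (y : Y i) := y - u i (hf r (addr0 i) y).
have qB i y y' : q i (y - y') = q i y - q i y'.
  by rewrite /q hfB raddfB /= !opprD addrACA.
have q0 i y y' : v i y = v i y' -> q i y = q i y'.
  move=> e; apply/eqP; rewrite -subr_eq0 -qB; apply/eqP.
  have [|x <-] := ses_ex S (y := y - y'); first by rewrite raddfB /= e subrr.
  by rewrite /q ru subrr.
have qa p i k (h : p + i = k) a y : q k (act h a y) = act h a (q i y).
  by rewrite /q (hf_act r h _ (addr0 i) h) mulr0 mmor_act actBr.
pose s i (z : Z i) := sval (cid (ses_surj S z)).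
have sK i z : v i (s i z) = z by rewrite /s; case: cid.
have vq i y : v i (q i y) = v i y by rewrite /q raddfB /= (ses_0 S) subr0.
have qN i y : q i (- y) = - q i y.
  have q00 : q i 0 = 0 by rewrite /q hf0 raddf0 subr0.
  by rewrite -sub0r qB q00 sub0r.
have qD i y y' : q i (y + y') = q i y + q i y' by rewrite -[in LHS](opprK y') qB qN opprK.
unshelve eexists.
  refine (@Hom A V Y n (fun i j h x => q j (s j (hf f h x))) _ _) => [i j h x y|p i j k l hp hk hn hl a x].
    by rewrite -qD; apply: q0; rewrite raddfD /= !sK hfD.
  rewrite -qa -[ksgn _ (q l _)]/(if _ then _ else _) -qN.
  have -> (b : bool) (y : Y l) : (if b then q l (- y) else q l y) = q l (if b then - y else y) by case: b.
  apply: q0; rewrite sK (hf_act f hp hk hn hl) /ksgn.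
  by case: ifP => _; rewrite ?raddfN /= mmor_act sK.
by apply: hom_ext => i j h x /=; rewrite vq sK.
Qed.

Lemma post_ses V : graded_inj X -> ses (post V u) (post V v).
Proof.
move=> gX; split.
- move=> n f e; apply: hom_ext => i j h x; apply: (ses_inj S).
  exact: (hf_eq h x e).
- by move=> n f; apply: post_surj.
- by move=> n f; apply: post_lift.
- by move=> n f; apply: hom_ext => i j h x /=; rewrite (ses_0 S).
Qed.

Lemma ses_graded_inj_mid : graded_inj X -> graded_inj Z -> graded_inj Y.
Proof.
move=> gX gZ P Q w hw n f.
have [g eg] := gZ _ _ w hw n (post_hom v f).
have [g' eg'] := post_surj g gX.
have [|k ek] := post_lift (V := P) (n := n) (f := f - pre_hom w g').
  apply: hom_ext => i j h x; rewrite /= raddfB.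
  have := hf_eq h x eg; rewrite -eg' /= => ->; exact: subrr.
have [k' ek'] := gX _ _ w hw n k.
exists (g' + post_hom u k'); apply: hom_ext => i j h x /=.
have := hf_eq h x ek; rewrite /= -(hf_eq h x ek') /= => ->.
by rewrite addrC subrK.
Qed.

Lemma ses_graded_inj_right : graded_inj X -> graded_inj Y -> graded_inj Z.
Proof.
move=> gX gY P Q w hw n f; have [f' ef'] := post_surj f gX.
have [g' eg'] := gY _ _ w hw n f'.
by exists (post_hom v g'); apply: hom_ext => i j h x; rewrite -ef' -eg'.
Qed.

Lemma ses_semiinj_mid : semiinj X -> semiinj Z -> semiinj Y.
Proof.
move=> [kX gX] [kZ gZ]; split; last exact: ses_graded_inj_mid.
move=> N aN; apply/acyclicP => i.
apply: (ses_exactY (post_ses N gX)).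
  exact: (proj1 (acyclicP _) (kX N aN)).
exact: (proj1 (acyclicP _) (kZ N aN)).
Qed.

Lemma ses_semiinj_right : semiinj X -> semiinj Y -> semiinj Z.
Proof.
move=> [kX gX] [kY gY]; split; last exact: ses_graded_inj_right.
move=> N aN; apply/acyclicP => i.
apply: (ses_exactZ (post_ses N gX) (erefl (i + 1))).
  exact: (proj1 (acyclicP _) (kY N aN)).
exact: (proj1 (acyclicP _) (kX N aN)).
Qed.
End HomSes.

Section Contract.
Variables (A : cdgring).

Lemma comp_hom_of (M N P : dgmod A) n (u : dgmor N P) (f : hom M N n) :
  comp (addr0 n) (hom_of u) f = post_hom u f.
Proof.
apply: hom_ext => i j h x; rewrite (compE (addr0 n) _ _ h h (addr0 j)).
by rewrite hom_ofE.
Qed.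

Lemma null_post (M N P : dgmod A) n (u : dgmor N P) (f : hom M N n) :
  @bnd (hom_cplx N P) 0 (hom_of u) -> @cyc (hom_cplx M N) n f ->
  @bnd (hom_cplx M P) n (post_hom u f).
Proof.
move=> /(bnd_at (addNr 1))[h eh] cf; rewrite -comp_hom_of.
have e : n + -1 + 1 = n by rewrite subrK.
exists (n + -1), e, (comp erefl h f).
have e2 : n + 1 + -1 = n by rewrite addrK.
rewrite [LHS](comp_d erefl (addNr 1) (erefl (n + 1)) e (addr0 n) e2).
have -> : hom_d erefl f = 0 by apply: cf.
rewrite -[hom_d (addNr 1) h]/(df (hom_cplx N P) (addNr 1) h) eh.
have -> : comp e2 h (0 : hom M N (n + 1)) = 0.
  by apply: hom_ext => i j e' x; rewrite /= hf0.
by rewrite ksgn0 addr0.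
Qed.

Lemma Kinj_acyclic (M J : dgmod A) i : Kinjective J -> acyclic M -> exact (hdg M J) i.
Proof. by move=> kJ aM; apply: (proj1 (acyclicP _) (kJ M aM)). Qed.

(** The identity of J is a cocycle of the exact complex Hom(J, J), so J is contractible and every
    cocycle with values in J is null. *)
Lemma acyclic_Kinj (M J : dgmod A) i : Kinjective J -> acyclic J -> exact (hdg M J) i.
Proof.
move=> kJ aJ f cf.
have -> : f = post_hom (dgmor_id J) f by apply: hom_ext.
by apply: null_post cf; apply: (Kinj_acyclic kJ aJ); apply: hom_of_cyc.
Qed.
End Contract.

(** * Truncations and degree bounds for Hom *)

Section Trunc.
Variables (A : cdgring) (m : int) (M : dgmod A).
Definition trle_sg i : subgroup (M i).
Proof.
exists (fun x => (m < i -> x = 0) /\ (m <= i -> cyc x)).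
  by split=> // _; apply: cyc0.
move=> x y [hx cx] [hy cy]; split=> h; first by rewrite hx // hy // subr0.
by apply: cycB; auto.
Defined.
(** Stability under A uses that A lives in nonpositive degrees. Negative elements lower the degree;
    for a in degree 0 and x a cocycle in degree m, the product is again a cocycle because d a lies
    in A^1 = 0. *)
Definition trle : submod M.
Proof.
exists trle_sg.
  move=> i j h x [hx cx]; split=> hm; last exact: cyc_d.
  by apply: cx; lia.
move=> i j k h a x [hx cx].
have [hi|hi] := leP i 0; last first.
  by rewrite (dg_nonpos hi a) act0l; split=> // _; apply: cyc0.
have H : m < k -> act h a x = 0 by move=> hk; rewrite hx ?act0r //; lia.
split=> // hk; have [hmk|hmk] := ltP m k; first by rewrite H //; apply: cyc0.
have [hij|hij] := ltP m j; first by rewrite hx // act0r; apply: cyc0.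
have ek : k = m by lia.
have [ei|ei] := EM (i = 0); last by exfalso; lia.
subst i; have ej : j = m by lia.
apply: (cyc_at (h := erefl)).
have h1 : 0 + (j + 1) = k + 1 by lia.
have h2 : 1 + j = k + 1 by lia.
rewrite (act_d h (add0r 1) erefl erefl h2 h1) (dg_nonpos _ (df A (add0r 1) a)) //.
by rewrite act0l cx ?act0r ?ksgn0 ?addr0 //; lia.
Defined.
Definition tau := sub trle.
Definition tauq := quo trle.
Definition tau_in : dgmor tau M := sub_in trle.
Definition tau_pi : dgmor M tauq := quo_pi trle.
Lemma tau_ses : ses tau_in tau_pi. Proof. exact: sub_quo_ses. Qed.

Lemma tau_0 i (x : tau i) : m < i -> x = 0.
Proof. by move=> hi; apply: val_inj; have [h _] := sg_prop x; apply: h. Qed.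
Lemma tau_hi i : m < i -> exact tau i.
Proof. by move=> hi z _; rewrite (tau_0 z hi); apply: bnd0. Qed.
Lemma tau_mk i (x : M i) : i <= m -> cyc x -> exists y : tau i, tau_in i y = x.
Proof.
move=> hi cx; have hp : trle_sg i x by split=> //; lia.
by exists (mksg hp : tau i).
Qed.
Lemma tau_mk' i (x : M i) : i < m -> exists y : tau i, tau_in i y = x.
Proof.
move=> hi; have hp : trle_sg i x by split=> //; lia.
by exists (mksg hp : tau i).
Qed.
Lemma tau_Hinj i : i <= m -> Hinj tau_in i.
Proof.
move=> hi z hz /(bnd_at (subrK 1 i))[u eu].
have [|w ew] := @tau_mk' (i - 1) u; first by lia.
exists (i - 1), (subrK 1 i), w; apply: (ses_inj' tau_ses).
by rewrite -cmor_d ew.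
Qed.
Lemma tau_Hsurj i : i <= m -> Hsurj tau_in i.
Proof.
move=> hi w hw; have [y ey] := tau_mk hi hw.
exists y; rewrite ey subrr; split; last exact: bnd0.
by apply: (ses_cyc tau_ses); rewrite ey.
Qed.
Lemma tauq_lo i : i <= m -> exact tauq i.
Proof.
move=> hi; apply: (ses_exactZ' tau_ses (erefl (i + 1))).
  exact: tau_Hsurj.
have [h|h] := leP (i + 1) m; first exact: tau_Hinj.
by apply: exact_Hinj; apply: tau_hi.
Qed.
Lemma tau_exact i : exact M i -> exact tau i.
Proof.
have [h|h] := leP i m; last by move=> _; apply: tau_hi.
by apply: Hinj_exact; apply: tau_Hinj.
Qed.
Lemma tauq_Hinj i : m < i -> Hinj tau_pi i.
Proof. by move=> h; apply: (ses_gHinj tau_ses); apply: tau_hi. Qed.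
Lemma tauq_Hsurj i : m < i -> Hsurj tau_pi i.
Proof. by move=> h; apply: (ses_gHsurj tau_ses erefl); apply: tau_hi; lia. Qed.
Lemma tauq_exact i : exact M i -> exact tauq i.
Proof.
have [h|h] := leP i m; first by move=> _; apply: tauq_lo.
by apply: Hsurj_exact; apply: tauq_Hsurj.
Qed.
End Trunc.

Section TStructure.
Variable A : cdgring.

Lemma pre_exact_qiso (X Y Z J : dgmod A) (u : dgmor X Y) (v : dgmor Y Z) (S : ses u v) i :
  semiinj J -> acyclic Z -> exact (hdg X J) i -> exact (hdg Y J) i.
Proof.
move=> [kJ gJ] aZ; apply: (ses_exactY (pre_ses S gJ)); exact: Kinj_acyclic.
Qed.

(** M may be replaced by its truncation at m. A cocycle of degree j then takes values in the
    truncation of J at m + j < z, which is acyclic, and the inclusion of an acyclic module into a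
    K-injective one is null-homotopic. *)
Lemma hom_bounds (M J : dgmod A) (m z j : int) : semiinj J ->
  (forall i, i < z -> exact J i) -> (forall i, m < i -> exact M i) ->
  j < z - m -> exact (hdg M J) j.
Proof.
move=> sJ lJ uM hj.
apply: (pre_exact_qiso (tau_ses m M)) => //.
  apply/acyclicP => i; have [h|h] := leP i m; first exact: tauq_lo.
  by apply: tauq_exact; apply: uM.
move=> f cf; set l := m + j.
have land i k (h : i + j = k) x : exists y, tau_in l J k y = hf f h x.
  have [hi|hi] := ltP m i; first by exists 0; rewrite (tau_0 x hi) hf0 raddf0.
  have [hi'|hi'] := ltP i m; first by apply: tau_mk'; rewrite /l; lia.
  apply: tau_mk; first by rewrite /l; lia.
  (* Here i = m. The truncation of M vanishes in degree m + 1, so the term f(d x) disappears from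
     the cocycle equation and f x is itself a cocycle. *)
  apply: (cyc_at (h := erefl)).
  have e : i + (j + 1) = k + 1 by lia.
  have e2 : i + 1 + j = k + 1 by lia.
  have := hf_eq e x (cf _ (erefl (j + 1)) : hom_d erefl f = 0).
  rewrite (hom_dE erefl f e h erefl erefl e2) (tau_0 (df (tau m M) erefl x)).
    by rewrite hf0 ksgn0 subr0.
  by lia.
have [|f' ef'] := @post_lift _ _ _ _ _ _ (tau_ses l J) _ _ f.
  apply: hom_ext => i k h x; have [y ey] := land i k h x.
  by rewrite /= -ey (ses_0 (tau_ses l J)).
rewrite -ef'; apply: null_post.
  apply: (Kinj_acyclic (proj1 sJ)); last exact: hom_of_cyc.
  apply/acyclicP => i; have [h|h] := leP i l; last exact: tau_hi.
  by apply: tau_exact; apply: lJ; rewrite /l in h; lia.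
have inj : forall f g : hom (tau m M) (tau l J) (j + 1),
  post_hom (tau_in l J) f = post_hom (tau_in l J) g -> f = g.
  move=> g g' e; apply: hom_ext => i k h x; apply: (ses_inj' (tau_ses l J)).
  exact: (hf_eq h x e).
apply: (cyc_at (h := erefl)); apply: inj.
apply: etrans (esym (cmor_d (post (tau m M) (tau_in l J)) erefl f')) _.
rewrite -[post _ _ _ _]/(post_hom (tau_in l J) f') ef' cf.
by apply: hom_ext => i k h x; apply/esym; exact: (raddf0 (tau_in l J k)).
Qed.
End TStructure.

Section FibMap.
Variables (A : cdgring) (X Y X' Y' : dgmod A) (u : dgmor X Y) (u' : dgmor X' Y').
Variables (p : dgmor X X') (q : dgmor Y Y').
Hypothesis E : forall i x, q i (u i x) = u' i (p i x).
Definition fib_map : dgmor (fib u) (fib u').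
Proof.
apply: (@mkmor A (fib u) (fib u') (fun i x => (p i x.1, q (i + -1) x.2))).
- by move=> i [x y] [x' y'] /=; rewrite !raddfB.
- move=> i j h [x w]; rewrite /= /tw_d /= cmor_d; congr pair.
  rewrite raddfD /= -(cmor_d q); congr (_ + _).
  by rewrite (ksgn_mor (q (j + -1))) mor_tr E.
- by move=> i j k h a [x w]; rewrite /= !mmor_act.
Defined.
End FibMap.

Section FibSes.
Variables (A : cdgring) (X Y X' Y' X'' Y'' : dgmod A).
Variables (u : dgmor X Y) (u' : dgmor X' Y') (u'' : dgmor X'' Y'').
Variables (p : dgmor X X') (q : dgmor Y Y') (p' : dgmor X' X'') (q' : dgmor Y' Y'').
Hypothesis E : forall i x, q i (u i x) = u' i (p i x).
Hypothesis E' : forall i x, q' i (u' i x) = u'' i (p' i x).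
Lemma fib_ses : ses p p' -> ses q q' -> ses (fib_map E) (fib_map E').
Proof.
move=> Sp Sq; split.
- by move=> i [x w] [/(ses_inj Sp) -> /(ses_inj Sq) ->].
- move=> i [x w]; have [x' ex] := ses_surj Sp x; have [w' ew] := ses_surj Sq w.
  by exists (x', w'); rewrite /= ex ew.
- move=> i [x w] [/(ses_ex Sp)[x' ex] /(ses_ex Sq)[w' ew]].
  by exists (x', w'); rewrite /= ex ew.
- by move=> i [x w]; rewrite /= (ses_0 Sp) (ses_0 Sq).
Qed.
End FibSes.

Section FibExact.
Variables (A : cdgring) (X Y : dgmod A) (u : dgmor X Y).

Lemma fib_exact i : Hinj u i -> Hsurj u (i - 1) -> exact (fib u) i.
Proof.
move=> hi hs [x w] cxw.
have cx : cyc x by move=> j h; have [] := cxw j h.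
have /(bnd_at (subrK 1 i))[x' ex'] := hi x cx (fib_bnd_iff (cxw _ erefl)).
set c := (x, w) : fib u i; set c0 := (x', 0) : fib u (i - 1).
have [w' ew'] : exists w', tw_in (fib_thd u) i w' = c - df (fib u) (subrK 1 i) c0.
  apply: (ses_ex (tw_ses (fib_thd u))); rewrite raddfB /= /tw_d /= ex'; exact: subrr.
have cw' : @cyc (sh (-1) Y) i w'.
  apply: (ses_cyc (tw_ses (fib_thd u))); rewrite ew'; apply: cycB => //; exact: cyc_d.
rewrite -[c](subrK (df (fib u) (subrK 1 i) c0)); apply: bndD; last exact: bnd_d.
rewrite -ew'.
have cw : @cyc Y (i - 1) w' by apply: (cyc_at (h := sh_eq1 (-1) erefl)); apply: (cw' _ erefl).
have [y [cy /(bnd_at (subrK 1 (i - 1)))[t et]]] := hs w' cw.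
have e : w' = u (i - 1) y + df Y (subrK 1 (i - 1)) t by rewrite et addrC subrK.
exists (i - 1), (subrK 1 i), ((ksgn (i - 1) y, (t : sh (-1) Y (i - 1))) : fib u (i - 1)).
rewrite /= /tw_d /= df_ksgn cy ksgn0; congr pair.
rewrite (ksgn_mor (u (i - 1))) ksgn_tr ksgnK tr_id e [LHS]addrC; congr (_ + _).
exact: df_irr.
Qed.

Lemma fib_Hinj i : exact (fib u) i -> Hinj u i.
Proof.
move=> e z cz /(bnd_at (subrK 1 i))[y ey].
have /e : @cyc (fib u) i (z, - ksgn i y).
  by apply: fib_cyc => //; rewrite raddfN /= df_ksgn ey.
by move/(bnd_mor (tw_pr (fib_thd u))).
Qed.

Lemma fib_Hsurj i j (h : i + 1 = j) : exact (fib u) j -> Hsurj u i.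
Proof.
move=> e w cw; have ei : i = j + -1 by lia.
have cw' : @cyc (sh (-1) Y) j (tr ei w).
  apply: (cyc_at (h := erefl)); exact: (tr_cyc ei cw).
have /e/(bnd_at h)[[x t] /= [ex et]] := cyc_mor (tw_in (fib_thd u)) cw'.
exists (ksgn i x); split; first by apply: ksgn_cyc; apply: (cyc_at (h := h)).
apply/(tr_bnd ei).
rewrite (ksgn_mor (u i)) raddfB /= -et (tr_irr _ ei) ksgn_tr addrK.
exact: (bnd_d (sh_eq1 (-1) h)).
Qed.

Lemma fib_quasi_iso : (forall i, exact (fib u) i) <-> quasi_iso u.
Proof.
rewrite quasi_isoP; split=> h i.
  by split; [apply: fib_Hinj|apply: (fib_Hsurj erefl)].
by apply: fib_exact; [case: (h i)|case: (h (i - 1))].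
Qed.

Lemma fib_acyclic : quasi_iso u -> acyclic (fib u).
Proof. by move/fib_quasi_iso/acyclicP. Qed.
End FibExact.

Section FiveLemma.
Variables (A : cdgring) (X Y Z X' Y' Z' : dgmod A).
Variables (p : dgmor X Y) (q : dgmor Y Z) (p' : dgmor X' Y') (q' : dgmor Y' Z').
Hypotheses (S : ses p q) (S' : ses p' q').
Variables (a : dgmor X X') (b : dgmor Y Y') (c : dgmor Z Z').
Hypothesis E : forall i x, p' i (a i x) = b i (p i x).
Hypothesis E' : forall i x, q' i (b i x) = c i (q i x).

Let SS := fib_ses E E' S S'.
(** The fibres of a, b, c form a short exact sequence themselves, so the five lemma becomes
    exactness of the third term. *)
Lemma five_right : quasi_iso a -> quasi_iso b -> quasi_iso c.
Proof.
move=> /fib_quasi_iso ha /fib_quasi_iso hc; apply/fib_quasi_iso => i.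
exact: (ses_exactZ SS erefl).
Qed.
End FiveLemma.

Section SesFib.
Variables (A : cdgring) (X Y Z : dgmod A) (u : dgmor X Y) (v : dgmor Y Z).
Hypothesis S : ses u v.
Definition ses_fib : dgmor X (fib v).
Proof.
apply: (@mkmor A X (fib v) (fun i x => (u i x, 0))).
- by move=> i x y; rewrite raddfB -[RHS]/(_, 0 - 0) subr0.
- by move=> i j h x; rewrite /= /tw_d /= cmor_d (ses_0 S) !raddf0 ksgn0 addr0.
- by move=> i j k h a x; rewrite /= mmor_act act0r.
Defined.
Lemma ses_fib_qiso : quasi_iso ses_fib.
Proof.
apply/quasi_isoP => i; split.
  move=> x cx /(bnd_at (subrK 1 i))[[y w] /= [ey ew]].
  have ei : i - 1 + 1 = i by lia.
  have [z' ez'] := ses_surj S (w : Z (i - 1 + -1)).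
  pose s := ksgn (i - 1) (df Y (subrK 1 (i - 1)) z').
  have [|x' ex'] := ses_ex S (y := y + s).
    rewrite raddfD /= /s (ksgn_mor (v (i - 1))) -cmor_d ez'.
    apply: (@ksgn_inj _ (i - 1)); rewrite ksgnD ksgnK ksgn0.
    have := ew; rewrite tr_id => e; apply: etrans (addrC _ _) _; apply: etrans e.
    congr (_ + _); exact: df_irr.
  exists (i - 1), (subrK 1 i), x'; apply: (ses_inj' S).
  by rewrite -cmor_d ex' raddfD /= ey /s df_ksgn dfK ksgn0 addr0.
move=> [y w] cyw; have [z ez] := ses_surj S (w : Z (i + -1)).
have ey : df Y erefl y = 0 by have [] := cyw _ erefl.
have ew := congr1 snd (cyw _ (erefl (i + 1))); rewrite /= in ew.
have ew' : df Z (subrK 1 i) w = - ksgn i (v i y).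
  have e : i = i + 1 + -1 by lia.
  have E : tr e (df Z (subrK 1 i) w) = tr e (- ksgn i (v i y)).
    rewrite raddfN /= ksgn_tr; apply/eqP; rewrite -addr_eq0 -[X in _ == X]ew; apply/eqP.
    congr (_ + _); last by congr (ksgn _ _); apply: tr_irr.
    by apply/esym; apply: (df_tr (erefl (i + -1))).
  by move: E; case: _ / e.
have [|x ex] := ses_ex S (y := y + ksgn i (df Y (subrK 1 i) z)).
  by rewrite raddfD /= (ksgn_mor (v i)) -cmor_d ez ew' ksgnN ksgnK subrr.
have cx : cyc x.
  apply: (ses_cyc S); rewrite ex; apply: cycD; first exact: cyc_at ey.
  by apply: ksgn_cyc; apply: cyc_d.
exists x; split=> //.
exists (i - 1), (subrK 1 i), ((- ksgn i z, 0) : fib v (i - 1)).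
rewrite /= ex -[RHS]/(y - (y + ksgn i (df Y (subrK 1 i) z)), w - 0).
rewrite /tw_d /= raddfN /= df_ksgn raddf0 raddfN /= (ksgn_mor (v (i - 1))) ez.
congr pair; first by rewrite opprD addrA subrr sub0r.
rewrite add0r tr_id ksgnN ksgnM subr0 /ksgn.
have -> : oddz (i - 1 + i) = true.
  by rewrite oddzD oddzB oddz1; case: (oddz i).
by rewrite opprK.
Qed.
End SesFib.

(** * Cohomological predicates and finiteness *)

(* [h M i] stands for the vanishing at M of the i-th term of a cohomological
   functor. *)
Record coho (A : cdgring) (h : dgmod A -> int -> Prop) : Prop := Coho {
  coho_mid : forall X Y Z (u : dgmor X Y) (v : dgmor Y Z), ses u v ->
    forall i, h X i -> h Z i -> h Y i;
  coho_right : forall X Y Z (u : dgmor X Y) (v : dgmor Y Z), ses u v ->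
    forall i j : int, i + 1 = j -> h Y i -> h X j -> h Z i;
  coho_left : forall X Y Z (u : dgmor X Y) (v : dgmor Y Z), ses u v ->
    forall i j : int, j + 1 = i -> h Y i -> h Z j -> h X i;
  coho_0 : forall X : dgmod A, acyclic X -> forall i, h X i
}.

Section Coho.
Variables (A : cdgring) (h : dgmod A -> int -> Prop) (H : coho h).

Lemma coho_fib X Y (u : dgmor X Y) : quasi_iso u -> forall i j, i + 1 = j ->
  h X i <-> h (sh (-1) Y) j.
Proof.
move=> /fib_acyclic/(coho_0 H) a i j e; split=> hX.
  exact: (coho_left H (tw_ses (fib_thd u)) e).
exact: (coho_right H (tw_ses (fib_thd u)) e).
Qed.

Lemma id_quasi_iso (M : dgmod A) : quasi_iso (dgmor_id M).
Proof. by apply: bij_quasi_iso => // i y; exists y. Qed.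

(** The fibres of u and of the identity of Y are both acyclic extensions by the same shifted Y, so h
    on X and h on Y are both compared with h on that shift. *)
Lemma coho_qiso X Y (u : dgmor X Y) : quasi_iso u -> forall i, h X i <-> h Y i.
Proof.
by move=> q i; rewrite (coho_fib q (erefl (i + 1))) -(coho_fib (id_quasi_iso Y) erefl).
Qed.

Lemma coho_shN X i j : i + 1 = j -> h (sh (-1) X) j <-> h X i.
Proof. by move=> e; rewrite -(coho_fib (id_quasi_iso X) e). Qed.

Lemma coho_sh_add X m n l (e : m + n = l) i : h (sh n (sh m X)) i <-> h (sh l X) i.
Proof.
apply: (coho_qiso (u := sh_add e X)); apply: bij_quasi_iso.
  exact: sh_add_inj.
exact: sh_add_surj.
Qed.

Lemma coho_sh0 X i : h (sh 0 X) i <-> h X i.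
Proof.
apply: (coho_qiso (u := sh0 X)); apply: bij_quasi_iso.
  move=> j x hx; have hx' : @tr X (j + 0) j (addr0 j) x = 0 := hx.
  apply: etrans (esym (@trK X _ _ (addr0 j) (esym (addr0 j)) x)) _.
  by rewrite hx' raddf0.
by move=> j y; exists (@tr X _ _ (esym (addr0 j)) y); apply: (@trK X).
Qed.

Lemma coho_sh X m i j : i + m = j -> h (sh m X) i <-> h X j.
Proof.
have pos (n : nat) : forall i j, i - n%:Z = j -> h (sh (- n%:Z) X) i <-> h X j.
  elim: n => [|n IH] i' j' e.
    by rewrite coho_sh0; have -> : i' = j' by lia.
  have e1 : - n%:Z + -1 = - n.+1%:Z by lia.
  rewrite -(coho_sh_add X e1) (coho_shN _ (subrK 1 i')); apply: IH; lia.
move=> e; have [hm|hm] := leP m 0.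
  have [n en] : exists n : nat, m = - n%:Z by exists `|m|%N; lia.
  by rewrite en; apply: pos; lia.
have [n en] : exists n : nat, m = n%:Z by exists `|m|%N; lia.
rewrite en in e *.
have e1 : n%:Z + - n%:Z = 0 by lia.
elim: n {en hm} i e e1 => [|n IH] i e e1.
  by rewrite coho_sh0; have -> : i = j by lia.
have e2 : n.+1%:Z + -1 = n%:Z by lia.
rewrite -(coho_shN _ (erefl (i + 1))) (coho_sh_add X e2); apply: IH; lia.
Qed.
End Coho.

(** X is quasi-isomorphic to the fibre of v, an extension of Y by a shift of Z, so the middle clause
    yields the left one; rotating once more yields the right one. *)
Lemma coho_mk (A : cdgring) (h : dgmod A -> int -> Prop) :
  (forall X Y Z (u : dgmor X Y) (v : dgmor Y Z), ses u v ->
    forall i, h X i -> h Z i -> h Y i) ->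
  (forall X Y (u : dgmor X Y), quasi_iso u -> forall i, h X i <-> h Y i) ->
  (forall X (i j : int), i + 1 = j -> h (sh (-1) X) j <-> h X i) ->
  (forall X : dgmod A, acyclic X -> forall i, h X i) -> coho h.
Proof.
move=> mid qi shN h0.
have left X Y Z (u : dgmor X Y) (v : dgmor Y Z) (S : ses u v) i j (e : j + 1 = i) :
    h Y i -> h Z j -> h X i.
  move=> hY hZ; rewrite (qi _ _ (ses_fib S) (ses_fib_qiso S)).
  by apply: (mid _ _ _ _ _ (tw_ses (fib_thd v))) => //; rewrite (shN Z j).
split=> // X Y Z u v S i j e hY hX.
rewrite -(shN Z i j e).
have T := tw_ses (fib_thd v).
apply: (left _ _ _ _ _ T j i e); last exact: hY.
by rewrite -(qi _ _ (ses_fib S) (ses_fib_qiso S)).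
Qed.

Lemma coho_exact A : coho (fun (M : dgmod A) i => exact M i).
Proof.
split=> [X Y Z u v S i|X Y Z u v S i j e|X Y Z u v S i j e|X /acyclicP//].
- exact: (ses_exactY S).
- exact: (ses_exactZ S e).
- exact: (ses_exactX S e).
Qed.

(** * Finite generation and attaching cells *)

Section Span.
Variables (R : comPzRingType).

Fixpoint span (V : lmodType R) (L : seq V) (x : V) : Prop :=
  if L is v :: L' then exists r : R, span L' (x - r *: v) else x = 0.

Section One.
Variable V : lmodType R.
Lemma span0 (L : seq V) : span L 0.
Proof. by elim: L => //= v L IH; exists 0; rewrite scale0r subr0. Qed.
Lemma spanD (L : seq V) x y : span L x -> span L y -> span L (x + y).
Proof.
elim: L x y => [|v L IH] x y /=; first by move=> -> ->; rewrite addr0.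
move=> [r hr] [s hs]; exists (r + s).
by rewrite scalerDl opprD addrACA; apply: IH.
Qed.
Lemma spanZ (L : seq V) a x : span L x -> span L (a *: x).
Proof.
elim: L x => [|v L IH] x /=; first by move=> ->; rewrite scaler0.
by move=> [r hr]; exists (a * r); rewrite -scalerA -scalerBr; apply: IH.
Qed.
Lemma spanN (L : seq V) x : span L x -> span L (- x).
Proof. by rewrite -scaleN1r; apply: spanZ. Qed.
Lemma spanB (L : seq V) x y : span L x -> span L y -> span L (x - y).
Proof. by move=> hx hy; apply: spanD => //; apply: spanN. Qed.
Lemma span_cat (L L' : seq V) x y : span L x -> span L' y -> span (L ++ L') (x + y).
Proof.
elim: L x => [|v L IH] x /=; first by move=> ->; rewrite add0r.
by move=> [r hr] hy; exists r; rewrite addrAC; apply: IH.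
Qed.
Lemma span_bigsum (n : nat) (t : 'I_n -> V) (b : 'I_n -> R) (s : seq 'I_n) :
  span (map t s) (\sum_(i <- s) b i *: t i).
Proof.
elim: s => [|i s IH]; first by rewrite big_nil.
by rewrite big_cons /=; exists (b i); rewrite addrC addKr.
Qed.
Lemma span_sum (L : seq V) x : span L x ->
  exists b : nat -> R, x = \sum_(i < size L) b i *: L`_i.
Proof.
elim: L x => [|v L IH] x /=; first by move=> ->; exists (fun _ => 0); rewrite big_ord0.
move=> [r /IH[b eb]]; exists (fun n => if n is n'.+1 then b n' else r).
rewrite big_ord_recl /= -(subrK (r *: v) x) eb addrC; congr (_ + _).
Qed.
Lemma fin_genP : fin_gen V <-> exists L : seq V, forall x, span L x.
Proof.
split=> [[n [v h]]|[L h]].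
  exists (map v (index_enum 'I_n)) => x; have [b ->] := h x; exact: span_bigsum.
exists (size L), (fun i => L`_i) => x; have [b eb] := span_sum (h x).
by exists b.
Qed.
End One.

Lemma span_map (V W : lmodType R) (f : V -> W) :
  (forall x y, f (x + y) = f x + f y) -> (forall a x, f (a *: x) = a *: f x) ->
  forall L x, span L x -> span (map f L) (f x).
Proof.
move=> fD fZ; have f0 : f 0 = 0 by rewrite -(scale0r 0) fZ scale0r.
elim=> [|v L IH] x /=; first by move->.
move=> [r /IH hr]; exists r; move: hr; rewrite fD -scaleNr fZ scaleNr; exact.
Qed.

Lemma span_lift (V W : lmodType R) (f : V -> W) :
  (forall x y, f (x + y) = f x + f y) -> (forall a x, f (a *: x) = a *: f x) ->
  forall (L : seq V) y, span (map f L) y -> exists2 x, span L x & f x = y.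
Proof.
move=> fD fZ; have f0 : f 0 = 0 by rewrite -(scale0r 0) fZ scale0r.
elim=> [|v L IH] y /=; first by move->; exists 0.
move=> [r /IH[x hx ex]]; exists (x + r *: v); last by rewrite fD fZ ex subrK.
by exists r; rewrite addrK.
Qed.

Hypothesis noeth : noetherian R.

(** The coefficients of v in elements of T modulo [span L] form an ideal. Elements of T realizing
    finitely many generators of this ideal, together with generators of the part of T inside
    [span L], generate T. *)
Lemma noeth_sub (V : lmodType R) (L : seq V) (T : V -> Prop) :
  T 0 -> (forall x y, T x -> T y -> T (x + y)) -> (forall a x, T x -> T (a *: x)) ->
  (forall x, T x -> span L x) ->
  exists L' : seq V, (forall x, x \in L' -> T x) /\ forall x, T x -> span L' x.
Proof.
elim: L T => [|v L IH] T T0 TD TZ hT.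
  by exists [::]; split=> // x /hT.
pose I : classical_sets.set R := fun r => exists2 t, T t & span L (t - r *: v).
have [n [e eI]] : exists (n : nat) (e : 'I_n -> R), generates e I.
  apply: noeth; split.
  - by exists 0 => //; rewrite scale0r subr0; apply: span0.
  - move=> r s [t ht hr] [t' ht' hs]; exists (t + t'); first exact: TD.
    by rewrite scalerDl opprD addrACA; apply: spanD.
  - move=> a r [t ht hr]; exists (a *: t); first exact: TZ.
    by rewrite -scalerA -scalerBr; apply: spanZ.
have he i : I (e i).
  rewrite eI; exists (fun j => (j == i)%:R).
  rewrite (bigD1 i) //= eqxx mul1r big1 ?addr0 // => j /negbTE ->.
  by rewrite mul0r.
pose t i := sval (cid2 (he i)).
have tP i : T (t i) /\ span L (t i - e i *: v) by rewrite /t; case: cid2.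
have TS (b : 'I_n -> R) s : T (\sum_(i <- s) b i *: t i).
  by apply: (big_ind T) => // i _; apply: TZ; case: (tP i).
have [||||L0 [hL0 gL0]] := IH (fun x => T x /\ span L x).
- by split=> //; apply: span0.
- by move=> x y [hx sx] [hy sy]; split; [apply: TD|apply: spanD].
- by move=> a x [hx sx]; split; [apply: TZ|apply: spanZ].
- by move=> x [].
exists (map t (index_enum 'I_n) ++ L0); split.
  move=> x; rewrite mem_cat => /orP[/mapP[i _ ->]|/hL0[]//]; by case: (tP i).
move=> x hx; have [r hr] := hT _ hx.
have : I r by exists x.
rewrite eI => -[b eb].
rewrite -[x](subrK (\sum_i b i *: t i)) addrC; apply: span_cat; first exact: span_bigsum.
apply: gL0; split.
  by apply: TD => //; rewrite -scaleN1r; apply: TZ; apply: TS.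
have -> : x - \sum_i b i *: t i = (x - r *: v) - \sum_i b i *: (t i - e i *: v).
  rewrite eb scaler_suml.
  have -> : \sum_i b i *: (t i - e i *: v) = \sum_i b i *: t i - \sum_i (b i * e i) *: v.
    by rewrite -sumrB; apply: eq_bigr => i _; rewrite scalerBr scalerA.
  by rewrite opprB addrA subrK.
apply: spanB => //; apply: (big_ind (span L)); first exact: span0.
  by move=> *; apply: spanD.
by move=> i _; apply: spanZ; case: (tP i).
Qed.

Lemma fin_gen_mid (U V W : lmodType R) (f : U -> V) (g : V -> W) :
  (forall x y, f (x + y) = f x + f y) -> (forall a x, f (a *: x) = a *: f x) ->
  (forall x y, g (x + y) = g x + g y) -> (forall a x, g (a *: x) = a *: g x) ->
  (forall v, g v = 0 -> exists u, f u = v) ->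
  fin_gen U -> fin_gen W -> fin_gen V.
Proof.
move=> fD fZ gD gZ ex /fin_genP[LU hU] /fin_genP[LW hW]; apply/fin_genP.
have g0 : g 0 = 0 by rewrite -(scale0r 0) gZ scale0r.
have [||||L [hL gL]] := @noeth_sub W LW (fun w => exists v, g v = w).
- by exists 0.
- by move=> _ _ [x <-] [y <-]; exists (x + y).
- by move=> a _ [x <-]; exists (a *: x).
- by move=> x _; apply: hW.
have [LV eLV] : exists LV, map g LV = L.
  elim: L hL {gL} => [|w L IH] hL; first by exists [::].
  have [x hx|LV eLV] := IH; first by apply: hL; rewrite inE hx orbT.
  have [v ev] := hL w (mem_head _ _).
  by exists (v :: LV); rewrite /= ev eLV.
exists (map f LU ++ LV) => x.
have : span L (g x) by apply: gL; exists x.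
rewrite -eLV => /(span_lift gD gZ)[y hy ey].
have [u eu] : exists u, f u = x - y.
  apply: ex; rewrite gD -scaleN1r gZ ey scaleN1r; exact: subrr.
rewrite -[x](subrK y) -eu; apply: span_cat => //; exact: (span_map fD fZ).
Qed.
End Span.

Section FG.
Variable A : cdgring.

Definition fg (M : dgmod A) i : Prop := fin_gen (Hmod M i : lmodType (Abar A)).

Section Cmap.
Variables (M N : dgmod A) (f : dgmor M N) (i : int).
Definition cmap : (Hmod M i : lmodType (Abar A)) -> (Hmod N i : lmodType (Abar A)) :=
  fun c => cohomology_map f c.
Lemma cmapD x y : cmap (x + y) = cmap x + cmap y.
Proof.
have [a -> _] := clsS x; have [b -> _] := clsS y.
rewrite /cmap -[X in cohomology_map _ X]clsD !cohomology_mapE -[RHS]clsD; congr cls.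
by apply: val_inj; rewrite /= raddfD.
Qed.
Lemma cmapZ a x : cmap (a *: x) = a *: cmap x.
Proof.
have [b -> _] := clsS x; have [c -> _] := clsS (a : cohomology A 0).
apply: (etrans (congr1 (cohomology_map f (i := i)) (cohomology_actE c b))).
apply: etrans; last first.
  apply/esym; apply: (etrans (congr1 (cohomology_act (cls c : H0 A)) (cohomology_mapE f b))).
  exact: cohomology_actE.
rewrite cohomology_mapE; congr cls; apply: val_inj; exact: mmor_act.
Qed.
Lemma cmap0 x : Hinj f i -> cmap x = 0 -> x = 0.
Proof.
have [b -> cb] := clsS x; rewrite /cmap cohomology_mapE => h /cls0 hb.
by apply/cls0; apply: h.
Qed.
Lemma cmap_surj y : Hsurj f i -> exists x, cmap x = y.
Proof.
have [w -> cw] := clsS y; move=> /(_ _ cw)[z [/cyc_is cz bz]].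
exists (cls (Cocycle cz)); rewrite /cmap cohomology_mapE.
by apply/esym/cls_eq.
Qed.
End Cmap.

Hypothesis noeth : noetherian (Abar A).

Lemma fg_exact (M : dgmod A) i : exact M i -> fg M i.
Proof.
move=> /exactP h; apply/fin_genP; exists [::] => x; exact: h.
Qed.

Lemma fg_Hinj (M N : dgmod A) (f : dgmor M N) i : Hinj f i -> fg N i -> fg M i.
Proof.
move=> h hN.
apply: (@fin_gen_mid _ noeth (Hmod N i) (Hmod M i) (Hmod N i) (fun _ => 0) (@cmap _ _ f i)) => //.
- by move=> x y; rewrite addr0.
- by move=> a x; rewrite scaler0.
- exact: cmapD.
- exact: cmapZ.
- by move=> v e; exists 0; rewrite (cmap0 h e).
Qed.

Lemma fg_Hsurj (M N : dgmod A) (f : dgmor M N) i : Hsurj f i -> fg M i -> fg N i.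
Proof.
move=> h /fin_genP[L hL]; apply/fin_genP; exists (map (@cmap _ _ f i) L) => y.
have [x <-] := cmap_surj y h; apply: span_map => //; [exact: cmapD|exact: cmapZ].
Qed.

(** The span in cohomology, read on cochains with coefficients in A^0 and modulo boundaries. Working
    below the quotient lets the same list of generators be followed through shifts, attached cells
    and restriction of scalars. *)
Fixpoint espan (M : dgmod A) i (L : seq (M i)) (z : M i) : Prop :=
  if L is v :: L' then exists a : A 0, espan L' (z - act (add0r i) a v) else bnd z.

Lemma espanP (M : dgmod A) i (L : seq (cocycle M i)) (z : cocycle M i) :
  espan (map (fun c => cval c) L) (cval z) <-> 
  @span (Abar A) (Hmod M i) (map (fun c => cls c : Hmod M i) L) (cls z : Hmod M i).
Proof.
elim: L z => [|v L IH] z; first by rewrite /= -cls0.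
have E (a : A 0) : (cls z : Hmod M i) - (cls (cocycle0 a) : Abar A) *: (cls v : Hmod M i)
    = cls (z - cocycle_act (cocycle0 a) v).
  apply: (etrans (congr1 (fun t : Hmod M i => (cls z : Hmod M i) - t) (cohomology_actE (cocycle0 a) v))).
  exact: esym (clsB _ _).
split=> /=.
  move=> [a ha]; exists (cls (cocycle0 a)); rewrite E; apply/IH; exact: ha.
move=> [r]; have [c -> _] := clsS (r : cohomology A 0).
rewrite -(cocycle0K c) => h; exists (cval c); move: h; rewrite E => /IH; exact.
Qed.

Lemma fgP (M : dgmod A) i : fg M i <->
  exists L : seq (M i), (forall x, x \in L -> cyc x) /\ forall z, cyc z -> espan L z.
Proof.
split=> [/fin_genP[L hL]|[L [cL hL]]].
  exists (map (fun c => cval (rep (c : cohomology M i))) L); split.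
    by move=> x /mapP[c _ ->]; apply/cyc_is; apply: cvalP.
  move=> z /cyc_is cz.
  have := hL (cls (Cocycle cz)).
  have {1}-> : L = map (fun c => cls c : Hmod M i) (map (fun c : Hmod M i => rep (c : cohomology M i)) L).
    by rewrite -map_comp -[LHS]map_id; apply: eq_map => c /=; rewrite repK.
  by move/espanP; rewrite -map_comp; exact.
have [L' eL'] : exists L' : seq (cocycle M i), map (fun c => cval c) L' = L.
  elim: L cL {hL} => [|v L IH] cL; first by exists [::].
  have [x hx|L' <-] := IH; first by apply: cL; rewrite inE hx orbT.
  have /cyc_is cv := cL v (mem_head _ _).
  by exists (Cocycle cv :: L').
apply/fin_genP; exists (map (fun c => cls c : Hmod M i) L') => c.
have [z -> cz] := clsS (c : cohomology M i).
by apply/espanP; rewrite eL'; apply: hL.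
Qed.

Lemma sh_cyc m (M : dgmod A) i (z : M (i + m)) : @cyc (sh m M) i z <-> @cyc M (i + m) z.
Proof.
split=> h; first exact: (cyc_at (h := sh_eq1 m erefl) (h _ erefl)).
by apply: (@cyc_at (sh m M) i _ erefl); apply: h.
Qed.

Lemma sh_bnd m (M : dgmod A) i (z : M (i + m)) : @bnd (sh m M) i z <-> @bnd M (i + m) z.
Proof.
split=> [[j [h [u e]]]|]; first by exists (j + m), (sh_eq1 m h), u.
have h : i - 1 + 1 = i by rewrite subrK.
move/(bnd_at (sh_eq1 m h)) => [u e]; exists (i - 1), h, u; exact: e.
Qed.

Lemma sh_espan m (M : dgmod A) i (L : seq (M (i + m))) z :
  @espan (sh m M) i L z <-> @espan M (i + m) L z.
Proof.
elim: L z => [|v L IH] z /=; first exact: sh_bnd.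
have E (a : A 0) : act (sh_eq2 m (add0r i)) a v = act (add0r (i + m)) a v.
  exact: act_irr.
split=> -[a ha]; exists a; first by move/IH: ha; rewrite -E.
by apply/IH; rewrite -E in ha.
Qed.

Lemma fg_sh m (M : dgmod A) i : fg (sh m M) i <-> fg M (i + m).
Proof.
by rewrite !fgP; split=> -[L [cL hL]]; exists L; split=> x hx;
  by [apply/sh_cyc/cL | apply/sh_espan/hL/sh_cyc].
Qed.

Lemma coho_fg : coho (fun (M : dgmod A) i => fg M i).
Proof.
apply: coho_mk => [X Y Z u v S i fX fZ|X Y u q i|X i j e|X aX i].
- apply: (fin_gen_mid noeth (@cmapD _ _ u i) (@cmapZ _ _ u i) (@cmapD _ _ v i) (@cmapZ _ _ v i)) => //.
  move=> c; have [y -> cy] := clsS (c : cohomology Y i).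
  rewrite /cmap cohomology_mapE => /cls0 hb.
  have [x [/cyc_is cx bx]] := les_mid S cy hb.
  exists (cls (Cocycle cx)); rewrite cohomology_mapE; apply/esym/cls_eq; exact: bx.
- have [hi hs] := proj1 (quasi_isoP _) q i.
  by split; [apply: fg_Hsurj hs|apply: fg_Hinj hi].
- by rewrite fg_sh; have -> : j + -1 = i by lia.
- by apply: fg_exact; apply: (proj1 (acyclicP _) aX).
Qed.

Definition Dminus k (M : dgmod A) := (forall i, fg M i) /\ (forall i, k < i -> exact M i).

Section Attach.
Variables (M : dgmod A) (k m : int) (hm : m + k = 1) (z : M k) (cz : cyc z).

Lemma att_eq i j : i + 1 = j -> (i + m) + k = j.
Proof. by rewrite -addrA hm. Qed.

Definition att_th : hom (sh m (selfmod A)) M 1.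
Proof.
exists (fun i j h (a : A (i + m)) => ksgn i (act (att_eq h) a z)).
  by move=> i j h x y; rewrite -ksgnD; congr ksgn; exact: actDl.
move=> p i j l o hp hk hn hl a x.
have e : p + j = o by lia.
rewrite -[act hp a x]/(dgmul (sh_eq2 m hp) a x).
rewrite (actA (sh_eq2 m hp) (att_eq hk) (att_eq hn) hl) act_ksgn ksgnM.
by apply: ksgn_odd; rewrite -hp mulr1.
Defined.

Lemma att_thd n (h : 1 + 1 = n) : hom_d h att_th = 0.
Proof.
apply: hom_ext => i j e x.
have e1 : i + 1 + 1 = j by lia.
rewrite (hom_dE h att_th e erefl e1 erefl e1) /= df_ksgn.
have e2 : i + m + (k + 1) = j by move: hm; lia.
have e3 : i + m + 1 + k = j by move: hm; lia.
have e4 : i + 1 + m = i + m + 1 by lia.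
rewrite (act_d (att_eq erefl) erefl erefl e1 e3 e2) (cz erefl) act0r ksgn0 addr0.
have -> : act (att_eq e1) (df A (sh_eq1 m erefl) x) z = act e3 (df A erefl x) z.
  move: (sh_eq1 m erefl) (att_eq e1); rewrite e4 => E1 E2.
  by rewrite (df_irr E1 erefl) (act_irr E2 e3).
rewrite /ksgn (oddzS (erefl (i + 1))); case: (oddz i); rewrite /= ?opprK ?addNr ?subrr //.
Qed.

(** M with a free cell whose generator sits in degree k - 1 and has differential z up to sign: the
    cone of the map from a shifted A to M that hits z. *)
Definition att := tw att_thd.
Definition att_in : dgmor M att := tw_in att_thd.
Lemma att_ses : ses att_in (tw_pr att_thd). Proof. exact: tw_ses. Qed.

Lemma att_kill : @bnd att k (att_in k z).
Proof.
have e : k - 1 + 1 = k by lia.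
have e0 : 0 = k - 1 + m by move: hm; lia.
have E : df att e ((@tr A 0 _ e0 (dgone A), 0) : att (k - 1)) = ksgn (k - 1) (att_in k z).
  rewrite -(ksgn_mor (att_in k)) /= /tw_d /= raddf0 add0r; congr pair.
    apply: (tr_cyc e0); apply/cyc_is; exact: cocycle0_subproof.
  congr ksgn; have e1 : 0 + k = k by rewrite add0r.
  move: (att_eq e); case: _ / e0 => E; by rewrite act1.
rewrite -(ksgnK (k - 1) (att_in k z)) -E; apply: ksgn_bnd; exact: bnd_d.
Qed.

(** The cell is zero above degree k - 1, so killing the class of z creates no new cocycles in degree
    k. *)
Lemma att_lift (y : att k) : cyc y -> exists2 x, cyc x & att_in k x = y.
Proof.
case: y => a x cy; have ea : a = 0 by apply: dg_nonpos; move: hm; lia.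
subst a; exists x => //.
by apply: (ses_cyc att_ses).
Qed.
End Attach.
End FG.

(** * Way-out induction and evaluation at 1 *)

Section Wayout.
Variable A : cdgring.

Lemma act_bnd0 (M : dgmod A) i (a : A 0) (x : M i) : bnd x -> bnd (act (add0r i) a x).
Proof.
move=> /(bnd_at (subrK 1 i))[u <-].
have e1 : 1 + (i - 1) = i by lia.
have e2 : 0 + (i - 1) = i - 1 by lia.
exists (i - 1), (subrK 1 i), (act e2 a u).
rewrite (act_d e2 (add0r 1) (subrK 1 i) (subrK 1 i) e1 (add0r i)).
by rewrite (dg_nonpos _ (df A (add0r 1) a)) // act0l add0r.
Qed.

Lemma espan_bnd (M : dgmod A) i (L : seq (M i)) x y : espan L x -> bnd y -> espan L (x + y).
Proof.
elim: L x => [|v L IH] x /=; first exact: bndD.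
by move=> [a ha] hy; exists a; rewrite addrAC; apply: IH.
Qed.

Lemma espan_mor (M N : dgmod A) (f : dgmor M N) i (L : seq (M i)) x :
  espan L x -> espan (map (f i) L) (f i x).
Proof.
elim: L x => [|v L IH] x /=; first exact: bnd_mor.
by move=> [a /IH ha]; exists a; rewrite -mmor_act -raddfB.
Qed.

Hypothesis pn : pseudo_noetherian A.
Let noeth : noetherian (Abar A) := proj1 pn.

Lemma A_exact i : 0 < i -> exact (selfmod A) i.
Proof. by move=> hi z _; rewrite (dg_nonpos hi z); apply: bnd0. Qed.

Lemma A_Dminus : Dminus 0 (selfmod A).
Proof. split=> i; [exact: (proj2 pn)|exact: A_exact]. Qed.

(* Decreasing the top degree by attaching copies of A that kill generators of
   the top cohomology reduces any M to degrees where [base] applies. *)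
Lemma wayout (h : dgmod A -> int -> Prop) (H : coho h) (c s : int) :
  (forall k M, Dminus k M -> forall j, k + c < j -> h M j) ->
  (forall j, s < j -> h (selfmod A) j) ->
  forall k M, Dminus k M -> forall j, k + s < j -> h M j.
Proof.
move=> base unit.
(* n measures how far j is from the range of [base]. An inner induction on the number of generators
   of H^k empties that group; then k, and with it n, drops by one. *)
suff main (n : nat) : forall k M, Dminus k M -> forall j, k + s < j -> k + c - n%:Z < j -> h M j.
  by move=> k M hM j hj; apply: (@main (absz (k + c - j + 1)) k M hM j hj); lia.
elim: n => [|n IH] k M hM j hj hj2.
  by apply: (base k M hM); lia.
have /fgP[L [cL gL]] := proj1 hM k.
move eL: (size L) => nL.
elim: nL M L hM cL gL eL => [|nL IHL] M [|z L] hM cL gL // => [_|[eL]].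
  apply: (IH (k - 1)); try lia.
  split=> [i|i hi]; first exact: (proj1 hM).
  have [ei|ei] := EM (i = k); last by apply: (proj2 hM); lia.
  by subst i; move=> z /gL.
have hm : (1 - k) + k = 1 by lia.
have cz : cyc z by apply: cL; apply: mem_head.
have S := att_ses hm cz.
(* M is the left term of M -> [att] -> A[1 - k], so besides [att] one needs h of the shifted A at j
   - 1, which is h of A at j - k > s. *)
apply: (coho_left H S (j := j - 1)); first by lia.
  apply: (IHL _ (map (att_in hm cz k) L)); last by rewrite size_map.
  - split=> i.
      apply: (coho_mid (coho_fg noeth) S); first exact: (proj1 hM).
      by apply/fg_sh; apply: (proj2 pn).
    move=> hi; apply: (ses_exactY S); first exact: (proj2 hM).
    by apply: (proj2 (@sh_exact A (1 - k) (selfmod A) i _ erefl)); apply: A_exact; lia.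
  - by move=> x /mapP[y hy ->]; apply: cyc_mor; apply: cL; rewrite inE hy orbT.
  - move=> y cy; have [x cx <-] := att_lift cy.
    (* The multiple of z becomes a boundary after the attachment, so the remaining generators
       suffice. *)
    have [a ha] : exists a : A 0, espan L (x - act (add0r k) a z) := gL x cx.
    have -> : att_in hm cz k x
        = att_in hm cz k (x - act (add0r k) a z) + act (add0r k) a (att_in hm cz k z).
      by rewrite -mmor_act -raddfD subrK.
    apply: espan_bnd; first exact: espan_mor.
    by apply: act_bnd0; apply: att_kill.
have e : j - 1 + (1 - k) = j - k by lia.
by apply: (proj2 (@coho_sh _ _ H _ _ _ _ e)); apply: unit; lia.
Qed.

Lemma wayout_all (h : dgmod A -> int -> Prop) (H : coho h) (c : int) :
  (forall k M, Dminus k M -> forall j, k + c < j -> h M j) ->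
  (forall j, h (selfmod A) j) ->
  forall k M, Dminus k M -> forall j, h M j.
Proof.
move=> base unit k M hM j.
by apply: (wayout H (s := j - k - 1) base _ hM) => //; lia.
Qed.

(** M is cut at l = j - c, so that the upper part, exact below l + 1, falls in the range of the
    second hypothesis exactly at j, while the lower part is bounded above. *)
Lemma coho_all (h : dgmod A -> int -> Prop) (H : coho h) (c : int) :
  (forall k M, Dminus k M -> forall j, h M j) ->
  (forall k M, (forall i, fg M i) -> (forall i, i < k -> exact M i) -> forall j, j < k + c -> h M j) ->
  forall M, (forall i, fg M i) -> forall j, h M j.
Proof.
move=> hm hp M fM j; set l := j - c.
have lo i : l < i -> exact (tau l M) i by apply: tau_hi.
have hi i : i < l + 1 -> exact (tauq l M) i by move=> ?; apply: tauq_lo; lia.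
have fl i : fg (tau l M) i.
  have [e|e] := leP i l; last by apply: fg_exact; apply: lo.
  by apply: (fg_Hinj noeth (f := tau_in l M)) (fM i); apply: tau_Hinj.
have fh i : fg (tauq l M) i.
  have [e|e] := leP i l; first by apply: fg_exact; apply: hi; lia.
  by apply: (fg_Hsurj (f := tau_pi l M)) (fM i); apply: tauq_Hsurj.
apply: (coho_mid H (tau_ses l M)); first exact: (hm l).
by apply: (hp (l + 1)) => //; rewrite /l; lia.
Qed.
End Wayout.

(** Hom(-, J) reverses arrows; negating the index makes its connecting maps run in the direction
    that [coho] expects. *)
Lemma coho_hdg A (h : dgmod A -> int -> Prop) (H : coho h) (J : dgmod A) : semiinj J ->
  coho (fun M j => h (hdg M J) (- j)).
Proof.
move=> [kJ gJ]; split=> [X Y Z u v S i hX hZ|X Y Z u v S i j e hY hX|X Y Z u v S i j e hY hZ|X aX i].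
- exact: (coho_mid H (pre_ses S gJ)).
- by apply: (coho_left H (pre_ses S gJ)) hY hX; lia.
- by apply: (coho_right H (pre_ses S gJ)) hY hZ; lia.
- by apply: (coho_0 H); apply/acyclicP => k; apply: Kinj_acyclic.
Qed.

Section Eval.
Variables (A : cdgring) (J : dgmod A).
Definition ev1 : dgmor (hdg (selfmod A) J) J.
Proof.
apply: (@mkmor A (hdg (selfmod A) J) J (fun n f => hf f (add0r n) (dgone A))).
- by [].
- move=> n n' h f; rewrite -[RHS]/(hf (hom_d h f) (add0r n') (dgone A)).
  have e : 1 + n = n' by lia.
  rewrite (hom_dE h f (add0r n') (add0r n) h (add0r 1) e).
  have -> : df (selfmod A) (add0r 1) (dgone A) = 0 by apply: dg_nonpos.
  by rewrite hf0 ksgn0 subr0.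
- by move=> p n q h a f; rewrite (hactE h _ _ (add0r q) (add0r n) h).
Defined.
Lemma ev1_hom n (f : hom (selfmod A) J n) i j (h : i + n = j) (h' : i + n = j) (a : A i) :
  hf f h a = ksgn (i * n) (act h' a (ev1 n f)).
Proof.
have e : a = act (d := selfmod A) (addr0 i) a (dgone A).
  by apply/esym; apply: (dgmul1r (addr0 i)).
by rewrite {1}e (hf_act f (addr0 i) h (add0r n) h').
Qed.
Lemma ev1_inj n f : ev1 n f = 0 -> f = 0.
Proof.
move=> e; apply: hom_ext => i j h a; rewrite (ev1_hom f h h) e act0r ksgn0 //.
Qed.
Lemma ev1_surj n (y : J n) : exists f, ev1 n f = y.
Proof.
unshelve eexists.
  refine (@Hom A (selfmod A) J n (fun i j h a => ksgn (i * n) (act h a y)) _ _).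
    by move=> i j h a b; rewrite actDl ksgnD.
  move=> p i j k l hp hk hn hl a x; rewrite act_ksgn ksgnM.
  rewrite -[act hp a x]/(dgmul hp a x) (actA hp hk hn hl).
  by apply: ksgn_odd; rewrite -hp mulrDl.
by rewrite /= mul0r act1.
Qed.
Lemma ev1_qiso : quasi_iso ev1.
Proof. apply: bij_quasi_iso; [exact: ev1_inj|exact: ev1_surj]. Qed.
End Eval.

(** * Adjunction between restriction and coinduction *)

Section Restrict.
Variables (A B : cdgring) (phi : dgrmor A B).
Definition res_mor (M N : dgmod B) (u : dgmor M N) :
  dgmor (restrict_dg phi M) (restrict_dg phi N).
Proof.
apply: (@mkmor A (restrict_dg phi M) (restrict_dg phi N) (fun i x => u i x)).
- by move=> i; apply: additiveB.
- by move=> i j h x; apply: cmor_d.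
- by move=> i j k h a x; exact: (mmor_act u h (phi i a) x).
Defined.

Variable J : dgmod A.
Local Notation C := (coind phi (selfmod B) J).

Definition ev : dgmor (restrict_dg phi C) J.
Proof.
apply: (@mkmor A (restrict_dg phi C) J
  (fun n (f : hom (restrict_dg phi (selfmod B)) J n) => hf f (add0r n) (dgone B))).
- by [].
- move=> n n' h f.
  rewrite -[RHS]/(hf (hom_d h (f : hom (restrict_dg phi (selfmod B)) J n)) (add0r n') (dgone B)).
  have e : 1 + n = n' by lia.
  rewrite (hom_dE h f (add0r n') (add0r n) h (add0r 1) e).
  have -> : df (restrict_dg phi (selfmod B)) (add0r 1) (dgone B) = 0 by apply: dg_nonpos.
  by rewrite hf0 ksgn0 subr0.
- move=> p n q h a f.
  rewrite -[LHS]/(hf (coind_act h (phi p a) (f : hom (restrict_dg phi (selfmod B)) J n)) (add0r q) (dgone B)).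
  rewrite (coind_actE h _ _ _ (addr0 p) h).
  rewrite -[@act B (selfmod B) _ _ _ (addr0 p) (phi p a) (dgone B)]/(@act A (restrict_dg phi (selfmod B)) _ _ _ (addr0 p) a (dgone B)).
  by rewrite (hf_act f (addr0 p) h (add0r n) h) ksgnK.
Defined.

Section Hom.
Variable M : dgmod B.
Local Notation rM := (restrict_dg phi M).

Lemma adj_eq (i n j p q : int) : i + n = j -> p + j = q -> (p + i) + n = q. Proof. lia. Qed.

Definition adj_in n (f : hom rM J n) i j (h : i + n = j) (x : M i) :
  hom (restrict_dg phi (selfmod B)) J j.
Proof.
exists (fun p q (e : p + j = q) (b : B p) =>
  ksgn (p * i) (hf f (adj_eq h e) (@act B M _ _ _ erefl b x))).
  by move=> p q e b b'; rewrite actDl hfD ksgnD.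
move=> r p s q t hr hq hp ht a b.
have e1 : r + (p + i) = q + i by lia.
have e2 : q + i + n = t by lia.
have e3 : p + i + n = s by lia.
rewrite (hf_irr _ _ e2) (hf_irr _ (adj_eq h hp) e3).
have -> : @act B M _ _ _ erefl (@act A (restrict_dg phi (selfmod B)) _ _ _ hr a b) x
  = @act A rM _ _ _ e1 a (@act B M _ _ _ erefl b x).
  exact: (actA hr erefl erefl e1 (phi r a) b x).
rewrite (hf_act f e1 e2 e3 ht) act_ksgn !ksgnM; apply: ksgn_odd.
by rewrite -hr -h !(oddzD, oddzM); case: (oddz r); case: (oddz p); case: (oddz i); case: (oddz n).
Defined.

Lemma adj_inE n (f : hom rM J n) i j (h : i + n = j) x p q (e : p + j = q) b k
  (h1 : p + i = k) (h2 : k + n = q) :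
  hf (adj_in f h x) e b = ksgn (p * i) (hf f h2 (@act B M _ _ _ h1 b x)).
Proof. by subst k; rewrite /=; congr ksgn; apply: hf_irr. Qed.

Definition adjn n (f : hom rM J n) : hom M C n.
Proof.
exists (fun i j h x => adj_in f h x : C j).
  move=> i j h x y; apply: hom_ext => p q e b; rewrite /= actDr hfD ksgnD; exact: erefl.
move=> r i k j l hr hk hn hl c x; apply: hom_ext => p q e b.
have e1 : p + j = p + j by [].
have e2 : p + j + n = q by lia.
rewrite (adj_inE f _ _ e b erefl e2).
have -> : hf (ksgn (r * n) (act hl c (adj_in f hn x : C k))
             : hom (restrict_dg phi (selfmod B)) J l) e b
  = ksgn (r * n) (hf (coind_act hl c (adj_in f hn x)) e b).
  by rewrite /ksgn; case: (oddz (r * n)).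
have e3 : r + p + k = q by lia.
rewrite (coind_actE hl c _ e erefl e3).
have e4 : r + p + i = p + j by lia.
rewrite (adj_inE f hn x e3 _ e4 e2).
have e5 : p + r = r + p by lia.
have -> : @act B (selfmod B) r p (r + p) erefl c b = ksgn (p * r) (dgmul e5 b c).
  exact: (dgmulC e5 erefl b c).
have e6 : r + i = j by lia.
rewrite act_ksgnl hf_ksgn (actA e5 e4 hr erefl) !ksgnM; apply: ksgn_odd.
rewrite -hr -hn !(oddzD, oddzM).
by case: (oddz r); case: (oddz p); case: (oddz i); case: (oddz n).
Defined.

Definition kap_hom n (f : hom M C n) : hom rM J n.
Proof.
exists (fun i j h x => ev j (hf f h x)).
  by move=> i j h x y; rewrite hfD raddfD.
move=> p i j k l hp hk hn hl a x.
have -> : @act A rM _ _ _ hp a x = @act B M _ _ _ hp (phi p a) x by [].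
rewrite (hf_act f hp hk hn hl) (ksgn_mor (ev l)); congr ksgn.
exact: (mmor_act ev hl a).
Defined.

(** The adjunction isomorphism Hom_B(M, Hom_A(B, J)) = Hom_A(M, J) on whole Hom complexes, given by
    evaluation at 1. Through it, questions over B on coinduced modules become questions over A. *)
Definition kap : dgmor (restrict_dg phi (hdg M C)) (hdg rM J).
Proof.
apply: (@mkmor A (restrict_dg phi (hdg M C)) (hdg rM J) (fun n f => kap_hom f)).
- by move=> n f g; apply: hom_ext => i j h x.
- move=> n n' hn f; apply: hom_ext => i j h x.
  have e1 : i + n + 1 = j by lia.
  have e2 : i + 1 + n = j by lia.
  rewrite [LHS](hom_dE hn _ h erefl e1 erefl e2).
  rewrite [RHS](congr1 (ev j) (hom_dE hn f h erefl e1 erefl e2 x)).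
  rewrite raddfB (ksgn_mor (ev j)); congr (_ - _).
  exact: (cmor_d ev).
- move=> p n q hq a f; apply: hom_ext => i j h x.
  have e1 : p + (i + n) = j by lia.
  rewrite [RHS](hactE hq _ _ h erefl e1).
  rewrite [LHS](congr1 (ev j) (hactE hq (phi p a) f h erefl e1 x)).
  exact: (mmor_act ev).
Defined.

Lemma kap_adjn n (f : hom rM J n) : kap n (adjn f) = f.
Proof.
apply: hom_ext => i j h x.
rewrite [LHS](adj_inE f h x (add0r j) (dgone B) (add0r i) h) mul0r.
by rewrite (act1 (d := M)) /ksgn; apply: hf_irr.
Qed.

Lemma kap_inj n (f : hom M C n) : kap n f = 0 -> f = 0.
Proof.
move=> e0; apply: hom_ext => i j h x; apply: hom_ext => p q e b.
have e1 : p + i + n = q by lia.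
have E := @hf_eq A rM J n (kap n f) 0 _ _ e1 (@act B M _ _ _ erefl b x) e0.
have {E} : hf (hf f e1 (@act B M _ _ _ erefl b x) : hom (restrict_dg phi (selfmod B)) J q)
   (add0r q) (dgone B) = 0 := E.
rewrite (hf_act f erefl e1 h e).
have -> : hf (ksgn (p * n) (act e b (hf f h x)) : hom (restrict_dg phi (selfmod B)) J q)
   (add0r q) (dgone B) = ksgn (p * n) (hf (coind_act e b (hf f h x : hom (restrict_dg phi (selfmod B)) J j)) (add0r q) (dgone B)).
  by rewrite /ksgn; case: (oddz (p * n)).
rewrite (coind_actE e _ _ _ (addr0 p) e).
have -> : @act B (selfmod B) p 0 p (addr0 p) b (dgone B) = b by apply: (dgmul1r (addr0 p)).
by move=> E; apply: (@ksgn_inj _ (p * j)); apply: (@ksgn_inj _ (p * n)); rewrite E !ksgn0.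
Qed.

Lemma kap_surj n (f : hom rM J n) : exists g, kap n g = f.
Proof. by exists (adjn f); apply: kap_adjn. Qed.

Lemma kap_qiso : quasi_iso kap.
Proof. apply: bij_quasi_iso; [exact: kap_inj|exact: kap_surj]. Qed.

Lemma kap_exact i : exact (hdg M C) i <-> exact (hdg rM J) i.
Proof. exact: (@bij_exact (restrict_dg phi (hdg M C)) (hdg rM J) kap kap_inj kap_surj i). Qed.

Lemma adjn_cyc (e : dgmor rM J) : @cyc (hom_cplx M C) 0 (adjn (hom_of e)).
Proof.
apply: (@cyc_at (hom_cplx M C) 0 1 (add0r 1)); apply: kap_inj.
apply: etrans (esym (cmor_d kap (add0r 1) (adjn (hom_of e)))) _.
by rewrite kap_adjn; apply: hom_of_cyc.
Qed.

Definition adj (e : dgmor rM J) : dgmor M C := mor_of (adjn_cyc e).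

Lemma adjE (e : dgmor rM J) i x : ev i (adj e i x) = e i x.
Proof.
have := @hf_eq A rM J 0 _ _ _ _ (addr0 i) x (kap_adjn (hom_of e)); rewrite hom_ofE; exact.
Qed.
Lemma adj_inj (e : dgmor rM J) : (forall i x, e i x = 0 -> x = 0) ->
  forall i x, adj e i x = 0 -> x = 0.
Proof. by move=> h i x e0; apply: h; rewrite -adjE e0 raddf0. Qed.
End Hom.

Lemma coind_Kinj : Kinjective J -> Kinjective C.
Proof.
move=> kJ N aN; apply/acyclicP => i; apply/kap_exact.
exact: (proj1 (acyclicP _) (kJ (restrict_dg phi N) aN)).
Qed.

Lemma coind_graded_inj : graded_inj J -> graded_inj C.
Proof.
move=> gJ X Y u hu n f.
have [g eg] := gJ _ _ (res_mor u) hu n (kap X n f).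
exists (adjn g); apply/eqP; rewrite -subr_eq0; apply/eqP/kap_inj.
have E : kap X n (pre_hom u (adjn g)) = kap X n f.
  apply: hom_ext => i j h x; rewrite -eg.
  exact: (@hf_eq A (restrict_dg phi Y) J n _ _ _ _ h (u i x) (kap_adjn g)).
by rewrite raddfB E subrr.
Qed.

Lemma coind_semiinj : semiinj J -> semiinj C.
Proof. by move=> [kJ gJ]; split; [apply: coind_Kinj|apply: coind_graded_inj]. Qed.
End Restrict.

Definition coind_mor (A B : cdgring) (phi : dgrmor A B) (J J' : dgmod A) (u : dgmor J J') :
  dgmor (coind phi (selfmod B) J) (coind phi (selfmod B) J').
Proof.
apply: (@mkmor B (coind phi (selfmod B) J) (coind phi (selfmod B) J')
  (fun i f => post_hom u (f : hom (restrict_dg phi (selfmod B)) J i))).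
- by move=> i; apply: (additiveB (post (restrict_dg phi (selfmod B)) u i)).
- by move=> i j h; apply: (cmor_d (post (restrict_dg phi (selfmod B)) u)).
- move=> p n q h b f; apply: hom_ext => i j e x.
  have e1 : p + i + n = j by lia.
  rewrite [RHS](coind_actE h b _ e erefl e1).
  rewrite [LHS](congr1 (u j) (coind_actE h b (f : hom (restrict_dg phi (selfmod B)) J n) e erefl e1 x)).
  exact: (ksgn_mor (u j)).
Defined.

Lemma coind_ses (A B : cdgring) (phi : dgrmor A B) (X Y Z : dgmod A) (u : dgmor X Y) (v : dgmor Y Z) :
  ses u v -> graded_inj X -> ses (coind_mor phi u) (coind_mor phi v).
Proof.
move=> S gX; have [a b c d] := post_ses S (restrict_dg phi (selfmod B)) gX.
split; [exact: a|exact: b|exact: c|exact: d].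
Qed.

(** * K-injective resolutions *)

Section InjectiveGroups.

(** G is the graph of an additive map defined on a subgroup of V, so [inj_group] is injectivity
    among abelian groups without subgroup types. *)
Record padd (V W : zmodType) (G : V -> W -> Prop) : Prop := Padd {
  padd0 : G 0 0;
  paddB : forall x y a b, G x a -> G y b -> G (x - y) (a - b);
  padd_sv : forall a, G 0 a -> a = 0
}.

Definition inj_group (W : zmodType) := forall (V : zmodType) (G : V -> W -> Prop),
  padd G -> exists chi : {additive V -> W}, forall x a, G x a -> chi x = a.

Section Padd.
Variables (V W : zmodType) (G : V -> W -> Prop) (hG : padd G).
Lemma paddN x a : G x a -> G (- x) (- a).
Proof. by move=> h; rewrite -[- x]sub0r -[- a]sub0r; apply: paddB => //; apply: padd0. Qed.
Lemma paddD x y a b : G x a -> G y b -> G (x + y) (a + b).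
Proof. by move=> h h'; rewrite -[y]opprK -[b]opprK; apply: paddB => //; apply: paddN. Qed.
Lemma padd_fun x a b : G x a -> G x b -> a = b.
Proof.
move=> h h'; apply/eqP; rewrite -subr_eq0; apply/eqP/(padd_sv hG).
by rewrite -(subrr x); apply: paddB.
Qed.
Lemma paddMn x a (n : nat) : G x a -> G (x *+ n) (a *+ n).
Proof.
move=> h; elim: n => [|n IH]; first by rewrite !mulr0n; apply: padd0.
by rewrite !mulrS; apply: paddD.
Qed.
Lemma paddMz x a (n : int) : G x a -> G (x *~ n) (a *~ n).
Proof.
by case: n => n h; rewrite ?NegzE ?mulrNz; [|apply: paddN]; apply: paddMn.
Qed.
End Padd.

(** The integers n with n v in P form an ideal, generated by its least positive element if it has
    one. *)
Lemma period (V : zmodType) (P : subgroup V) (v : V) :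
  (forall n : int, P (v *~ n) -> n = 0) \/
  exists2 m : int, 0 < m & P (v *~ m) /\ forall n : int, P (v *~ n) -> exists k, n = m * k.
Proof.
have PM x (k : int) : P x -> P (x *~ k).
  move=> hx; have Pn (n : nat) : P (x *+ n).
    by elim: n => [|n IH]; rewrite ?mulr0n ?mulrS; [apply: sgp0|apply: sgpD].
  by case: k => n; rewrite ?NegzE ?mulrNz; [|apply: sgpN]; apply: Pn.
have [[n0 hn0]|h] := EM (exists n : nat, `[< P (v *+ n.+1) >]); last first.
  left => n hn; case: (ltrgt0P n) => // hn0; exfalso; apply: h.
    exists `|n|.-1%N; apply/asboolP; have -> : (`|n|.-1).+1%N = `|n|%N by lia.
    by rewrite -[_ *+ _]/(v *~ (`|n|%N)%:Z) gtz0_abs.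
  exists `|n|.-1%N; apply/asboolP; have -> : (`|n|.-1).+1%N = `|n|%N by lia.
  by rewrite -[_ *+ _]/(v *~ (`|n|%N)%:Z) ltz0_abs // mulrNz; apply: sgpN.
right; have ex : exists n : nat, `[< P (v *+ n.+1) >] by exists n0.
case: (ex_minnP ex) => m0 /asboolP hm min.
pose m : int := m0.+1%:Z.
have hm' : P (v *~ m) by [].
exists m => //; split=> // n hn.
have hr : P (v *~ (n %% m)%Z).
  have -> : (n %% m)%Z = n - m * (n %/ m)%Z by rewrite {2}(divz_eq n m) mulrC addrC addKr.
  by rewrite mulrzBr; apply: sgpB => //; rewrite mulrzA; apply: PM.
have r0 : 0 <= (n %% m)%Z by apply: modz_ge0.
have r1 : (n %% m)%Z < m by apply: ltz_pmod.
exists (n %/ m)%Z; rewrite {1}(divz_eq n m) mulrC.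
case er : (n %% m)%Z r0 r1 hr => [[|r]|r] // _ r1 hr; first by rewrite addr0.
have := min r; have -> : `[< P (v *+ r.+1) >] by apply/asboolP.
move=> /(_ isT) le; exfalso; move: r1 le; rewrite /m; lia.
Qed.

Lemma divisible_inj (W : zmodType) :
  (forall (m : int) (a : W), 0 < m -> exists b, b *~ m = a) -> inj_group W.
Proof.
move=> div V G0 hG0.
(* Adding G0 to every X lets the empty chain, whose union is empty, satisfy the condition of Zorn's
   lemma. *)
pose U (X : classical_sets.set (V * W)) x a := X (x, a) \/ G0 x a.
have [|X [hX maxX]] := @Zorn_bigcup (V * W)%type (fun X => padd (U X)).
  move=> F FP tot; have ch p q : (exists2 X, F X & X p) \/ G0 p.1 p.2 ->
      (exists2 X, F X & X q) \/ G0 q.1 q.2 ->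
      (G0 p.1 p.2 /\ G0 q.1 q.2) \/ exists2 X, F X & U X p.1 p.2 /\ U X q.1 q.2.
    case: p q => [x a] [y b] /= [[X FX Xp]|gp] [[Y FY Yq]|gq].
    - have [s|s] := tot _ _ FX FY; right.
        by exists Y => //; split; left => //; apply: s.
      by exists X => //; split; left => //; apply: s.
    - by right; exists X => //; split; [left|right].
    - by right; exists Y => //; split; [right|left].
    - by left.
  split.
  - by right; apply: padd0.
  - move=> x y a b hx hy; have [||[g g']|[Y FY [/= h h']]] := ch (x, a) (y, b).
    + by case: hx => [[Y FY h]|h]; [left; exists Y|right].
    + by case: hy => [[Y FY h]|h]; [left; exists Y|right].
    + by right; apply: (paddB hG0).
    + by have [h1|h1] := paddB (FP _ FY) h h'; [left; exists Y|right].
  - move=> a [[Y FY h]|h]; last exact: (padd_sv hG0).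
    by apply: (padd_sv (FP _ FY)); left.
set G := U X in hX.
have dom v : exists a, G v a.
  apply: contrapT => nv.
  have D0 : exists a, G 0 a by exists 0; apply: padd0.
  have DB x y : (exists a, G x a) -> (exists a, G y a) -> exists a, G (x - y) a.
    by move=> [a ha] [b hb]; exists (a - b); apply: (paddB hX).
  pose D := Subgroup D0 DB.
  (* q is the value to be given to v. If m v is the first positive multiple in the domain,
     divisibility supplies q with m q equal to the value already prescribed; if there is none, 0
     will do. *)
  have [q hq] : exists q : W, forall (n : int) a, G (v *~ n) a -> a = q *~ n.
    have [h|[m m0 [[a0 ha0] h]]] := period D v.
      exists 0 => n a ha; have n0 : n = 0 by apply: h; exists a.
      by subst n; rewrite mul0rz; apply: (padd_sv hX); rewrite mulr0z in ha.
    have [q hq] := div m a0 m0; exists q => n a ha.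
    have [k ek] := h n (ex_intro _ a ha); subst n.
    apply: (padd_fun hX ha); rewrite !mulrzA hq; exact: (paddMz hX).
  pose X' : classical_sets.set (V * W) := fun p =>
    exists x a (n : int), G x a /\ p = (x + v *~ n, a + q *~ n).
  have inX' x a : G x a -> X' (x, a) by exists x, a, 0; rewrite !mulr0z !addr0.
  apply: (maxX X').
    split=> [[x a] h|h]; first by apply: inX'; left.
    apply: nv; exists q; left; apply: h; exists 0, 0, 1; rewrite !add0r !mulr1z.
    by split=> //; apply: padd0.
  have UX' x a : U X' x a <-> X' (x, a).
    by split=> [[//|h]|]; [apply: inX'; right|left].
  split.
  - by apply/UX'; apply: inX'; apply: (padd0 hX).
  - move=> x y a b /UX'[x1 [a1 [n [h1 [-> ->]]]]] /UX'[x2 [a2 [n' [h2 [-> ->]]]]].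
    apply/UX'; exists (x1 - x2), (a1 - a2), (n - n'); split; first exact: (paddB hX).
    by rewrite !mulrzBr !opprD; congr pair; rewrite addrACA.
  - move=> a /UX'[x [b [n [h [ex ->]]]]].
    have ev : v *~ (- n) = x by rewrite mulrNz; apply/eqP; rewrite eqr_oppLR -addr_eq0 addrC -ex.
    by rewrite (hq (- n) b) ?ev // mulrNz addNr.
pose f v := sval (cid (dom v)).
have fP v : G v (f v) by rewrite /f; case: cid.
have fB : zmod_morphism f by move=> x y; apply: (padd_fun hX (fP _)); apply: (paddB hX).
exists (mkadd fB) => x a h; apply: (padd_fun hX (fP x)); by right.
Qed.

Lemma inj_group_fun (I : Type) (W : zmodType) : inj_group W -> inj_group (I -> W).
Proof.
move=> hW V G hG.
have ex i : exists chi : {additive V -> W}, forall x g, G x g -> chi x = g i.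
  have [|chi hc] := hW V (fun x a => exists2 g, G x g & g i = a).
    split.
    - by exists 0 => //; apply: padd0.
    - by move=> x y a b [g hg <-] [g' hg' <-]; exists (g - g') => //; apply: (paddB hG).
    - by move=> a [g hg <-]; rewrite (padd_sv hG hg).
  by exists chi => x g h; apply: hc; exists g.
pose f x : I -> W := fun i => sval (cid (ex i)) x.
have fB : zmod_morphism f.
  by move=> x y; apply: functional_extensionality_dep => i; rewrite /f raddfB.
exists (mkadd fB) => x g h; apply: functional_extensionality_dep => i.
by rewrite /= /f; case: cid => chi /= hc; apply: hc.
Qed.

Lemma inj_group_prod (W W' : zmodType) : inj_group W -> inj_group W' ->
  inj_group ((W * W')%type : zmodType).
Proof.
move=> hW hW' V G hG.
have [|c hc] := hW V (fun x a => exists b, G x (a, b)).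
  split.
  - by exists 0; apply: (padd0 hG).
  - by move=> x y a b [a' ha] [b' hb]; exists (a' - b'); apply: (paddB hG ha hb).
  - by move=> a [b /(padd_sv hG)[]].
have [|c' hc'] := hW' V (fun x b => exists a, G x (a, b)).
  split.
  - by exists 0; apply: (padd0 hG).
  - by move=> x y a b [a' ha] [b' hb]; exists (a' - b'); apply: (paddB hG ha hb).
  - by move=> a [b /(padd_sv hG)[]].
have fB : zmod_morphism (fun x => (c x, c' x)) by move=> x y; rewrite !raddfB.
exists (mkadd fB) => x [a b] h; rewrite /= (hc x a) ?(hc' x b) //; by [exists a|exists b].
Qed.

Definition ratZ : subgroup rat.
Proof.
exists (fun q : rat => exists z : int, q = z%:~R); first by exists 0.
by move=> _ _ [x ->] [y ->]; exists (x - y); rewrite rmorphB.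
Defined.
Definition QZ : zmodType := qzT ratZ.
Definition qz : {additive rat -> QZ} := qpi ratZ.

Lemma QZ_inj : inj_group QZ.
Proof.
apply: divisible_inj => m a hm; have [r <-] := qpi_surj a.
exists (qz (r / m%:~R)); rewrite -raddfMz; congr (qz _).
rewrite -mulrzr divfK //; apply/eqP => /eqP; rewrite intr_eq0 => /eqP; lia.
Qed.

(** v is sent to 1/m, where m is its order modulo P, or to 1/2 when that order is infinite;
    injectivity extends this by zero on P to all of V. *)
Lemma QZ_cogen (V : zmodType) (P : subgroup V) v : ~ P v ->
  exists chi : {additive V -> QZ}, (forall x, P x -> chi x = 0) /\ chi v <> 0.
Proof.
move=> hv.
have [q q0 hq] : exists2 q : QZ, q <> 0 & forall n : int, P (v *~ n) -> q *~ n = 0.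
  have nz (m : int) : 1 < m -> qz (m%:~R)^-1 <> 0.
    move=> hm /qpi0[z ez].
    have m0 : m%:~R != 0 :> rat by rewrite intr_eq0; lia.
    have : (z * m)%:~R = 1%:~R :> rat by rewrite rmorphM /= -ez mulVf.
    move/eqP; rewrite eqr_int => /eqP e.
    have [h|[h|h]] : z <= 0 \/ z = 1 \/ 1 < z by lia.
    - have : z * m <= 0 by rewrite mulr_le0_ge0 //; lia.
      by rewrite e.
    - by move: e; rewrite h mul1r; lia.
    - have : 1 < z * m by rewrite (lt_trans h) // ltr_pMr; lia.
      by rewrite e.
  have [h|[m m0 [hm h]]] := period P v.
    exists (qz (2%:~R)^-1); first exact: nz.
    by move=> n /h ->; rewrite mulr0z.
  have m1 : 1 < m.
    have : m <> 1 by move=> e; apply: hv; move: hm; rewrite e mulr1z.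
    lia.
  exists (qz (m%:~R)^-1); first exact: nz.
  move=> n /h[k ->]; rewrite -raddfMz; apply/qpi0; exists k.
  rewrite -mulrzr rmorphM /= mulKf // intr_eq0; lia.
have [|chi hc] := @QZ_inj V (fun x a => exists p (n : int), P p /\ x = p + v *~ n /\ a = q *~ n).
  split.
  - by exists 0, 0; rewrite !mulr0z addr0; split=> //; apply: sgp0.
  - move=> _ _ _ _ [p [n [hp [-> ->]]]] [p' [n' [hp' [-> ->]]]].
    exists (p - p'), (n - n'); split; first exact: sgpB.
    by rewrite !mulrzBr opprD addrACA.
  - move=> _ [p [n [hp [e ->]]]]; apply: hq.
    have -> : v *~ n = - p by apply/eqP; rewrite -addr_eq0 addrC -e.
    exact: sgpN.
exists chi; split.
  by move=> x hx; apply: hc; exists x, 0; rewrite !mulr0z addr0.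
have -> : chi v = q; last exact: q0.
by apply: hc; exists 0, 1; rewrite !mulr1z add0r; split=> //; apply: sgp0.
Qed.
End InjectiveGroups.

Notation Zd := (ring_dg int).

Section ConstantComplex.
Variables (W W' : zmodType).
Definition Ec : zmodType := (W * (W' * W'))%type.
Definition eact i (a : conc int i) (x : Ec) : Ec :=
  match i return conc int i -> Ec with Posz 0 => fun a => x *~ a | _ => fun _ => 0 end a.
Lemma eact0 i x : @eact i 0 x = 0.
Proof. by case: i => [[|i]|i] //=; rewrite mulr0z. Qed.
Lemma eact0r i a : @eact i a 0 = 0.
Proof. by case: i a => [[|i]|i] a //=; rewrite mul0rz. Qed.
Definition ed (x : Ec) : Ec := (0, (x.2.2, 0)).
Lemma edB : zmod_morphism ed.
Proof. by move=> [w [a b]] [w' [a' b']]; rewrite -[RHS]/(0 - 0, (b - b', 0 - 0)) subr0 subr0. Qed.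
HB.instance Definition _ := GRing.isZmodMorphism.Build Ec Ec ed edB.

(* W plus the cone of the identity of W', in every degree. *)
Definition constZ : dgmod Zd.
Proof.
exists (@Complex (fun i => Ec) (fun i j h => ed : {additive Ec -> Ec})
   (fun i j k h h' x => erefl))
  (fun i j k h a x => eact a x).
- by move=> [[|i]|i] j k h a a' x //=; rewrite ?addr0 // mulrzDr.
- by move=> [[|i]|i] j k h a x x' //=; rewrite ?addr0 // mulrzDl.
- move=> i j k ij jk ijk h1 h2 h3 h4 a b x.
  have [ei|ei] := EM (i = 0); last first.
    by rewrite [a](conc_triv _ ei) dgmul0l !eact0.
  have [ej|ej] := EM (j = 0); last first.
    by rewrite [b](conc_triv _ ej) dgmul0r !eact0 eact0r.
  have eij : ij = 0 by lia.
  by subst i j ij; rewrite /= mulrC mulrzA.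
- by move=> i h x; apply: mulr1z.
- move=> i j k i' j' k' h hi hj hk h1 h2 a x.
  have -> : df Zd hi a = 0 by [].
  rewrite eact0 add0r.
  have [ei|ei] := EM (i = 0); last first.
    by rewrite [a](conc_triv _ ei) !eact0 ksgn0 raddf0.
  by subst i; rewrite /= -raddfMz.
Defined.

Lemma Zact (N : dgmod Zd) i (h : 0 + i = i) (a : int) (x : N i) :
  act h (a : Zd 0) x = x *~ a.
Proof.
have fB : zmod_morphism (fun a : int => act h (a : Zd 0) x).
  by move=> b c; rewrite -actBl.
have := raddfMz (mkadd fB) a 1; rewrite /= intz => ->.
by congr (_ *~ _); apply: (act1 (d := N)).
Qed.

Lemma Zlin (N : dgmod Zd) (g : forall i, {additive N i -> Ec}) p i k (h : p + i = k)
  (a : Zd p) x : g k (act h a x) = eact a (g i x).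
Proof.
have [ep|ep] := EM (p = 0); last first.
  by rewrite [a](conc_triv _ ep) act0l raddf0 eact0.
subst p; have ek : i = k by lia.
case: _ / ek h => h; have -> : act h a x = x *~ (a : int) by apply: Zact.
by rewrite raddfMz.
Qed.

Lemma Zlin_sgn (N : dgmod Zd) (g : forall i, {additive N i -> Ec}) n p i k (h : p + i = k)
  (a : Zd p) x : g k (act h a x) = ksgn (p * n) (eact a (g i x)).
Proof.
rewrite Zlin; have [ep|ep] := EM (p = 0); first by subst p; rewrite mul0r.
by rewrite [a](conc_triv _ ep) eact0 ksgn0.
Qed.

Definition mkE (N : dgmod Zd) (g : forall i, {additive N i -> Ec}) n : hom N constZ n.
Proof.
exists (fun i j h x => g i x : constZ j).
  by move=> i j h x y; apply: raddfD.
by move=> p i j k l hp hk hn hl a x; apply: Zlin_sgn.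
Defined.

Lemma EEhf (N : dgmod Zd) n (f : hom N constZ n) i j (h : i + n = j) x :
  hf f h x = hf f (erefl (i + n)) x.
Proof. by subst j. Qed.

Hypotheses (iW : inj_group W) (iW' : inj_group W').
Let iE : inj_group Ec. Proof. by apply: inj_group_prod => //; apply: inj_group_prod. Qed.

Lemma constZ_graded_inj : graded_inj constZ.
Proof.
move=> X Y u hu n f.
have ex i : exists g : {additive Y i -> Ec}, forall x, g (u i x) = hf f (erefl (i + n)) x.
  have [|g hg] := iE (G := fun (y : Y i) (e : Ec) => exists x, u i x = y /\ hf f (erefl (i + n)) x = e).
    split.
    - by exists 0; rewrite raddf0 hf0.
    - by move=> _ _ _ _ [x [<- <-]] [y [<- <-]]; exists (x - y); rewrite raddfB hfB.
    - by move=> _ [x [/hu -> <-]]; rewrite hf0.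
  by exists g => x; apply: hg; exists x.
exists (mkE (fun i => sval (cid (ex i))) n).
by apply: hom_ext => i j h x; rewrite /= (EEhf f h); case: cid => g /= hg.
Qed.

(** A cocycle has components (w, (a, b)) where w kills boundaries and b is a composed with d up to
    sign. As N is acyclic, w factors through d, and injectivity of W extends the factor g from
    boundaries to all of N. The null-homotopy is (g, (0, a)). *)
Lemma constZ_Kinj : Kinjective constZ.
Proof.
move=> N /acyclicP aN; apply/acyclicP => n f cf.
pose v i (x : N i) : Ec := hf f (erefl (i + n)) x.
have vB i : zmod_morphism (@v i) by move=> x y; exact: (hfB f erefl x y).
have v0 i : v i 0 = 0 by exact: (hf0 f erefl).
have cyc_v i j (e : i + 1 = j) (x : N i) : ed (v i x) = ksgn n (v j (df N e x)).
  have e1 : i + (n + 1) = i + n + 1 by lia.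
  have e2 : j + n = i + n + 1 by lia.
  have := hf_eq e1 x (cf _ erefl : hom_d erefl f = 0).
  rewrite (hom_dE _ f e1 erefl erefl e e2) (EEhf f e2) => /eqP.
  by rewrite subr_eq0 => /eqP.
have sg1 (x : Ec) : (ksgn n x).1 = ksgn n x.1 by rewrite /ksgn; case: (oddz n).
have sg2 (x : Ec) : (ksgn n x).2 = ksgn n x.2 by rewrite /ksgn; case: (oddz n).
have sg3 (x : (W' * W')%type : zmodType) : (ksgn n x).1 = ksgn n x.1 by rewrite /ksgn; case: (oddz n).
have sg4 (x : (W' * W')%type : zmodType) : (ksgn n x).2 = ksgn n x.2 by rewrite /ksgn; case: (oddz n).
have v1 i j (e : i + 1 = j) (x : N i) : (v j (df N e x)).1 = 0.
  have /(congr1 fst) := cyc_v i j e x; rewrite sg1 /= => h.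
  by apply: (@ksgn_inj _ n); rewrite -h ksgn0.
have v2 i j (e : i + 1 = j) (x : N i) : (v i x).2.2 = ksgn n (v j (df N e x)).2.1.
  by have /(congr1 (fun t => t.2.1)) := cyc_v i j e x; rewrite /= sg2 sg3.
have ex i : exists g : {additive N i -> W}, forall j (e : j + 1 = i) x, g (df N e x) = ksgn n (v j x).1.
  have [|g hg] := iW (G := fun (y : N i) (w : W) => exists x, df N (subrK 1 i) x = y /\ w = ksgn n (v (i - 1) x).1).
    split.
    - by exists 0; rewrite raddf0 v0 ksgn0.
    - move=> _ _ _ _ [x [<- ->]] [y [<- ->]]; exists (x - y).
      by rewrite raddfB vB /= ksgnB.
    - move=> _ [x [ex ->]].
      have /aN/(bnd_at (subrK 1 (i - 1)))[t <-] : cyc x by apply: (cyc_at ex).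
      by rewrite v1 ksgn0.
  exists g => j e x; apply: hg; have ej : j = i - 1 by lia.
  by subst j; exists x; rewrite (df_irr _ e).
pose g i x : Ec := (sval (cid (ex i)) x, (0, (v i x).2.1)).
have gB i : zmod_morphism (@g i).
  move=> x y; rewrite /g vB -[RHS]/(_ - _, (0 - 0, (v i x).2.1 - (v i y).2.1)).
  by rewrite raddfB subr0.
exists (n - 1), (subrK 1 n), (mkE (fun i => mkadd (@gB i)) (n - 1)).
apply: hom_ext => i j h x.
have e1 : i + (n - 1) + 1 = j by lia.
have e2 : i + 1 + (n - 1) = j by lia.
rewrite [LHS](hom_dE (subrK 1 n) _ h erefl e1 erefl e2) (EEhf f h) -[RHS]/(v i x).
rewrite /= /ed /g /=.
have E : (sval (cid (ex (i + 1))) (df N erefl x), (0, (v (i + 1) (df N erefl x)).2.1))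
  = ksgn n ((v i x).1, (0, (v i x).2.2)) :> Ec.
  case: cid => t /= -> ; rewrite (v2 _ _ (erefl (i + 1))) /ksgn.
  by case: (oddz n) => //; rewrite -[RHS]/(- _, (- 0, - - _)) oppr0 opprK.
rewrite E ksgnM.
have -> (y : Ec) : ksgn (n - 1 + n) y = - y.
  have o : oddz (n - 1 + n) by rewrite oddzD oddzB oddz1; case: (oddz n).
  by rewrite /ksgn o.
rewrite opprK -[LHS]/(0 + (v i x).1, ((v i x).2.1 + 0, 0 + (v i x).2.2)).
by rewrite !add0r addr0; case: (v i x) => [? []].
Qed.

Lemma constZ_semiinj : semiinj constZ. Proof. by split; [apply: constZ_Kinj|apply: constZ_graded_inj]. Qed.
End ConstantComplex.

Section IntegersToA.
Variable A : cdgring.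
Definition int_fun i : conc int i -> A i :=
  match i return conc int i -> A i with
  | Posz 0 => fun a => dgone A *~ a
  | _ => fun _ => 0
  end.
Lemma int_funB i : zmod_morphism (@int_fun i).
Proof. by case: i => [[|i]|i] a b /=; rewrite ?subr0 // mulrzBr. Qed.
Lemma int_fun0 i : int_fun (0 : conc int i) = 0.
Proof. exact: (raddf0 (mkadd (@int_funB i))). Qed.
Lemma one_cyc : @cyc A 0 (dgone A). Proof. apply/cyc_is; exact: cocycle0_subproof. Qed.

Definition int_cplx : cplxmor Zd A.
Proof.
exists (fun i => mkadd (@int_funB i)) => i j h x /=.
rewrite int_fun0; have [ei|ei] := EM (i = 0); last first.
  by rewrite [x](conc_triv _ ei) int_fun0 raddf0.
by subst i; rewrite /= raddfMz one_cyc mul0rz.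
Defined.

Definition intA : dgrmor Zd A.
Proof.
exists int_cplx; last by rewrite /= mulr1z.
move=> i j k h a b /=.
have [ei|ei] := EM (i = 0); last first.
  by rewrite [a](conc_triv _ ei) conc_mul0l !int_fun0 dgmul0l.
have [ej|ej] := EM (j = 0); last first.
  by rewrite [b](conc_triv _ ej) conc_mul0r !int_fun0 dgmul0r.
have ek : k = 0 by lia.
subst i j; move: h; rewrite ek => h; rewrite /=.
have fB : zmod_morphism (fun x : A 0 => dgmul h x (dgone A *~ b)).
  by move=> x y; apply: (@actBl A (selfmod A)).
have := raddfMz (mkadd fB) a (dgone A); rewrite /= => ->.
by rewrite dgmul1l mulrC mulrzA.
Defined.
End IntegersToA.

Section Embed.
Variables (A : cdgring) (M : dgmod A).
(** A character is a family over all degrees because [constZ] has the same group in every degree; a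
    character of a single degree is extended by zero in [char_of]. *)
Definition chars := forall i, {additive M i -> QZ}.
Definition cchars := {c : chars | forall i j (h : i + 1 = j) x, c j (df M h x) = 0}.
Variables (I I' : Type) (c : I -> cchars) (c' : I' -> chars).
Local Notation W := ((I -> QZ)%type : zmodType).
Local Notation W' := ((I' -> QZ)%type : zmodType).

Definition emb_fun i (x : M i) : Ec W W' :=
  ((fun k => sval (c k) i x), ((fun k => c' k i x), (fun k => c' k (i + 1) (df M erefl x)))).
Lemma emb_funB i : zmod_morphism (@emb_fun i).
Proof.
move=> x y; congr (_, (_, _)); apply: functional_extensionality_dep => k;
  by rewrite /= ?raddfB.
Qed.
Definition emb0 : dgmor (restrict_dg (intA A) M) (constZ W W').
Proof.
apply: (@mkmor Zd (restrict_dg (intA A) M) (constZ W W') (fun i x => emb_fun x)).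
- by move=> i; apply: emb_funB.
- move=> i j h x; subst j; congr (_, (_, _)); apply: functional_extensionality_dep => k.
    by rewrite (svalP (c k)).
  by rewrite dfK raddf0.
- move=> i j k h a x.
  exact: (@Zlin W W' (restrict_dg (intA A) M) (fun i => mkadd (@emb_funB i)) i j k h a x).
Defined.
Definition embT : dgmod A := coind (intA A) (selfmod A) (constZ W W').
Definition emb : dgmor M embT := adj emb0.
Lemma QZf_inj (T : Type) : inj_group ((T -> QZ)%type : zmodType).
Proof. by apply: inj_group_fun; apply: QZ_inj. Qed.
Lemma embT_semiinj : semiinj embT.
Proof. by apply: coind_semiinj; apply: constZ_semiinj; apply: QZf_inj. Qed.
End Embed.

Section Chars.
Variables (A : cdgring) (M : dgmod A) (i0 : int) (chi : {additive M i0 -> QZ}).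
Definition char_fun j (x : M j) : QZ :=
  if pselect (j = i0) is left e then chi (tr e x) else 0.
Lemma char_funB j : zmod_morphism (@char_fun j).
Proof. by move=> x y; rewrite /char_fun; case: pselect => e; rewrite ?subr0 // !raddfB. Qed.
Definition char_of : chars M := fun j => mkadd (@char_funB j).
Lemma char_ofE x : char_of i0 x = chi x.
Proof. by rewrite /= /char_fun; case: pselect => // e; rewrite tr_id. Qed.
Lemma char_of_d : (forall x, bnd x -> chi x = 0) ->
  forall i j (h : i + 1 = j) x, char_of j (df M h x) = 0.
Proof.
move=> hc i j h x; rewrite /= /char_fun; case: pselect => // e; apply: hc.
by apply/tr_bnd; apply: bnd_d.
Qed.
End Chars.

Section Contractible.
Variables (A : cdgring) (M : dgmod A).
(** Without W only the cone of an identity remains, so this module is contractible, and all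
    characters together separate elements. As an extra summand of a target it makes any map
    injective without changing it up to quasi-isomorphism. *)
Definition acyc_hull : dgmod A := embT A void (chars M).
Definition acyc_hull_in : dgmor M acyc_hull :=
  emb (fun v : void => match v return cchars M with end) (fun x : chars M => x).
Lemma acyc_hull_semiinj : semiinj acyc_hull. Proof. exact: embT_semiinj. Qed.
Lemma acyc_hull_acyclic : acyclic acyc_hull.
Proof.
apply/acyclicP => i.
have a : acyclic (constZ ((void -> QZ)%type : zmodType) ((chars M -> QZ)%type : zmodType)).
  apply/acyclicP => n; case=> w [a b] cy; exists (n - 1), (subrK 1 n), (0, (0, a)).
  rewrite /= /ed /=; congr pair; first by apply: functional_extensionality_dep => -[].
  congr pair; have := cy _ erefl; rewrite /= /ed /=; by case.
by apply: (acyclic_Kinj (J := constZ _ _)) a; apply: constZ_Kinj; apply: QZf_inj.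
Qed.
Lemma acyc_hull_in_inj i x : acyc_hull_in i x = 0 -> x = 0.
Proof.
apply: adj_inj => {x}{}i x; rewrite /= /emb_fun => e.
apply: contrapT => nx.
have [chi [_ hc]] := @QZ_cogen (M i) (Subgroup (sgp := fun y => y = 0) erefl
   (fun x y (ex : x = 0) (ey : y = 0) => etrans (congr2 (fun a b => a - b) ex ey) (subrr 0))) x nx.
apply: hc; rewrite -(char_ofE chi x).
exact: (congr1 (fun t : Ec _ _ => t.2.1 (char_of chi)) e).
Qed.
End Contractible.

Section Cohomological.
Variables (A : cdgring) (M : dgmod A).
(** Without W' the differential of [constZ] is zero, and the characters used vanish on boundaries;
    they separate every element that is not a boundary from zero, so the map is injective on
    cohomology. *)
Definition coh_hull : dgmod A := embT A (cchars M) void.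
Definition coh_hull_in : dgmor M coh_hull :=
  emb (fun x : cchars M => x) (fun v : void => match v return chars M with end).
Lemma coh_hull_semiinj : semiinj coh_hull. Proof. exact: embT_semiinj. Qed.
Lemma coh_hull_in_Hinj i (z : M i) : bnd (coh_hull_in i z) -> bnd z.
Proof.
move=> /(bnd_mor (ev (intA A) _)); rewrite adjE => -[j [h [u eu]]].
apply: contrapT => nz.
have [chi [h0 hc]] := @QZ_cogen (M i) (Subgroup (@bnd0 M i) (@bndB M i)) z nz.
have cd := char_of_d h0.
apply: hc; rewrite -(char_ofE chi z).
exact: esym (congr1 (fun t : Ec _ _ => t.1 (exist _ (char_of chi) cd)) eu).
Qed.
End Cohomological.

Section ShiftHom.
Variables (A : cdgring) (m : int) (X J : dgmod A).
Lemma hom_unshift_eq (n i j : int) : i + n = j -> i + (n + m) = j + m. Proof. lia. Qed.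
Definition hom_unshift_hom n (f : hom X J (n + m)) : hom X (sh m J) n.
Proof.
exists (fun i j h x => ksgn (m * i) (hf f (hom_unshift_eq h) x) : sh m J j).
  by move=> i j h x y; rewrite hfD ksgnD.
move=> p i j k l hp hk hn hl a x.
rewrite (hf_act f hp (hom_unshift_eq hk) (hom_unshift_eq hn) (sh_eq2 m hl)).
rewrite -[act hl a _]/(act (sh_eq2 m hl) a (ksgn (m * i) (hf f (hom_unshift_eq hn) x))).
rewrite act_ksgn !ksgnM; apply: ksgn_odd; rewrite -hp !(oddzD, oddzM).
by case: (oddz m); case: (oddz p); case: (oddz i); case: (oddz n).
Defined.
Definition hom_unshift : dgmor (sh m (hdg X J)) (hdg X (sh m J)).
Proof.
apply: (@mkmor A (sh m (hdg X J)) (hdg X (sh m J)) (fun n f => hom_unshift_hom f)).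
- by move=> n f g; apply: hom_ext => i j h x /=; rewrite -ksgnB.
- move=> n n' hn f; apply: hom_ext => i j h x.
  have e1 : i + n + 1 = j by lia.
  have e2 : i + 1 + n = j by lia.
  rewrite [LHS](hom_dE hn _ h erefl e1 erefl e2) /=.
  have e3 : i + (n + m) = i + n + m by lia.
  have e4 : i + n + m + 1 = j + m by lia.
  have e5 : i + 1 + (n + m) = j + m by lia.
  rewrite -[RHS]/(ksgn (m * i) (hf (hom_d (sh_eq1 m hn) f) (hom_unshift_eq h) x)).
  rewrite (hom_dE (sh_eq1 m hn) f (hom_unshift_eq h) e3 e4 erefl e5) ksgnB df_ksgn.
  congr (_ - _); first by congr ksgn; rewrite (df_irr _ e4); congr (df _ _ _); apply: hf_irr.
  rewrite !ksgnM (hf_irr _ _ e5); apply: ksgn_odd; rewrite !(oddzD, oddzM) oddz1.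
  by case: (oddz m); case: (oddz i); case: (oddz n).
- move=> p n q h a f; apply: hom_ext => i j e x.
  have e1 : p + (i + n) = j by lia.
  rewrite [RHS](hactE h _ _ e erefl e1).
  have e3 : i + (n + m) = i + n + m by lia.
  have e2 : p + (i + n + m) = j + m by lia.
  rewrite -[LHS]/(ksgn (m * i) (hf (hact (sh_eq2 m h) a f) (hom_unshift_eq e) x)).
  rewrite (hactE (sh_eq2 m h) _ _ (hom_unshift_eq e) e3 e2) -act_ksgn.
  rewrite -[RHS]/(act (sh_eq2 m e1) a (ksgn (m * i) (hf f (hom_unshift_eq erefl) x))).
  by rewrite [RHS](act_irr (sh_eq2 m e1) e2) (hf_irr f (hom_unshift_eq erefl) e3).
Defined.
Lemma hom_unshift_inj n f : hom_unshift n f = 0 -> f = 0.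
Proof.
move=> e; apply: hom_ext => i j h x.
have ej : j - m + m = j by lia.
have h1 : i + n = j - m by lia.
have E := hf_eq h1 x e; have {}E : ksgn (m * i) (hf f (hom_unshift_eq h1) x) = 0 := E.
have {}E : hf f (hom_unshift_eq h1) x = 0 by apply: (@ksgn_inj _ (m * i)); rewrite E ksgn0.
by move: (hom_unshift_eq h1) E; rewrite ej => h2 E; rewrite (hf_irr _ _ h2).
Qed.
Lemma hom_unshift_surj n g : exists f, hom_unshift n f = g.
Proof.
have eq i j : i + (n + m) = j -> i + n + m = j by lia.
unshelve eexists.
  refine (@Hom A X J (n + m) (fun i j h x => ksgn (m * i) (@tr J _ _ (eq i j h) (hf g (erefl (i + n)) x))) _ _).
    by move=> i j h x y; rewrite hfD raddfD ksgnD.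
  move=> p i j k l hp hk hn hl a x.
  have e1 : p + (i + n) = k + n by lia.
  have E : @tr J _ _ (eq _ _ hk) (hf g (erefl (k + n)) (act hp a x))
      = ksgn (p * n) (act hl a (@tr J _ _ (eq _ _ hn) (hf g (erefl (i + n)) x))).
    rewrite (hf_act g hp erefl erefl e1) (act_tr (eq _ _ hn) (eq _ _ hk) (sh_eq2 m e1) hl).
    exact: ksgn_tr.
  rewrite E act_ksgn !ksgnM; apply: ksgn_odd; rewrite -hp !(oddzD, oddzM).
  by case: (oddz m); case: (oddz p); case: (oddz i); case: (oddz n).
apply: hom_ext => i j h x; rewrite /= ksgnK; subst j; exact: tr_id.
Qed.
End ShiftHom.

Section QisoLemmas.
Variables (M N P : complex) (f : cplxmor M N) (g : cplxmor N P) (k : cplxmor M P).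
Hypothesis E : forall i x, k i x = g i (f i x).
Lemma qiso_comp : quasi_iso f -> quasi_iso g -> quasi_iso k.
Proof.
rewrite !quasi_isoP => hf hg i; case: (hf i) (hg i) => a b [c d].
by split; [exact: (@Hinj_comp _ _ _ _ _ _ _ (@E i) a c)|exact: (@Hsurj_comp _ _ _ _ _ _ _ (@E i) b d)].
Qed.
Lemma qiso_compl : quasi_iso k -> quasi_iso g -> quasi_iso f.
Proof.
rewrite !quasi_isoP => hf hg i; case: (hf i) (hg i) => a b [c d].
by split; [exact: (@Hinj_compl _ _ _ _ _ _ _ (@E i) a)|exact: (@Hsurj_compl _ _ _ _ _ _ _ (@E i) b c)].
Qed.
Lemma qiso_compr : quasi_iso k -> quasi_iso f -> quasi_iso g.
Proof.
rewrite !quasi_isoP => hf hg i; case: (hf i) (hg i) => a b [c d].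
by split; [exact: (@Hinj_compr _ _ _ _ _ _ _ (@E i) a d)|exact: (@Hsurj_compr _ _ _ _ _ _ _ (@E i) b)].
Qed.
End QisoLemmas.

Lemma ses_qiso_left (X Y Z : complex) (f : cplxmor X Y) (g : cplxmor Y Z) :
  ses f g -> acyclic Z <-> quasi_iso f.
Proof.
move=> S; rewrite acyclicP quasi_isoP; split=> h i.
  by split; [apply: (ses_Hinj S (subrK 1 i))|apply: (ses_Hsurj S)].
by apply: (ses_exactZ' S erefl); [case: (h i)|case: (h (i + 1))].
Qed.

Section InvMor.
Variables (A : cdgring) (X Y : dgmod A) (u : dgmor X Y).
Hypothesis ui : forall i x, u i x = 0 -> x = 0.
Hypothesis us : forall i y, exists x, u i x = y.
Let inv i (y : Y i) : X i := sval (cid (us y)).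
Let invK i y : u i (@inv i y) = y. Proof. by rewrite /inv; case: cid. Qed.
Let uinj i x y : u i x = u i y -> x = y.
Proof. by move=> e; apply/eqP; rewrite -subr_eq0; apply/eqP/ui; rewrite raddfB /= e subrr. Qed.
Lemma inv_mor : exists v : dgmor Y X, (forall i y, u i (v i y) = y) /\ forall i x, v i (u i x) = x.
Proof.
unshelve eexists.
  apply: (@mkmor A Y X (fun i y => inv y)).
  - by move=> i x y; apply: uinj; rewrite raddfB /= !invK.
  - by move=> i j h x; apply: uinj; rewrite -cmor_d !invK.
  - by move=> i j k h a x; apply: uinj; rewrite mmor_act !invK.
split=> i x; first exact: invK.
by apply: uinj; apply: invK.
Qed.
End InvMor.

Section Ext.
Variables (A : cdgring) (X Y Z : dgmod A) (u : dgmor X Y) (v : dgmor Y Z) (S : ses u v).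
Variable J : dgmod A.
Lemma ext_mor (f : dgmor X J) : graded_inj J -> exact (hdg Z J) 1 ->
  exists g : dgmor Y J, forall i x, g i (u i x) = f i x.
Proof.
move=> gJ e; have [g cg eg] := les_lift (pre_ses S gJ) (add0r 1) e (hom_of_cyc f).
exists (mor_of cg) => i x.
have := hf_eq (addr0 i) x eg; rewrite hom_ofE; exact.
Qed.

Lemma graded_inj_rel (V W : dgmod A) (w : dgmor V W) n (f : hom V Y n) (g : hom W Z n) :
  graded_inj X -> (forall i x, w i x = 0 -> x = 0) -> post_hom v f = pre_hom w g ->
  exists h : hom W Y n, post_hom v h = g /\ pre_hom w h = f.
Proof.
move=> gX hw e; have [h eh] := post_surj S g gX.
have [|k ek] := post_lift S (V := V) (f := f - pre_hom w h).
  apply: hom_ext => i j E x; rewrite /= raddfB.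
  have -> : v j (hf f E x) = hf g E (w i x) := hf_eq E x e.
  rewrite -eh; exact: subrr.
have [k' ek'] := gX _ _ w hw n k.
exists (h + post_hom u k'); split; apply: hom_ext => i j E x /=.
  by rewrite raddfD /= (ses_0 S) addr0 -eh.
have := hf_eq E x ek; rewrite -ek' /= => ->.
by rewrite addrC subrK.
Qed.
End Ext.

Section ShiftSemi.
Variables (A : cdgring) (m : int) (J : dgmod A).
Lemma hdg_sh X n j : n + m = j -> exact (hdg X (sh m J)) n <-> exact (hdg X J) j.
Proof.
move=> e; rewrite -(sh_exact (hdg X J) e).
by apply: iff_sym; apply: (bij_exact (f := hom_unshift m X J)); [apply: hom_unshift_inj|apply: hom_unshift_surj].
Qed.
Lemma sh_graded_inj : graded_inj J -> graded_inj (sh m J).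
Proof.
move=> gJ X Y u hu n f; have [f' ef'] := hom_unshift_surj f.
have [g eg] := gJ _ _ u hu (n + m) f'.
by exists (hom_unshift m Y J n g); rewrite -ef' -eg; apply: hom_ext => i j h x.
Qed.
Lemma sh_semiinj : semiinj J -> semiinj (sh m J).
Proof.
move=> [kJ gJ]; split; last exact: sh_graded_inj.
move=> N aN; apply/acyclicP => i; apply/(hdg_sh N (erefl (i + m))).
exact: Kinj_acyclic.
Qed.
End ShiftSemi.

Lemma dep_choice (T : nat -> Type) (R : forall k, T k -> T k.+1 -> Prop) (x0 : T 0%N) :
  (forall k x, exists y, @R k x y) ->
  exists f : forall k, T k, f 0%N = x0 /\ forall k, R k (f k) (f k.+1).
Proof.
move=> h; exists (nat_rect T x0 (fun k x => sval (cid (h k x)))); split=> // k.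
by rewrite /=; case: cid.
Qed.

Definition dprod (V : nat -> zmodType) := forall n, V n.
Section DProd.
Variable V : nat -> zmodType.
HB.instance Definition _ := gen_eqMixin (dprod V).
HB.instance Definition _ := gen_choiceMixin (dprod V).
Let dzero : dprod V := fun n => 0.
Let dopp (f : dprod V) : dprod V := fun n => - f n.
Let dadd (f g : dprod V) : dprod V := fun n => f n + g n.
Let daddA : associative dadd.
Proof. by move=> f g h; apply: functional_extensionality_dep => n; apply: addrA. Qed.
Let daddC : commutative dadd.
Proof. by move=> f g; apply: functional_extensionality_dep => n; apply: addrC. Qed.
Let dadd0 : left_id dzero dadd.
Proof. by move=> f; apply: functional_extensionality_dep => n; apply: add0r. Qed.
Let daddN : left_inverse dzero dopp dadd.
Proof. by move=> f; apply: functional_extensionality_dep => n; apply: addNr. Qed.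
HB.instance Definition _ := GRing.isZmodule.Build (dprod V) daddA daddC dadd0 daddN.
End DProd.

Section Product.
Variables (A : cdgring) (F : nat -> dgmod A).
Definition prod_d i j (h : i + 1 = j) (x : dprod (fun n => F n i)) : dprod (fun n => F n j) :=
  fun n => df (F n) h (x n).
Lemma prod_dB i j (h : i + 1 = j) : zmod_morphism (prod_d h).
Proof. by move=> x y; apply: functional_extensionality_dep => n; rewrite /prod_d raddfB. Qed.
Lemma prod_dK i j k (h : i + 1 = j) (h' : j + 1 = k) x :
  mkadd (prod_dB h') (mkadd (prod_dB h) x) = 0.
Proof. by apply: functional_extensionality_dep => n; apply: dfK. Qed.
Definition prodm : dgmod A.
Proof.
exists (@Complex (fun i => dprod (fun n => F n i) : zmodType) (fun i j h => mkadd (prod_dB h)) prod_dK)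
  (fun i j k h a x => fun n => act h a (x n)).
- by move=> *; apply: functional_extensionality_dep => n; apply: actDl.
- by move=> *; apply: functional_extensionality_dep => n; apply: actDr.
- by move=> *; apply: functional_extensionality_dep => n; apply: actA.
- by move=> *; apply: functional_extensionality_dep => n; apply: act1.
- move=> i j k i' j' k' h hi hj hk h1 h2 a x; apply: functional_extensionality_dep => n.
  apply: (etrans (act_d h hi hj hk h1 h2 a (x n))).
  by rewrite /ksgn; case: (oddz i).
Defined.
Definition prod_pr n : dgmor prodm (F n).
Proof. by apply: (@mkmor A prodm (F n) (fun i x => x n)). Defined.
End Product.

Section Limit.
Variables (A : cdgring) (F : nat -> dgmod A) (p : forall k, dgmor (F k.+1) (F k)).
Definition lim_sg i : subgroup (prodm F i).
Proof.
exists (fun x => forall k, p k i (x k.+1) = x k).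
  by move=> k; apply: raddf0.
by move=> x y hx hy k; rewrite -[RHS]/(x k - y k) -hx -hy -raddfB.
Defined.
Definition lim_sub : submod (prodm F).
Proof.
exists lim_sg.
- by move=> i j h x hx k /=; rewrite /prod_d -cmor_d hx.
- by move=> i j k h a x hx n /=; rewrite mmor_act hx.
Defined.
Definition lim : dgmod A := sub lim_sub.
Definition lim_pr k : dgmor lim (F k) := dgmor_comp (prod_pr F k) (sub_in lim_sub).
Lemma lim_compat k i x : p k i (lim_pr k.+1 i x) = lim_pr k i x.
Proof. exact: (sg_prop x). Qed.
Lemma lim_eq i (x y : lim i) : (forall k, lim_pr k i x = lim_pr k i y) -> x = y.
Proof. by move=> h; apply: val_inj; apply: functional_extensionality_dep => k; apply: h. Qed.
Lemma lim_mk i (x : forall k, F k i) : (forall k, p k i (x k.+1) = x k) ->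
  exists y : lim i, forall k, lim_pr k i y = x k.
Proof. by move=> h; exists (@mksg _ (lim_sg i) x h). Qed.

Lemma lim_hom Y n (h : forall k, hom Y (F k) n) :
  (forall k, post_hom (p k) (h k.+1) = h k) ->
  exists g : hom Y lim n, forall k, post_hom (lim_pr k) g = h k.
Proof.
move=> hc.
have c i j (e : i + n = j) x k : p k j (hf (h k.+1) e x) = hf (h k) e x := hf_eq e x (hc k).
unshelve eexists.
  exists (fun i j e x => @mksg _ (lim_sg j) (fun k => hf (h k) e x) (c i j e x)).
    by move=> i j e x y; apply: lim_eq => k; rewrite raddfD /= hfD.
  move=> q i j k l hp hk hn hl a x; apply: lim_eq => m.
  by rewrite (ksgn_mor (lim_pr m l)) mmor_act; apply: (hf_act (h m)).
by move=> k; apply: hom_ext => i j e x.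
Qed.

Hypothesis ps : forall k i y, exists x, p k i x = y.
Lemma lim_surj i (y : F 0%N i) : exists x, lim_pr 0 i x = y.
Proof.
have [f [f0 hf]] := @dep_choice (fun k => F k i) (fun k a b => p k i b = a) y (fun k a => ps a).
by have [x hx] := lim_mk hf; exists x; rewrite hx.
Qed.

(** Two bounding cochains at stage k + 1 differ by a cocycle, which bounds only after projection to
    stage k. So the choices [T k] are made one stage ahead, and they are compatible, hence define an
    element of the limit, after one more projection. *)
Lemma lim_acyclic : (forall k i (z : F k.+1 i), cyc z -> bnd (p k i z)) -> acyclic lim.
Proof.
move=> hz; apply/acyclicP => i z cz.
pose T k := {w : F k.+1 (i - 1) | df (F k.+1) (subrK 1 i) w = lim_pr k.+1 i z}.
have czk k : cyc (lim_pr k i z) by apply: cyc_mor.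
have ex k : exists w, df (F k) (subrK 1 i) w = lim_pr k i z.
  by apply/bnd_at; rewrite -lim_compat; apply: hz.
have [w0 hw0] := ex 1%N.
have [k [w hw]|f [_ hf]] := @dep_choice T
   (fun k a b => p k _ (p k.+1 _ (sval b)) = p k _ (sval a)) (exist _ w0 hw0).
  have [w' hw'] := ex k.+2.
  have : cyc (p k.+1 _ w' - w).
    apply: (cyc_at (h := subrK 1 i)); rewrite raddfB /= cmor_d hw' hw lim_compat; exact: subrr.
  move=> /hz/(bnd_at (subrK 1 (i - 1)))[t et].
  have [t1 et1] := ps t; have [t2 et2] := ps t1.
  have hw2 : df (F k.+2) (subrK 1 i) (w' - df _ (subrK 1 (i - 1)) t2) = lim_pr k.+2 i z.
    by rewrite raddfB /= dfK subr0.
  exists (exist (fun w => df (F k.+2) (subrK 1 i) w = lim_pr k.+2 i z) _ hw2 : T k.+1) => /=.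
  by rewrite !raddfB /= -!cmor_d et2 et1 et raddfB /= subKr.
have [u hu] := lim_mk (x := fun k => p k _ (sval (f k))) (fun k => hf k).
exists (i - 1), (subrK 1 i), u; apply: lim_eq => k.
by rewrite -cmor_d hu cmor_d (svalP (f k)) lim_compat.
Qed.

Variables (Q : nat -> dgmod A) (q : forall k, dgmor (Q k) (F k.+1)).
Hypothesis S : forall k, ses (q k) (p k).
Hypothesis sQ : forall k, semiinj (Q k).
(** F 0 is arbitrary, but the kernel of the projection onto it starts from zero and grows only by
    extensions by the semi-injective Q k; maps and homotopies into it are built stage by stage. *)
Definition lim_ker : dgmod A := ker (lim_pr 0).
Lemma lim_ker_ses : ses (sub_in (ker_sub (lim_pr 0))) (lim_pr 0).
Proof. by apply: ker_ses; apply: lim_surj. Qed.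

Lemma lim_hom_eq Y n (f g : hom Y lim n) :
  (forall k, post_hom (lim_pr k) f = post_hom (lim_pr k) g) -> f = g.
Proof.
move=> h; apply: hom_ext => i j e x; apply: lim_eq => k.
exact: (hf_eq e x (h k)).
Qed.
Lemma ker_hom_eq Y n (f g : hom Y lim_ker n) :
  post_hom (sub_in (ker_sub (lim_pr 0))) f = post_hom (sub_in (ker_sub (lim_pr 0))) g -> f = g.
Proof.
move=> h; apply: hom_ext => i j e x; apply: (ses_inj' lim_ker_ses).
exact: (hf_eq e x h).
Qed.

Lemma lim_ker_graded_inj : graded_inj lim_ker.
Proof.
move=> X Y u hu n f.
pose io := sub_in (ker_sub (lim_pr 0)).
pose fk k := post_hom (lim_pr k) (post_hom io f).
pose T k := {h : hom Y (F k) n | pre_hom u h = fk k}.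
have f0 : pre_hom u 0 = fk 0%N.
  by apply: hom_ext => i j e x; apply/esym; exact: (ses_0 lim_ker_ses).
have [k [h hh]|g [g0 hg]] := @dep_choice T
   (fun k a b => post_hom (p k) (sval b) = sval a) (exist _ 0 f0).
  have [|h' [e1 e2]] := graded_inj_rel (S k) (f := fk k.+1) (g := h) (w := u) (proj2 (sQ k)) hu.
    by rewrite hh; apply: hom_ext => i j e x; apply: lim_compat.
  by exists (exist (fun h => pre_hom u h = fk k.+1) h' e2 : T k.+1).
have [h hh] := lim_hom hg.
have [|h' eh'] := post_lift lim_ker_ses (f := h); first by rewrite hh g0.
exists h'; apply: ker_hom_eq; apply: lim_hom_eq => k.
apply: (@etrans _ _ (pre_hom u (post_hom (lim_pr k) h))).
  by rewrite -eh'; apply: hom_ext.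
by rewrite hh; case: (g k).
Qed.

Lemma lim_ker_Kinj : Kinjective lim_ker.
Proof.
move=> N aN; apply/acyclicP => n f cf.
pose io := sub_in (ker_sub (lim_pr 0)).
pose fk k : hdg N (F k) n := post _ (lim_pr k) n (post _ io n f).
have cfk k : cyc (fk k) by apply: cyc_mor; apply: cyc_mor.
pose T k := {h : hdg N (F k) (n - 1) | df (hdg N (F k)) (subrK 1 n) h = fk k}.
have f0 : df (hdg N (F 0%N)) (subrK 1 n) 0 = fk 0%N.
  rewrite raddf0; apply: hom_ext => i j e x; apply/esym; exact: (ses_0 lim_ker_ses).
have [k [h hh]|g [g0 hg]] := @dep_choice T
   (fun k a b => post_hom (p k) (sval b) = sval a) (exist _ 0 f0).
  have Sk := post_ses (S k) N (proj2 (sQ k)).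
  have [|h' e1 e2] := les_rel Sk (h := subrK 1 n) (y := fk k.+1) (z := h)
     (Kinj_acyclic (proj1 (sQ k)) aN) (cfk _).
    by rewrite hh; apply: hom_ext => i j e x; apply/esym; apply: lim_compat.
  by exists (exist (fun h => df (hdg N (F k.+1)) (subrK 1 n) h = fk k.+1) h' e2 : T k.+1).
have [h hh] := lim_hom hg.
have [|h' eh'] := post_lift lim_ker_ses (f := h); first by rewrite hh g0.
exists (n - 1), (subrK 1 n), h'; apply: ker_hom_eq; apply: lim_hom_eq => k.
rewrite -[RHS]/(fk k) -(svalP (g k)) -hh -eh'.
rewrite -[post_hom (lim_pr k) _]/(post _ (lim_pr k) n (post _ io n (df (hdg N lim_ker) (subrK 1 n) h'))).
by rewrite -!cmor_d.
Qed.
End Limit.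

Section Resolution.
Variable A : cdgring.
Section Tower.
Variable M : dgmod A.
(* Each stage kills all cohomology of the previous one, so the inverse limit is
   acyclic, and the kernel of its projection to M is a shifted resolution. *)
Fixpoint rtower (n : nat) : dgmod A := if n is n'.+1 then fib (coh_hull_in (rtower n')) else M.
Definition rtower_pr n : dgmor (rtower n.+1) (rtower n) := tw_pr (fib_thd (coh_hull_in (rtower n))).
Definition rtower_in n : dgmor (sh (-1) (coh_hull (rtower n))) (rtower n.+1) :=
  tw_in (fib_thd (coh_hull_in (rtower n))).
Lemma rtower_ses n : ses (rtower_in n) (rtower_pr n). Proof. exact: tw_ses. Qed.
Lemma rtower_acyclic : acyclic (lim rtower_pr).
Proof.
apply: lim_acyclic => k i; first exact: (ses_surj (rtower_ses k)).
by move=> [z w] cz; apply: coh_hull_in_Hinj; apply: fib_bnd_iff (cz _ erefl).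
Qed.
Definition rker := lim_ker rtower_pr.
Lemma rker_semiinj : semiinj rker.
Proof.
have sG k : semiinj (sh (-1) (coh_hull (rtower k))) by apply: sh_semiinj; apply: coh_hull_semiinj.
have su k := ses_surj (rtower_ses k).
split; [exact: (lim_ker_Kinj su rtower_ses sG)|exact: (lim_ker_graded_inj su rtower_ses sG)].
Qed.
(** The fibre of lim -> M is quasi-isomorphic to [rker] by exactness and to the shifted M because
    the limit is acyclic. The arrow from [rker] into the fibre points the wrong way; being an
    injective quasi-isomorphism out of a semi-injective module, it has a retraction. *)
Lemma rker_qiso : exists u : dgmor (sh (-1) M) rker, quasi_iso u.
Proof.
have su k := ses_surj (rtower_ses k).
have S := lim_ker_ses su; have [kK gK] := rker_semiinj.
pose w := ses_fib S; have qw : quasi_iso w := ses_fib_qiso S.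
have wi i x : w i x = 0 -> x = 0 by move=> /(congr1 fst); apply: (ses_inj S).
have Sw := coker_ses wi.
have [|r er] := @ext_mor A _ _ _ _ _ Sw _ (dgmor_id rker) gK.
  by apply: Kinj_acyclic => //; apply/(ses_qiso_left Sw).
have qr : quasi_iso r.
  by apply: (qiso_compr (f := w) (k := dgmor_id rker)) => //; exact: id_quasi_iso.
have T := tw_ses (fib_thd (lim_pr rtower_pr 0)).
exists (dgmor_comp r (tw_in _)); apply: (qiso_comp (f := tw_in _)) qr => //.
by apply/(ses_qiso_left T); apply: rtower_acyclic.
Qed.
End Tower.

Lemma bij_sh0 (M : dgmod A) : exists u : dgmor M (sh (-1) (sh 1 M)), quasi_iso u.
Proof.
have e : 1 + -1 = 0 :> int by [].
have [|u [u1 u2]] := inv_mor (@sh_add_inj A 1 (-1) 0 e M); first exact: sh_add_surj.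
have i0 i x : sh0 M i x = 0 -> x = 0.
  move=> h; have h' : @tr M _ _ (addr0 i) x = 0 := h.
  apply: etrans (esym (@trK M _ _ (addr0 i) (esym (addr0 i)) x)) _.
  by rewrite h' raddf0.
have [|v [v1 v2]] := inv_mor i0.
  by move=> i y; exists (@tr M _ _ (esym (addr0 i)) y); apply: (@trK M).
exists (dgmor_comp u v); apply: bij_quasi_iso => i x.
  move=> h; have h1 : v i x = 0.
    apply: etrans (esym (u1 i (v i x))) _; apply: etrans (congr1 (sh_add e M i) h) _.
    exact: (raddf0 (sh_add e M i)).
  apply: etrans (esym (v1 i x)) _; apply: etrans (congr1 (sh0 M i) h1) _.
  exact: (raddf0 (sh0 M i)).
by exists (sh0 M i (sh_add e M i x)); rewrite /= v2 u2.
Qed.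

Lemma sum_qiso (M P Q : dgmod A) (u : dgmor M P) (v : dgmor M Q) :
  acyclic P -> quasi_iso v -> quasi_iso (sum_mor u v).
Proof.
move=> aP qv; have T := tw_ses (sum_th P Q).
have qi : quasi_iso (tw_in (sum_th P Q)) by apply/(ses_qiso_left T).
have B2 i : zmod_morphism (fun x : sum P Q i => x.2) by [].
have d2 i j (h : i + 1 = j) (x : sum P Q i) : df Q h x.2 = (df (sum P Q) h x).2.
  by rewrite /= /tw_d /= addr0.
pose pr2 := @mkmor A (sum P Q) Q (fun i x => x.2) B2 d2 (fun i j k h a x => erefl).
have q2 : quasi_iso pr2.
  by apply: (qiso_compr (f := tw_in (sum_th P Q)) (k := dgmor_id Q)) => //; apply: id_quasi_iso.
exact: (qiso_compl (f := sum_mor u v) (g := pr2) (k := v)).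
Qed.

(** Resolving the shift of M by 1 compensates the shift in [rker_qiso]. The contractible summand
    makes u injective, so that maps into semi-injective modules extend strictly along u. *)
Lemma resolution (M : dgmod A) : exists (J : dgmod A) (u : dgmor M J),
  [/\ semiinj J, quasi_iso u & forall i x, u i x = 0 -> x = 0].
Proof.
have [u qu] := bij_sh0 M; have [v qv] := rker_qiso (sh 1 M).
exists (sum (acyc_hull M) (rker (sh 1 M))), (sum_mor (acyc_hull_in M) (dgmor_comp v u)); split.
- apply: (ses_semiinj_mid (tw_ses _)); [exact: rker_semiinj|exact: acyc_hull_semiinj].
- apply: sum_qiso; first exact: acyc_hull_acyclic.
  exact: (qiso_comp (f := u) (g := v)).
- by move=> i x /(congr1 fst); apply: acyc_hull_in_inj.
Qed.
End Resolution.

Section SumMaps.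
Variables (A : cdgring) (P Q : dgmod A).
Definition sum_in1 : dgmor P (sum P Q).
Proof.
apply: (@mkmor A P (sum P Q) (fun i x => (x, 0))).
- by move=> i x y; rewrite -[RHS]/(x - y, 0 - 0) subr0.
- by move=> i j h x; rewrite /= /tw_d /= raddf0 addr0.
- by move=> i j k h a x; rewrite /= act0r.
Defined.
Definition sum_pr2 : dgmor (sum P Q) Q.
Proof.
apply: (@mkmor A (sum P Q) Q (fun i x => x.2)) => //.
by move=> i j h x; rewrite /= /tw_d /= addr0.
Defined.
Lemma sum_ses : ses sum_in1 sum_pr2.
Proof.
split=> //.
- by move=> i x /(congr1 fst).
- by move=> i z; exists (0, z).
- by move=> i [p q] /= ->; exists p.
Qed.
End SumMaps.

Definition zero_mor (A : cdgring) (X Y : dgmod A) : dgmor X Y.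
Proof.
apply: (@mkmor A X Y (fun i _ => 0)) => [i x y|i j h x|i j k h a x].
- by rewrite subr0.
- exact: raddf0.
- by rewrite act0r.
Defined.

Lemma ses_lift (A : cdgring) (X Y Z T : dgmod A) (u : dgmor X Y) (v : dgmor Y Z) (S : ses u v)
  (f : dgmor Y T) : (forall i x, f i (u i x) = 0) ->
  exists g : dgmor Z T, forall i y, g i (v i y) = f i y.
Proof.
move=> e; pose s i z := sval (cid (ses_surj S (i := i) z)).
have sK i z : v i (s i z) = z by rewrite /s; case: cid.
have E i y y' : v i y = v i y' -> f i y = f i y'.
  move=> h; have [|x ex] := ses_ex S (y := y - y'); first by rewrite raddfB /= h subrr.
  by apply/eqP; rewrite -subr_eq0 -raddfB -ex e.
unshelve eexists.
  apply: (@mkmor A Z T (fun i z => f i (s i z))).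
  - by move=> i x y; rewrite -raddfB; apply: E; rewrite raddfB /= !sK.
  - by move=> i j h x; rewrite cmor_d; apply: E; rewrite -cmor_d !sK.
  - by move=> i j k h a x; rewrite -mmor_act; apply: E; rewrite mmor_act !sK.
by move=> i y; apply: E; rewrite sK.
Qed.

Lemma ses_qiso_right (X Y Z : complex) (f : cplxmor X Y) (g : cplxmor Y Z) :
  ses f g -> acyclic X -> quasi_iso g.
Proof.
move=> S /acyclicP aX; apply/quasi_isoP => i.
by split; [apply: (ses_gHinj S)|apply: (ses_gHsurj S erefl)].
Qed.

(** * Homotopies and invariance of Hom complexes *)

Section Homotopy.
Variable A : cdgring.

Definition htpic (X Y : dgmod A) (f g : dgmor X Y) :=
  @bnd (hom_cplx X Y) 0 (hom_of f - hom_of g).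

Section Fixed.
Variables (X Y : dgmod A) (f g : dgmor X Y) (H : htpic f g).
Lemma htpic_H i (x : X i) : cyc x -> bnd (f i x - g i x).
Proof.
move: H => /(bnd_at (addNr 1))[h eh] cx.
have e1 : i + -1 + 1 = i by lia.
have e2 : i + 1 + -1 = i by lia.
have E : hf (hom_d (addNr 1) h) (addr0 i) x = f i x - g i x.
  by rewrite -[hom_d _ h]/(df (hom_cplx X Y) (addNr 1) h) eh -(hom_ofE f (addr0 i)) -(hom_ofE g (addr0 i)).
rewrite -E (hom_dE (addNr 1) h (addr0 i) erefl e1 erefl e2) (cx _ erefl) hf0 ksgn0 subr0.
exact: bnd_d.
Qed.
Lemma htpic_pre J n (phi : hdg Y J n) : cyc phi -> bnd (pre J f n phi - pre J g n phi).
Proof.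
move: H => /(bnd_at (addNr 1))[h eh] cphi.
have e : n - 1 + 1 = n by rewrite subrK.
have e1 : -1 + n = n - 1 by rewrite addrC.
have e3 : -1 + (n + 1) = n by lia.
have := comp_d e1 (erefl (n + 1)) (addNr 1) e e3 (add0r n) phi h.
have -> : hom_d erefl phi = 0 := cphi _ erefl.
rewrite -[hom_d (addNr 1) h]/(df (hom_cplx X Y) (addNr 1) h) eh.
have -> : comp e3 (0 : hom Y J (n + 1)) h = 0 by apply: hom_ext.
have -> : comp (add0r n) phi (hom_of f - hom_of g) = pre J f n phi - pre J g n phi.
  apply: hom_ext => i j k x; rewrite (compE (add0r n) _ _ k (addr0 i) k).
  rewrite -[hf (hom_of f - hom_of g) _ _]/(hf (hom_of f) (addr0 i) x - hf (hom_of g) (addr0 i) x).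
  by rewrite !hom_ofE hfB.
rewrite add0r => E.
rewrite -[pre J f n phi - _](ksgnK n); apply: ksgn_bnd; rewrite -[ksgn _ _]E.
exact: (@bnd_d (hom_cplx X J)).
Qed.
Lemma htpic_qiso : quasi_iso f -> quasi_iso g.
Proof.
move=> /quasi_isoP q; apply/quasi_isoP => i; have [a b] := q i.
by split; [apply: Hinj_homotopic a|apply: Hsurj_homotopic b]; apply: htpic_H.
Qed.
End Fixed.

Lemma htpic_factor (X K Y : dgmod A) (u : dgmor X K) (v : dgmor K Y) (f g : dgmor X Y) :
  Kinjective K -> acyclic K -> (forall i x, f i x = g i x + v i (u i x)) -> htpic f g.
Proof.
move=> kK aK E; have b : @bnd (hdg X K) 0 (hom_of u).
  by apply: acyclic_Kinj => //; apply: hom_of_cyc.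
have := bnd_mor (post X v) b; congr bnd; apply: hom_ext => i j h x.
have e : i = j by lia.
rewrite -[RHS]/(hf (hom_of f) h x - hf (hom_of g) h x).
by rewrite !(hom_ofE' _ h e) -raddfB E (addrC (g i x)) addrK -[LHS]/(v j (hf (hom_of u) h x)) (hom_ofE' _ h e) mor_tr.
Qed.

(** Adding the contractible hull of X to Y makes u injective with acyclic cokernel, so f extends
    strictly; restricting the extension to Y changes f only by a map through the hull. *)
Lemma htpy_ext (X Y J : dgmod A) (u : dgmor X Y) (f : dgmor X J) : semiinj J -> quasi_iso u ->
  exists g : dgmor Y J, htpic f (dgmor_comp g u).
Proof.
move=> [kJ gJ] qu; pose u' := sum_mor (acyc_hull_in X) u.
have qu' : quasi_iso u' by apply: sum_qiso => //; apply: acyc_hull_acyclic.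
have iu' i x : u' i x = 0 -> x = 0 by move/(congr1 fst); apply: acyc_hull_in_inj.
have S := coker_ses iu'.
have [|g' eg'] := ext_mor S f gJ.
  by apply: Kinj_acyclic => //; apply/(ses_qiso_left S).
exists (dgmor_comp g' (tw_in (sum_th (acyc_hull X) Y))).
have [kK _] := acyc_hull_semiinj X.
apply: (htpic_factor (u := acyc_hull_in X) (v := dgmor_comp g' (sum_in1 _ _)) kK (@acyc_hull_acyclic A X)).
move=> i x; rewrite -eg' -[RHS]/(g' i (0, u i x) + g' i (acyc_hull_in X i x, 0)) -raddfD.
congr (g' i _); rewrite -[RHS]/(0 + acyc_hull_in X i x, u i x + 0) add0r addr0 //.
Qed.

Lemma pre_qiso (X Y J : dgmod A) (u : dgmor X Y) : semiinj J -> quasi_iso u -> quasi_iso (pre J u).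
Proof.
move=> [kJ gJ] qu; pose u' := sum_mor (acyc_hull_in X) u.
have qu' : quasi_iso u' by apply: sum_qiso => //; apply: acyc_hull_acyclic.
have iu' i x : u' i x = 0 -> x = 0 by move/(congr1 fst); apply: acyc_hull_in_inj.
have S := coker_ses iu'.
have aD (Z : dgmod A) : acyclic Z -> acyclic (hdg Z J).
  by move=> aZ; apply/acyclicP => i; apply: Kinj_acyclic.
apply: (qiso_comp (f := pre J (sum_pr2 (acyc_hull X) Y)) (g := pre J u')).
- by move=> n f; apply: hom_ext.
- apply/(ses_qiso_left (pre_ses (sum_ses (acyc_hull X) Y) gJ)).
  by apply: aD; apply: acyc_hull_acyclic.
- apply: (ses_qiso_right (pre_ses S gJ)); apply: aD.
  by apply/(ses_qiso_left S).
Qed.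

Section PostQiso.
Variables (M K J : dgmod A) (r : dgmor K J).
Hypotheses (kK : Kinjective K) (sJ : semiinj J) (qr : quasi_iso r).
Let T := fib r.
Lemma fib_Kinj : Kinjective T.
Proof.
move=> N aN; apply/acyclicP => i; have [kS gS] := sh_semiinj (-1) sJ.
apply: (ses_exactY (post_ses (tw_ses (fib_thd r)) N gS)); by apply: Kinj_acyclic.
Qed.
Lemma fib_hom_exact i : exact (hdg M T) i.
Proof. by apply: acyclic_Kinj; [apply: fib_Kinj|apply: fib_acyclic]. Qed.

Definition fib_snd n (f : hom M T n) : hom M (sh (-1) J) n.
Proof.
exists (fun i j h x => (hf f h x).2).
  by move=> i j h x y; rewrite hfD.
move=> p i j k l hp hk hn hl a x; rewrite (hf_act f hp hk hn hl).
by rewrite /ksgn; case: (oddz (p * n)).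
Defined.
Definition fib_pair n (f : hom M K n) (g : hom M (sh (-1) J) n) : hom M T n.
Proof.
exists (fun i j h x => (hf f h x, hf g h x) : T j).
  by move=> i j h x y; rewrite !hfD.
move=> p i j k l hp hk hn hl a x.
by rewrite (hf_act f hp hk hn hl) (hf_act g hp hk hn hl) /ksgn; case: (oddz (p * n)).
Defined.

Lemma hom_tr (X Y : dgmod A) n n' (e : n = n') (g : hom X Y n) i j (h : i + n' = j) (h' : i + n = j) x :
  hf (@tr (hdg X Y) n n' e g) h x = hf g h' x.
Proof. by case: n' / e h => h; apply: hf_irr. Qed.

Lemma hf_cod (X Y : dgmod A) n (g : hom X Y n) i j k (h : i + n = j) (h' : i + n = k) (e : j = k) x :
  @tr Y _ _ e (hf g h x) = hf g h' x.
Proof. by case: k / e h' => h'; apply: hf_irr. Qed.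

Lemma fib_th_unt n n' (hn : n + 1 = n') (e : n = n' + -1) (f : hom M K n) :
  comp hn (fib_th r) f = ksgn n (hom_unshift (-1) M J n' (@tr (hdg M J) _ _ e (post M r n f))).
Proof.
apply: hom_ext => i j h x.
have h2 : i + n + 1 = j by lia.
have h3 : i + n = j + -1 by lia.
rewrite (compE hn _ _ h erefl h2) ksgn_hf.
rewrite -[hf (hom_unshift _ _ _ _ _) h x]/(ksgn (-1 * i) (hf (@tr (hdg M J) n (n' + -1) e (post_hom r f)) (hom_unshift_eq (-1) h) x)).
rewrite (hom_tr e _ _ h3) -[LHS]/(ksgn (i + n) (@tr J _ _ (fib_eq h2) (hf (post_hom r f) erefl x))).
rewrite (hf_cod _ erefl h3) ksgnM; apply: ksgn_odd.
by rewrite oddzD mulN1r oddzD oddzN addbC.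
Qed.

Lemma fib_pair_d n n' (hn : n + 1 = n') (k : hom M K n) (g : hom M (sh (-1) J) n) :
  hom_d hn (fib_pair k g) = fib_pair (hom_d hn k) (hom_d hn g + comp hn (fib_th r) k).
Proof.
apply: hom_ext => i j h x.
have e1 : i + n + 1 = j by lia.
have e2 : i + 1 + n = j by lia.
rewrite (hom_dE hn (fib_pair k g) h erefl e1 erefl e2).
rewrite -[RHS]/((hf (hom_d hn k) h x, hf (hom_d hn g) h x + hf (comp hn (fib_th r) k) h x)).
rewrite (hom_dE hn k h erefl e1 erefl e2) (hom_dE hn g h erefl e1 erefl e2) (compE hn _ _ h erefl e1).
rewrite -[LHS]/((df K e1 (hf k erefl x), df (sh (-1) J) e1 (hf g erefl x) + hf (fib_th r) e1 (hf k erefl x)) - ksgn n ((hf k e2 (df M erefl x), hf g e2 (df M erefl x)))).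
rewrite /ksgn; case: (oddz n); rewrite -[LHS]/(_, _) /=; congr pair; exact: addrAC.
Qed.

Lemma fib_pairE n (t : hom M T n) : t = fib_pair (post_hom (tw_pr (fib_thd r)) t) (fib_snd t).
Proof.
apply: hom_ext => i j h x; rewrite -[RHS]/(_, _).
by rewrite /= ; case: (hf t h x).
Qed.

(** K is only K-injective, which is all that [Kinj_resolution] provides, so Hom(M, -) need not be
    exact at K. The fibre of r is K-injective and acyclic, hence Hom(M, [fib r]) is exact, and
    reading its elements as pairs gives both halves of the claim. *)
Lemma post_qiso : quasi_iso (post M r).
Proof.
apply/quasi_isoP => n; split.
  move=> k ck /(bnd_at (subrK 1 n))[j ej].
  have e : n = n + 1 + -1 by rewrite addrK.
  pose g : hom M (sh (-1) J) n := - ksgn n (hom_unshift (-1) M J n (j : hdg M J (n + -1))).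
  have dg : hom_d erefl g + comp erefl (fib_th r) k = 0.
    rewrite (fib_th_unt erefl e k) -ej -[hom_d _ g]/(df (hdg M (sh (-1) J)) erefl g).
    rewrite raddfN /= -[hom_d _ _]/(df (hdg M (sh (-1) J)) erefl (ksgn n (hom_unshift (-1) M J n (j : hdg M J (n + -1))))).
    rewrite df_ksgn cmor_d.
    have -> : df (sh (-1) (hdg M J)) (erefl (n + 1)) j = @tr (hdg M J) _ _ e (df (hdg M J) (subrK 1 n) j).
      exact: (@df_tr (hdg M J) _ _ _ _ (erefl (n - 1)) e (subrK 1 n) (sh_eq1 (-1) erefl)).
    by rewrite addNr.
  have : @cyc (hdg M T) n (fib_pair k g).
    apply: (cyc_at (h := erefl)); rewrite -[LHS]/(hom_d erefl (fib_pair k g)).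
    rewrite fib_pair_d dg -[hom_d erefl k]/(df (hdg M K) erefl k) ck.
    by apply: hom_ext.
  move=> /fib_hom_exact /(bnd_mor (post M (tw_pr (fib_thd r)))).
  by congr bnd; apply: hom_ext.
move=> f cf; have e : n = n + 1 + -1 by rewrite addrK.
pose g : hom M (sh (-1) J) (n + 1) := hom_unshift (-1) M J (n + 1) (@tr (hdg M J) _ _ e f).
have : @cyc (hdg M T) (n + 1) (fib_pair 0 g).
  apply: (cyc_at (h := erefl)); rewrite -[LHS]/(hom_d erefl (fib_pair 0 g)) fib_pair_d.
  rewrite -[hom_d _ 0]/(df (hdg M K) erefl 0) raddf0.
  have -> : comp erefl (fib_th r) (0 : hom M K (n + 1)) = 0 by apply: hom_ext => i j h x; exact: (hf0 (fib_th r)).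
  rewrite addr0 -[hom_d _ g]/(df (hdg M (sh (-1) J)) erefl g) cmor_d.
  have -> : df (sh (-1) (hdg M J)) erefl (@tr (hdg M J) _ _ e f) = 0.
    exact: (tr_cyc e cf).
  by rewrite raddf0; apply: hom_ext.
move=> /fib_hom_exact /(bnd_at (erefl (n + 1)))[t]; rewrite -[LHS]/(hom_d erefl t) {1}[t]fib_pairE fib_pair_d.
set k := post_hom _ t; set s := fib_snd t => E.
have ck : hom_d erefl k = 0.
  by apply: hom_ext => i j h x; have := congr1 (fun g : hom M T _ => (hf g h x).1) E.
have es : hom_d erefl s + comp erefl (fib_th r) k = g.
  by apply: hom_ext => i j h x; have := congr1 (fun g : hom M T _ => (hf g h x).2) E.
have ck' : @cyc (hdg M K) n k by apply: (cyc_at (C := hdg M K) (h := erefl)); exact: ck.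
exists (ksgn n k : hdg M K n); split; first by apply: ksgn_cyc.
have [s' es'] := hom_unshift_surj s.
have E1 : df (sh (-1) (hdg M J)) (erefl (n + 1)) s' = @tr (hdg M J) _ _ e (f - ksgn n (post M r n k)).
  have ui x y : hom_unshift (-1) M J (n + 1) x = hom_unshift (-1) M J (n + 1) y -> x = y.
    move=> e'; apply/eqP; rewrite -subr_eq0; apply/eqP/(@hom_unshift_inj _ (-1) M J (n + 1)).
    by apply: etrans (raddfB _ _ _) _; apply/eqP; rewrite subr_eq0; apply/eqP.
  apply: ui; rewrite -cmor_d es'; move: es; rewrite (fib_th_unt erefl e k) => es.
  rewrite raddfB /= ksgn_tr; apply: esym; apply: etrans (raddfB (hom_unshift (-1) M J (n + 1)) _ _) _.
  rewrite (ksgn_mor (hom_unshift (-1) M J (n + 1))); apply/eqP; rewrite subr_eq; apply/eqP; exact: esym es.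
have -> : post M r n (ksgn n k) = ksgn n (post M r n k) by rewrite (ksgn_mor (post M r n)).
apply/(@tr_bnd (hdg M J) _ _ e); rewrite -E1; exact: (@bnd_d (hdg M J)).
Qed.
End PostQiso.
End Homotopy.

Lemma qiso_exact (M N : complex) (f : cplxmor M N) : quasi_iso f -> forall i, exact M i <-> exact N i.
Proof.
move=> /quasi_isoP q i; have [a b] := q i.
by split; [apply: Hsurj_exact b|apply: Hinj_exact a].
Qed.

(** A horseshoe argument with injective resolutions. The hull of JX is added to J to make JX -> JY
    injective, and t extends the embedding of JX into its hull along u, so that the left square
    commutes strictly and induces c on cokernels. *)
Lemma ses_res (A : cdgring) (X Y Z : dgmod A) (u : dgmor X Y) (v : dgmor Y Z) : ses u v ->
  exists (JX JY JZ : dgmod A) (p : dgmor JX JY) (q : dgmor JY JZ)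
    (a : dgmor X JX) (b : dgmor Y JY) (c : dgmor Z JZ),
  [/\ ses p q, [/\ semiinj JX, semiinj JY & semiinj JZ] & [/\ quasi_iso a, quasi_iso b & quasi_iso c]].
Proof.
move=> S; have [JX [a [sX qa ia]]] := resolution X; have [J [b0 [sJ qb0 ib0]]] := resolution Y.
have [|w ew] := ext_mor (coker_ses ia) (dgmor_comp b0 u) (proj2 sJ).
  by apply: Kinj_acyclic; [exact: (proj1 sJ)|apply/(ses_qiso_left (coker_ses ia))].
have sk := acyc_hull_semiinj JX; have ak := @acyc_hull_acyclic A JX.
have [|t et] := ext_mor S (dgmor_comp (acyc_hull_in JX) a) (proj2 sk).
  by apply: acyclic_Kinj; [exact: (proj1 sk)|exact: ak].
pose p := sum_mor (acyc_hull_in JX) w.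
have ip i x : p i x = 0 -> x = 0 by move/(congr1 fst); apply: acyc_hull_in_inj.
have sY : semiinj (sum (acyc_hull JX) J) by apply: (ses_semiinj_mid (tw_ses (@sum_th _ _ _))).
have P := coker_ses ip.
pose b := sum_mor t b0.
have qb : quasi_iso b by apply: sum_qiso.
have E i x : b i (u i x) = p i (a i x).
  by rewrite -[LHS]/(t i (u i x), b0 i (u i x)) et -[RHS]/(_, w i (a i x)) ew.
have [|c ec] := ses_lift S (f := dgmor_comp (quo_pi (im_sub p)) b).
  by move=> i x; rewrite -[LHS]/(quo_pi (im_sub p) i (b i (u i x))) E (ses_0 P).
have qc : quasi_iso c by apply: (five_right S P (a := a) (b := b) (c := c)).
exists JX, (sum (acyc_hull JX) J), (coker p), p, (quo_pi (im_sub p)), a, b, c; split=> //; split=> //.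
exact: (ses_semiinj_right P).
Qed.

Section rhom_exact.
Variables (A : cdgring) (V : dgmod A).
(* Vanishing of H^j RHom(V, M), for every choice of semi-injective resolution. *)
Definition rhom_exact (M : dgmod A) j := forall (J : dgmod A) (u : dgmor M J), semiinj J -> quasi_iso u ->
  exact (hdg V J) j.
Lemma rhom_exactE M J (u : dgmor M J) : semiinj J -> quasi_iso u -> forall j, rhom_exact M j <-> exact (hdg V J) j.
Proof.
move=> sJ qu j; split=> [h|h J' u' sJ' qu']; first exact: h sJ qu.
have [g hg] := htpy_ext u' sJ' qu.
have qg : quasi_iso g.
  by apply: (qiso_compr (f := u) (k := dgmor_comp g u)) => //; apply: (htpic_qiso hg).
exact: (proj1 (qiso_exact (post_qiso V (proj1 sJ) sJ' qg) j) h).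
Qed.
Lemma rhom_exact_self J j : semiinj J -> rhom_exact J j <-> exact (hdg V J) j.
Proof. by move=> sJ; apply: (rhom_exactE sJ (id_quasi_iso J)). Qed.
Lemma coho_rhom_exact : coho rhom_exact.
Proof.
have aS X Y Z (u : dgmor X Y) (v : dgmor Y Z) (S : ses u v) :
    exists JX JY JZ (p : dgmor JX JY) (q : dgmor JY JZ), ses (post V p) (post V q) /\
    forall j, [/\ rhom_exact X j <-> exact (hdg V JX) j, rhom_exact Y j <-> exact (hdg V JY) j & rhom_exact Z j <-> exact (hdg V JZ) j].
  have [JX [JY [JZ [p [q [a [b [c [P [sX sY sZ] [qa qb qc]]]]]]]]]] := ses_res S.
  exists JX, JY, JZ, p, q; split; first by apply: (post_ses P); exact: (proj2 sX).
  by move=> j; split; [apply: rhom_exactE sX qa j|apply: rhom_exactE sY qb j|apply: rhom_exactE sZ qc j].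
split=> [X Y Z u v /aS[JX [JY [JZ [p [q [T E]]]]]] i|X Y Z u v /aS[JX [JY [JZ [p [q [T E]]]]]] i j e|X Y Z u v /aS[JX [JY [JZ [p [q [T E]]]]]] i j e|X aX i].
- by case: (E i) => -> -> ->; apply: (ses_exactY T).
- by case: (E i) => _ -> ->; case: (E j) => -> _ _; apply: (ses_exactZ T e).
- by case: (E i) => -> -> _; case: (E j) => _ _ ->; apply: (ses_exactX T e).
- move=> J u sJ qu; apply: acyclic_Kinj; first exact: (proj1 sJ).
  by apply/acyclicP => k; apply: (proj1 (qiso_exact qu k)); move/acyclicP: aX; exact.
Qed.
End rhom_exact.

Lemma rhom_exact_hdg (A : cdgring) (pn : pseudo_noetherian A) (V I : dgmod A) (x0 v i0 : int) : semiinj I ->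
  (forall j, j < x0 -> exact I j) -> (forall j, v < j -> exact V j) ->
  (forall j, j < i0 -> exact (hdg V I) j) ->
  forall k N, Dminus k N -> forall j, j < i0 - k -> rhom_exact V (hdg N I) j.
Proof.
move=> sI lI uV lV k N hN j hj.
have H := coho_hdg (coho_rhom_exact V) sI.
rewrite -[j]opprK; apply: (wayout pn H (c := v - x0) (s := - i0) _ _ hN); last by lia.
  move=> l M [_ uM] m hm J u sJ qu; apply: (hom_bounds (z := x0 - l) sJ _ uV); last by lia.
  move=> i hi; apply: (proj1 (qiso_exact qu i)); apply: hom_bounds lI uM _ => //.
move=> l hl; apply: (proj2 (coho_qiso (coho_rhom_exact V) (ev1_qiso I) _)).
by apply: (proj2 (rhom_exact_self _ _ sI)); apply: lV; lia.
Qed.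

(** * Homothety and biduality *)

Section MulDelta.
Variables (A : cdgring) (J : dgmod A).

Definition mulJ_hom n (a : A n) : hom J J n.
Proof.
apply: (@Hom A J J n (fun i j h x => act (etrans (addrC n i) h) a x)) => [i j h x y|p i j k l hp hk hn hl b x].
  by rewrite actDr.
have e1 : p + n = n + p by lia.
have e2 : n + p + i = l by lia.
have e3 : n + i = j by lia.
have e4 : n + k = l by lia.
rewrite (act_irr _ e4) (act_irr (etrans _ hn) e3).
by rewrite -(actA (erefl _) e2) (dgmulC e1) act_ksgnl (actA e1 e2 e3 hl).
Defined.
Definition mulJ : dgmor (selfmod A) (hdg J J).
Proof.
apply: (@mkmor A (selfmod A) (hdg J J) (fun n a => mulJ_hom a)).
- by move=> n a b; apply: hom_ext => i j h x; rewrite /= actBl.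
- move=> n n' hn a; apply: hom_ext => i j h x.
  have e1 : i + n + 1 = j by lia.
  have e2 : i + 1 + n = j by lia.
  rewrite [LHS](hom_dE hn _ h erefl e1 erefl e2) /=.
  have e3 : n + i = i + n by lia.
  have e4 : n + (i + 1) = j by lia.
  have e5 : n' + i = j by lia.
  rewrite (act_irr _ e3) (act_irr (etrans (addrC n (i + 1)) e2) e4) (act_irr (etrans _ h) e5).
  by rewrite (act_d e3 hn (erefl _) e1 e5 e4) addrK.
- move=> p n q h b a; apply: hom_ext => i j e x.
  have e1 : p + (i + n) = j by lia.
  rewrite [RHS](hactE h _ _ e erefl e1) /=.
  exact: actA.
Defined.

Variable M : dgmod A.
Definition delta_hom i (x : M i) : hom (hdg M J) J i.
Proof.
apply: (@Hom A (hdg M J) J i (fun n j h f => ksgn (i * n) (hf f (etrans (addrC i n) h) x))) => [n j h f g|p n j k l hp hk hn hl a f].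
  by rewrite -ksgnD.
rewrite act_ksgn ksgnM.
have e1 : p + j = l by lia.
rewrite (hactE hp a f (etrans (addrC i k) hk) (etrans (addrC i n) hn) e1) (act_irr e1 hl).
by apply: ksgn_odd; rewrite -hp !(oddzD, oddzM); case: (oddz p); case: (oddz i); case: (oddz n).
Defined.
Lemma delta_homE i (x : M i) n j (h : n + i = j) (h' : i + n = j) f :
  hf (delta_hom x) h f = ksgn (i * n) (hf f h' x).
Proof. by rewrite /=; congr ksgn; apply: hf_irr. Qed.
Definition delta : dgmor M (hdg (hdg M J) J).
Proof.
apply: (@mkmor A M (hdg (hdg M J) J) (fun i x => delta_hom x)).
- by move=> i x y; apply: hom_ext => n j h f; rewrite /= hfB ksgnB.
- move=> i i' hi x; apply: hom_ext => n j h f.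
  have e1 : n + i + 1 = j by lia.
  have e2 : n + 1 + i = j by lia.
  have e3 : i + n = n + i by lia.
  have e4 : i + (n + 1) = j by lia.
  have e5 : i' + n = j by lia.
  rewrite [LHS](hom_dE hi _ h erefl e1 erefl e2) (delta_homE x erefl e3) (delta_homE x e2 e4).
  rewrite (delta_homE _ h e5) -[df (hdg M J) _ _]/(hom_d _ f).
  rewrite (hom_dE erefl f e4 e3 e1 hi e5) !ksgnB !ksgnM df_ksgn.
  rewrite [X in _ - (X - _)](@ksgn_odd _ _ (i * n)); last by rewrite !(oddzD, oddzM) oddz1; case: (oddz i); case: (oddz n).
  rewrite subKr; apply: ksgn_odd; rewrite -hi !(oddzD, oddzM) oddz1.
  by case: (oddz i); case: (oddz n).
- move=> p i k h a x; apply: hom_ext => n j e f.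
  have e1 : p + (n + i) = j by lia.
  have e2 : k + n = j by lia.
  have e3 : i + n = n + i by lia.
  rewrite [RHS](hactE h _ _ e erefl e1) (delta_homE _ e e2) (delta_homE x erefl e3) act_ksgn.
  rewrite (hf_act f h e2 e3 e1) ksgnM; apply: ksgn_odd; rewrite -h !(oddzD, oddzM).
  by case: (oddz i); case: (oddz n); case: (oddz p).
Defined.
End MulDelta.

Lemma delta_nat (A : cdgring) (J M N : dgmod A) (u : dgmor M N) i x :
  delta J N i (u i x) = pre J (pre J u) i (delta J M i x).
Proof. by apply: hom_ext. Qed.

(** Identifying Hom(A, J) with J turns biduality at A into the homothety A -> Hom(J, J), so the
    third dualizing condition is biduality at the free module. *)
Lemma delta_self (A : cdgring) (J : dgmod A) i (a : A i) :
  delta J (selfmod A) i a = pre J (ev1 J) i (mulJ J i a).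
Proof.
apply: hom_ext => n j h f; have e : i + n = j by lia.
rewrite (@delta_homE A J (selfmod A) i a n j h e f) (ev1_hom f e e) ksgnK -[RHS]/(act _ a (ev1 J n f)).
exact: act_irr.
Qed.

Section DeltaCoho.
Variables (A : cdgring) (J : dgmod A) (sJ : semiinj J).

Lemma hdg_acyclic (M : dgmod A) : acyclic M -> acyclic (hdg M J).
Proof. by move=> aM; apply/acyclicP => i; apply: Kinj_acyclic => //; case: sJ. Qed.

Lemma delta_self_qiso : quasi_iso (delta J (selfmod A)) <-> quasi_iso (mulJ J).
Proof.
have q := pre_qiso sJ (ev1_qiso J); have E := @delta_self A J.
split=> h.
  by apply: (qiso_compl (g := pre J (ev1 J)) (k := delta J (selfmod A))).
by apply: (qiso_comp (f := mulJ J) (g := pre J (ev1 J))).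
Qed.

(** Biduality is natural and its target is exact in M, so its fibre is exact in M too; this makes
    biduality accessible to way-out induction. *)
Lemma coho_delta : coho (fun M i => exact (fib (delta J M)) i).
Proof.
have F X Y Z (u : dgmor X Y) (v : dgmor Y Z) (S : ses u v) :=
  fib_ses (fun i x => esym (delta_nat J u x)) (fun i x => esym (delta_nat J v x)) S (pre_ses (pre_ses S (proj2 sJ)) (proj2 sJ)).
split=> [X Y Z u v S i|X Y Z u v S i j e|X Y Z u v S i j e|X aX i].
- exact: (ses_exactY (F _ _ _ _ _ S)).
- exact: (ses_exactZ (F _ _ _ _ _ S) e).
- exact: (ses_exactX (F _ _ _ _ _ S) e).
- move: i; apply/fib_quasi_iso/quasi_isoP => i; split; first by apply: exact_Hinj; move/acyclicP: aX.
  by apply: exact_Hsurj; have /acyclicP := hdg_acyclic (hdg_acyclic aX).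
Qed.
End DeltaCoho.

(** * Dualizing modules and coinduction *)

(* Being dualizing, read off a semi-injective representative. *)
Record dual (A : cdgring) (J : dgmod A) (d0 d1 : int) : Prop := Dual {
  dual_semi : semiinj J;
  dual_fg : forall i, fg J i;
  dual_lo : forall (M : dgmod A) k, (forall i, k < i -> exact M i) ->
    forall j, j < d0 - k -> exact (hdg M J) j;
  dual_hi : forall (M : dgmod A) k, (forall i, i < k -> exact M i) ->
    forall j, d1 - k < j -> exact (hdg M J) j;
  dual_mul : quasi_iso (mulJ J)
}.

Lemma fib_exact_at (A : cdgring) (X Y : dgmod A) (u : dgmor X Y) (i j : int) : j + 1 = i ->
  exact X i -> exact Y j -> exact (fib u) i.
Proof.
move=> e hX hY; apply: (ses_exactY (tw_ses (fib_thd u))) => //.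
by apply: (proj2 (@sh_exact A (-1) Y i j _)) => //; lia.
Qed.

Section Dual.
Variables (A : cdgring) (pn : pseudo_noetherian A) (J : dgmod A) (d0 d1 : int) (D : dual J d0 d1).
Let sJ := dual_semi D.

Lemma dual_exact j : j < d0 -> exact J j.
Proof.
move=> hj; apply: (proj1 (qiso_exact (ev1_qiso J) j)).
by apply: (dual_lo D (k := 0)); [apply: A_exact|lia].
Qed.

(** Modules bounded above reduce to A, where Hom(A, J) is J; the part of M in high degrees
    contributes nothing at j because J has finite injective dimension. *)
Lemma fg_hdg M : (forall i, fg M i) -> forall j, fg (hdg M J) j.
Proof.
have H := coho_hdg (coho_fg (proj1 pn)) sJ.
move=> fM j; rewrite -[j]opprK.
apply: (coho_all pn H (c := - d1) _ _ fM) => [k X hX i|k X _ lX i hi].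
  apply: (wayout_all pn H (c := - d0) _ _ hX) => [l Y [_ uY] m hm|m].
    by apply: fg_exact; apply: (dual_lo D uY); lia.
  by apply: (proj2 (coho_qiso (coho_fg (proj1 pn)) (ev1_qiso J) _)); apply: (dual_fg D).
by apply: fg_exact; apply: (dual_hi D lX); lia.
Qed.

Lemma delta_qiso M : (forall i, fg M i) -> quasi_iso (delta J M).
Proof.
(* The double dual moves cohomological bounds by at most |d1 - d0| and the fibre by one more; beyond
   c both terms of the fibre vanish. *)
have H := coho_delta sJ; pose c : int := (absz (d1 - d0)).+2%:Z.
move=> fM; apply/fib_quasi_iso => j.
apply: (coho_all pn H (c := - c) _ _ fM) => [k X hX i|k X _ lX i hi].
  apply: (wayout_all pn H (c := c) _ _ hX) => [l Y [_ uY] m hm|m].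
    apply: (fib_exact_at (subrK 1 m)); first by apply: uY; lia.
    by apply: (dual_hi D (k := d0 - l)); [apply: (dual_lo D uY)|lia].
  by move: m; apply/fib_quasi_iso/(delta_self_qiso sJ); apply: (dual_mul D).
apply: (fib_exact_at (subrK 1 i)); first by apply: lX; lia.
by apply: (dual_lo D (k := d1 - k)); [apply: (dual_hi D lX)|lia].
Qed.

Lemma dual_qiso (J' : dgmod A) (f : dgmor J J') : semiinj J' -> quasi_iso f -> dual J' d0 d1.
Proof.
move=> sJ' q; have P M := post_qiso M (proj1 sJ) sJ' q.
split=> // [i|M k uM j hj|M k lM j hj|].
- by apply: (proj1 (coho_qiso (coho_fg (proj1 pn)) q i)); apply: (dual_fg D).
- by apply: (proj1 (qiso_exact (P M) j)); apply: (dual_lo D uM).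
- by apply: (proj1 (qiso_exact (P M) j)); apply: (dual_hi D lM).
have qf : quasi_iso (dgmor_comp (post J f) (mulJ J)).
  by apply: (qiso_comp (f := mulJ J) (g := post J f)) => //; apply: (dual_mul D).
apply: (qiso_compl (g := pre J' f) (k := dgmor_comp (post J f) (mulJ J))) => //.
  move=> n a; apply: hom_ext => i j h x; rewrite -[RHS]/(act _ a (f i x)).
  rewrite -[LHS]/(f j (hf (mulJ J n a) h x)) -[hf _ _ _]/(act _ a x); exact: mmor_act.
exact: pre_qiso.
Qed.
End Dual.

Section CanonDegreeZero.
Variable A : cdgring.
Lemma canon_surj i (b : ring_dg (Abar A) i) : exists a, canon A i a = b.
Proof.
have [e|ne] := EM (i = 0); last by exists 0; rewrite raddf0 [b]conc_triv.
subst i; have [z ez cz] := clsS (b : cohomology A 0); exists (cval z).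
by rewrite -[LHS]/(cls (cocycle0 (cval z))) cocycle0K ez.
Qed.
Lemma canon_eq0 (a : A 0) : canon A 0 a = 0 -> @bnd A 0 a.
Proof. by move=> /(@cls0 A 0 (cocycle0 a)). Qed.
End CanonDegreeZero.

Section RingCase.
Variable R : comPzRingType.
Let io (r : R) : Abar (ring_dg R) := canon (ring_dg R) 0 r.
Let ioD x y : io (x + y) = io x + io y.
Proof. exact: (raddfD (canon (ring_dg R) 0)). Qed.
Let ioM x y : io (x * y) = io x * io y.
Proof. exact: (rmor_mul (canon (ring_dg R)) (addr0 0)). Qed.
Let io_surj y : exists x, io x = y.
Proof. exact: (@canon_surj (ring_dg R) 0). Qed.
Let io_sum n (b e : 'I_n -> R) : io (\sum_(i < n) b i * e i) = \sum_(i < n) io (b i) * io (e i).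
Proof.
apply: (big_ind2 (fun x y => io x = y)) => [|x x' y y' <- <-|i _]; last exact: ioM.
  exact: (raddf0 (canon (ring_dg R) 0)).
exact: ioD.
Qed.

(** H^0 of R placed in degree 0 is a quotient type, isomorphic but not equal to R; ideals are
    carried across by [io]. *)
Lemma ring_noetherian : noetherian R -> noetherian (Abar (ring_dg R)).
Proof.
move=> nR I [I0 ID IM].
have [|n [e ge]] := nR (fun x => I (io x)).
  split; first by rewrite (_ : io 0 = 0) //; exact: (raddf0 (canon (ring_dg R) 0)).
    by move=> x y hx hy; rewrite ioD; apply: ID.
  by move=> a x hx; rewrite ioM; apply: IM.
exists n, (fun i => io (e i)); rewrite /generates; apply/seteqP; split=> [y|y [b ->]].
  have [x <-] := io_surj y; rewrite -[I _]/((fun x => I (io x)) x).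
  have /(congr1 (fun f => f x)) -> := ge; move=> -[b ->].
  by exists (fun i => io (b i)); rewrite io_sum.
pose c i := sval (cid (io_surj (b i))).
have cE i : io (c i) = b i by rewrite /c; case: cid.
have : (fun x => I (io x)) (\sum_(i < n) c i * e i) by have /(congr1 (fun f => f (\sum_(i < n) c i * e i))) -> := ge; exists c.
rewrite /= io_sum; congr I; apply: eq_bigr => i _; by rewrite cE.
Qed.

Lemma ring_pn : noetherian R -> pseudo_noetherian (ring_dg R).
Proof.
move=> nR; split=> [|i]; first exact: ring_noetherian.
apply/(@fgP (ring_dg R) (selfmod (ring_dg R)) i).
have [e|ne] := EM (i = 0); last first.
  by exists [::]; split=> // z _; rewrite [z]conc_triv //; apply: bnd0.
subst i; exists [:: (1 : R)]; split=> [x _ j h|z _]; first by [].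
by exists z => /=; rewrite mulr1 subrr; apply: bnd0.
Qed.
End RingCase.

Section Surjective.
Variables (A B : cdgring) (phi : dgrmor A B).
Definition phi_mor : dgmor (selfmod A) (restrict_dg phi (selfmod B)).
Proof.
apply: (@mkmor A (selfmod A) (restrict_dg phi (selfmod B)) (fun i a => phi i a)).
- by move=> i; apply: additiveB.
- by move=> i j h x; apply: cmor_d.
- by move=> i j k h a x; apply: (rmor_mul phi h).
Defined.
Hypothesis phi0 : forall b : B 0, exists a, phi 0 a = b.
(** Coefficients in B^0 lift to A^0, so spans read on cochains coincide and H^0(A) need not be
    compared with H^0(B). *)
Lemma fg_restrict X i : fg X i <-> fg (restrict_dg phi X) i.
Proof.
have E L z : @espan B X i L z <-> @espan A (restrict_dg phi X) i L z.
  elim: L z => [|v L IH] z //=; split=> -[a h].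
    have [b eb] := phi0 a; exists b; apply/IH.
    by rewrite -[act _ _ _]/(@act B X _ _ _ (add0r i) (phi 0 b) v) eb.
  by exists (phi 0 a); apply/IH.
by rewrite !fgP; split=> -[L [cL hL]]; exists L; split=> // z cz; apply/E/hL.
Qed.
End Surjective.

Section CanonKernel.
Variables (A : cdgring) (pn : pseudo_noetherian A).
Let phi := canon A.
Let B := ring_dg (Abar A).
Lemma B_pn : pseudo_noetherian B. Proof. exact: ring_pn (proj1 pn). Qed.
Definition canon_ker := ker (phi_mor phi).
Definition canon_ker_in : dgmor canon_ker (selfmod A) := sub_in _.
Lemma canon_ker_ses : ses canon_ker_in (phi_mor phi).
Proof. by apply: ker_ses => i b; apply: canon_surj. Qed.
Lemma restrB_Dminus : Dminus 0 (restrict_dg phi (selfmod B)).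
Proof.
split=> i; last by move=> hi z _; rewrite [z]conc_triv; [apply: bnd0|lia].
apply: (proj1 (@fg_restrict A B phi (@canon_surj A 0) (selfmod B) i)); exact: (proj2 B_pn).
Qed.
(** B is concentrated in degree 0, so the kernel contains all of A in negative degrees. An element
    of the kernel in degree 0 is a boundary in A, and its bounding cochain, of degree -1, is already
    in the kernel. *)
Lemma canon_ker_Dminus : Dminus (-1) canon_ker.
Proof.
split=> [i|i hi].
  apply: (coho_left (coho_fg (proj1 pn)) canon_ker_ses (subrK 1 i)).
    exact: (proj2 pn).
  exact: (proj1 restrB_Dminus).
have S := canon_ker_ses; move=> z cz.
have v0 : phi_mor phi i (canon_ker_in i z) = 0 := ses_0 S z.
have [e|ne] := EM (i = 0); last first.
  have -> : z = 0 by apply: (ses_inj S); apply: dg_nonpos; lia.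
  exact: bnd0.
subst i; have [j [h [u eu]]] : bnd (canon_ker_in 0 z) by apply: canon_eq0 v0.
have [|u' eu'] := ses_ex S (y := u).
  by apply: conc_triv; move: (h); lia.
exists j, h, u'; apply: (ses_inj' S); rewrite -cmor_d eu' //.
Qed.
End CanonKernel.

Section CoindHom.
Variables (A B : cdgring) (phi : dgrmor A B) (J : dgmod A).
Local Notation S := (coind phi (selfmod B) J).
Local Notation rB := (restrict_dg phi (selfmod B)).
Definition coind_hdg : dgmor (restrict_dg phi S) (hdg rB J).
Proof.
apply: (@mkmor A (restrict_dg phi S) (hdg rB J) (fun n (f : hom rB J n) => f)) => // p n q h a f.
apply: hom_ext => i j e x.
have e1 : p + i + n = j by lia.
have e2 : p + (i + n) = j by lia.
rewrite [RHS](hactE h a f e erefl e2).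
rewrite -[LHS]/(hf (coind_act h (phi p a) f) e x) (coind_actE h _ _ e erefl e1).
by apply: etrans (congr1 (ksgn (p * n)) (hf_act f erefl e1 erefl e2 a x)) _; rewrite ksgnK.
Defined.
Lemma coind_hdg_qiso : quasi_iso coind_hdg.
Proof. by apply: bij_quasi_iso => // i y; exists y. Qed.

(** Adjunction identifies Hom_B(S, S) with the double dual of B over A, and the homothety of S with
    biduality at B. So the third condition for S reduces to [delta_qiso] at B. *)
Lemma mulJ_coind i (b : B i) :
  kap phi J S i (mulJ S i b) = pre J coind_hdg i (delta J rB i b).
Proof.
apply: hom_ext => n j h s; have e : i + n = j by lia.
rewrite -[RHS]/(hf (delta_hom J (M := rB) b) h s) (@delta_homE A J rB i b n j h e s).
rewrite -[LHS]/(hf (coind_act (etrans (addrC i n) h) b s) (add0r j) (dgone B)).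
by rewrite (coind_actE _ _ _ (add0r j) (addr0 i) e) -[act _ _ _]/(dgmul (addr0 i) b (dgone B)) dgmul1r.
Qed.

Lemma dual_coind (phi0 : forall b : B 0, exists a, phi 0 a = b) (pnA : pseudo_noetherian A) (pnB : pseudo_noetherian B) d0 d1 :
  (forall i, fg rB i) -> dual J d0 d1 -> dual S d0 d1.
Proof.
move=> fB D; have kS := @kap_qiso A B phi J; split.
- by apply: coind_semiinj; apply: (dual_semi D).
- move=> i; apply: (proj2 (fg_restrict phi0 S i)).
  apply: (proj2 (coho_qiso (coho_fg (proj1 pnA)) coind_hdg_qiso i)).
  exact: (fg_hdg pnA D).
- move=> M k uM j hj; apply/kap_exact; exact: (dual_lo D (M := restrict_dg phi M) uM).
- move=> M k uM j hj; apply/kap_exact; exact: (dual_hi D (M := restrict_dg phi M) uM).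
apply: (@qiso_compl _ _ _ (mulJ S) (kap phi J S) (dgmor_comp (pre J coind_hdg) (delta J rB))).
- by move=> i b; exact: esym (mulJ_coind b).
- apply: (qiso_comp (f := delta J rB) (g := pre J coind_hdg)) => //.
    exact: (delta_qiso pnA D).
  by apply: pre_qiso coind_hdg_qiso; apply: (dual_semi D).
- exact: kS.
Qed.
End CoindHom.

Lemma qiso_eq (M N : complex) (f g : cplxmor M N) : (forall i x, f i x = g i x) -> quasi_iso f -> quasi_iso g.
Proof.
move=> E; rewrite !quasi_isoP => h i; have [a b] := h i; split.
  by move=> z cz; rewrite -E; apply: a.
by move=> w /b[z [cz bz]]; exists z; rewrite -E.
Qed.

Lemma coind_mor_ext (A B : cdgring) (phi : dgrmor A B) (J : dgmod A) (M : dgmod B)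
  (u v : dgmor M (coind phi (selfmod B) J)) :
  (forall i x, ev phi J i (u i x) = ev phi J i (v i x)) -> forall i x, u i x = v i x.
Proof.
move=> E i x.
have K : hom_of u - hom_of v = 0.
  apply: (@kap_inj A B phi J M 0); apply: hom_ext => n j h y.
  have e : n = j by lia.
  move: h; case: j / e => h.
  rewrite -[LHS]/(ev phi J n (hf (hom_of u) h y - hf (hom_of v) h y)) !hom_ofE.
  by apply: etrans (raddfB (ev phi J n) _ _) _; rewrite E subrr.
have e : hom_of u = hom_of v by apply/eqP; rewrite -subr_eq0 K.
by rewrite -(hom_ofE u (addr0 i)) -(hom_ofE v (addr0 i)) e.
Qed.

Lemma coind_mor_eq (A B : cdgring) (phi : dgrmor A B) (J J' : dgmod A)
  (tau : dgmor (coind phi (selfmod B) J) (coind phi (selfmod B) J'))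
  (g : dgmor (hdg (selfmod A) J) J') (lam : dgmor J J') :
  (forall n k, lam n (ev1 J n k) = g n k) ->
  (forall n f, g n (pre J (phi_mor phi) n (coind_hdg phi J n f)) = ev phi J' n (tau n f)) ->
  forall n f, tau n f = coind_mor phi lam n f.
Proof.
move=> h1 h2; apply: coind_mor_ext => n f; apply: etrans (esym (h2 n f)) _.
apply: etrans (esym (h1 _ _)) _; apply: (congr1 (lam n)).
exact: (congr1 (hf f (add0r n)) (rmor_one phi)).
Qed.

(** By adjunction tau is a degree 0 cocycle of Hom(Hom(B, J), J'). The obstruction to lifting it to
    Hom(Hom(A, J), J') lies in H^1 of the term for N. The lift is strict, so tau is equal to the map
    induced by lam, not merely homotopic to it. *)
Lemma coind_mor_lift (A B : cdgring) (phi : dgrmor A B) (J J' N : dgmod A) (u : dgmor N (selfmod A)) :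
  ses u (phi_mor phi) -> graded_inj J -> graded_inj J' ->
  forall tau : dgmor (coind phi (selfmod B) J) (coind phi (selfmod B) J'),
  exact (hdg (hdg N J) J') 1 ->
  exists lam : dgmor J J', forall n f, tau n f = coind_mor phi lam n f.
Proof.
move=> S gJ gJ' tau e1.
have [|c [c1 c2]] := @inv_mor A _ _ (coind_hdg phi J) (fun i x e => e); first by move=> i y; exists y.
pose e := dgmor_comp (ev phi J') (dgmor_comp (res_mor phi tau) c).
have T := pre_ses (pre_ses S gJ) gJ'.
have [g cg eg] := les_lift T (add0r 1) e1 (hom_of_cyc e).
have [|w [w1 w2]] := inv_mor (@ev1_inj A J); first exact: ev1_surj.
exists (dgmor_comp (mor_of cg) w); apply: (coind_mor_eq (g := mor_of cg)).
  by move=> n k; rewrite -[LHS]/(mor_of cg n (w n (ev1 J n k))) w2.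
move=> n f; pose f' := coind_hdg phi J n f.
have E1 : hf (pre J' (pre J (phi_mor phi)) 0 g) (addr0 n) f' = ev phi J' n (tau n (c n f')).
  by rewrite eg hom_ofE.
apply: etrans E1 _; apply: (congr1 (fun y => ev phi J' n (tau n y)) (c2 n f)).
Qed.

Lemma coind_qiso (A B : cdgring) (phi : dgrmor A B) (K J : dgmod A) (f : dgmor K J) :
  Kinjective K -> semiinj J -> quasi_iso f -> quasi_iso (coind_mor phi f).
Proof.
move=> kK sJ qf; apply/quasi_isoP => i.
have /quasi_isoP/(_ i)[a b] := post_qiso (restrict_dg phi (selfmod B)) kK sJ qf.
by split; [exact: a|exact: b].
Qed.

(** * Injectivity of the correspondence *)

Section Conservative.
Variables (A : cdgring) (pn : pseudo_noetherian A).
Local Notation phi := (canon A).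
Local Notation B := (ring_dg (Abar A)).
Local Notation rB := (restrict_dg phi (selfmod B)).

(* If the cohomology of J starts in degree x, then that of Hom(N, J) starts in
   degree x + 1, N being the kernel of A -> B; hence H^x(J) is a quotient of
   H^x Hom(B, J). *)
Lemma coind_conserv (J : dgmod A) x0 : semiinj J -> (forall i, i < x0 -> exact J i) ->
  acyclic (coind phi (selfmod B) J) -> acyclic J.
Proof.
move=> sJ lJ /acyclicP aJ.
suff H (n : nat) : forall i, i < x0 + n%:Z -> exact J i.
  by apply/acyclicP => i; apply: (H (absz (i - x0 + 1)) i); lia.
elim: n => [|n IH] i hi; first by apply: lJ; lia.
apply: (proj1 (qiso_exact (ev1_qiso J) i)).
apply: (ses_exactY (pre_ses (canon_ker_ses A) (proj2 sJ))); first exact: aJ.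
apply: (hom_bounds sJ IH (m := -1)); last by lia.
exact: (proj2 (canon_ker_Dminus pn)).
Qed.

Lemma coind_conserv_qiso (J J' : dgmod A) (f : dgmor J J') x0 : semiinj J -> semiinj J' ->
  (forall i, i < x0 -> exact J i) -> (forall i, i < x0 -> exact J' i) ->
  quasi_iso (coind_mor phi f) -> quasi_iso f.
Proof.
move=> sJ sJ' lJ lJ' q.
pose f' := sum_mor (acyc_hull_in J) f.
have if' i x : f' i x = 0 -> x = 0 by move/(congr1 fst); apply: acyc_hull_in_inj.
have S := coker_ses if'.
have T := tw_ses (@sum_th A (acyc_hull J) J' ).
have sI : semiinj (sum (acyc_hull J) J') by apply: (ses_semiinj_mid T) => //; apply: acyc_hull_semiinj.
have sC := ses_semiinj_right S sJ sI.
have qp : quasi_iso (sum_pr2 (acyc_hull J) J') by apply: (ses_qiso_right (sum_ses _ _)); apply: acyc_hull_acyclic.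
have aC : acyclic (coker f').
  (* In degree i the cokernel depends on H^(i+1)(J), so its lower bound is one less than that of
     J. *)
  apply: (coind_conserv (x0 := x0 - 1)) => // [i hi|].
    apply: (ses_exactZ S (erefl (i + 1))); last by apply: lJ; lia.
    by apply: (proj2 (qiso_exact qp i)); apply: lJ'; lia.
  apply/(ses_qiso_left (coind_ses phi S (proj2 sJ))).
  apply: (qiso_compl (g := coind_mor phi (sum_pr2 (acyc_hull J) J')) (k := coind_mor phi f)) => //.
    by move=> i x; apply: hom_ext.
  by apply: coind_qiso => //; case: sI.
by apply: (qiso_comp (f := f') (g := sum_pr2 (acyc_hull J) J')) => //; apply/(ses_qiso_left S).
Qed.

Section Injectivity.
Variables (J J' : dgmod A) (d0 d1 d0' d1' : int) (D : dual J d0 d1) (D' : dual J' d0' d1').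
Local Notation S := (coind phi (selfmod B) J).
Local Notation S' := (coind phi (selfmod B) J').
Variables (tau : dgmor S S') (qtau : quasi_iso tau).
Let sJ := dual_semi D.
Let sJ' := dual_semi D'.
Let F M := hdg (hdg M J) J'.

Lemma coho_bidual : coho (fun M j => exact (F M) j).
Proof.
have H := coho_hdg (coho_hdg (coho_exact A) sJ') sJ.
have E M j : exact (F M) j <-> exact (F M) (- - j) by rewrite opprK.
split=> [X Y Z u v T i /E hX /E hZ|X Y Z u v T i j e /E hY /E hX|X Y Z u v T i j e /E hY /E hZ|X aX i]; apply/E.
- exact: (coho_mid H T hX hZ).
- exact: (coho_right H T e hY hX).
- exact: (coho_left H T e hY hZ).
- exact: (coho_0 H aX).
Qed.

Lemma bidual_base k M : Dminus k M -> forall j, k + (d1' - d0) < j -> exact (F M) j.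
Proof.
move=> [_ uM] j hj; apply: (dual_hi D' (k := d0 - k)); last by lia.
by move=> i hi; apply: (dual_lo D uM).
Qed.

(** The term F(B) is Hom_B(S, S') by adjunction, Hom_B(S, S) through tau, and B itself because S is
    dualizing. *)
Lemma bidual_rB j : 0 < j -> exact (F rB) j.
Proof.
move=> hj; apply: (proj2 (qiso_exact (pre_qiso sJ' (coind_hdg_qiso phi J)) j)).
apply/(@kap_exact A B phi J' S).
have sS := @coind_semiinj A B phi J sJ; have sS' := @coind_semiinj A B phi J' sJ'.
apply: (proj1 (qiso_exact (post_qiso S (proj1 sS) sS' qtau) j)).
have DS := dual_coind (@canon_surj A 0) pn (B_pn pn) (proj1 (restrB_Dminus pn)) D.
apply: (proj1 (qiso_exact (dual_mul DS) j)); exact: A_exact.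
Qed.

Lemma bidual_ker s : (forall j, s < j -> exact (F (selfmod A)) j) ->
  forall j, s - 1 < j -> exact (F (canon_ker A)) j.
Proof.
move=> h j hj; apply: (wayout pn coho_bidual bidual_base h (canon_ker_Dminus pn)); lia.
Qed.

(* Descending induction on an upper bound s of the cohomology of F(A): then N,
   sitting in negative degrees, has F(N) bounded by s - 1, while F(B) is
   isomorphic to B. *)
Lemma bidual_unit j : 0 < j -> exact (F (selfmod A)) j.
Proof.
have st : forall j, d1' - d0 < j -> exact (F (selfmod A)) j.
  by move=> i hi; apply: (bidual_base (A_Dminus pn)); lia.
suff H (n : nat) : forall j, 0 < j -> d1' - d0 - n%:Z < j -> exact (F (selfmod A)) j.
  by move=> hj; apply: (H (absz (d1' - d0))) => //; lia.
elim: n => [|n IH] i hi hn; first by apply: st; lia.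
apply: (coho_mid coho_bidual (canon_ker_ses A)); last exact: bidual_rB.
apply: (@bidual_ker (Num.max 0 (d1' - d0 - n%:Z))); last by lia.
by move=> l hl; apply: IH; lia.
Qed.

Lemma coind_full : exists lam : dgmor J J', quasi_iso lam.
Proof.
have e1 : exact (F (canon_ker A)) 1 by apply: (@bidual_ker 0) => // j hj; apply: bidual_unit.
have [lam elam] := coind_mor_lift (canon_ker_ses A) (proj2 sJ) (proj2 sJ') tau e1.
exists lam; apply: (coind_conserv_qiso (x0 := Num.min d0 d0')) => //.
- by move=> i hi; apply: (dual_exact D); lia.
- by move=> i hi; apply: (dual_exact D'); lia.
exact: (qiso_eq elam qtau).
Qed.
End Injectivity.
End Conservative.

(** * Lifting dualizing modules from B to A *)

(* The properties of A -> H^0(A) that are used; phi is kept abstract because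
   conversion would unfold the construction of [canon]. *)
Record H0_map (A B : cdgring) (phi : dgrmor A B) : Prop := H0Map {
  H0_map_pnA : pseudo_noetherian A;
  H0_map_pnB : pseudo_noetherian B;
  H0_map_surj : forall i (b : B i), exists a, phi i a = b;
  H0_map_D : Dminus 0 (restrict_dg phi (selfmod B));
  H0_map_ker : Dminus (-1) (ker (phi_mor phi));
  H0_map_ker0 : forall a : A 0, phi 0 a = 0 -> bnd a
}.

Lemma canon_H0_map (A : cdgring) : pseudo_noetherian A -> H0_map (canon A).
Proof.
move=> pn; split=> //; first exact: B_pn.
- exact: canon_surj.
- exact: restrB_Dminus.
- exact: canon_ker_Dminus.
- exact: canon_eq0.
Qed.

Section Good.
Variables (A B : cdgring) (phi : dgrmor A B) (G : H0_map phi).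
Local Notation res := (restrict_dg phi).
Local Notation rB := (restrict_dg phi (selfmod B)).
Local Notation N := (ker (phi_mor phi)).
Let pnA := H0_map_pnA G.
Let pnB := H0_map_pnB G.

Lemma H0_map_ses : ses (sub_in (ker_sub (phi_mor phi))) (phi_mor phi).
Proof. by apply: ker_ses => i b; apply: (H0_map_surj G). Qed.

Lemma res_ses (X Y Z : dgmod B) (u : dgmor X Y) (v : dgmor Y Z) : ses u v -> ses (res_mor phi u) (res_mor phi v).
Proof. by case=> a b c d; split; [exact: a|exact: b|exact: c|exact: d]. Qed.

Section Quotient.
Variables (X : dgmod B) (I : dgmod A) (rho : dgmor (res X) I).
Hypotheses (gI : graded_inj I) (irho : forall i x, rho i x = 0 -> x = 0) (qrho : quasi_iso rho).
Let sigma := adj rho.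
Let E := coker sigma.

Lemma ev_inj i x : ev phi I i x = 0 -> x = 0.
Proof.
move=> e; have S := pre_ses H0_map_ses gI.
apply: (ses_inj S); apply: (@ev1_inj A I i).
by rewrite -[LHS]/(hf (x : hom rB I i) (add0r i) (phi 0 (dgone A))) rmor_one.
Qed.

Lemma coind_quot_ses : ses sigma (quo_pi (im_sub sigma)).
Proof. by apply: coker_ses; apply: adj_inj. Qed.

(* With U = Hom(B, I) inside I, the sequence is U/X -> I/X -> I/U. *)
Lemma coind_quot : exists (W : dgmod A) (e : dgmor (res E) W) (v : dgmor W (hdg N I)),
  acyclic W /\ ses e v.
Proof.
have Sr := coker_ses irho; have T := pre_ses H0_map_ses gI.
have [|w [w1 w2]] := inv_mor (@ev1_inj A I); first exact: ev1_surj.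
have wev i u : w i (ev phi I i u) = pre I (phi_mor phi) i (coind_hdg phi I i u).
  apply: etrans (w2 i _); apply: (congr1 (w i)).
  by rewrite -[RHS]/(hf (u : hom rB I i) (add0r i) (phi 0 (dgone A))) rmor_one.
have [|e ee] := ses_lift (res_ses coind_quot_ses) (f := dgmor_comp (quo_pi (im_sub rho)) (ev phi I)).
  move=> i x; apply: etrans (ses_0 Sr x); apply: (congr1 (quo_pi (im_sub rho) i)); exact: adjE.
pose k := pre I (sub_in (ker_sub (phi_mor phi))).
have [|v ve] := ses_lift Sr (f := dgmor_comp k w).
  move=> i x; rewrite -[LHS]/(k i (w i (rho i x))) -[rho i x]adjE wev; exact: (ses_0 T).
exists (coker rho), e, v; split; first by apply/(ses_qiso_left Sr).
split.
- move=> i z; have [u <-] := ses_surj coind_quot_ses z.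
  move=> h; have {}h : quo_pi (im_sub rho) i (ev phi I i u) = 0 by rewrite -h; exact: esym (ee i u).
  have [x ex] := ses_ex Sr h.
  suff -> : u = sigma i x by exact: (ses_0 coind_quot_ses).
  apply/eqP; rewrite -subr_eq0; apply/eqP/ev_inj; apply: etrans (raddfB (ev phi I i) _ _) _.
  by rewrite -ex -[X in _ - X]/(ev phi I i (adj rho i x)) adjE subrr.
- move=> i z; have [k' ek] := ses_surj T z; exists (quo_pi (im_sub rho) i (ev1 I i k')).
  by rewrite ve -[LHS]/(k i (w i (ev1 I i k'))) w2.
- move=> i z; have [y <-] := ses_surj Sr z; rewrite ve => h.
  have [u eu] := ses_ex T (h : k i (w i y) = 0).
  exists (quo_pi (im_sub sigma) i u); apply: etrans (ee i u) _.
  apply: (congr1 (quo_pi (im_sub rho) i)); rewrite -[y]w1 -eu.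
  rewrite -[RHS]/(hf (u : hom rB I i) (add0r i) (phi 0 (dgone A))) rmor_one //.
- move=> i z; have [u <-] := ses_surj coind_quot_ses z.
  have -> : e i (quo_pi (im_sub sigma) i u) = quo_pi (im_sub rho) i (ev phi I i u) by apply: ee.
  rewrite ve -[LHS]/(k i (w i (ev phi I i u))) wev; exact: (ses_0 T).
Qed.

(** The middle term W is I/X, acyclic because rho is a quasi-isomorphism, so U/X has the cohomology
    of Hom(N, I) shifted by one. *)
Lemma coind_quot_coho h (H : coho h) i j : i + 1 = j -> h (hdg N I) i -> h (res E) j.
Proof.
move=> e hN; have [W [a [v [aW S]]]] := coind_quot.
apply: (coho_left H S e) => //; exact: (coho_0 H).
Qed.
End Quotient.

Section QuotientBounds.
Variables (X : dgmod B) (I : dgmod A) (rho : dgmor (res X) I).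
Hypotheses (sX : semiinj X) (sI : semiinj I).
Hypotheses (irho : forall i x, rho i x = 0 -> x = 0) (qrho : quasi_iso rho).
Variable x0 : int.
Hypothesis lX : forall i, i < x0 -> exact X i.
Let E := coker (adj rho).

Lemma quot_exactI i : i < x0 -> exact I i.
Proof. by move=> hi; apply: (proj1 (qiso_exact qrho i)); apply: lX. Qed.

Lemma quot_semiinj : semiinj E.
Proof. by apply: (ses_semiinj_right (coind_quot_ses irho)) => //; apply: coind_semiinj. Qed.

(** One of the two degrees comes from N lying in degrees at most -1, the other from the shift in
    [coind_quot_coho]. *)
Lemma quot_exact i : i < x0 + 2 -> exact E i.
Proof.
move=> hi; apply: (coind_quot_coho (proj2 sI) irho qrho (coho_exact A) (subrK 1 i)).
by apply: (hom_bounds sI quot_exactI (proj2 (H0_map_ker G))); lia.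
Qed.

Variables (V : dgmod B) (v : int) (uV : forall i, v < i -> exact V i).
Local Notation a Y i := (forall j, j < i -> rhom_exact (res V) (res Y) j).
Local Notation b Y i := (forall j, j < i -> exact (hdg V Y) j).

Lemma quot_aE j : rhom_exact (res V) (res X) j <-> exact (hdg V (coind phi (selfmod B) I)) j.
Proof.
split=> h; first by apply/kap_exact; apply: (proj1 (rhom_exactE _ sI qrho j)).
by apply: (proj2 (rhom_exactE _ sI qrho j)); apply/kap_exact.
Qed.

(** The same two degrees, now after applying RHom_A(V, -); the one due to N is [rhom_exact_hdg]. *)
Lemma quot_a i : a X i -> a E (i + 2).
Proof.
move=> h j hj; apply: (coind_quot_coho (proj2 sI) irho qrho (coho_rhom_exact (res V)) (subrK 1 j)).
have hI l : l < i -> exact (hdg (res V) I) l.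
  by move=> hl; apply: (proj1 (rhom_exactE _ sI qrho l)); apply: h.
have := @rhom_exact_hdg A pnA (res V) I x0 v i sI quot_exactI uV hI _ _ (H0_map_ker G) (j - 1).
by apply; lia.
Qed.

Lemma quot_post : ses (post V (adj rho)) (post V (quo_pi (im_sub (adj rho)))).
Proof. by apply: (post_ses (coind_quot_ses irho)); case: sX. Qed.
End QuotientBounds.

Section QuotientTest.
Variables (V : dgmod B) (v : int) (uV : forall i, v < i -> exact V i).
Local Notation a Y i := (forall j, j < i -> rhom_exact (res V) (res Y) j).
Local Notation b Y i := (forall j, j < i -> exact (hdg V Y) j).

(* With a the vanishing bound of RHom_A(V, X) and b that of RHom_B(V, X), the
   quotient U/X gains two degrees for a; the long exact sequence of
   X -> U -> U/X transfers bounds between a and b. *)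
Lemma quot_ab (n : nat) : forall (X : dgmod B) x0, semiinj X -> (forall i, i < x0 -> exact X i) ->
  forall i, i <= x0 - v + n%:Z -> a X i -> b X i.
Proof.
elim: n => [|n IH] X x0 sX lX i hi h j hj; first by apply: (hom_bounds sX lX uV); lia.
have [I [rho [sI qr ir]]] := resolution (res X).
apply: (ses_exactX (quot_post sX ir V) (subrK 1 j)).
  by apply/(quot_aE sI qr); apply: h.
apply: (IH _ (x0 + 2) (quot_semiinj sX sI ir) (quot_exact sI ir qr lX) (i - 1)); try lia.
by move=> l hl; apply: (quot_a sI ir qr lX uV h); lia.
Qed.

Variables (X : dgmod B) (I : dgmod A) (rho : dgmor (res X) I).
Hypotheses (sX : semiinj X) (sI : semiinj I).
Hypotheses (irho : forall i x, rho i x = 0 -> x = 0) (qrho : quasi_iso rho).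
Variable x0 : int.
Hypothesis lX : forall i, i < x0 -> exact X i.

Lemma quot_ab_E i : a X i -> b (coker (adj rho)) (i + 2).
Proof.
move=> h; pose n := absz (i - x0 + v).
have hi : i + 2 <= x0 + 2 - v + n%:Z by rewrite /n; lia.
apply: (quot_ab (quot_semiinj sX sI irho) (quot_exact sI irho qrho lX) hi).
by move=> j hj; apply: (quot_a sI irho qrho lX uV h).
Qed.

(** A bootstrap: the bound i - 1 over A gives i + 1 for U/X over B by [quot_ab_E], more than enough
    for the sequence X -> U -> U/X to carry the bound i over B to i over A. *)
Lemma quot_b (n : nat) : forall i, i <= x0 - v + n%:Z -> b X i -> a X i.
Proof.
elim: n => [|n IH] i hi h j hj.
  apply: (proj2 (rhom_exactE _ sI qrho j)).
  by apply: (@hom_bounds A (res V) I v x0 j sI (quot_exactI qrho lX) uV); lia.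
apply/(quot_aE sI qrho); apply: (ses_exactY (quot_post sX irho V)); first by apply: h; lia.
apply: (@quot_ab_E (i - 1)); last by lia.
by apply: IH; [lia|move=> l hl; apply: h; lia].
Qed.

Lemma quot_b_E i : b X i -> b (coker (adj rho)) (i + 2).
Proof.
move=> h; have hi : i <= x0 - v + (absz (i - x0 + v))%:Z by lia.
by move=> j hj; apply: (quot_ab_E (quot_b hi h)).
Qed.
End QuotientTest.
End Good.

Lemma fg_hdg_bounded (A : cdgring) (pn : pseudo_noetherian A) (J : dgmod A) z k M : semiinj J ->
  (forall i, fg J i) -> (forall i, i < z -> exact J i) -> Dminus k M -> forall j, fg (hdg M J) j.
Proof.
move=> sJ fJ lJ hM j; have cf := coho_fg (proj1 pn); have H := coho_hdg cf sJ.
rewrite -[j]opprK; apply: (wayout_all pn H (c := - z) _ _ hM) => [l Y [_ uY] m hm|m].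
  by apply: fg_exact; apply: (hom_bounds sJ lJ uY); lia.
by apply: (proj2 (coho_qiso cf (ev1_qiso J) _)).
Qed.

Lemma null_pre (A : cdgring) (X Y J : dgmod A) (f : dgmor X Y) n (z : hdg Y J n) :
  @bnd (hom_cplx X Y) 0 (hom_of f) -> cyc z -> bnd (pre J f n z).
Proof.
move=> b cz; pose o := zero_mor X Y.
have eo i x : o i x = 0 by [].
have h : htpic f o.
  rewrite /htpic; have -> : hom_of o = 0 by apply: hom_ext => i j h x; rewrite (hom_ofE' o h (etrans (esym (addr0 i)) h)) eo raddf0.
  by rewrite subr0.
have := htpic_pre h cz; have -> : pre J o n z = 0 by apply: hom_ext => i j e x; exact: hf0.
by rewrite subr0.
Qed.

(** * Duals of quotients and one step of the construction *)

Section Bidual.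
Variables (B : cdgring) (pn : pseudo_noetherian B) (S : dgmod B) (d0 d1 : int) (D : dual S d0 d1).
Let sS := dual_semi D.

Lemma bidual_Hinj (X Y : dgmod B) (u : dgmor X Y) i : (forall i, fg X i) -> (forall i, fg Y i) ->
  Hinj u i -> Hinj (pre S (pre S u)) i.
Proof.
move=> /(delta_qiso pn D)/quasi_isoP/(_ i)[a b] /(delta_qiso pn D)/quasi_isoP/(_ i)[c d] h.
have E1 i' x : dgmor_comp (delta S Y) u i' x = pre S (pre S u) i' (delta S X i' x) by apply: delta_nat.
apply: (@Hinj_compr _ _ _ _ _ _ _ (@E1 i)) => //.
by apply: (@Hinj_comp _ _ _ u (delta S Y) (dgmor_comp (delta S Y) u) i).
Qed.
Lemma bidual_Hsurj (X Y : dgmod B) (u : dgmor X Y) i : (forall i, fg X i) -> (forall i, fg Y i) ->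
  Hsurj u i -> Hsurj (pre S (pre S u)) i.
Proof.
move=> /(delta_qiso pn D)/quasi_isoP/(_ i)[a b] /(delta_qiso pn D)/quasi_isoP/(_ i)[c d] h.
have E1 i' x : dgmor_comp (delta S Y) u i' x = pre S (pre S u) i' (delta S X i' x) by apply: delta_nat.
apply: (@Hsurj_compr _ _ _ _ _ _ _ (@E1 i)).
by apply: (@Hsurj_comp _ _ _ u (delta S Y) (dgmor_comp (delta S Y) u) i).
Qed.

Lemma delta_retract (E : dgmod B) : semiinj E -> (forall i, fg E i) ->
  exists r : dgmor (hdg (hdg E S) S) E, quasi_iso r.
Proof.
move=> sE fE; have q := delta_qiso pn D fE.
have [r hr] := htpy_ext (dgmor_id E) sE q; exists r.
apply: (qiso_compr (f := delta S E) (k := dgmor_comp r (delta S E))) => //.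
exact: (htpic_qiso hr (id_quasi_iso E)).
Qed.

Lemma fg_tauq m (M : dgmod B) : (forall i, fg M i) -> forall i, fg (tauq m M) i.
Proof.
move=> fM i; have [e|e] := leP i m; first by apply: fg_exact; apply: tauq_lo.
by apply: (fg_Hsurj (f := tau_pi m M)) (fM i); apply: tauq_Hsurj.
Qed.

(* The top cohomology of Hom(E, S) is tested against its own truncation Y: a map
   D Y -> E that is null-homotopic dualizes to the projection onto Y. *)
Lemma hdg_top (E : dgmod B) e0 p : semiinj E -> (forall i, fg E i) -> (forall i, i < e0 -> exact E i) ->
  (forall j Y, p < j -> (forall i, fg Y i) -> (forall i, i <> j -> exact Y i) ->
    exact (hdg (hdg Y S) E) 0) ->
  forall j, p < j -> exact (hdg E S) j.
Proof.
move=> sE fE lE h; set Q := hdg E S.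
have top i : d1 - e0 < i -> exact Q i by apply: (dual_hi D lE).
suff H (n : nat) : forall i, p < i -> d1 - e0 - n%:Z < i -> exact Q i.
  by move=> j hj; apply: (H (absz (d1 - e0 - j + 1))) => //; lia.
elim: n => [|n IH] j hj hn; first by apply: top; lia.
have fQ : forall i, fg Q i by apply: (fg_hdg pn D).
pose Y := tauq (j - 1) Q; pose pi := tau_pi (j - 1) Q : dgmor Q Y.
have fY : forall i, fg Y i by apply: fg_tauq.
have cY i : i <> j -> exact Y i.
  move=> ne; have [l|l] := leP i (j - 1); first exact: tauq_lo.
  by apply: tauq_exact; apply: IH; lia.
have [r qr] := delta_retract sE fE.
have /(_ _ (hom_of_cyc (dgmor_comp r (pre S pi)))) nl := h j Y hj fY cY.
move=> z cz.
have hi : Hinj (pre S (pre S pi)) j by apply: bidual_Hinj => //; apply: tauq_Hinj; lia.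
have [hr _] := (proj1 (quasi_isoP _) (pre_qiso sS qr)) j.
have cr := cyc_mor (pre S r) cz.
apply: (hr _ cz); apply: (hi _ cr).
by have := null_pre nl cz; congr bnd; apply: hom_ext.
Qed.
End Bidual.

Section GoodTop.
Variables (A B : cdgring) (phi : dgrmor A B) (G : H0_map phi).
Local Notation res := (restrict_dg phi).
Variables (S : dgmod B) (d0 d1 : int) (D : dual S d0 d1).
Let sS := dual_semi D.
Let pnA := H0_map_pnA G.
Let pnB := H0_map_pnB G.
Let phi0 := @H0_map_surj _ _ _ G 0.

Section Quotient.
Variables (X : dgmod B) (I : dgmod A) (rho : dgmor (res X) I).
Hypotheses (sX : semiinj X) (sI : semiinj I).
Hypotheses (irho : forall i x, rho i x = 0 -> x = 0).
Hypotheses (fX : forall i, fg X i) (fI : forall i, fg I i).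
Variable x0 : int.
Hypothesis lI : forall i, i < x0 -> exact I i.

Lemma fg_coind i : fg (coind phi (selfmod B) I) i.
Proof.
apply: (proj2 (fg_restrict phi0 _ _)).
apply: (proj2 (coho_qiso (coho_fg (proj1 pnA)) (coind_hdg_qiso phi I) i)).
exact: (fg_hdg_bounded pnA sI fI lI (H0_map_D G)).
Qed.

Lemma fg_coind_coker i : fg (coker (adj rho)) i.
Proof.
apply: (coho_right (coho_fg (proj1 pnB)) (coind_quot_ses irho) (erefl (i + 1))); first exact: fg_coind.
exact: fX.
Qed.
End Quotient.

(** By [hdg_top] it suffices to test with V = Hom(Y, S), Y having cohomology only in one degree j >
    t - 2. Biduality of X turns the bound t into vanishing of Hom(V, X) below j - t; for the
    quotient this becomes j - t + 2, which is positive, so degree 0 is covered. *)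
Lemma hdg_quot (X : dgmod B) (I : dgmod A) (rho : dgmor (res X) I) x0 t :
  semiinj X -> semiinj I -> (forall i x, rho i x = 0 -> x = 0) -> quasi_iso rho ->
  (forall i, fg X i) -> (forall i, i < x0 -> exact X i) ->
  (forall j, t < j -> exact (hdg X S) j) ->
  forall j, t - 2 < j -> exact (hdg (coker (adj rho)) S) j.
Proof.
move=> sX sI ir qr fX lX hX.
have fI i : fg I i by apply: (proj1 (coho_qiso (coho_fg (proj1 pnA)) qr i)); apply: (proj1 (fg_restrict phi0 X i)).
have lI i : i < x0 -> exact I i by move=> hi; apply: (proj1 (qiso_exact qr i)); apply: lX.
apply: (hdg_top pnB D (quot_semiinj sX sI ir) (fg_coind_coker sI ir fX fI lI) (quot_exact G sI ir qr lX)).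
move=> j Y hj fY cY.
set V := hdg Y S.
have fV : forall i, fg V i by apply: (fg_hdg pnB D).
have uV i : d1 - j < i -> exact V i by apply: (dual_hi D (k := j)) => l hl; apply: cY; lia.
have hV l : l < j -> exact (hdg V S) l.
  by move=> hl; apply: (proj1 (qiso_exact (delta_qiso pnB D fY) l)); apply: cY; lia.
have bX l : l < j - t -> exact (hdg V X) l.
  move=> hl; apply: (proj1 (rhom_exact_self V l sX)).
  apply: (proj2 (coho_qiso (coho_rhom_exact V) (delta_qiso pnB D fX) l)).
  apply: (rhom_exact_hdg pnB sS _ uV hV (N := hdg X S) (k := t)) => //.
    exact: (dual_exact D).
  by split=> //; apply: (fg_hdg pnB D).
by apply: (quot_b_E G uV sX sI ir qr lX bX); lia.
Qed.
End GoodTop.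

Section QuotientSes.
Variables (A : cdgring) (P Q R S : dgmod A) (p : dgmor P Q) (q : dgmor Q R) (T : ses p q).
Variables (i : dgmor S Q) (i' : dgmor S R).
Hypotheses (ei : forall n x, i' n x = q n (i n x)) (ii : forall n x, i' n x = 0 -> x = 0).
Lemma ses_quot_inj n x : i n x = 0 -> x = 0.
Proof. by move=> e; apply: ii; rewrite ei e raddf0. Qed.
Lemma ses_quot : exists g : dgmor (coker i) (coker i'), ses (dgmor_comp (quo_pi (im_sub i)) p) g.
Proof.
have Si := coker_ses ses_quot_inj; have Si' := coker_ses ii.
have [|g eg] := ses_lift Si (f := dgmor_comp (quo_pi (im_sub i')) q).
  by move=> n x; rewrite -[LHS]/(quo_pi (im_sub i') n (q n (i n x))) -ei (ses_0 Si').
exists g; split.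
- move=> n x /(ses_ex Si)[y ey]; apply: (ses_inj T); rewrite -ey.
  suff -> : y = 0 by rewrite raddf0.
  by apply: ii; rewrite ei ey (ses_0 T).
- move=> n z; have [y <-] := ses_surj Si' z; have [x <-] := ses_surj T y.
  by exists (quo_pi (im_sub i) n x); rewrite eg.
- move=> n y; have [x <-] := ses_surj Si y; rewrite eg => /(ses_ex Si')[s es].
  have [|w ew] := ses_ex T (y := x - i n s); first by rewrite raddfB -ei es subrr.
  exists w; rewrite -[LHS]/(quo_pi (im_sub i) n (p n w)) ew.
  by apply: etrans (raddfB _ _ _) _; rewrite (ses_0 Si) subr0.
- by move=> n x; rewrite eg -[LHS]/(quo_pi (im_sub i') n (q n (p n x))) (ses_0 T) raddf0.
Qed.
End QuotientSes.

Section Approx.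
Variables (B : cdgring) (pn : pseudo_noetherian B) (S : dgmod B) (d0 d1 : int) (D : dual S d0 d1).
Let sS := dual_semi D.
(* X is the dual of the lowest truncation quotient of the dual of C, mapped to C
   through a left inverse of biduality. *)
Lemma approx (C : dgmod B) p : semiinj C -> (forall i, fg C i) -> (forall j, p < j -> exact (hdg C S) j) ->
  exists (X : dgmod B) (f : dgmor X C), [/\ semiinj X, forall i, fg X i, forall i, i < d0 - p -> exact X i,
    forall i, i <> p -> exact (hdg X S) i & Hinj (pre S f) p /\ Hsurj (pre S f) p].
Proof.
move=> sC fC hC; set Q := hdg C S.
have fQ : forall i, fg Q i by apply: (fg_hdg pn D).
pose Y := tauq (p - 1) Q; pose pi := tau_pi (p - 1) Q : dgmor Q Y.
have fY : forall i, fg Y i by apply: fg_tauq.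
have cY i : i <> p -> exact Y i.
  move=> ne; have [l|l] := leP i (p - 1); first exact: tauq_lo.
  by apply: tauq_exact; apply: hC; lia.
set V := hdg Y S.
have lV i : i < d0 - p -> exact V i by apply: (dual_lo D) => l hl; apply: cY; lia.
have fV : forall i, fg V i by apply: (fg_hdg pn D).
have [X [u [sX qu _]]] := resolution V.
have [r qr] := delta_retract pn D sC fC.
have [f0 h0] := htpy_ext (dgmor_comp r (pre S pi)) sC qu.
exists X, f0; split=> //.
- by move=> i; apply: (proj1 (coho_qiso (coho_fg (proj1 pn)) qu i)).
- by move=> i hi; apply: (proj1 (qiso_exact qu i)); apply: lV.
- move=> i hi; apply: (proj2 (qiso_exact (pre_qiso sS qu) i)).
  by apply: (proj1 (qiso_exact (delta_qiso pn D fY) i)); apply: cY.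
have hpi : p - 1 < p by lia.
have tj : Hinj pi p by apply: tauq_Hinj.
have ts : Hsurj pi p by apply: tauq_Hsurj.
have [a b] := (proj1 (quasi_isoP _) (pre_qiso sS qr)) p.
have [c d] := (proj1 (quasi_isoP _) (pre_qiso sS qu)) p.
have e i (x : hdg C S i) : pre S (dgmor_comp r (pre S pi)) i x = pre S (pre S pi) i (pre S r i x) by apply: hom_ext.
have e' i (x : hdg C S i) : pre S (dgmor_comp f0 u) i x = pre S u i (pre S f0 i x) by apply: hom_ext.
have h i (x : hdg C S i) : cyc x -> bnd (pre S (dgmor_comp r (pre S pi)) i x - pre S (dgmor_comp f0 u) i x).
  exact: htpic_pre.
split.
  apply: (@Hinj_compl _ _ _ _ _ _ _ (@e' p)); apply: (Hinj_homotopic (@h p)).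
  apply: (@Hinj_comp _ _ _ _ _ _ _ (@e p)) => //; exact: (bidual_Hinj pn D fQ fY tj).
apply: (@Hsurj_compl _ _ _ _ _ _ _ (@e' p)) => //; apply: (Hsurj_homotopic (@h p)).
apply: (@Hsurj_comp _ _ _ _ _ _ _ (@e p)) => //; exact: (bidual_Hsurj pn D fQ fY ts).
Qed.
End Approx.

Section Step.
Variables (A B : cdgring) (phi : dgrmor A B) (G : H0_map phi).
Local Notation res := (restrict_dg phi).
Variables (S : dgmod B) (d0 d1 : int) (D : dual S d0 d1).
Let sS := dual_semi D.
Let pnA := H0_map_pnA G.
Let pnB := H0_map_pnB G.
Let phi0 := @H0_map_surj _ _ _ G 0.

(* I approximates the sought dualizing module: S -> Hom_A(B, I) is an isomorphism
   on cohomology in degrees up to about d0 - p. *)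
Record stage (p : int) (I : dgmod A) (s : dgmor (res S) I) : Prop := Stage {
  st_semi : semiinj I;
  st_fg : forall i, fg I i;
  st_lo : forall i, i < d0 -> exact I i;
  st_inj : forall i x, s i x = 0 -> x = 0;
  st_hdg : forall j, p < j -> exact (hdg (coker (adj s)) S) j
}.

Lemma stage0 : exists (I : dgmod A) (s : dgmor (res S) I), stage (-2) s.
Proof.
have [I [s [sI qs is_]]] := resolution (res S); exists I, s; split=> //.
- move=> i; apply: (proj1 (coho_qiso (coho_fg (proj1 pnA)) qs i)).
  apply: (proj1 (fg_restrict phi0 S i)); exact: (dual_fg D).
- by move=> i hi; apply: (proj1 (qiso_exact qs i)); apply: (dual_exact D hi).
(* Hom(S, S) is B, of top degree 0; the quotient gains two degrees, whence the initial bound -2. *)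
move=> j hj; apply: (hdg_quot G D sS sI is_ qs (dual_fg D) (dual_exact D) (t := 0)); last by lia.
by move=> l hl; apply: (proj1 (qiso_exact (dual_mul D) l)); apply: A_exact.
Qed.

Section OneStep.
Variables (p : int) (I : dgmod A) (s : dgmor (res S) I) (st : stage p s) (hp : p <= -2).
Let sI := st_semi st.
Let C := coker (adj s).
Let q := quo_pi (im_sub (adj s)).
Variables (X : dgmod B) (f : dgmor X (coind phi (selfmod B) I)).
Hypotheses (sX : semiinj X) (fX : forall i, fg X i) (lX : forall i, i < d0 - p -> exact X i).
Hypothesis hX : forall i, i <> p -> exact (hdg X S) i.
Hypotheses (jf : Hinj (pre S (dgmor_comp q f)) p) (sf : Hsurj (pre S (dgmor_comp q f)) p).
Variables (K : dgmod A) (rho : dgmor (res X) K) (g : dgmor K I).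
Hypotheses (sK : semiinj K) (qr : quasi_iso rho) (ir : forall i x, rho i x = 0 -> x = 0).
Hypothesis eg : forall i x, g i (rho i x) = ev phi I i (f i x).

(** y is g made injective by a contractible summand, so J, its cokernel, is a strict and
    semi-injective model of the cone of g. *)
Let I' := sum (acyc_hull K) I.
Let y : dgmor K I' := sum_mor (acyc_hull_in K) g.
Let iy i x : y i x = 0 -> x = 0.
Proof. by move/(congr1 fst); apply: acyc_hull_in_inj. Qed.
Let Sy := coker_ses iy.
Let J := coker y.
Let in2 : dgmor I I' := tw_in (sum_th (acyc_hull K) I).
Let jot : dgmor I J := dgmor_comp (quo_pi (im_sub y)) in2.
Let s' : dgmor (res S) J := dgmor_comp jot s.

Lemma jot_inj i x : jot i x = 0 -> x = 0.
Proof.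
move=> e; have [w ew] := ses_ex Sy (e : quo_pi (im_sub y) i (in2 i x) = 0).
have w0 : w = 0 by apply: (@acyc_hull_in_inj _ K); have := congr1 fst ew.
have ex : g i w = x := congr1 snd ew.
by rewrite -ex w0 raddf0.
Qed.
Lemma s'_inj i x : s' i x = 0 -> x = 0.
Proof. by move=> /jot_inj; apply: (st_inj st). Qed.
Let sI' : semiinj I'.
Proof. by apply: (ses_semiinj_mid (tw_ses (@sum_th A (acyc_hull K) I))) => //; apply: acyc_hull_semiinj. Qed.
Let sJ : semiinj J.
Proof. exact: (ses_semiinj_right Sy). Qed.
Let qin2 : quasi_iso in2.
Proof. by apply: (proj1 (ses_qiso_left (tw_ses (@sum_th A (acyc_hull K) I)))); apply: acyc_hull_acyclic. Qed.
Let lK i : i < d0 - p -> exact K i.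
Proof. by move=> hi; apply: (proj1 (qiso_exact qr i)); apply: lX. Qed.

Lemma jot_H i : i < d0 - p - 1 -> Hinj jot i /\ Hsurj jot i.
Proof.
move=> hi; have [a b] := proj1 (quasi_isoP _) qin2 i.
have E x : jot i x = quo_pi (im_sub y) i (in2 i x) by [].
split; [apply: (Hinj_comp E) => //|apply: (Hsurj_comp E) => //].
  by apply: (ses_gHinj Sy); apply: lK; lia.
by apply: (ses_gHsurj Sy erefl); apply: lK; lia.
Qed.

Let C' := coker s'.
Let in2c := coind_mor phi in2.
Let i2 : dgmor S (coind phi (selfmod B) I') := dgmor_comp in2c (adj s).
Let gI' := proj2 sI'.

Lemma adj_s' i x : adj s' i x = coind_mor phi (quo_pi (im_sub y)) i (i2 i x).
Proof.
apply: (@coind_mor_ext _ _ phi J S (adj s') (dgmor_comp (coind_mor phi (quo_pi (im_sub y))) i2)) => {}i {}x.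
rewrite adjE; apply: (congr1 (quo_pi (im_sub y) i)); apply: (congr1 (in2 i)); exact: esym (adjE s x).
Qed.

Let Sc := coind_ses phi Sy (proj2 sK).
Let ii2 := ses_quot_inj adj_s' (adj_inj s'_inj).
Let Sq := coker_ses ii2.
Let m : dgmor (coind phi (selfmod B) K) (coker i2) := dgmor_comp (quo_pi (im_sub i2)) (coind_mor phi y).

(** Passing from I to I' changes Hom_A(B, I) by a contractible summand only, so [coker i2] can
    replace C. The replacement is needed because the coinduced cone sequence has Hom_A(B, I') in the
    middle. *)
Lemma step_cc : exists cc : dgmor C (coker i2), quasi_iso cc /\
  forall i x, cc i (q i x) = quo_pi (im_sub i2) i (in2c i x).
Proof.
have Sa := coind_quot_ses (st_inj st).
have [|cc ecc] := ses_lift Sa (f := dgmor_comp (quo_pi (im_sub i2)) in2c).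
  by move=> i x; exact: (ses_0 Sq).
exists cc; split; last exact: ecc.
apply: (five_right Sa Sq (a := dgmor_id S) (b := in2c) (c := cc)) => //.
- exact: id_quasi_iso.
- by apply: coind_qiso => //; case: sI.
Qed.

(** After evaluation at 1 the two composites from X differ only in the summand [acyc_hull K], and a
    map through a contractible module is null. This ties the strict sequence built from y to the
    original map f. *)
Lemma step_htpic (cc : dgmor C (coker i2)) : (forall i x, cc i (q i x) = quo_pi (im_sub i2) i (in2c i x)) ->
  htpic (dgmor_comp m (adj rho)) (dgmor_comp cc (dgmor_comp q f)).
Proof.
move=> ecc; have [kk gk] := acyc_hull_semiinj K.
have aK : acyclic (coind phi (selfmod B) (acyc_hull K)).
  by apply/acyclicP => i; exact: (@acyclic_Kinj A (res (selfmod B)) (acyc_hull K) i kk (@acyc_hull_acyclic A K)).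
pose v := dgmor_comp (quo_pi (im_sub i2)) (coind_mor phi (sum_in1 (acyc_hull K) I)).
apply: (htpic_factor (u := adj (dgmor_comp (acyc_hull_in K) rho)) (v := v) (coind_Kinj kk) aK) => i x.
rewrite -[X in X + _]/(cc i (q i (f i x))) ecc.
rewrite -[X in _ + X]/(quo_pi (im_sub i2) i (coind_mor phi (sum_in1 (acyc_hull K) I) i (adj (dgmor_comp (acyc_hull_in K) rho) i x))).
rewrite -raddfD -[LHS]/(quo_pi (im_sub i2) i (coind_mor phi y i (adj rho i x))).
apply: (congr1 (quo_pi (im_sub i2) i)).
apply/eqP; rewrite -subr_eq0; apply/eqP/(ev_inj G gI').
apply: etrans (raddfB (ev phi I' i) _ _) _; apply/eqP; rewrite subr_eq0; apply/eqP.
apply: etrans (esym (raddfD (ev phi I' i) _ _)).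
have E1 : ev phi I' i (coind_mor phi y i (adj rho i x)) = y i (rho i x) := congr1 (y i) (adjE rho x).
have E2 : ev phi I' i (in2c i (f i x)) = in2 i (g i (rho i x)) := congr1 (in2 i) (esym (eg x)).
have E3 : ev phi I' i (coind_mor phi (sum_in1 (acyc_hull K) I) i (adj (dgmor_comp (acyc_hull_in K) rho) i x))
   = sum_in1 (acyc_hull K) I i (acyc_hull_in K i (rho i x)) := congr1 (sum_in1 (acyc_hull K) I i) (adjE (dgmor_comp (acyc_hull_in K) rho) x).
rewrite E1 E2 E3 -[RHS]/(0 + acyc_hull_in K i (rho i x), g i (rho i x) + 0) add0r addr0 //.
Qed.

(** Dualizing U_K -> [coker i2] -> C', with U_K coinduced from K: the quotient of U_K by X has dual
    vanishing above p - 2, so in degrees above p - 2 the dual of U_K is that of X, living in degree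
    p only. By the choice of f the map m is an isomorphism on H^p of the duals. This cancels the top
    degree p of the dual of C and leaves nothing above p - 1. *)
Lemma step_hdg j : p - 1 < j -> exact (hdg (coker (adj s')) S) j.
Proof.
have [n T] := ses_quot Sc adj_s' (adj_inj s'_inj).
have TD := pre_ses T (proj2 sS).
have [cc [qcc ecc]] := step_cc.
have qcc' := pre_qiso sS qcc.
have eC' i : p < i -> exact (hdg (coker i2) S) i.
  by move=> hi; apply: (proj2 (qiso_exact qcc' i)); apply: (st_hdg st).
have hE : forall i, p - 2 < i -> exact (hdg (coker (adj rho)) S) i.
  apply: (hdg_quot G D sX sK ir qr fX lX) => i hi; apply: hX; lia.
have U := pre_ses (coind_quot_ses ir) (proj2 sS).
have eU i : p - 2 < i -> i <> p -> exact (hdg (coind phi (selfmod B) K) S) i.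
  by move=> hi ne; apply: (ses_exactY U); [apply: hE|apply: hX].
have [a b] := proj1 (quasi_isoP _) qcc' p.
have h := @htpic_pre B _ _ _ _ (step_htpic ecc) S p.
have e1 (x : hdg (coker i2) S p) : pre S (dgmor_comp m (adj rho)) p x = pre S (adj rho) p (pre S m p x) by apply: hom_ext.
have e2 (x : hdg (coker i2) S p) : pre S (dgmor_comp cc (dgmor_comp q f)) p x = pre S (dgmor_comp q f) p (pre S cc p x) by apply: hom_ext.
have h' (x : hdg (coker i2) S p) : cyc x -> bnd (pre S (dgmor_comp cc (dgmor_comp q f)) p x - pre S (dgmor_comp m (adj rho)) p x).
  by move=> cx; rewrite -opprB; apply: bndN; apply: h.
have mj : Hinj (pre S m) p.
  by apply: (Hinj_compl e1); apply: (Hinj_homotopic h'); apply: (Hinj_comp e2).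
have ms : Hsurj (pre S m) p.
  apply: (Hsurj_compl e1); last by apply: (ses_gHinj U); apply: hE; lia.
  by apply: (Hsurj_homotopic h'); apply: (Hsurj_comp e2).
move=> hj; have [ej|ne] := EM (j = p).
  subst j; apply: (ses_exactX' TD (subrK 1 p)) => //.
  by apply: exact_Hsurj; apply: eU; lia.
apply: (ses_exactX' TD (subrK 1 j)); first by apply: exact_Hinj; apply: eC'; lia.
have [ej|ne'] := EM (j - 1 = p); first by rewrite ej.
by apply: exact_Hsurj; apply: eU; lia.
Qed.

Lemma step_stage : stage (p - 1) s'.
Proof.
split=> //; [move=> i|move=> i hi|exact: s'_inj|exact: step_hdg].
  have cf := coho_fg (proj1 pnA).
  apply: (coho_right cf Sy (erefl (i + 1))); last first.
    apply: (proj1 (coho_qiso cf qr _)); exact: (proj1 (fg_restrict phi0 X _)).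
  by apply: (proj1 (coho_qiso cf qin2 _)); apply: (st_fg st).
apply: (ses_exactZ Sy (erefl (i + 1))); last by apply: lK; lia.
by apply: (proj1 (qiso_exact qin2 i)); apply: (st_lo st).
Qed.
End OneStep.

(* I is replaced by the cone of a resolution of X mapping to I, which kills the
   part of degree p of the dual of the cokernel. *)
Lemma step p (I : dgmod A) (s : dgmor (res S) I) : stage p s -> p <= -2 ->
  exists (J : dgmod A) (jot : dgmor I J), [/\ stage (p - 1) (dgmor_comp jot s), forall i x, jot i x = 0 -> x = 0 &
    forall i, i < d0 - p - 1 -> Hinj jot i /\ Hsurj jot i].
Proof.
move=> st hp; have sI := st_semi st.
have Sa := coind_quot_ses (st_inj st).
have sC := quot_semiinj sS sI (st_inj st).
have fC := fg_coind_coker G sI (st_inj st) (dual_fg D) (st_fg st) (st_lo st).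
have [X [f0 [sX fX lX hX [jf sf]]]] := approx pnB D sC fC (st_hdg st).
(* The obstruction to lifting f0 from the quotient to Hom_A(B, I) lies in H^1 Hom(X, S), which
   vanishes because p <= -2 differs from 1. *)
have [|F cF eF] := les_lift (post_ses Sa X (proj2 sS)) (add0r 1) _ (hom_of_cyc f0).
  by apply: hX; lia.
pose f := mor_of cF.
have ef i x : f0 i x = quo_pi (im_sub (adj s)) i (f i x).
  by rewrite -(hom_ofE f0 (addr0 i)) -eF.
have [K [rho [sK qr ir]]] := resolution (res X).
have [|g eg] := ext_mor (coker_ses ir) (dgmor_comp (ev phi I) (res_mor phi f)) (proj2 sI).
  by apply: Kinj_acyclic; [case: sI|apply/(ses_qiso_left (coker_ses ir))].
pose qf := dgmor_comp (quo_pi (im_sub (adj s))) f.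
have e n (x : hdg (coker (adj s)) S n) : pre S qf n x = pre S f0 n x.
  by apply: hom_ext => i j h z; rewrite -[LHS]/(hf x h (quo_pi (im_sub (adj s)) i (f i z))) -ef.
have jf' : Hinj (pre S qf) p by move=> z cz; rewrite e; apply: jf.
have sf' : Hsurj (pre S qf) p by move=> w /sf[z [cz bz]]; exists z; rewrite e.
pose y := sum_mor (acyc_hull_in K) g.
exists (coker y), (dgmor_comp (quo_pi (im_sub y)) (tw_in (@sum_th A (acyc_hull K) I))); split.
  exact: (step_stage st hp sX fX lX hX jf' sf' sK qr ir eg).
  exact: (@jot_inj _ _ g).
move=> i hi; exact: (jot_H hp lX g qr hi).
Qed.
End Step.

(** * Colimit of the stages *)

Section Colimit.
Variables (A : cdgring) (I : nat -> dgmod A) (j : forall n, dgmor (I n) (I n.+1)).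

(** The default zero map makes [up n m] total in n and m: it is zero for n > m, so an element of
    stage n becomes a sequence that vanishes before n. *)
Definition cst n m : dgmor (I n) (I m) :=
  match @eqP _ n m with
  | ReflectT e => eq_rect n (fun k => dgmor (I n) (I k)) (dgmor_id (I n)) m e
  | ReflectF _ => zero_mor (I n) (I m)
  end.
Lemma cst_id n i x : cst n n i x = x.
Proof. by rewrite /cst; case: eqP => // e; rewrite (eq_irrelevance e erefl). Qed.

Fixpoint up n m : dgmor (I n) (I m) :=
  if m is m'.+1 then
    if n == m'.+1 then cst n m'.+1 else dgmor_comp (j m') (up n m')
  else cst n 0.
Lemma up_id n i x : up n n i x = x.
Proof. by case: n x => [|n] x /=; rewrite ?eqxx cst_id. Qed.
Lemma upS n m i x : (n <= m)%N -> up n m.+1 i x = j m i (up n m i x).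
Proof. by move=> h /=; case: eqP => // e; exfalso; lia. Qed.

Definition up_all n : dgmor (I n) (prodm I).
Proof.
apply: (@mkmor A (I n) (prodm I) (fun i x m => up n m i x)).
- by move=> i x y; apply: functional_extensionality_dep => m; apply: raddfB.
- by move=> i k h x; apply: functional_extensionality_dep => m; apply: cmor_d.
- by move=> i k l h a x; apply: functional_extensionality_dep => m; apply: mmor_act.
Defined.

Definition evc_sg i : subgroup (prodm I i).
Proof.
exists (fun x => exists m, forall n, (m <= n)%N -> x n.+1 = j n i (x n)).
  by exists 0%N => n _; apply/esym/raddf0.
move=> x y [m hm] [m' hm']; exists (m + m')%N => n hn.
by rewrite -[LHS]/(x n.+1 - y n.+1) hm ?hm' ?raddfB //; lia.
Defined.
Definition evc : submod (prodm I).
Proof.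
exists evc_sg.
- by move=> i k h x [m hm]; exists m => n hn; rewrite /= /prod_d hm // cmor_d.
- by move=> i k l h a x [m hm]; exists m => n hn; rewrite /= hm // mmor_act.
Defined.
Definition evz_sg i : subgroup (sub evc i).
Proof.
exists (fun x => exists m, forall n, (m <= n)%N -> sub_in evc i x n = 0).
  by exists 0%N.
move=> x y [m hm] [m' hm']; exists (m + m')%N => n hn.
by rewrite raddfB -[LHS]/(sub_in evc i x n - sub_in evc i y n) hm ?hm' ?subrr //; lia.
Defined.
Definition evz : submod (sub evc).
Proof.
exists evz_sg.
- by move=> i k h x [m hm]; exists m => n hn; rewrite -cmor_d -[LHS]/(df (I n) h (sub_in evc i x n)) hm // raddf0.
- by move=> i k l h a x [m hm]; exists m => n hn; rewrite mmor_act -[LHS]/(act h a (sub_in evc k x n)) hm // act0r.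
Defined.
(* Sequences that are eventually compatible, modulo those eventually zero. *)
Definition colim : dgmod A := quo evz.

Lemma up_evc n i x : evc i (up_all n i x).
Proof. by exists n => m hm; apply: upS. Qed.
Definition inc n : dgmor (I n) colim := dgmor_comp (quo_pi evz) (sub_lift (@up_evc n)).

Lemma incS n i x : inc n.+1 i (j n i x) = inc n i x.
Proof.
apply/eqP; rewrite -subr_eq0 -[X in X - _]/(quo_pi evz i (sub_lift (@up_evc n.+1) i (j n i x))).
rewrite -[X in _ - X]/(quo_pi evz i (sub_lift (@up_evc n) i x)) -raddfB; apply/eqP/quo_pi0.
exists n.+1 => m hm; rewrite raddfB -[LHS]/(up n.+1 m i (j n i x) - up n m i x).
elim: m hm => // m IH; rewrite leq_eqVlt => /orP[/eqP e|hm].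
  by move: e => [e]; subst m; rewrite up_id upS // up_id subrr.
by rewrite !upS //; [|lia]; rewrite -raddfB IH //= raddf0.
Qed.
Lemma inc_up n m i x : (n <= m)%N -> inc m i (up n m i x) = inc n i x.
Proof.
elim: m => [|m IH]; rewrite leq_eqVlt => /orP[/eqP e|hm] //; try by subst n; rewrite up_id.
by rewrite upS // incS IH.
Qed.
Lemma inc_surj i (c : colim i) : exists n x, inc n i x = c.
Proof.
have [x <-] := quo_pi_surj c; have [m hm] := sg_prop x.
exists m, (sub_in evc i x m); apply/eqP; rewrite -subr_eq0 -[X in X - _]/(quo_pi evz i (sub_lift (@up_evc m) i (sub_in evc i x m))).
rewrite -raddfB; apply/eqP/quo_pi0; exists m => n hn.
rewrite raddfB -[LHS]/(up m n i (sub_in evc i x m) - sub_in evc i x n).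
elim: n hn => [|n IH]; rewrite leq_eqVlt => /orP[/eqP e|hn] //; try by subst m; rewrite up_id subrr.
by rewrite upS // (hm _ hn : sub_in evc i x n.+1 = _) -raddfB IH //= raddf0.
Qed.

Hypothesis jinj : forall n i x, j n i x = 0 -> x = 0.
Lemma up_inj n m i x : (n <= m)%N -> up n m i x = 0 -> x = 0.
Proof.
elim: m => [|m IH]; rewrite leq_eqVlt => /orP[/eqP e|hm] //; try by subst n; rewrite up_id.
by rewrite upS // => /jinj; apply: IH.
Qed.
Lemma inc_inj n i x : inc n i x = 0 -> x = 0.
Proof.
move=> /quo_pi0[m hm]; apply: (@up_inj n (n + m)); first exact: leq_addr.
by apply: hm; apply: leq_addl.
Qed.
Lemma inc_inj' n i x y : inc n i x = inc n i y -> x = y.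
Proof. by move=> e; apply/eqP; rewrite -subr_eq0; apply/eqP/(@inc_inj n); apply: etrans (raddfB (inc n i) _ _) _; rewrite e subrr. Qed.

Section Range.
Variables (n : nat) (i : int).
Hypothesis hj : forall k, (n <= k)%N -> Hinj (j k) i /\ Hsurj (j k) i.
Lemma up_H k : (n <= k)%N -> Hinj (up n k) i /\ Hsurj (up n k) i.
Proof.
elim: k => [|k IH]; rewrite leq_eqVlt => /orP[/eqP e|hk] //; try (subst n; split).
- by move=> z cz; rewrite up_id.
- by move=> w cw; exists w; rewrite up_id subrr; split=> //; apply: bnd0.
- by move=> z cz; rewrite up_id.
- by move=> w cw; exists w; rewrite up_id subrr; split=> //; apply: bnd0.
have [a b] := IH hk; have [c d] := hj hk.
have E x : up n k.+1 i x = j k i (up n k i x) by apply: upS.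
by split; [apply: (Hinj_comp E)|apply: (Hsurj_comp E)].
Qed.
Lemma inc_H : Hinj (inc n) i /\ Hsurj (inc n) i.
Proof.
split=> [z cz /(bnd_at (subrK 1 i))[c ec]|w cw].
  have [m [y ey]] := inc_surj c; have hn := leq_addr m n; have hm := leq_addl n m.
  have [a _] := up_H hn; apply: (a _ cz); exists (i - 1), (subrK 1 i), (up m (n + m) _ y).
  by apply: (@inc_inj' (n + m)); rewrite inc_up // -cmor_d inc_up // ey ec.
have [m [y ey]] := inc_surj w; have hn := leq_addr m n; have hm := leq_addl n m.
have cy : cyc (up m (n + m) i y).
  by move=> l h; apply: (@inc_inj (n + m)); rewrite -cmor_d inc_up // ey cw.
have [_ b] := up_H hn; have [z [cz bz]] := b _ cy; exists z; split=> //.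
by rewrite -ey -(inc_up y hm) -(inc_up z hn) -raddfB; apply: bnd_mor.
Qed.
End Range.
End Colimit.

(** The cokernel of f, made injective, is exact below z - 1, and since B lies in nonpositive degrees
    so is the module coinduced from it. The passage to the cokernel costs the one degree. *)
Lemma coind_H (A B : cdgring) (phi : dgrmor A B) (K J : dgmod A) (f : dgmor K J) z :
  semiinj K -> semiinj J -> (forall i, 0 < i -> exact (restrict_dg phi (selfmod B)) i) ->
  (forall i, i < z -> Hinj f i /\ Hsurj f i) ->
  forall i, i < z - 1 -> Hinj (coind_mor phi f) i /\ Hsurj (coind_mor phi f) i.
Proof.
move=> sK sJ uB hf i hi; pose y := sum_mor (acyc_hull_in K) f.
have iy l x : y l x = 0 -> x = 0 by move/(congr1 fst); apply: acyc_hull_in_inj.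
have S := coker_ses iy.
have sI : semiinj (sum (acyc_hull K) J) by apply: (ses_semiinj_mid (tw_ses (@sum_th _ _ _))) => //; apply: acyc_hull_semiinj.
have sQ := ses_semiinj_right S sK sI.
pose pr := sum_pr2 (acyc_hull K) J.
have qp : quasi_iso pr by apply: (ses_qiso_right (sum_ses _ _)); apply: acyc_hull_acyclic.
have lQ l : l < z - 1 -> exact (coker y) l.
  move=> hl; have E k x : f k x = pr k (y k x) by [].
  have [[a b] [c d]] := (hf (l + 1) ltac:(lia), hf l ltac:(lia)).
  have [e _] := proj1 (quasi_isoP _) qp l.
  apply: (ses_exactZ' S (erefl (l + 1))).
    exact: (Hsurj_compl (@E l)).
  exact: (Hinj_compl (@E (l + 1))).
have hQ l : l < z - 1 -> exact (coind phi (selfmod B) (coker y)) l.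
  by move=> hl; apply: (@hom_bounds A (restrict_dg phi (selfmod B)) (coker y) 0 (z - 1) l sQ lQ uB); lia.
have T := coind_ses phi S (proj2 sK).
have [a b] := proj1 (quasi_isoP _) (coind_qiso phi (proj1 sI) sJ qp) i.
have E x : coind_mor phi f i x = coind_mor phi pr i (coind_mor phi y i x) by apply: hom_ext.
split.
  by apply: (Hinj_comp E) => //; apply: (ses_Hinj T (subrK 1 i)); apply: hQ; lia.
by apply: (Hsurj_comp E) => //; apply: (ses_Hsurj T); apply: hQ.
Qed.

Section Realize.
Variables (A B : cdgring) (phi : dgrmor A B) (G : H0_map phi).
Local Notation res := (restrict_dg phi).
Variables (S : dgmod B) (d0 d1 : int) (D : dual S d0 d1).
Let sS := dual_semi D.
Let pnA := H0_map_pnA G.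
Let pnB := H0_map_pnB G.

Lemma tower : exists (I : nat -> dgmod A) (j : forall n, dgmor (I n) (I n.+1)) (s : forall n, dgmor (res S) (I n)),
  [/\ forall n, stage d0 (-2 - n%:Z) (s n), forall n i x, s n.+1 i x = j n i (s n i x),
    forall n i x, j n i x = 0 -> x = 0 &
    forall n i, i < d0 + 1 + n%:Z -> Hinj (j n) i /\ Hsurj (j n) i].
Proof.
pose T n := {I : dgmod A & {s : dgmor (res S) I | stage d0 (-2 - n%:Z) s}}.
pose R n (a : T n) (b : T n.+1) := exists j : dgmor (projT1 a) (projT1 b),
  (forall i x, sval (projT2 b) i x = j i (sval (projT2 a) i x)) /\
  (forall i x, j i x = 0 -> x = 0) /\ forall i, i < d0 + 1 + n%:Z -> Hinj j i /\ Hsurj j i.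
have [I0 [s0 st0]] := stage0 G D.
have [|F [_ hF]] := @dep_choice T R (existT _ I0 (exist _ s0 st0)).
  move=> n [I [s st]]; have [|J [j [stJ ij hj]]] := step G D st; first by lia.
  have e : -2 - n%:Z - 1 = -2 - n.+1%:Z by lia.
  rewrite e in stJ; exists (existT _ J (exist _ _ stJ)); exists j; split=> //; split=> [|i hi]; first exact: ij.
  by apply: hj; lia.
exists (fun n => projT1 (F n)), (fun n => sval (cid (hF n))), (fun n => sval (projT2 (F n))); split.
- by move=> n; exact: (svalP (projT2 (F n))).
- by move=> n; have [? []] := svalP (cid (hF n)).
- by move=> n; have [? []] := svalP (cid (hF n)).
- by move=> n; have [? []] := svalP (cid (hF n)).
Qed.

(** By biduality the cokernel is the dual of Hom(C, S), which is bounded above by p; hence it starts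
    no lower than degree d0 - p. *)
Lemma stage_H p (I : dgmod A) (s : dgmor (res S) I) i : stage d0 p s -> i < d0 - p ->
  Hinj (adj s) i /\ Hsurj (adj s) i.
Proof.
move=> st hi; have Sa := coind_quot_ses (st_inj st).
have fC := fg_coind_coker G (st_semi st) (st_inj st) (dual_fg D) (st_fg st) (st_lo st).
have lC l : l < d0 - p -> exact (coker (adj s)) l.
  move=> hl; apply: (proj2 (qiso_exact (delta_qiso pnB D fC) l)).
  exact: (dual_lo D (st_hdg st)).
by split; [apply: (ses_Hinj Sa (subrK 1 i)); apply: lC; lia|apply: (ses_Hsurj Sa); apply: lC].
Qed.

(** Every degree of the colimit and of its coinduction is settled at a finite stage: stage n already
    agrees with the colimit below d0 + 1 + n, which also bounds and makes finite the cohomology of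
    J. *)
Lemma realize : exists (J : dgmod A) (tau : dgmor S (coind phi (selfmod B) J)),
  [/\ semiinj J, forall i, fg J i, forall i, i < d0 -> exact J i & quasi_iso tau].
Proof.
have [I [j [s [st ej jinj hj]]]] := tower.
have hI n i : i < d0 + 1 + n%:Z -> Hinj (inc j n) i /\ Hsurj (inc j n) i.
  by move=> hi; apply: inc_H => // k hk; apply: hj; lia.
have [J [u [sJ qu _]]] := resolution (colim j).
have big i : exists n : nat, i < d0 + n%:Z by exists (absz (i - d0 + 1)); lia.
pose t n := dgmor_comp u (dgmor_comp (inc j n) (s n)).
have tS n i x : t n i x = t 0%N i x.
  elim: n => // n <-; rewrite -[LHS]/(u i (inc j n.+1 i (s n.+1 i x))) ej incS //.
exists J, (adj (t 0%N)); split=> //.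
- move=> i; have [n hn] := big i; have [|_ b] := hI n i; first by lia.
  apply: (proj1 (coho_qiso (coho_fg (proj1 pnA)) qu i)); apply: (fg_Hsurj b).
  exact: (st_fg (st n)).
- move=> i hi; have [|_ b] := hI 0%N i; first by lia.
  by apply: (proj1 (qiso_exact qu i)); apply: (Hsurj_exact b); apply: (st_lo (st 0%N)).
apply/quasi_isoP => i; have [n hn] := big i.
have [a b] := stage_H (i := i) (st n) ltac:(lia).
pose v := dgmor_comp u (inc j n).
have hv k : k < d0 + 1 + n%:Z -> Hinj v k /\ Hsurj v k.
  move=> hk; have [c d] := hI n k hk; have [e f] := proj1 (quasi_isoP _) qu k.
  have E x : v k x = u k (inc j n k x) by [].
  by split; [apply: (Hinj_comp E)|apply: (Hsurj_comp E)].
have [|c d] := coind_H (i := i) (st_semi (st n)) sJ (proj2 (H0_map_D G)) hv; first by lia.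
have E x : adj (t 0%N) i x = coind_mor phi v i (adj (s n) i x).
  apply: (@coind_mor_ext _ _ phi J S (adj (t 0%N)) (dgmor_comp (coind_mor phi v) (adj (s n)))) => k y.
  rewrite adjE -(tS n); exact: (congr1 (v k) (esym (adjE (s n) y))).
by split; [apply: (Hinj_comp E)|apply: (Hsurj_comp E)].
Qed.
End Realize.

(** * Modules in a single degree and descent to B *)

Section Low.
Variables (A : cdgring) (Z : dgmod A) (p : int) (hZ : forall i (x : Z i), p < i -> x = 0).
Definition low_sg i : subgroup (Z i).
Proof.
exists (fun x => p <= i -> bnd x).
  by move=> _; apply: bnd0.
by move=> x y hx hy e; apply: bndB; [apply: hx|apply: hy].
Defined.
(** Z is already zero above p; dividing out everything below p and the boundaries in degree p leaves
    H^p(Z) placed in degree p. *)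
Definition low : submod Z.
Proof.
exists low_sg.
- by move=> i j h x _ _; apply: bnd_d.
- move=> i j k h a x hx hk; have [hi|hi] := ltP 0 i.
    by rewrite (dg_nonpos hi a) act0l; apply: bnd0.
  have [e|ne] := EM (i = 0); last by rewrite (@hZ _ x); [rewrite act0r; apply: bnd0|lia].
  subst i; have e : j = k by lia.
  case: k / e h hk => h hk; rewrite (act_irr h (add0r j)); apply: act_bnd0; exact: hx.
Defined.
Lemma quo_low0 i (c : quo low i) : i <> p -> c = 0.
Proof.
move=> ne; have [z <-] := quo_pi_surj c; apply/quo_pi0 => hi.
by rewrite (@hZ _ z); [apply: bnd0|lia].
Qed.
Lemma quo_low_qiso : (forall i, i <> p -> exact Z i) -> quasi_iso (quo_pi low).
Proof.
move=> hE; apply/quasi_isoP => i; have [e|ne] := EM (i = p); last first.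
  split; first exact/exact_Hinj/hE.
  by move=> w cw; exists 0; rewrite raddf0 (quo_low0 w ne) subr0; split; [apply: cyc0|apply: bnd0].
subst i; split.
  move=> z cz /(bnd_at (subrK 1 p))[u]; rewrite (quo_low0 u); last by lia.
  by rewrite raddf0 => /esym/quo_pi0; apply.
move=> w cw; have [z ez] := quo_pi_surj w; exists z; rewrite ez subrr; split; last exact: bnd0.
by move=> k h; apply: hZ; lia.
Qed.
End Low.

Section Descend.
Variables (A B : cdgring) (phi : dgrmor A B).
Hypothesis surj : forall i (b : B i), exists a, phi i a = b.
Variable M : dgmod A.
Hypothesis hk : forall i j k (h : i + j = k) a (x : M j), phi i a = 0 -> act h a x = 0.
Let lf i (b : B i) : A i := sval (cid (surj b)).
Let lfK i b : phi i (@lf i b) = b. Proof. by rewrite /lf; case: cid. Qed.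
Let hk' i j k (h : i + j = k) a a' (x : M j) : phi i a = phi i a' -> act h a x = act h a' x.
Proof. by move=> e; apply/eqP; rewrite -subr_eq0 -actBl; apply/eqP/hk; rewrite raddfB /= e subrr. Qed.
Definition descend : dgmod B.
Proof.
exists M (fun i j k h b x => act h (lf b) x).
- by move=> i j k h b b' x; rewrite -actDl; apply: hk'; rewrite raddfD /= !lfK.
- by move=> *; apply: actDr.
- move=> i j k ij jk ijk h1 h2 h3 h4 b b' x; rewrite -(actA h1 h2); apply: hk'.
  by rewrite rmor_mul !lfK.
- by move=> i h x; rewrite -[RHS](act1 h); apply: hk'; rewrite lfK rmor_one.
- move=> i j k i' j' k' h hi hj hk2 h1 h2 b x.
  rewrite (act_d h hi hj hk2 h1 h2); congr (_ + _).
  by apply: hk'; rewrite -cmor_d !lfK.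
Defined.
Definition descend_mor : dgmor (restrict_dg phi descend) M.
Proof.
apply: (@mkmor A (restrict_dg phi descend) M (fun i x => x)) => // i j k h a x.
by apply: hk'; rewrite lfK.
Defined.
Lemma descend_qiso : quasi_iso descend_mor.
Proof. by apply: bij_quasi_iso => // i y; exists y. Qed.
End Descend.

(* A module concentrated in one degree is annihilated by ker phi. *)
Lemma single (A B : cdgring) (phi : dgrmor A B) (G : H0_map phi) (M : dgmod A) p :
  (forall i, i <> p -> exact M i) ->
  exists M' : dgmod B, forall h, coho h -> forall j, h M j <-> h (restrict_dg phi M') j.
Proof.
move=> hM; set Z := tau p M.
have qZ : quasi_iso (tau_in p M).
  apply/quasi_isoP => i; have [hi|hi] := leP i p; first by split; [apply: tau_Hinj|apply: tau_Hsurj].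
  split; first by apply/exact_Hinj/tau_hi.
  by apply/exact_Hsurj/hM; lia.
have Z0 i (x : Z i) : p < i -> x = 0 by apply: tau_0.
have eZ i : i <> p -> exact Z i by move=> ne; apply: tau_exact; apply: hM.
pose Q := quo (low Z0).
have Q0 i (c : Q i) : i <> p -> c = 0 by apply: quo_low0.
have hk i j k (h : i + j = k) a (x : Q j) : phi i a = 0 -> act h a x = 0.
  move=> e0; have [ej|ne] := EM (j = p); last by rewrite (Q0 _ x ne) act0r.
  have [ei|ni] := EM (i = 0); last by apply: Q0; lia.
  (* An element a of degree 0 in the kernel is d a', so a x = d(a' x) up to a term a' d x; both a' x
     and d x lie outside degree p, where Q is zero. *)
  subst i; have [i [hi [a' ea]]] := H0_map_ker0 G e0.
  have e1 : i + j = k - 1 by lia.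
  have e2 : i + (j + 1) = k by lia.
  have := act_d e1 hi erefl (subrK 1 k) h e2 a' x.
  rewrite ea (Q0 _ (act e1 a' x)); last by lia.
  rewrite (Q0 _ (df Q erefl x)); last by lia.
  by rewrite raddf0 act0r ksgn0 addr0 => <-.
exists (descend (H0_map_surj G) hk) => h H j.
rewrite (coho_qiso H (descend_qiso (H0_map_surj G) hk)).
rewrite -(coho_qiso H (quo_low_qiso Z0 eZ)).
by rewrite (coho_qiso H qZ).
Qed.

Section UnionHom.
Variables (A : cdgring) (M J : dgmod A) (W : nat -> dgmod A).
Variables (inW : forall n, dgmor (W n) M) (jW : forall n, dgmor (W n) (W n.+1)).
Arguments inW : clear implicits.
Hypothesis inI : forall n i x y, inW n i x = inW n i y -> x = y.
Hypothesis injE : forall n i x, inW n.+1 i (jW n i x) = inW n i x.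
Hypothesis cov : forall i, exists n, forall x : M i, exists y, inW n i y = x.
Variables (d : int) (g : forall n, hom (W n) J d).
Hypothesis gE : forall n, pre_hom (jW n) (g n.+1) = g n.

Let in_up n m i x : (n <= m)%N -> inW m i (up jW n m i x) = inW n i x.
Proof.
elim: m => [|m IH]; rewrite leq_eqVlt => /orP[/eqP e|hm] //; try by subst n; rewrite up_id.
by rewrite upS // injE IH.
Qed.
Let g_up n m i j (h : i + d = j) x : (n <= m)%N -> hf (g m) h (up jW n m i x) = hf (g n) h x.
Proof.
elim: m => [|m IH]; rewrite leq_eqVlt => /orP[/eqP e|hm] //; try by subst n; rewrite up_id.
rewrite upS // -IH // -(gE m) //.
Qed.
Let g_eq n m i j (h : i + d = j) x y : inW n i x = inW m i y -> hf (g n) h x = hf (g m) h y.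
Proof.
move=> e; rewrite -(g_up h x (leq_addr m n)) -(g_up h y (leq_addl n m)); congr hf.
by apply: (@inI (n + m)); rewrite !in_up ?leq_addr ?leq_addl.
Qed.
Let N i := sval (cid (cov i)).
Let pk i (x : M i) : W (N i) i := sval (cid (svalP (cid (cov i)) x)).
Let pkE i (x : M i) : inW _ i (pk x) = x.
Proof. exact: (svalP (cid (svalP (cid (cov i)) x))). Qed.
Lemma union_hom : exists f : hom M J d, forall n i j (h : i + d = j) y, hf f h (inW n i y) = hf (g n) h y.
Proof.
unshelve eexists.
  exists (fun i j h x => hf (g (N i)) h (pk x)).
  - by move=> i j h x y; rewrite -hfD; apply: g_eq; rewrite raddfD /= !pkE.
  - move=> p i j k l hp hk hn hl a x.
    by rewrite -(hf_act (g (N i)) hp hk hn hl); apply: g_eq; rewrite mmor_act !pkE.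
by move=> n i j h y; apply: g_eq; rewrite pkE.
Qed.
End UnionHom.

Section TauTower.
Variables (A : cdgring) (M : dgmod A).
Lemma tau_mono m m' : m <= m' -> exists j : dgmor (tau m M) (tau m' M),
  forall i x, tau_in m' M i (j i x) = tau_in m M i x.
Proof.
move=> hm; have h i (x : tau m M i) : trle m' M i (tau_in m M i x).
  have [hx cx] := sg_prop x; split=> hi; first by apply: hx; lia.
  by apply: cx; lia.
by exists (sub_lift h).
Qed.

Variables (J : dgmod A) (sJ : semiinj J) (d1 k : int).
Hypothesis hS : forall p (Z : dgmod A), (forall i, i <> p -> exact Z i) -> forall j, d1 - p < j -> exact (hdg Z J) j.
Hypothesis lM : forall i, i < k -> exact M i.

(* A bounding cochain is built on the truncations of M one degree at a time; the
   obstructions live on modules with cohomology in a single degree. *)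
Lemma hdg_hi j : d1 - k < j -> exact (hdg M J) j.
Proof.
move=> hj f cf; pose m (n : nat) := k - 1 + n%:Z.
pose W n := tau (m n) M; pose iW n := tau_in (m n) M : dgmor (W n) M.
have ex n : exists w : dgmor (W n) (W n.+1), forall i x, iW n.+1 i (w i x) = iW n i x.
  by apply: tau_mono; rewrite /m; lia.
pose jW n := sval (cid (ex n)).
have jE n i x : iW n.+1 i (jW n i x) = iW n i x by rewrite /jW; case: cid.
have iI n i x y : iW n i x = iW n i y -> x = y by apply: (ses_inj' (tau_ses (m n) M)).
have jI n i x : jW n i x = 0 -> x = 0.
  by move=> e; apply: (@iI n); rewrite -jE e !raddf0.
have S n := coker_ses (@jI n).
(* Passing from one truncation to the next adds cohomology in degree [m n.+1] only, so [hS] applies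
   to each cokernel. *)
have hZ n i : i <> m n.+1 -> exact (coker (jW n)) i.
  move=> ne; have [l|l] := leP i (m n).
    have E x : iW n i x = iW n.+1 i (jW n i x) by rewrite jE.
    have l' : i <= m n.+1 by move: l; rewrite /m; lia.
    have js : Hsurj (jW n) i.
      by apply: (Hsurj_compl E); [apply: tau_Hsurj|apply: tau_Hinj].
    apply: (ses_exactZ' (S n) (erefl (i + 1))) => //.
    have [l2|l2] := leP (i + 1) (m n).
      have E' x : iW n (i + 1) x = iW n.+1 (i + 1) (jW n (i + 1) x) by rewrite jE.
      by apply: (Hinj_compl E'); apply: tau_Hinj.
    by apply/exact_Hinj/tau_hi.
  apply: (ses_exactZ (S n) (erefl (i + 1))); apply: tau_hi; move: ne l; rewrite /m; lia.
have cov i : exists n, forall x : M i, exists y, iW n i y = x.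
  exists (absz (i - k + 2)) => x; apply: tau_mk'; rewrite /m; lia.
pose T n := {g : hdg (W n) J (j - 1) | df (hdg (W n) J) (subrK 1 j) g = pre J (iW n) j f}.
have e0 : exact (hdg (W 0%N) J) j.
  apply: Kinj_acyclic; first by case: sJ.
  apply/acyclicP => i; have [l|l] := leP i (m 0%N); last exact: tau_hi.
  by apply: tau_exact; apply: lM; move: l; rewrite /m; lia.
have [g0 hg0] := bnd_at (subrK 1 j) (e0 _ (cyc_mor (pre J (iW 0%N)) cf)).
have [|F [_ hF]] := @dep_choice T (fun n a b => pre J (jW n) _ (sval b) = sval a) (exist _ g0 hg0).
  move=> n [g hg].
  have [|||g' eg' dg'] := les_rel (pre_ses (S n) (proj2 sJ)) (h := subrK 1 j) (y := pre J (iW n.+1) j f) (z := g).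
  - by apply: (hS (hZ n)); rewrite /m; lia.
  - exact: cyc_mor.
  - by rewrite hg; apply: hom_ext => i l h x; exact: (congr1 (hf f h) (esym (jE n i x))).
  by exists (exist _ g' dg').
have [g hg] := union_hom iI jE cov (g := fun n => sval (F n)) hF.
exists (j - 1), (subrK 1 j), (g : hdg M J (j - 1)); apply: hom_ext => i l h x.
have [n hn] := cov i; have [y ey] := hn x.
have e1 : i + (j - 1) + 1 = l by lia.
have e2 : i + 1 + (j - 1) = l by lia.
rewrite -[LHS]/(hf (hom_d (subrK 1 j) g) h x) (hom_dE (subrK 1 j) g h erefl e1 erefl e2).
rewrite -ey cmor_d !hg -(hom_dE (subrK 1 j) (sval (F n)) h erefl e1 erefl e2).
exact: (hf_eq h y (svalP (F n))).
Qed.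
End TauTower.

Section CoindDelta.
Variables (A B : cdgring) (phi : dgrmor A B) (J : dgmod A) (M : dgmod B).
Local Notation res := (restrict_dg phi).
Local Notation S := (coind phi (selfmod B) J).
Lemma kap_delta i (x : M i) :
  kap phi J (hdg M S) i (delta S M i x) = pre J (kap phi J M) i (delta J (res M) i x).
Proof.
apply: hom_ext => n j h f; have e : i + n = j by lia.
rewrite -[RHS]/(hf (delta_hom J (M := res M) x) h (kap phi J M n f)) (@delta_homE A J (res M) i x n j h e (kap phi J M n f)).
rewrite -[LHS]/(ev phi J j (hf (delta_hom S x) h f)) (delta_homE x h e) (ksgn_mor (ev phi J j)) //.
Qed.
(** The adjunction, used for M and for its dual, identifies the double dual over B into S with the
    double dual over A into J, compatibly with biduality. *)
Lemma delta_res_qiso : semiinj J -> quasi_iso (delta S M) -> quasi_iso (delta J (res M)).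
Proof.
move=> sJ q; have qk X := @kap_qiso A B phi J X.
apply: (@qiso_compl _ _ _ (delta J (res M)) (pre J (kap phi J M)) (dgmor_comp (kap phi J (hdg M S)) (res_mor phi (delta S M)))).
- by move=> i x; apply: kap_delta.
- apply: (@qiso_comp _ _ _ (res_mor phi (delta S M)) (kap phi J (hdg M S))) => //.
  exact: (@qiso_eq M (hdg (hdg M S) S) (delta S M) (res_mor phi (delta S M)) (fun i x => erefl) q).
- exact: pre_qiso.
Qed.
End CoindDelta.

Section DualLift.
Variables (A B : cdgring) (phi : dgrmor A B) (G : H0_map phi).
Local Notation res := (restrict_dg phi).
Let pnA := H0_map_pnA G.
Let pnB := H0_map_pnB G.
Let phi0 := @H0_map_surj _ _ _ G 0.
Variables (J : dgmod A) (d0 d1 : int).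
Local Notation S := (coind phi (selfmod B) J).
Hypotheses (sJ : semiinj J) (fJ : forall i, fg J i) (lJ : forall i, i < d0 -> exact J i) (D : dual S d0 d1).

Lemma lift_lo (M : dgmod A) k : (forall i, k < i -> exact M i) -> forall j, j < d0 - k -> exact (hdg M J) j.
Proof. by move=> uM j hj; apply: (hom_bounds sJ lJ uM). Qed.

Lemma lift_hi (M : dgmod A) k : (forall i, i < k -> exact M i) -> forall j, d1 - k < j -> exact (hdg M J) j.
Proof.
move=> lM; apply: (hdg_hi sJ _ lM) => p Z hZ j hj.
have [M' hM'] := single G hZ.
have lM' i : i < p -> exact M' i.
  by move=> hi; apply: (proj1 (hM' _ (coho_exact A) i)); apply: hZ; lia.
have := proj2 (hM' _ (coho_hdg (coho_exact A) sJ) (- j)); rewrite opprK; apply.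
by apply: (proj1 (@kap_exact A B phi J M' j)); apply: (dual_hi D lM').
Qed.

Local Notation h := (fun (M : dgmod A) j => exact (fib (delta J M)) j).
Let H : coho h := coho_delta sJ.

Lemma lift_single M p : (forall i, fg M i) -> (forall i, i <> p -> exact M i) -> forall j, h M j.
Proof.
move=> fM hM j; have [M' hM'] := single G hM; apply: (proj2 (hM' _ H j)).
have fM' i : fg M' i by apply: (proj2 (fg_restrict phi0 _ _)); apply: (proj1 (hM' _ (coho_fg (proj1 pnA)) i)).
move: j; apply/fib_quasi_iso; apply: delta_res_qiso => //; exact: (delta_qiso pnB D).
Qed.

Lemma fg_tau m (M : dgmod A) : (forall i, fg M i) -> forall i, fg (tau m M) i.
Proof.
move=> fM i; have [e|e] := leP i m; last by apply: fg_exact; apply: tau_hi.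
by apply: (fg_Hinj (proj1 pnA) (f := tau_in m M)) (fM i); apply: tau_Hinj.
Qed.

Lemma lift_bounded (n : nat) : forall (M : dgmod A) l, (forall i, fg M i) -> (forall i, i < l -> exact M i) ->
  (forall i, l + n%:Z < i -> exact M i) -> forall j, h M j.
Proof.
elim: n => [|n IH] M l fM lM uM j.
  by apply: (lift_single (p := l)) => // i ne; have [e|e] := ltP i l; [apply: lM|apply: uM; lia].
apply: (coho_mid H (tau_ses (l + n%:Z) M)).
  apply: (IH _ l); [exact: fg_tau|by move=> i hi; apply: tau_exact; apply: lM|by move=> i; apply: tau_hi].
apply: (lift_single (p := l + n.+1%:Z)); first exact: fg_tauq.
move=> i ne; have [e|e] := leP i (l + n%:Z); first exact: tauq_lo.
by apply: tauq_exact; apply: uM; lia.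
Qed.

(** A may have cohomology in infinitely many negative degrees, so it is cut at m far below j. The
    lower part and its double dual both vanish near j by the bounds; the upper part is bounded and
    reduces to single degrees. *)
Lemma lift_unit j : h (selfmod A) j.
Proof.
pose c : int := (absz (d1 - d0)).+2%:Z; pose m := j - c - 1; have fA := proj1 (A_Dminus pnA).
apply: (coho_mid H (tau_ses m (selfmod A))).
  have um i : m < i -> exact (tau m (selfmod A)) i by apply: tau_hi.
  apply: (fib_exact_at (subrK 1 j)); first by apply: um; rewrite /m /c; lia.
  by apply: (lift_hi (k := d0 - m)); [apply: lift_lo um|rewrite /m /c; lia].
apply: (@lift_bounded (absz m) _ m); first exact: fg_tauq.
  by move=> i hi; apply: tauq_lo; lia.
by move=> i hi; apply: tauq_exact; apply: A_exact; lia.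
Qed.

Lemma lift_dual : dual J d0 d1.
Proof.
split=> //; [exact: lift_lo|exact: lift_hi|].
by apply/(delta_self_qiso sJ)/fib_quasi_iso/lift_unit.
Qed.
End DualLift.

Lemma dual_lift (A B : cdgring) (phi : dgrmor A B) (S : dgmod B) d0 d1 : H0_map phi -> dual S d0 d1 ->
  exists (J : dgmod A) (tau : dgmor S (coind phi (selfmod B) J)), dual J d0 d1 /\ quasi_iso tau.
Proof.
move=> G D; have [J [tau [sJ fJ lJ q]]] := realize G D; exists J, tau; split=> //.
have DS := dual_qiso (H0_map_pnB G) D (coind_semiinj phi sJ) q.
exact: (lift_dual G sJ fJ lJ DS).
Qed.

(** * Zigzags *)

Section Zigzags.
Variable A : cdgring.

Lemma quasi_iso_surj (M N : complex) (s : cplxmor M N) : quasi_iso s ->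
  forall i (c : cohomology N i), exists b, cohomology_map s b = c.
Proof. by move=> h i c; have [g _ gK] := h i; exists (g c). Qed.

(** D(A) is given by formal words, so an invariant is needed to conclude anything from an
    isomorphism there; the action on cohomology is enough to recover quasi-isomorphisms. *)
Fixpoint Hz (M N : dgmod A) (f : zigzag M N) i : cohomology M i -> cohomology N i :=
  match f in zigzag M N return cohomology M i -> cohomology N i with
  | zmor _ _ f => fun c => cohomology_map f c
  | zinv _ _ s hs => fun c => sval (cid (quasi_iso_surj hs c))
  | zcomp _ _ _ g f => fun c => Hz g (Hz f c)
  end.

Lemma cohomology_map_id (M : complex) i (c : cohomology M i) : cohomology_map (cplx_id M) c = c.
Proof. by rewrite -[in LHS](repK c) cohomology_mapE -[RHS]repK; congr cls; apply: val_inj. Qed.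
Lemma cohomology_map_comp (M N P : complex) (g : cplxmor N P) (f : cplxmor M N) (k : cplxmor M P) i
  (E : forall x, k i x = g i (f i x)) (c : cohomology M i) :
  cohomology_map k c = cohomology_map g (cohomology_map f c).
Proof. by rewrite -[c]repK !cohomology_mapE; congr cls; apply: val_inj; apply: E. Qed.

Lemma zinvK (M N : dgmod A) (s : dgmor N M) (hs : quasi_iso s) i (c : cohomology M i) :
  cohomology_map s (Hz (zinv hs) c) = c.
Proof. exact: (svalP (cid (quasi_iso_surj hs c))). Qed.

Lemma Hz_eq (M N : dgmod A) (f g : zigzag M N) : zeq f g -> forall i c, @Hz M N f i c = Hz g c.
Proof.
elim=> //= {M N f g}.
- by move=> M N f g h _ E1 _ E2 i c; rewrite E1 E2.
- by move=> M N P g g' f f' _ Eg _ Ef i c; rewrite Ef Eg.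
- by move=> M N f i c; rewrite cohomology_map_id.
- by move=> M N f i c; rewrite cohomology_map_id.
- by move=> M N P g f i c; rewrite (@cohomology_map_comp _ _ _ g f).
- move=> M N s hs i c; rewrite cohomology_map_id.
  exact: (bij_inj (hs i) (zinvK hs (cohomology_map s c))).
- by move=> M N s hs i c; rewrite cohomology_map_id; exact: (zinvK hs).
Qed.

Lemma is_iso_H (M N : dgmod A) (f : zigzag M N) : is_iso f -> forall i, bijective (@Hz M N f i).
Proof.
move=> [g [/Hz_eq gf /Hz_eq fg]] i; exists (@Hz N M g i) => c.
  by have := gf i c; rewrite /= cohomology_map_id.
by have := fg i c; rewrite /= cohomology_map_id.
Qed.

Lemma zmor_iso (M N : dgmod A) (f : dgmor M N) : quasi_iso f -> is_iso (zmor f).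
Proof. by move=> q; exists (zinv q); split; [apply: zeq_invl|apply: zeq_invr]. Qed.
Lemma zmor_isoP (M N : dgmod A) (f : dgmor M N) : is_iso (zmor f) <-> quasi_iso f.
Proof. by split=> [/is_iso_H|/zmor_iso]. Qed.
Lemma zcomp_iso (M N P : dgmod A) (g : zigzag N P) (f : zigzag M N) : is_iso g -> is_iso f -> is_iso (zcomp g f).
Proof.
have E (X Y Z : dgmod A) (a : zigzag Y Z) (b : zigzag X Y) (a' : zigzag Z Y) (b' : zigzag Y X) :
    zeq (zcomp a' a) (zmor (dgmor_id Y)) -> zeq (zcomp b' b) (zmor (dgmor_id X)) ->
    zeq (zcomp (zcomp b' a') (zcomp a b)) (zmor (dgmor_id X)).
  move=> ha hb; apply: zeq_trans hb; apply: zeq_trans (zeq_sym (zeq_assoc _ _ _)) _.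
  apply: zeq_comp; first exact: zeq_refl.
  apply: zeq_trans (zeq_assoc _ _ _) _; apply: zeq_trans (zeq_idl _).
  by apply: zeq_comp => //; apply: zeq_refl.
by move=> [g' [g1 g2]] [f' [f1 f2]]; exists (zcomp f' g'); split; apply: E.
Qed.

Lemma isomorphic_refl (M : dgmod A) : isomorphic M M.
Proof. by exists (zmor (dgmor_id M)); apply/zmor_iso/id_quasi_iso. Qed.
Lemma isomorphic_sym (M N : dgmod A) : isomorphic M N -> isomorphic N M.
Proof. by move=> [f [g [h1 h2]]]; exists g, f. Qed.
Lemma isomorphic_trans (M N P : dgmod A) : isomorphic M N -> isomorphic N P -> isomorphic M P.
Proof. by move=> [f hf] [g hg]; exists (zcomp g f); apply: zcomp_iso. Qed.
Lemma isomorphic_qiso (M N : dgmod A) (f : dgmor M N) : quasi_iso f -> isomorphic M N.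
Proof. by move=> q; exists (zmor f); apply: zmor_iso. Qed.
Lemma iso_classP (M N : dgmod A) : iso_class M = iso_class N <-> isomorphic M N.
Proof.
split=> [e|h]; first by rewrite -[isomorphic M N]/(iso_class M N) e; apply: isomorphic_refl.
apply: functional_extensionality_dep => P; apply: propositional_extensionality; split=> h'.
  by apply: isomorphic_trans h'; apply: isomorphic_sym.
exact: isomorphic_trans h h'.
Qed.

(** An inverted quasi-isomorphism is absorbed by extending the map into J along it up to homotopy,
    so a whole zigzag ending in J is replaced by one genuine morphism with the same effect on
    cohomology. *)
Lemma zigzag_pull (J : dgmod A) : semiinj J -> forall (M N : dgmod A) (f : zigzag M N) (u : dgmor N J),
  exists v : dgmor M J, forall i (c : cohomology M i), cohomology_map v c = cohomology_map u (Hz f c).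
Proof.
move=> sJ M N; elim=> {M N}.
- by move=> M N f u; exists (dgmor_comp u f) => i c; rewrite (@cohomology_map_comp _ _ _ u f).
- move=> M N s hs u; have [v hv] := htpy_ext u sJ hs; exists v => i c.
  rewrite -[in LHS](zinvK hs c); set b := Hz _ c.
  rewrite -(@cohomology_map_comp _ _ _ v s (dgmor_comp v s)) //.
  rewrite -[b]repK !cohomology_mapE; apply/esym/cls_eq.
  by have [j [h [x ex]]] := htpic_H hv (fun j h => cocycleE (rep b) h); exists j, h, x.
- move=> M N P g IHg f IHf u; have [v hv] := IHg u; have [w hw] := IHf v.
  by exists w => i c; rewrite hw hv.
Qed.

Lemma isomorphic_qiso_semiinj (M N J : dgmod A) (u : dgmor M J) : semiinj J -> quasi_iso u -> isomorphic M N ->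
  exists v : dgmor N J, quasi_iso v.
Proof.
move=> sJ qu /isomorphic_sym[f /is_iso_H hf]; have [v hv] := zigzag_pull sJ f u.
exists v => i; apply: (eq_bij (bij_comp (qu i) (hf i))) => c; exact: esym (hv i c).
Qed.
End Zigzags.

(** * The correspondence *)

Local Open Scope classical_set_scope.

Lemma Kinj_resolutionP (A : cdgring) (R : dgmod A) : is_Kinj_resolution (Kinj_resolution R).
Proof.
rewrite /Kinj_resolution; case: pselect => [h|[]]; first exact: svalP (cid h).
by have [J [u [[kJ _] qu _]]] := resolution R; exists (Target u).
Qed.

Section Con.
Variable M : complex.
Lemma not_exact i : (exists c : cohomology M i, c <> 0) <-> ~ exact M i.
Proof.
rewrite exactP; split=> [[c nc] h|h]; first by apply: nc.
by apply: contrapT => h'; apply: h => c; apply: contrapT => nc; apply: h'; exists c.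
Qed.
Lemma con_exact i : ~ exact M i -> con M i.
Proof. by move=> /not_exact h I [_ hI]; apply: hI. Qed.
Lemma con_sub (I : set int) : int_interval I -> (forall i, ~ exact M i -> I i) -> con M `<=` I.
Proof. by move=> hI h i; apply; split=> // k /not_exact; apply: h. Qed.
Lemma con_interval : int_interval (con M).
Proof. by move=> x y hx hy z hz I [hI sI]; apply: (hI x y) => //; [apply: hx|apply: hy]. Qed.
End Con.

Lemma opp_shift_interval (I : set int) d0 d1 : int_interval I -> d0 <= d1 -> int_interval (opp_shift I d0 d1).
Proof.
move=> hI hd x y [i Ii hi] [j Ij hj] z hz; have [e|e] := leP i (d1 - z).
  by exists i => //; lia.
have [e'|e'] := leP (d0 - z) j; first by exists j => //; lia.
by exists (d1 - z); [apply: (hI j i) => //; lia|lia].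
Qed.

Section Interface.
Variables (A : cdgring) (pn : pseudo_noetherian A).

Definition res_id (M : dgmod A) : dgmor (restrict_dg (dgr_id A) M) M.
Proof. by apply: (@mkmor A (restrict_dg (dgr_id A) M) M (fun i x => x)). Defined.
Lemma res_id_qiso M : quasi_iso (res_id M).
Proof. by apply: bij_quasi_iso => // i y; exists y. Qed.

(** Degree a lies in the shifted interval exactly when [con M] meets [d0 - a, d1 - a]. An interval
    that misses this segment lies entirely on one side of it, which is where the two one-sided
    bounds come from. *)
Lemma fin_injdimP (R J : dgmod A) (r : dgmor (Kinj_resolution R) J) d0 d1 : semiinj J -> quasi_iso r -> d0 <= d1 ->
  (forall M, con (RHom M R) `<=` opp_shift (con M) d0 d1) <->
  (forall (M : dgmod A) k, (forall i, k < i -> exact M i) -> forall j, j < d0 - k -> exact (hdg M J) j) /\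
  (forall (M : dgmod A) k, (forall i, i < k -> exact M i) -> forall j, d1 - k < j -> exact (hdg M J) j).
Proof.
move=> sJ qr hd; have [kK _] := Kinj_resolutionP R.
have E M j : exact (RHom M R) j <-> exact (hdg M J) j.
  apply: iff_trans (qiso_exact (post_qiso (restrict_dg (dgr_id A) M) kK sJ qr) j) _.
  exact: iff_sym (qiso_exact (pre_qiso sJ (res_id_qiso M)) j).
split=> [h|[lo hi] M].
  split=> M k hM j hj; apply/E; apply: contrapT => /con_exact/h[i ci hi].
    have : [set l | l <= k] i.
      apply: (con_sub _ _ ci) => [x y hx hy z|l nl] /=; first by rewrite /= in hx hy; lia.
      by rewrite leNgt; apply/negP => l'; apply: nl; apply: hM.
    rewrite /=; lia.
  have : [set l | k <= l] i.
    apply: (con_sub _ _ ci) => [x y hx hy z|l nl] /=; first by rewrite /= in hx hy; lia.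
    by rewrite leNgt; apply/negP => l'; apply: nl; apply: hM.
  rewrite /=; lia.
apply: con_sub => [|a na]; first by apply: opp_shift_interval => //; apply: con_interval.
apply: contrapT => no; apply: na; apply/E.
have out i : con M i -> (i < d0 - a) || (d1 - a < i).
  move=> ci; apply/negP => hi'; apply: no; exists i => //; lia.
have [al|nal] := EM (forall i, con M i -> i < d0 - a).
  apply: (lo M (d0 - a - 1)); last by lia.
  move=> i hi'; apply: contrapT => /con_exact/al; lia.
apply: (hi M (d1 - a + 1)); last by lia.
move=> i hi'; apply: contrapT => /con_exact ci; apply: nal => l cl.
have l1 : i < d0 - a by have := out i ci; lia.
have := out l cl => /orP[//|l2].
have := out (d0 - a) (con_interval ci cl _); lia.
Qed.

Lemma adjunctionP (R J : dgmod A) (r : dgmor (Kinj_resolution R) J) : semiinj J -> quasi_iso r ->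
  is_iso (zmor (adjunction R)) <-> quasi_iso (mulJ J).
Proof.
move=> sJ qr; rewrite zmor_isoP; have [kK qe] := Kinj_resolutionP R.
set e := tgt_map _ in qe.
pose w := dgmor_comp r (dgmor_comp e (res_id R)).
have qw : quasi_iso w.
  apply: (qiso_comp (f := dgmor_comp e (res_id R)) (g := r)) => //.
  by apply: (qiso_comp (f := res_id R) (g := e)) => //; apply: res_id_qiso.
have qp := post_qiso (restrict_dg (dgr_id A) R) kK sJ qr.
pose t := cplx_comp (post (restrict_dg (dgr_id A) R) r) (adjunction R : cplxmor _ (hdg _ _)).
have E i x : t i x = pre J w i (mulJ J i x).
  apply: hom_ext => n j h y; exact: (mmor_act r).
split=> q.
  by apply: (@qiso_compl _ _ _ (mulJ J) (pre J w) t) => //; [apply: qiso_comp q qp|apply: pre_qiso].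
by apply: (@qiso_compl _ _ _ (adjunction R) (post (restrict_dg (dgr_id A) R) r) t) => //; apply: (@qiso_comp _ _ _ (mulJ J) (pre J w)) => //; apply: pre_qiso.
Qed.

Lemma fg_resolution (R J : dgmod A) (r : dgmor (Kinj_resolution R) J) i : quasi_iso r ->
  fg R i <-> fg J i.
Proof.
move=> qr; have [_ qe] := Kinj_resolutionP R; have cf := coho_fg (proj1 pn).
exact: iff_trans (coho_qiso cf qe i) (coho_qiso cf qr i).
Qed.

Lemma Kinj_semiinj (R J : dgmod A) (u : dgmor R J) : semiinj J -> quasi_iso u ->
  exists r : dgmor (Kinj_resolution R) J, quasi_iso r.
Proof.
move=> sJ qu; have [_ qe] := Kinj_resolutionP R.
have [r hr] := htpy_ext u sJ qe; exists r.
by apply: (qiso_compr (f := tgt_map (Kinj_resolution R)) (k := dgmor_comp r (tgt_map (Kinj_resolution R)))) => //; apply: htpic_qiso hr _.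
Qed.

Lemma dualizing_dual (R J : dgmod A) (u : dgmor R J) : semiinj J -> quasi_iso u -> dualizing R ->
  exists d0 d1, dual J d0 d1.
Proof.
move=> sJ qu [fR [d0 [d1 [hd hi]]] ad]; have [r qr] := Kinj_semiinj sJ qu.
exists d0, d1; have [lo up] := proj1 (fin_injdimP sJ qr hd) hi; split=> //.
  by move=> i; apply: (proj1 (fg_resolution i qr)); apply: fR.
exact: (proj1 (adjunctionP sJ qr)).
Qed.

Lemma dual_dualizing (R J : dgmod A) (u : dgmor R J) d0 d1 : dual J d0 d1 -> quasi_iso u -> dualizing R.
Proof.
move=> D qu; have sJ := dual_semi D; have [r qr] := Kinj_semiinj sJ qu; split.
- by move=> i; apply: (proj2 (fg_resolution i qr)); apply: (dual_fg D).
(* Finite injective dimension asks for d0 <= d1, which [dual] does not record; lowering d0 only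
   weakens the lower bound. *)
- exists (Num.min d0 d1), d1; split; first by lia.
  apply: (proj2 (fin_injdimP sJ qr _)); first by lia.
  split; last exact: (dual_hi D).
  by move=> M k hM j hj; apply: (dual_lo D hM); lia.
- by apply: (proj2 (adjunctionP sJ qr)); apply: (dual_mul D).
Qed.
End Interface.

Lemma dclass_eq (A : cdgring) (R R' : dgmod A) (hR : dualizing R) (hR' : dualizing R') :
  dclass hR = dclass hR' <-> isomorphic R R'.
Proof.
split=> [/(congr1 (@sval _ _)) /iso_classP //|/iso_classP e].
exact: eq_exist.
Qed.

Lemma dclass_surj (A : cdgring) (C : dualizing_class A) : exists (R : dgmod A) (hR : dualizing R), C = dclass hR.
Proof. by case: C => C [R [hR e]]; exists R, hR; subst C; apply: eq_exist. Qed.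

Section Main.
Variables (A : cdgring) (pn : pseudo_noetherian A).
Local Notation B := (ring_dg (Abar A)).

Lemma RHom_bar_qiso (R J : dgmod A) (u : dgmor R J) : semiinj J -> quasi_iso u ->
  exists v : dgmor (RHom_bar R) (coind (canon A) (selfmod B) J), quasi_iso v.
Proof.
move=> sJ qu; have [r qr] := Kinj_semiinj sJ qu; have [kK _] := Kinj_resolutionP R.
by exists (coind_mor (canon A) r); apply: coind_qiso.
Qed.

Lemma RHom_bar_dualizing (R : dgmod A) : dualizing R -> dualizing (RHom_bar R).
Proof.
move=> hR; have [J [u [sJ qu _]]] := resolution R.
have [d0 [d1 D]] := dualizing_dual pn sJ qu hR; have [v qv] := RHom_bar_qiso sJ qu.
have G := canon_H0_map pn.
exact: (dual_dualizing (B_pn pn) (dual_coind (@H0_map_surj _ _ _ G 0) pn (B_pn pn) (proj1 (H0_map_D G)) D) qv).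
Qed.

Lemma RHom_bar_iso (R R' : dgmod A) : isomorphic R R' -> isomorphic (RHom_bar R) (RHom_bar R').
Proof.
move=> h; have [J [u [sJ qu _]]] := resolution R.
have [u' qu'] := isomorphic_qiso_semiinj sJ qu h.
have [v qv] := RHom_bar_qiso sJ qu; have [v' qv'] := RHom_bar_qiso sJ qu'.
exact: isomorphic_trans (isomorphic_qiso qv) (isomorphic_sym (isomorphic_qiso qv')).
Qed.

Lemma RHom_bar_inj (R R' : dgmod A) : dualizing R -> dualizing R' ->
  isomorphic (RHom_bar R) (RHom_bar R') -> isomorphic R R'.
Proof.
move=> hR hR' h; have [J [u [sJ qu _]]] := resolution R; have [J' [u' [sJ' qu' _]]] := resolution R'.
have [d0 [d1 D]] := dualizing_dual pn sJ qu hR; have [d0' [d1' D']] := dualizing_dual pn sJ' qu' hR'.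
have [v qv] := RHom_bar_qiso sJ qu; have [v' qv'] := RHom_bar_qiso sJ' qu'.
have sS' := @coind_semiinj A B (canon A) J' sJ'.
have [w qw] := isomorphic_qiso_semiinj sS' qv' (isomorphic_sym h).
have [tau ht] := htpy_ext w sS' qv.
have qt : quasi_iso tau.
  by apply: (qiso_compr (f := v) (k := dgmor_comp tau v)) => //; apply: htpic_qiso ht qw.
have [lam ql] := coind_full pn D D' qt.
apply: isomorphic_trans (isomorphic_qiso qu) _; apply: isomorphic_trans (isomorphic_qiso ql) _.
exact: isomorphic_sym (isomorphic_qiso qu').
Qed.

Lemma RHom_bar_surj (S : dgmod B) : dualizing S -> exists R : dgmod A, dualizing R /\ isomorphic (RHom_bar R) S.
Proof.
move=> hS; have [J [u [sJ qu _]]] := resolution S.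
have [d0 [d1 D]] := dualizing_dual (B_pn pn) sJ qu hS.
have [R [tau [DR qt]]] := dual_lift (canon_H0_map pn) D; exists R.
have qi := id_quasi_iso R; split; first exact: (dual_dualizing pn DR qi).
have [v qv] := RHom_bar_qiso (dual_semi DR) qi.
apply: isomorphic_trans (isomorphic_qiso qv) _; apply: isomorphic_sym.
exact: isomorphic_trans (isomorphic_qiso qu) (isomorphic_qiso qt).
Qed.
End Main.

Theorem corollary0p6 (A : cdgring) (hA : tractable A) :
  exists Phi : dualizing_class A -> dualizing_class (ring_dg (Abar A)),
    bijective Phi /\
    forall (R : dgmod A) (hR : dualizing R),
      exists hR' : dualizing (RHom_bar R), Phi (dclass hR) = dclass hR'.
Proof.
have pn := proj1 hA; have hd R hR := @RHom_bar_dualizing A pn R hR.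
pose rp (C : dualizing_class A) := cid (dclass_surj C).
(* Phi is computed on a chosen representative of the class; [RHom_bar_iso] makes it independent of
   the choice. *)
pose Phi C := dclass (hd _ (sval (cid (svalP (rp C))))).
have PhiE R (hR : dualizing R) : Phi (dclass hR) = dclass (hd R hR).
  apply/dclass_eq/RHom_bar_iso/(dclass_eq (sval (cid (svalP (rp (dclass hR))))) hR).
  exact: esym (svalP (cid (svalP (rp (dclass hR))))).
have inj : injective Phi.
  move=> C C'; have [R [hR ->]] := dclass_surj C; have [R' [hR' ->]] := dclass_surj C'.
  by rewrite !PhiE => /dclass_eq h; apply/dclass_eq; apply: (RHom_bar_inj pn hR hR' h).
have surj C : exists C', Phi C' = C.
  have [S [hS ->]] := dclass_surj C; have [R [hR h]] := RHom_bar_surj pn hS.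
  by exists (dclass hR); rewrite PhiE; apply/dclass_eq.
exists Phi; split; last by move=> R hR; exists (hd R hR); apply: PhiE.
exists (fun C => sval (cid (surj C))) => C; last exact: (svalP (cid (surj C))).
by apply: inj; apply: (svalP (cid (surj (Phi C)))).
Qed.
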